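(* (1) The model checking and satisfiability problems of first-order team logic $\mathrm{FO}(=\!(\ldots),\sim)$, its three-variable fragment $\mathrm{FO}^3(=\!(\ldots),\sim)$, and $\mathrm{SO}$ are equivalent to $\mathbf{\Delta^3_0}$ under logspace-reductions. (2) The countable satisfiability problem of $\mathrm{FO}(=\!(\ldots),\sim)$, its three-variable fragment $\mathrm{FO}^3(=\!(\ldots),\sim)$, and $\mathrm{SO}$ is equivalent to $\mathbf{\Delta^2_0}$ under logspace-reductions. (3) The model checking and (countable) satisfiability problems of $\mathrm{TeamLTL}^a(\sim)$ are logspace-reducible to $\mathbf{\Delta^3_0}$ ($\mathbf{\Delta^2_0}$).
   Context: Hyperproperties are expressed over structures $\mathcal{M}_T$ encoding a trace set $T$: domain $T\times\mathbb{N}$, an order $\le$ within each trace, predicates $P_i=\{(t,j)\mid p_i\in t(j)\}$, and (for $\mathrm{FO}^3(=\!(\ldots),\sim)$) the equal-level predicate $E=\{((t,n),(t',m))\mid n=m\}$. $\mathrm{FO}(=\!(\ldots),\sim)$ is first-order logic under team semantics with dependence atoms $=\!(x_1,\dots,x_n,y)$ (any two assignments agreeing on the $x_i$ agree on $y$) and Boolean negation $\sim$; $\mathrm{SO}$ is second-order logic; $\mathrm{TeamLTL}^a(\sim)$ is LTL under asynchronous team semantics with Boolean negation. Model checking: given a formula and a finite Kripke structure $K$, decide whether the set of traces of $K$ satisfies the formula. (Countable) satisfiability: given a formula, decide whether it is satisfied by some non-empty (countable) trace set. $\mathbf{\Delta^3_0}$ (resp. $\mathbf{\Delta^2_0}$)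 denotes the set of third-order (resp. second-order) arithmetic sentences true in $(\mathbb{N},+,\times,\le,0,1)$. *)

(* Defs.v *)
From HB Require Import structures.
From mathcomp Require Import all_boot.
From mathcomp Require Import boolp classical_sets cardinality.

Set Implicit Arguments.
Unset Strict Implicit.
Unset Printing Implicit Defensive.

Local Open Scope classical_set_scope.

Definition upd (I : eqType) (A : Type) (s : I -> A) (x : I) (a : A) : I -> A :=
  fun y => if y == x then a else s y.

(* Languages are over the alphabet {0,1}. *)
Definition language := set (seq bool).

Inductive move := MLeft | MStay | MRight.

(* The read-only input tape carries an end marker on either side. *)
Inductive isymbol := LEnd | REnd | Bit of bool.

(* A step may append one bit to the write-only output. *)
Record transducer := Transducer {
  tstate : finType;
  talpha : finType;
  tblank : talpha;
  tstart : tstate;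
  thalt  : pred tstate;
  tstep  : tstate -> isymbol -> talpha ->
           tstate * talpha * move * move * option bool }.

Section Run.
Variables (M : transducer) (x : seq bool).

(* The left marker is at position 0, the bits of [x] are at positions 1 to
   [size x], and the right marker is at position [(size x).+1]. *)
Definition read_input (i : nat) : isymbol :=
  if i is j.+1 then (if onth x j is Some b then Bit b else REnd) else LEnd.

Record config := Config {
  cstate : tstate M;
  cin    : nat;
  cwork  : nat -> talpha M;
  chead  : nat;
  cout   : seq bool }.

Definition shift (m : move) (i : nat) : nat :=
  match m with MLeft => i.-1 | MStay => i | MRight => i.+1 end.

Definition initial : config := Config (tstart M) 0 (fun=> tblank M) 0 [::].

Definition step (c : config) : config :=
  if thalt (cstate c) then c else
  let: (q, a, mi, mw, o) :=
    tstep (cstate c) (read_input (cin c)) (cwork c (chead c)) in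
  Config q (minn (shift mi (cin c)) (size x).+1)
    (upd (cwork c) (chead c) a) (shift mw (chead c))
    (if o is Some b then rcons (cout c) b else cout c).

Definition outputs (y : seq bool) : Prop :=
  exists k, let c := iter k step initial in thalt (cstate c) /\ cout c = y.

Definition work_space_le (s : nat) : Prop :=
  forall k, chead (iter k step initial) <= s.

End Run.

Definition logspace (f : seq bool -> seq bool) : Prop :=
  exists (M : transducer) (c : nat), forall x,
    outputs M x (f x) /\ work_space_le M x (c * (trunc_log 2 (size x)).+1).

Definition logspace_reducible (A B : language) : Prop :=
  exists2 f, logspace f & forall x, A x <-> B (f x).

Definition logspace_equivalent (A B : language) : Prop :=
  logspace_reducible A B /\ logspace_reducible B A.

Notation tree := (GenTree.tree nat).
Notation leaf := (@GenTree.Leaf nat).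
Notation node := (@GenTree.Node nat).

(* Numbers only tag constructors and name variables, relations, propositions
   and worlds, so unary notation is as good as binary up to logspace
   renaming. *)
Definition unary (n : nat) : seq bool := rcons (nseq n true) false.

(* A prefix code, since the number of children is recorded. *)
Fixpoint ser (t : tree) : seq bool :=
  match t with
  | GenTree.Leaf n => false :: unary n
  | GenTree.Node k ts => true :: unary k ++ unary (size ts) ++ flatten (map ser ts)
  end.

Definition leaves (s : seq nat) : tree := node 0 [seq leaf i | i <- s].

(* Propositions are p_0, p_1, ...; [t j i] means p_i \in t(j). *)
Definition trace := nat -> nat -> bool.

Definition dom (T : set trace) : Type := (T * nat)%type.

Inductive atom :=
  | Eq of nat & nat
  | Le of nat & nat
  | Pred of nat & nat     (* [Pred i x] is P_i(x) *)
  | Level of nat & nat.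

Definition atom_vars (a : atom) : seq nat :=
  match a with
  | Eq x y | Le x y | Level x y => [:: x; y]
  | Pred _ x => [:: x]
  end.

Definition level_free_atom (a : atom) : bool :=
  if a is Level _ _ then false else true.

Definition atom_code (a : atom) : tree :=
  match a with
  | Eq x y => node 0 [:: leaf x; leaf y]
  | Le x y => node 1 [:: leaf x; leaf y]
  | Pred i x => node 2 [:: leaf i; leaf x]
  | Level x y => node 3 [:: leaf x; leaf y]
  end.

(* Assignments are partial; [None] marks a variable outside the domain. *)
Definition assignment (T : set trace) := nat -> option (dom T).

Definition empty_assignment (T : set trace) : assignment T := fun=> None.

Definition sat_atom (T : set trace) (s : assignment T) (a : atom) : Prop :=
  match a with
  | Eq x y => exists2 d, s x = Some d & s y = Some d
  | Le x y => exists t n m, [/\ s x = Some (t, n), s y = Some (t, m) & n <= m]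
  | Pred i x => exists2 d, s x = Some d & val d.1 d.2 i
  | Level x y => exists t t' n, s x = Some (t, n) /\ s y = Some (t', n)
  end.

Inductive fo :=
  | FLit of bool & atom   (* [FLit false a] is the negated atom *)
  | FDep of seq nat & nat
  | FNot of fo            (* Boolean negation ~ *)
  | FAnd of fo & fo
  | FOr of fo & fo
  | FEx of nat & fo
  | FAll of nat & fo.

Fixpoint fo_code (f : fo) : tree :=
  match f with
  | FLit b a => node 0 [:: leaf b; atom_code a]
  | FDep xs y => node 1 [:: leaves xs; leaf y]
  | FNot f => node 2 [:: fo_code f]
  | FAnd f g => node 3 [:: fo_code f; fo_code g]
  | FOr f g => node 4 [:: fo_code f; fo_code g]
  | FEx x f => node 5 [:: leaf x; fo_code f]
  | FAll x f => node 6 [:: leaf x; fo_code f]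
  end.

Fixpoint fo_vars (f : fo) : seq nat :=
  match f with
  | FLit _ a => atom_vars a
  | FDep xs y => y :: xs
  | FNot f => fo_vars f
  | FAnd f g | FOr f g => fo_vars f ++ fo_vars g
  | FEx x f | FAll x f => x :: fo_vars f
  end.

Fixpoint fo_free (f : fo) : seq nat :=
  match f with
  | FLit _ a => atom_vars a
  | FDep xs y => y :: xs
  | FNot f => fo_free f
  | FAnd f g | FOr f g => fo_free f ++ fo_free g
  | FEx x f | FAll x f => [seq y <- fo_free f | y != x]
  end.

Fixpoint fo_level_free (f : fo) : bool :=
  match f with
  | FLit _ a => level_free_atom a
  | FDep _ _ => true
  | FNot f | FEx _ f | FAll _ f => fo_level_free f
  | FAnd f g | FOr f g => fo_level_free f && fo_level_free g
  end.

(* Lax team semantics. *)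
Fixpoint fo_sat (T : set trace) (S : set (assignment T)) (f : fo) : Prop :=
  match f with
  | FLit b a => forall s, S s -> if b then sat_atom s a else ~ sat_atom s a
  | FDep xs y => forall s s', S s -> S s' ->
      {in xs, forall x, s x = s' x} -> s y = s' y
  | FNot f => ~ fo_sat S f
  | FAnd f g => fo_sat S f /\ fo_sat S g
  | FOr f g => exists S1 S2, [/\ S = S1 `|` S2, fo_sat S1 f & fo_sat S2 g]
  | FEx x f => exists F : assignment T -> set (dom T),
      (forall s, S s -> F s !=set0) /\
      fo_sat [set s' | exists s d, [/\ S s, F s d &
                         s' = upd s x (Some d)]] f
  | FAll x f =>
      fo_sat [set s' | exists s d, S s /\ s' = upd s x (Some d)] f
  end.

Definition fo_models (T : set trace) (f : fo) : Prop :=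
  fo_sat [set @empty_assignment T] f.

(* Relation variables are named by an index and an arity; [SRel i xs] is the
   atom X(xs), with X the variable of index [i] and arity [size xs]. *)
Inductive so :=
  | SAtom of atom
  | SRel of nat & seq nat
  | SNot of so
  | SAnd of so & so
  | SOr of so & so
  | SEx of nat & so
  | SAll of nat & so
  | SExR of nat & nat & so
  | SAllR of nat & nat & so.

Fixpoint so_code (f : so) : tree :=
  match f with
  | SAtom a => node 0 [:: atom_code a]
  | SRel i xs => node 1 [:: leaf i; leaves xs]
  | SNot f => node 2 [:: so_code f]
  | SAnd f g => node 3 [:: so_code f; so_code g]
  | SOr f g => node 4 [:: so_code f; so_code g]
  | SEx x f => node 5 [:: leaf x; so_code f]
  | SAll x f => node 6 [:: leaf x; so_code f]
  | SExR i k f => node 7 [:: leaf i; leaf k; so_code f]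
  | SAllR i k f => node 8 [:: leaf i; leaf k; so_code f]
  end.

Fixpoint so_free (f : so) : seq nat :=
  match f with
  | SAtom a => atom_vars a
  | SRel _ xs => xs
  | SNot f | SExR _ _ f | SAllR _ _ f => so_free f
  | SAnd f g | SOr f g => so_free f ++ so_free g
  | SEx x f | SAll x f => [seq y <- so_free f | y != x]
  end.

Fixpoint so_free_rel (f : so) : seq (nat * nat) :=
  match f with
  | SAtom _ => [::]
  | SRel i xs => [:: (i, size xs)]
  | SNot f | SEx _ f | SAll _ f => so_free_rel f
  | SAnd f g | SOr f g => so_free_rel f ++ so_free_rel g
  | SExR i k f | SAllR i k f => [seq X <- so_free_rel f | X != (i, k)]
  end.

Fixpoint so_level_free (f : so) : bool :=
  match f with
  | SAtom a => level_free_atom a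
  | SRel _ _ => true
  | SNot f | SEx _ f | SAll _ f | SExR _ _ f | SAllR _ _ f => so_level_free f
  | SAnd f g | SOr f g => so_level_free f && so_level_free g
  end.

(* A k-ary relation is a set of sequences of which only the members of length
   k are ever inspected. *)
Fixpoint so_sat (T : set trace) (V : nat * nat -> set (seq (dom T)))
    (s : assignment T) (f : so) : Prop :=
  match f with
  | SAtom a => sat_atom s a
  | SRel i xs => exists2 ds, map s xs = map Some ds & V (i, size xs) ds
  | SNot f => ~ so_sat V s f
  | SAnd f g => so_sat V s f /\ so_sat V s g
  | SOr f g => so_sat V s f \/ so_sat V s g
  | SEx x f => exists d, so_sat V (upd s x (Some d)) f
  | SAll x f => forall d, so_sat V (upd s x (Some d)) f
  | SExR i k f => exists R, so_sat (upd V (i, k) R) s f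
  | SAllR i k f => forall R, so_sat (upd V (i, k) R) s f
  end.

Definition so_models (T : set trace) (f : so) : Prop :=
  so_sat (fun=> set0) (@empty_assignment T) f.

Inductive ltl :=
  | LLit of bool & nat    (* [LLit false p] is the negated proposition *)
  | LNot of ltl           (* Boolean negation ~ *)
  | LAnd of ltl & ltl
  | LOr of ltl & ltl
  | LNext of ltl
  | LFin of ltl
  | LGlob of ltl
  | LUntil of ltl & ltl.

Fixpoint ltl_code (f : ltl) : tree :=
  match f with
  | LLit b p => node 0 [:: leaf b; leaf p]
  | LNot f => node 1 [:: ltl_code f]
  | LAnd f g => node 2 [:: ltl_code f; ltl_code g]
  | LOr f g => node 3 [:: ltl_code f; ltl_code g]
  | LNext f => node 4 [:: ltl_code f]
  | LFin f => node 5 [:: ltl_code f]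
  | LGlob f => node 6 [:: ltl_code f]
  | LUntil f g => node 7 [:: ltl_code f; ltl_code g]
  end.

(* T[h,oo) = { t[h(t),oo) | t \in T }; a function on T is represented by a
   function on all traces. *)
Definition suffixes (h : trace -> nat) (T : set trace) : set trace :=
  [set (fun j => t (h t + j)) | t in T].

(* In the clause for until, traces whose obligation is already met at position
   0 drop out of the team on which the left argument is evaluated. *)
Fixpoint ltl_sat (T : set trace) (f : ltl) : Prop :=
  match f with
  | LLit b p => forall t, T t -> t 0 p = b
  | LNot f => ~ ltl_sat T f
  | LAnd f g => ltl_sat T f /\ ltl_sat T g
  | LOr f g => exists T1 T2, [/\ T = T1 `|` T2, ltl_sat T1 f & ltl_sat T2 g]
  | LNext f => ltl_sat (suffixes (fun=> 1) T) f
  | LFin f => exists h, ltl_sat (suffixes h T) f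
  | LGlob f => forall h, ltl_sat (suffixes h T) f
  | LUntil f g => exists h, ltl_sat (suffixes h T) g /\
      let T' := [set t | T t /\ 0 < h t] in
      forall h', (forall t, T' t -> h' t < h t) -> ltl_sat (suffixes h' T') f
  end.

(* The label of a world is the finite set of propositions listed. *)
Record kripke := Kripke {
  kworlds : nat;
  kinit   : 'I_kworlds;
  ktrans  : rel 'I_kworlds;
  klabel  : 'I_kworlds -> seq nat;
  ktotal  : forall w, exists w', ktrans w w' }.

Definition traces (K : kripke) : set trace :=
  [set t | exists pi : nat -> 'I_(kworlds K),
    [/\ pi 0 = kinit K,
        forall j, ktrans (pi j) (pi j.+1) &
        forall j p, t j p = (p \in klabel (pi j))]].

Definition kripke_code (K : kripke) : tree :=
  node 0 [:: leaf (kinit K);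
    node 0 [seq node 0 [:: leaves (klabel w);
                           leaves [seq val w' | w' <- enum 'I_(kworlds K)
                                              & ktrans w w']]
           | w <- enum 'I_(kworlds K)]].

Record logic := Logic {
  form     : Type;
  fcode    : form -> tree;
  sentence : form -> bool;
  models   : set trace -> form -> Prop }.

Definition FO_team : logic := {|
  form := fo; fcode := fo_code; models := fo_models;
  sentence f := (fo_free f == [::]) && fo_level_free f |}.

(* At most three distinct variables; only here does the vocabulary contain the
   equal-level predicate. *)
Definition FO3_team : logic := {|
  form := fo; fcode := fo_code; models := fo_models;
  sentence f := (fo_free f == [::]) && (size (undup (fo_vars f)) <= 3) |}.

Definition SO : logic := {|
  form := so; fcode := so_code; models := so_models;
  sentence f := [&& so_free f == [::], so_free_rel f == [::]
                  & so_level_free f] |}.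

Definition TeamLTLa : logic := {|
  form := ltl; fcode := ltl_code; models := ltl_sat;
  sentence _ := true |}.

Definition model_checking (L : logic) : language :=
  [set w | exists (f : form L) (K : kripke),
    [/\ sentence f, models (traces K) f &
        w = ser (node 0 [:: fcode f; kripke_code K])]].

Definition satisfiability (L : logic) : language :=
  [set w | exists f : form L, [/\ sentence f, w = ser (fcode f) &
    exists T : set trace, T !=set0 /\ models T f]].

Definition countable_satisfiability (L : logic) : language :=
  [set w | exists f : form L, [/\ sentence f, w = ser (fcode f) &
    exists T : set trace, [/\ T !=set0, countable T & models T f]]].

(* Variables range over numbers, sets of numbers, and sets of sets of
   numbers. *)
Inductive order := O1 | O2 | O3.

Definition order_nat (o : order) : nat :=
  match o with O1 => 1 | O2 => 2 | O3 => 3 end.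

Lemma order_nat_inj : injective order_nat.
Proof. by do 2!case. Qed.

HB.instance Definition _ := Equality.copy order (inj_type order_nat_inj).

Inductive term :=
  | TVar of nat
  | TZero
  | TOne
  | TAdd of term & term
  | TMul of term & term.

Inductive arith :=
  | AEq of term & term
  | ALe of term & term
  | AIn2 of term & nat    (* [AIn2 t X] is t \in X, with X of order 2 *)
  | AIn3 of nat & nat     (* [AIn3 X Y] is X \in Y, with X, Y of orders 2, 3 *)
  | ANot of arith
  | AAnd of arith & arith
  | AOr of arith & arith
  | AEx of order & nat & arith
  | AAll of order & nat & arith.

Fixpoint term_code (t : term) : tree :=
  match t with
  | TVar x => node 0 [:: leaf x]
  | TZero => node 1 [::]
  | TOne => node 2 [::]
  | TAdd t u => node 3 [:: term_code t; term_code u]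
  | TMul t u => node 4 [:: term_code t; term_code u]
  end.

Fixpoint arith_code (f : arith) : tree :=
  match f with
  | AEq t u => node 0 [:: term_code t; term_code u]
  | ALe t u => node 1 [:: term_code t; term_code u]
  | AIn2 t x => node 2 [:: term_code t; leaf x]
  | AIn3 x y => node 3 [:: leaf x; leaf y]
  | ANot f => node 4 [:: arith_code f]
  | AAnd f g => node 5 [:: arith_code f; arith_code g]
  | AOr f g => node 6 [:: arith_code f; arith_code g]
  | AEx o x f => node 7 [:: leaf (order_nat o); leaf x; arith_code f]
  | AAll o x f => node 8 [:: leaf (order_nat o); leaf x; arith_code f]
  end.

Fixpoint term_vars (t : term) : seq nat :=
  match t with
  | TVar x => [:: x]
  | TZero | TOne => [::]
  | TAdd t u | TMul t u => term_vars t ++ term_vars u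
  end.

Fixpoint arith_free (f : arith) : seq (order * nat) :=
  match f with
  | AEq t u | ALe t u => [seq (O1, x) | x <- term_vars t ++ term_vars u]
  | AIn2 t x => (O2, x) :: [seq (O1, y) | y <- term_vars t]
  | AIn3 x y => [:: (O2, x); (O3, y)]
  | ANot f => arith_free f
  | AAnd f g | AOr f g => arith_free f ++ arith_free g
  | AEx o x f | AAll o x f => [seq v <- arith_free f | v != (o, x)]
  end.

Fixpoint second_order (f : arith) : bool :=
  match f with
  | AEq _ _ | ALe _ _ | AIn2 _ _ => true
  | AIn3 _ _ => false
  | ANot f => second_order f
  | AAnd f g | AOr f g => second_order f && second_order g
  | AEx o _ f | AAll o _ f => (o != O3) && second_order f
  end.

Fixpoint term_val (v : nat -> nat) (t : term) : nat :=
  match t with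
  | TVar x => v x
  | TZero => 0
  | TOne => 1
  | TAdd t u => term_val v t + term_val v u
  | TMul t u => term_val v t * term_val v u
  end.

Fixpoint arith_sat (v1 : nat -> nat) (v2 : nat -> set nat)
    (v3 : nat -> set (set nat)) (f : arith) : Prop :=
  match f with
  | AEq t u => term_val v1 t = term_val v1 u
  | ALe t u => term_val v1 t <= term_val v1 u
  | AIn2 t x => v2 x (term_val v1 t)
  | AIn3 x y => v3 y (v2 x)
  | ANot f => ~ arith_sat v1 v2 v3 f
  | AAnd f g => arith_sat v1 v2 v3 f /\ arith_sat v1 v2 v3 g
  | AOr f g => arith_sat v1 v2 v3 f \/ arith_sat v1 v2 v3 g
  | AEx O1 x f => exists a, arith_sat (upd v1 x a) v2 v3 f
  | AEx O2 x f => exists a, arith_sat v1 (upd v2 x a) v3 f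
  | AEx O3 x f => exists a, arith_sat v1 v2 (upd v3 x a) f
  | AAll O1 x f => forall a, arith_sat (upd v1 x a) v2 v3 f
  | AAll O2 x f => forall a, arith_sat v1 (upd v2 x a) v3 f
  | AAll O3 x f => forall a, arith_sat v1 v2 (upd v3 x a) f
  end.

Definition true_in_N (f : arith) : Prop :=
  arith_free f = [::] /\
  arith_sat (fun=> 0) (fun=> set0) (fun=> set0) f.

Definition Delta30 : language :=
  [set w | exists2 f, true_in_N f & w = ser (arith_code f)].

Definition Delta20 : language :=
  [set w | exists f, [/\ second_order f, true_in_N f &
                         w = ser (arith_code f)]].

(* Main.v *)
(* All reductions come from one construction: a top-down tree-to-string
   transducer with finitely many states runs in logarithmic space, because a node
   of the syntax tree can be revisited with counters only, the state at a node
   being recomputed from the root.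

   Upper bounds: a trace, or an assignment with finite support, is coded by a set
   of numbers, so a team is a set of sets of numbers and team semantics becomes
   third-order arithmetic. Over a countable trace set the sets of numbers that
   occur are the rows of a single binary relation, which saves one order.

   Lower bounds: arithmetic is interpreted in monadic second-order logic over a
   trace set, where a trace stands for the set of positions satisfying p_0, a
   number for a singleton, and addition and multiplication for sets of traces
   that code triples by means of p_0, p_1 and p_2. This logic is interpreted in
   SO directly, and in team logic with three variables by a single team, whose
   elements (t, k) state that t belongs to the k-th set variable. *)

Require Import Defs.
From mathcomp Require Import all_boot.
From mathcomp Require Import boolp classical_sets functions cardinality.
From mathcomp Require Import zify.

Set Implicit Arguments.
Unset Strict Implicit.
Unset Printing Implicit Defensive.

(** Two obstacles shape the proof. First, a reduction must also reject every word that does not code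
    an instance, and a finite-state pass over a tree can check tags and arities but cannot compare
    numbers. Whatever needs comparison (closedness, the bound of three variables, the binding of
    relation variables, range and order of the successors in a Kripke structure) therefore becomes
    part of the output sentence. Second, a pass has finitely many states but faces unboundedly many
    variable names. In the translations of the upper bounds a name becomes the value of one of a few
    registers, written as a numeral; in those of the lower bounds an index determines only how often
    a string is repeated. The upper bounds translate once, into formulas whose set variables range
    over an abstract type of points. With all sets of numbers as points this gives third-order
    arithmetic; with the rows of a relation, closed under the operations that the translation uses,
    second-order arithmetic. In the lower bounds the third-order case adds a comprehension axiom,
    which only uncountable trace sets satisfy. *)

Lemma updE (I : eqType) (A : Type) (s : I -> A) x a : upd s x a x = a.
Proof. by rewrite /upd eqxx. Qed.

Lemma upd_upd (I : eqType) (A : Type) (s : I -> A) x a b :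
  upd (upd s x a) x b = upd s x b.
Proof. by apply/funext => y; rewrite /upd; case: eqP. Qed.

Lemma upd_same (I : eqType) (A : Type) (s : I -> A) x : upd s x (s x) = s.
Proof. by apply/funext => y; rewrite /upd; case: eqP => // ->. Qed.

(** * Binary digits *)

Fixpoint bitn (j n : nat) : bool := if j is j'.+1 then bitn j' n./2 else odd n.

Lemma bitn_add j k m :
  ~~ bitn j m -> bitn k (m + 2 ^ j) = (k == j) || bitn k m.
Proof.
elim: j k m => [|j IHj] [|k] m //= mj.
- by rewrite oddD (negbTE mj).
- by rewrite expn0 addn1 -uphalfE uphalf_half (negbTE mj) add0n.
- by rewrite oddD expnS oddM andFb addbF.
by rewrite halfD expnS oddM andFb andbF add0n mul2n doubleK IHj.
Qed.

Lemma bitn_ge j n : n < 2 ^ j -> bitn j n = false.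
Proof.
elim: j n => [|j IHj] n /=; first by rewrite expn0 ltnS leqn0 => /eqP->.
by rewrite expnS => lt_n; apply: IHj; lia.
Qed.

Lemma bitn_sub j k m :
  2 ^ j <= m -> bitn j m -> bitn k (m - 2 ^ j) = (k != j) && bitn k m.
Proof.
move=> jm mj.
have nj : ~~ bitn j (m - 2 ^ j).
  apply/negP; move=> mj'.
  have mod_bit i a : bitn i (a + 2 ^ i) = ~~ bitn i a.
    elim: i a => [|i IHi] a /=; first by rewrite oddD addbT.
    by rewrite halfD expnS oddM andFb andbF add0n mul2n doubleK IHi.
  by have := mod_bit j (m - 2 ^ j); rewrite subnK // mj mj'.
have := bitn_add k nj; rewrite subnK // => ->.
by case: eqP => //= ->; apply: negbTE.
Qed.

(** When a carry or a borrow has travelled over [j] digits, the number in question is divisible by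
    [2 ^ j]; the next digit then decides whether it travels on. *)
Lemma bitn_dvd j n : 2 ^ j %| n -> bitn j n = ~~ (2 ^ j.+1 %| n).
Proof.
elim: j n => [|j IHj] n /=; first by rewrite expn1 dvdn2 negbK.
move=> jn; have n2 : n = n./2.*2.
  have : 2 %| n by apply: dvdn_trans jn; rewrite expnS dvdn_mulr.
  by rewrite dvdn2 => /negbTE on; rewrite -[LHS]odd_double_half on.
move: jn; rewrite {1 3}n2 -!mul2n expnS [2 ^ j.+2]expnS !dvdn_pmul2l //.
exact: IHj.
Qed.

(** * Programs with counters and their compilation to a logspace transducer *)

Section Programs.

Variables (K : nat) (S : finType).

(** A counter is tested only by [CDec], which reports to the control whether it was positive before,
    and leaves zero at zero. All other tests concern the finite control. *)
Inductive cmd :=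
  | CAct of S -> isymbol -> S * move * option bool
  | CInc of 'I_K
  | CDec of 'I_K & (S -> bool -> S)
  | CSkip
  | CSeq of cmd & cmd
  | CIf of (S -> bool) & cmd & cmd
  | CWhile of (S -> bool) & cmd.

Record store := Store {
  sctl : S; shead : nat; scnt : 'I_K -> nat; sout : seq bool }.

Definition emit (o : option bool) (w : seq bool) :=
  if o is Some b then rcons w b else w.

Section Exec.
Variables (x : seq bool) (N : nat).

(* [N] bounds the counters, hence the space needed to store them in binary. *)
Inductive exec : cmd -> store -> store -> Prop :=
  | EAct f s h c w : exec (CAct f) (Store s h c w)
      (Store (f s (read_input x h)).1.1
        (minn (shift (f s (read_input x h)).1.2 h) (size x).+1) c
        (emit (f s (read_input x h)).2 w))
  | EInc i s h c w : c i < N ->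
      exec (CInc i) (Store s h c w) (Store s h (upd c i (c i).+1) w)
  | EDec i f s h c w :
      exec (CDec i f) (Store s h c w)
        (Store (f s (0 < c i)) h (upd c i (c i).-1) w)
  | ESkip st : exec CSkip st st
  | ESeq a b st st1 st2 : exec a st st1 -> exec b st1 st2 ->
      exec (CSeq a b) st st2
  | EIfT (b : S -> bool) c1 c2 st st1 : b (sctl st) -> exec c1 st st1 ->
      exec (CIf b c1 c2) st st1
  | EIfF (b : S -> bool) c1 c2 st st1 : ~~ b (sctl st) -> exec c2 st st1 ->
      exec (CIf b c1 c2) st st1
  | EWhileF (b : S -> bool) c st : ~~ b (sctl st) -> exec (CWhile b c) st st
  | EWhileT (b : S -> bool) c st st1 st2 : b (sctl st) -> exec c st st1 ->
      exec (CWhile b c) st1 st2 -> exec (CWhile b c) st st2.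

End Exec.

Inductive instr :=
  | IAct of S -> isymbol -> S * move * option bool
  | IInc of 'I_K
  | IDec of 'I_K & (S -> bool -> S)
  | IBr of (S -> bool) & nat.

Fixpoint len (c : cmd) : nat :=
  match c with
  | CAct _ | CInc _ | CDec _ _ => 1
  | CSkip => 0
  | CSeq a b => len a + len b
  | CIf _ a b => (len a + (len b).+1).+1
  | CWhile _ a => (len a).+2
  end.

(** [IBr] jumps when its test fails, so [IBr xpred0] is an unconditional jump. *)
Fixpoint comp (pc : nat) (c : cmd) : seq instr :=
  match c with
  | CAct f => [:: IAct f]
  | CInc i => [:: IInc i]
  | CDec i f => [:: IDec i f]
  | CSkip => [::]
  | CSeq a b => comp pc a ++ comp (pc + len a) b
  | CIf t a b => IBr t (pc.+1 + len a).+1 ::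
      (comp pc.+1 a ++ IBr xpred0 ((pc.+1 + len a).+1 + len b) ::
        comp (pc.+1 + len a).+1 b)
  | CWhile t a => IBr t (pc.+1 + len a).+1 ::
      (comp pc.+1 a ++ [:: IBr xpred0 pc])
  end.

Lemma size_comp pc c : size (comp pc c) = len c.
Proof.
elim: c pc => //= [a IHa b IHb|b c1 IH1 c2 IH2|b c IHc] pc.
- by rewrite size_cat IHa IHb.
- by rewrite size_cat /= IH1 IH2.
- by rewrite size_cat /= IHc addn1.
Qed.

Section Transducer.

Variables (code : seq instr) (s0 : S).

Definition cell : finType := (bool * bool * {ffun 'I_K -> bool})%type.

Definition setbit (a : cell) (i : 'I_K) (b : bool) : cell :=
  (a.1.1, a.1.2, [ffun k => if k == i then b else a.2 k]).

(** [None] is the start state, in which the mark is written. Otherwise: program counter ([size code]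
    means halt), control, and the phase of a counter instruction, which scans to the right and comes
    back to the mark. *)
Definition ctrl : finType := option ('I_(size code).+1 * S * 'I_4)%type.

Definition ct (pc : nat) (s : S) (ph : nat) : ctrl :=
  Some (inord pc, s, inord ph).

(* The leftmost cell only carries the mark; counters are stored in binary from
   cell 1 on, one per track, low bits first, within a prefix of used cells. *)
Definition tstep (q : ctrl) (a : isymbol) (z : cell) :
    ctrl * cell * move * move * option bool :=
  if q isn't Some (pc, s, ph) then
    (ct 0 s0 0, (true, z.1.2, z.2), MStay, MStay, None)
  else match nth (IBr xpred0 0) code pc with
  | IAct f => let '(s', m, o) := f s a in (ct pc.+1 s' 0, z, m, MStay, o)
  | IBr b t => (ct (if b s then pc.+1 else t) s 0, z, MStay, MStay, None)
  | IInc i =>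
    match val ph with
    | 0 => (ct pc s 1, z, MStay, MRight, None)
    | 1 => if z.2 i then (ct pc s 1, setbit z i false, MStay, MRight, None)
           else (ct pc s 2, setbit (z.1.1, true, z.2) i true,
                 MStay, MLeft, None)
    | _ => if z.1.1 then (ct pc.+1 s 0, z, MStay, MStay, None)
           else (ct pc s 2, z, MStay, MLeft, None)
    end
  | IDec i f =>
    match val ph with
    | 0 => (ct pc s 1, z, MStay, MRight, None)
    | 1 => if z.1.2 then
             if z.2 i then (ct pc s 2, setbit z i false, MStay, MLeft, None)
             else (ct pc s 1, setbit z i true, MStay, MRight, None)
           else (ct pc s 3, z, MStay, MLeft, None)
    | 2 => if z.1.1 then (ct pc.+1 (f s true) 0, z, MStay, MStay, None)
           else (ct pc s 2, z, MStay, MLeft, None)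
    | _ => if z.1.1 then (ct pc.+1 (f s false) 0, z, MStay, MStay, None)
           else (ct pc s 3, setbit z i false, MStay, MLeft, None)
    end
  end.

Definition machine : transducer :=
  @Transducer ctrl cell (false, false, [ffun=> false]) None
    (fun q => if q is Some (pc, _, _) then val pc == size code else false)
    tstep.

Definition tape (U : nat) (c : 'I_K -> nat) (j : nat) : cell :=
  if j is j'.+1 then (false, j' < U, [ffun i => bitn j' (c i)])
  else (true, false, [ffun=> false]).

Variable x : seq bool.

Definition reach (W : nat) (c c' : config machine) : Prop :=
  exists m, iter m (step x) c = c' /\
    forall k, k <= m -> chead (iter k (step x) c) <= W.

Lemma reach_refl W c : chead c <= W -> reach W c c.
Proof. by move=> cW; exists 0; split=> // k; rewrite leqn0 => /eqP->. Qed.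

Lemma reach_trans W c1 c2 c3 : reach W c1 c2 -> reach W c2 c3 -> reach W c1 c3.
Proof.
move=> [m [m2 mW]] [n [n2 nW]]; exists (n + m); split.
  by rewrite iterD m2.
move=> k; case: (leqP k m) => [km _|mk kn]; first exact: mW.
have := nW (k - m); rewrite -m2 -iterD subnK ?(ltnW mk) //; apply; lia.
Qed.

Lemma reach_step W c c' : chead c <= W -> chead c' <= W -> step x c = c' ->
  reach W c c'.
Proof.
move=> cW c'W cc'; exists 1; split=> // -[|[|k]] //=.
by rewrite cc'.
Qed.

Definition conf (ph : nat) (pc : nat) (s : S) (h : nat) (w : seq bool)
    (T : nat -> cell) (p : nat) : config machine :=
  @Config machine (ct pc s ph) h T p w.

Lemma stepE ph pc s h w T p : pc < size code -> ph < 4 -> h <= (size x).+1 ->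
  step x (conf ph pc s h w T p) =
  let: (q, a, mi, mw, o) :=
    tstep (ct pc s ph) (read_input x h) (T p) in
  @Config machine q (minn (shift mi h) (size x).+1) (upd T p a) (shift mw p)
    (emit o w).
Proof.
move=> pcc ph4 hx; rewrite /step /conf /= /ct.
by rewrite inordK ?ltn_eqF // ltnW.
Qed.

Lemma tstepE pc s ph a z : pc < size code -> ph < 4 ->
  tstep (ct pc s ph) a z =
  match nth (IBr xpred0 0) code pc with
  | IAct f => let '(s', m, o) := f s a in (ct pc.+1 s' 0, z, m, MStay, o)
  | IBr b t => (ct (if b s then pc.+1 else t) s 0, z, MStay, MStay, None)
  | IInc i =>
    match ph with
    | 0 => (ct pc s 1, z, MStay, MRight, None)
    | 1 => if z.2 i then (ct pc s 1, setbit z i false, MStay, MRight, None)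
           else (ct pc s 2, setbit (z.1.1, true, z.2) i true,
                 MStay, MLeft, None)
    | _ => if z.1.1 then (ct pc.+1 s 0, z, MStay, MStay, None)
           else (ct pc s 2, z, MStay, MLeft, None)
    end
  | IDec i f =>
    match ph with
    | 0 => (ct pc s 1, z, MStay, MRight, None)
    | 1 => if z.1.2 then
             if z.2 i then (ct pc s 2, setbit z i false, MStay, MLeft, None)
             else (ct pc s 1, setbit z i true, MStay, MRight, None)
           else (ct pc s 3, z, MStay, MLeft, None)
    | 2 => if z.1.1 then (ct pc.+1 (f s true) 0, z, MStay, MStay, None)
           else (ct pc s 2, z, MStay, MLeft, None)
    | _ => if z.1.1 then (ct pc.+1 (f s false) 0, z, MStay, MStay, None)
           else (ct pc s 3, setbit z i false, MStay, MLeft, None)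
    end
  end.
Proof.
move=> pcc ph4; rewrite /tstep {1}/ct /=.
have -> : (inord pc : 'I_(size code).+1) = pc :> nat by rewrite inordK // ltnW.
have -> : (inord ph : 'I_4) = ph :> nat by rewrite inordK.
by [].
Qed.

Lemma tape_upd U c i j m n b z : z = tape U (upd c i m) j.+1 ->
  (forall k, bitn k n = if k == j then b else bitn k m) ->
  upd (tape U (upd c i m)) j.+1 (setbit z i b) = tape U (upd c i n).
Proof.
move=> -> nE; apply/funext => -[|k] //; rewrite /upd eqSS /=.
case: eqP => [->|kj].
  congr (_, _, _); apply/ffunP => l; rewrite !ffunE; case: eqP => // _.
  by rewrite nE eqxx.
congr (_, _, _); apply/ffunP => l; rewrite !ffunE; case: eqP => // _.
by rewrite nE; case: eqP.
Qed.

Lemma tape_use U c : (forall i, c i < 2 ^ U) ->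
  upd (tape U c) U.+1 (false, true, (tape U c U.+1).2) = tape U.+1 c.
Proof.
move=> cU; apply/funext => -[|k] //; rewrite /upd eqSS /=.
by case: eqP => [->|kU]; rewrite ?ltnSn // ltnS [k <= U]leq_eqVlt; case: eqP kU.
Qed.

Lemma go_left W pc s h w (T : nat -> cell) p : pc < size code ->
  h <= (size x).+1 -> p <= W -> (T 0).1.1 ->
  (forall j, j < p -> (T j.+1).1.1 = false) ->
  (match nth (IBr xpred0 0) code pc with
   | IInc _ | IDec _ _ => true | _ => false end) ->
  reach W (conf 2 pc s h w T p)
    (conf 0 pc.+1
      (if nth (IBr xpred0 0) code pc is IDec _ f then f s true else s) h w T 0).
Proof.
move=> pcc hx; have hm := minn_idPl hx.
case E: (nth _ _ _) => [g|i|i g|b t] pW T0 TS // _.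
- elim: p pW TS => [|p IHp] pW TS.
    by apply: reach_step => //; rewrite stepE // tstepE // E T0 /= hm upd_same.
  apply: (@reach_trans _ _ (conf 2 pc s h w T p)).
    apply: reach_step => //=; first exact: ltnW.
    by rewrite stepE // tstepE // E TS //= hm upd_same.
  by apply: IHp => [|j jp]; [exact: ltnW|apply: TS; exact: ltnW].
elim: p pW TS => [|p IHp] pW TS.
  by apply: reach_step => //; rewrite stepE // tstepE // E T0 /= hm upd_same.
apply: (@reach_trans _ _ (conf 2 pc s h w T p)).
  apply: reach_step => //=; first exact: ltnW.
  by rewrite stepE // tstepE // E TS //= hm upd_same.
by apply: IHp => [|j jp]; [exact: ltnW|apply: TS; exact: ltnW].
Qed.

(** The used prefix grows only when the new value needs another digit. This ties its length to the
    logarithm of the bound on the counters. *)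
Lemma inc_run W pc s h w U c i : pc < size code -> h <= (size x).+1 -> U < W ->
  nth (IBr xpred0 0) code pc = IInc i -> (forall k, c k < 2 ^ U) ->
  exists U', [/\ U <= U', forall k, upd c i (c i).+1 k < 2 ^ U',
    U' <= U \/ 2 ^ U <= (c i).+1 /\ U' = U.+1 &
    reach W (conf 0 pc s h w (tape U c) 0)
      (conf 0 pc.+1 s h w (tape U' (upd c i (c i).+1)) 0)].
Proof.
move=> pcc hx UW E cU; have hm := minn_idPl hx.
(* After [j] carries the low [j] digits, all of them ones, have been erased, which leaves
   [(c i).+1 - 2 ^ j] on the tape. *)
have scan j : j <= U -> 2 ^ j %| (c i).+1 ->
    exists U', [/\ U <= U', forall k, upd c i (c i).+1 k < 2 ^ U',
    U' <= U \/ 2 ^ U <= (c i).+1 /\ U' = U.+1 &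
    reach W (conf 1 pc s h w (tape U (upd c i ((c i).+1 - 2 ^ j))) j.+1)
      (conf 0 pc.+1 s h w (tape U' (upd c i (c i).+1)) 0)].
  move En: (U - j) => n; elim: n j En => [|n IHn] j En jU dj.
    have jEU : j = U by lia. 
    subst j.
    have ci : (c i).+1 = 2 ^ U.
      apply/eqP; rewrite eqn_leq cU; exact: dvdn_leq dj.
    exists U.+1; split=> //.
    - move=> k; rewrite /upd; case: eqP => _; first by rewrite ci ltn_exp2l.
      by apply: ltn_trans (cU k) _; rewrite ltn_exp2l.
    - by right; rewrite ci.
    rewrite ci subnn.
    apply: (@reach_trans _ _
        (conf 2 pc s h w (tape U.+1 (upd c i (2 ^ U))) U)).
      apply: reach_step => //=; first exact: ltnW.
      rewrite stepE // tstepE // E /= ffunE updE bitn_ge ?expn_gt0 //= hm.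
      congr Config; rewrite -(@tape_upd U.+1 c i U 0 (2 ^ U) true
        (tape U.+1 (upd c i 0) U.+1)) //; last first.
        move=> k; rewrite -{1}[2 ^ U]add0n bitn_add ?bitn_ge ?expn_gt0 //.
      rewrite -tape_use; last first.
        by move=> k; rewrite /upd; case: (k == i); rewrite ?expn_gt0.
      by rewrite upd_upd updE.
    have := @go_left W pc s h w (tape U.+1 (upd c i (2 ^ U))) U pcc hx.
    by rewrite E; apply=> //; exact: ltnW.
  have ltjU : j < U by lia.
  case bj: (bitn j ((c i).+1 - 2 ^ j)).
    have j1 : 2 ^ j.+1 <= (c i).+1.
      rewrite leqNgt; apply/negP => lt_j.
      by move: bj; rewrite bitn_ge //; move: lt_j; rewrite expnS; lia.
    have dj1 : 2 ^ j.+1 %| (c i).+1.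
      apply: contraT => ndj; move: bj; have := bitn_dvd dj; rewrite ndj => bj'.
      have := bitn_sub j (dvdn_leq (ltn0Sn _) dj) bj'.
      by rewrite eqxx /= => ->.
    have [|||U' [h1 h2 h3 h4]] := IHn j.+1; [by lia|by lia|by []|].
    exists U'; split=> //; apply: reach_trans h4.
    apply: reach_step => //=; [by lia|by lia|].
    rewrite stepE // tstepE // E /= ffunE updE bj /= hm.
    congr Config; apply: tape_upd => // k.
    rewrite expnS mul2n -addnn subnDA bitn_sub //; first by case: (k == j).
    by move: j1; rewrite expnS; lia.
  have ej : (c i).+1 - 2 ^ j + 2 ^ j = (c i).+1.
    by rewrite subnK //; exact: dvdn_leq dj.
  have ciU : (c i).+1 < 2 ^ U.
    rewrite ltn_neqAle cU andbT; apply/eqP => ciE; move: bj.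
    rewrite ciE; have := bitn_dvd dj; rewrite ciE.
    rewrite dvdn_exp2l // => nb.
    move=> bj0; have := bitn_add j (negbT bj0).
    by rewrite subnK ?eqxx ?nb // leq_exp2l // ltnW.
  exists U; split=> //; [|by left|].
    by move=> k; rewrite /upd; case: eqP.
  apply: (@reach_trans _ _ (conf 2 pc s h w (tape U (upd c i (c i).+1)) j)).
    apply: reach_step => //=; [by lia|by lia|].
    rewrite stepE // tstepE // E /= ffunE updE bj /= hm.
    congr Config; apply: tape_upd => [|k]; first by rewrite /= ltjU.
    by rewrite -{1}ej bitn_add ?bj //; case: (k == j).
  have := @go_left W pc s h w (tape U (upd c i (c i).+1)) j pcc hx.
  by rewrite E; apply=> //; lia.
have [||U' [h1 h2 h3 h4]] := scan 0; rewrite ?dvd1n //.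
exists U'; split=> //; apply: reach_trans h4; apply: reach_step => //=; first by lia.
by rewrite stepE // tstepE // E /= hm upd_same subSS subn0 upd_same.
Qed.

(** The zero test is a borrow that runs off the used prefix: nothing but zeros was found, and phase
    3 undoes the damage on the way back. *)
Lemma dec_run W pc s h w U c i f : pc < size code -> h <= (size x).+1 -> U < W ->
  nth (IBr xpred0 0) code pc = IDec i f -> (forall k, c k < 2 ^ U) ->
  reach W (conf 0 pc s h w (tape U c) 0)
    (conf 0 pc.+1 (f s (0 < c i)) h w (tape U (upd c i (c i).-1)) 0).
Proof.
move=> pcc hx UW E cU; have hm := minn_idPl hx.
(* After the failed borrow the digits are all ones; the return trip erases them from the top. *)
have undo j : j <= U ->
    reach W (conf 3 pc s h w (tape U (upd c i (2 ^ j).-1)) j)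
      (conf 0 pc.+1 (f s false) h w (tape U (upd c i 0)) 0).
  elim: j => [|j IHj] jU.
    apply: reach_step => //=; rewrite stepE // tstepE // E /= hm.
    by congr Config; apply: (upd_same (tape U (upd c i 0)) 0).
  apply: (@reach_trans _ _ (conf 3 pc s h w (tape U (upd c i (2 ^ j).-1)) j)).
    apply: reach_step => //=; [by lia|by lia|].
    rewrite stepE // tstepE // E /= hm.
    congr Config; apply: tape_upd => // k.
    have -> : (2 ^ j.+1).-1 = (2 ^ j).-1 + 2 ^ j.
      by rewrite expnS; have := expn_gt0 2 j; lia.
    rewrite bitn_add; last by rewrite bitn_ge // prednK ?expn_gt0.
    case: eqP => [->|//] /=; rewrite bitn_ge //.
    by rewrite prednK ?expn_gt0.
  by apply: IHj; lia.
(* After [j] borrows the low [j] digits, all of them zeros, have become ones, which adds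
   [(2 ^ j).-1]. *)
have scan j : j <= U -> 2 ^ j %| c i ->
    reach W (conf 1 pc s h w (tape U (upd c i (c i + (2 ^ j).-1))) j.+1)
      (conf 0 pc.+1 (f s (0 < c i)) h w (tape U (upd c i (c i).-1)) 0).
  move En: (U - j) => n; elim: n j En => [|n IHn] j En jU dj.
    have jEU : j = U by lia. 
    subst j.
    have ci : c i = 0.
      by apply/eqP; case: (c i) (cU i) dj => // m mU /dvdn_leq; lia.
    rewrite ci /= add0n; apply: reach_trans (undo U _) => //.
    apply: reach_step => //=; first exact: ltnW.
    rewrite stepE // tstepE // E /= ltnn /= hm; congr Config.
    apply/funext => -[|k] //; rewrite /upd eqSS; case: (k =P U) => [->|//].
    by rewrite /= ltnn.
  have ltjU : j < U by lia.
  have bE k : bitn k (c i + (2 ^ j).-1) = (k < j) || bitn k (c i).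
    elim: j k (c i) dj {IHn En jU ltjU} => [|j IHj] k m dj /=.
      by rewrite addn0.
    have m2 : m = m./2.*2.
      have : 2 %| m by apply: dvdn_trans dj; rewrite expnS dvdn_mulr.
      by rewrite dvdn2 => /negbTE om; rewrite -[LHS]odd_double_half om.
    have -> : m + (2 ^ j.+1).-1 = (m./2 + (2 ^ j).-1).*2.+1.
      rewrite {1}m2 expnS; have := expn_gt0 2 j; lia.
    case: k => [|k] /=; first by rewrite odd_double.
    rewrite uphalf_double IHj //.
    by move: dj; rewrite {1}m2 -mul2n expnS dvdn_pmul2l.
  have bj := bE j; rewrite ltnn /= in bj.
  case bc: (bitn j (c i)).
    have c0 : 0 < c i by case: (c i) bc => // b0; rewrite bitn_ge ?expn_gt0 in b0.
    have cj : 2 ^ j <= c i by exact: dvdn_leq dj.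
    rewrite c0.
    apply: (@reach_trans _ _ (conf 2 pc s h w (tape U (upd c i (c i).-1)) j)).
      apply: reach_step => //=; [by lia|by lia|].
      rewrite stepE // tstepE // E /= ltjU ffunE updE bj bc /= hm.
      congr Config.
      have -> : (c i).-1 = c i + (2 ^ j).-1 - 2 ^ j by have := expn_gt0 2 j; lia.
      apply: tape_upd => [|k]; first by rewrite /= ltjU.
      by rewrite bitn_sub ?bj //; [case: (k == j)|lia].
    have := @go_left W pc s h w (tape U (upd c i (c i).-1)) j pcc hx.
    by rewrite E; apply=> //; lia.
  have dj1 : 2 ^ j.+1 %| c i by apply: contraT => nd; rewrite bitn_dvd ?nd in bc.
  apply: reach_trans (IHn j.+1 _ _ dj1); [|by lia|by lia].
  apply: reach_step => //=; [by lia|by lia|].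
  rewrite stepE // tstepE // E /= ltjU ffunE updE bj bc /= hm.
  congr Config.
  have -> : c i + (2 ^ j.+1).-1 = c i + (2 ^ j).-1 + 2 ^ j.
    by rewrite expnS; have := expn_gt0 2 j; lia.
  apply: tape_upd => [|k]; first by rewrite /= ltjU.
  by rewrite bitn_add ?bj ?bc //; case: (k == j).
have := scan 0; rewrite dvd1n expn0 addn0 upd_same => scan0.
apply: reach_trans (scan0 _ _) => //; apply: reach_step => //=; first by lia.
by rewrite stepE // tstepE // E /= hm upd_same.
Qed.

Definition code_at (pc : nat) (l : seq instr) : Prop :=
  pc + size l <= size code /\ forall i, i < size l ->
    nth (IBr xpred0 0) code (pc + i) = nth (IBr xpred0 0) l i.

Lemma code_at_cat pc l l' : code_at pc (l ++ l') ->
  code_at pc l /\ code_at (pc + size l) l'.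
Proof.
rewrite /code_at size_cat => -[h1 h2]; split; split; try lia.
  by move=> i il; rewrite h2 ?nth_cat ?il //; lia.
move=> i il; rewrite -addnA h2 ?nth_cat; last by lia.
by rewrite ltnNge leq_addr addKn.
Qed.

Lemma code_at_cons pc a l : code_at pc (a :: l) ->
  [/\ pc < size code, nth (IBr xpred0 0) code pc = a & code_at pc.+1 l].
Proof.
move=> /(@code_at_cat pc [:: a]) [[h1 /(_ 0 isT) h2] h3].
by rewrite addn0 /= addn1 in h1 h2 h3; split.
Qed.

Variable N : nat.
(** The head reaches at most the cell [U.+1], and [U] is increased only if [2 ^ U <= N]; so [U < W]
    persists. *)
Let W := (trunc_log 2 N).+2.

Lemma exec_reach c st st' : exec x N c st st' -> shead st <= (size x).+1 ->
  forall pc U, code_at pc (comp pc c) -> (forall k, scnt st k < 2 ^ U) -> U < W ->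
  shead st' <= (size x).+1 /\
  exists U', [/\ forall k, scnt st' k < 2 ^ U', U' < W &
  reach W (conf 0 pc (sctl st) (shead st) (sout st) (tape U (scnt st)) 0)
    (conf 0 (pc + len c) (sctl st') (shead st') (sout st')
      (tape U' (scnt st')) 0)].
Proof.
have br pc s h w T b t : pc < size code -> h <= (size x).+1 ->
    nth (IBr xpred0 0) code pc = IBr b t ->
    reach W (conf 0 pc s h w T 0)
      (conf 0 (if b s then pc.+1 else t) s h w T 0).
  move=> pcc hx E; apply: reach_step => //; rewrite stepE // tstepE // E /=.
  by rewrite (minn_idPl hx) upd_same.
elim=> {c st st'}.
- move=> f s h c w /= hx pc U /code_at_cons[pcc E _] cU UW.
  split; first exact: geq_minr.
  exists U; split=> //; rewrite addn1; apply: reach_step => //.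
  rewrite stepE // tstepE // E; case: (f _ _) => [[s' m] o] /=.
  by rewrite upd_same.
- move=> i s h c w ciN /= hx pc U /code_at_cons[pcc E _] cU UW; split=> //.
  rewrite addn1; have [U' [_ h2 h3 h4]] := inc_run s w pcc hx UW E cU.
  exists U'; split=> //; case: h3 => [|[h5 ->]]; first by move/leq_ltn_trans; apply.
  have U2 : 2 ^ U <= N by exact: leq_trans h5 ciN.
  by rewrite /W !ltnS trunc_log_max.
- move=> i f s h c w /= hx pc U /code_at_cons[pcc E _] cU UW; split=> //.
  exists U; split=> //; last by rewrite addn1; exact: dec_run.
  move=> k; rewrite /upd; case: (k =P i) => [_|//]; apply: leq_ltn_trans (cU i).
  exact: leq_pred.
- move=> st /= hx pc U _ cU UW; split=> //; exists U; split=> //.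
  by rewrite addn0; apply: reach_refl.
- move=> a b st st1 st2 _ IHa _ IHb /= hx pc U /code_at_cat[ca cb] cU UW.
  have [hx1 [U1 [cU1 UW1 r1]]] := IHa hx _ _ ca cU UW.
  rewrite size_comp in cb.
  have [hx2 [U2 [cU2 UW2 r2]]] := IHb hx1 _ _ cb cU1 UW1.
  by split=> //; exists U2; split=> //; rewrite addnA; exact: reach_trans r1 r2.
- move=> b c1 c2 st st1 bs _ IH /= hx pc U /code_at_cons[pcc E].
  move=> /code_at_cat[ca]; rewrite size_comp => /code_at_cons[pcd E' cb] cU UW.
  have [hx1 [U1 [cU1 UW1 r1]]] := IH hx _ _ ca cU UW.
  split=> //; exists U1; split=> //.
  have := br pc (sctl st) (shead st) (sout st) (tape U (scnt st)) _ _ pcc hx E.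
  rewrite bs => r0; apply: reach_trans r0 _; apply: reach_trans r1 _.
  have := br _ (sctl st1) (shead st1) (sout st1) (tape U1 (scnt st1)) _ _ pcd hx1 E'.
  by rewrite /= -!addSnnS !addSn addnA.
- move=> b c1 c2 st st1 bs _ IH /= hx pc U /code_at_cons[pcc E].
  move=> /code_at_cat[ca]; rewrite size_comp => /code_at_cons[pcd E' cb] cU UW.
  have [hx1 [U1 [cU1 UW1 r1]]] := IH hx _ _ cb cU UW.
  split=> //; exists U1; split=> //.
  have := br pc (sctl st) (shead st) (sout st) (tape U (scnt st)) _ _ pcc hx E.
  rewrite (negbTE bs) => r0; apply: reach_trans r0 _; move: r1.
  by rewrite -!addSnnS !addSn addnA.
- move=> b c st bs /= hx pc U /code_at_cons[pcc E _] cU UW; split=> //.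
  exists U; split=> //.
  have := br pc (sctl st) (shead st) (sout st) (tape U (scnt st)) _ _ pcc hx E.
  by rewrite (negbTE bs) -!addSnnS !addSn.
move=> b c st st1 st2 bs _ IH1 _ IH2 /= hx pc U cw cU UW.
have [pcc E /code_at_cat[ca]] := code_at_cons cw.
rewrite size_comp => /code_at_cons[pcd E' _].
have [hx1 [U1 [cU1 UW1 r1]]] := IH1 hx _ _ ca cU UW.
have [hx2 [U2 [cU2 UW2 r2]]] := IH2 hx1 _ _ cw cU1 UW1.
split=> //; exists U2; split=> //.
have := br pc (sctl st) (shead st) (sout st) (tape U (scnt st)) _ _ pcc hx E.
rewrite bs => r0; apply: reach_trans r0 _; apply: reach_trans r1 _.
have := br _ (sctl st1) (shead st1) (sout st1) (tape U1 (scnt st1)) _ _ pcd hx1 E'.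
by move/reach_trans; apply.
Qed.

End Transducer.

(* A program that runs with polynomially (here: linearly) bounded counters
   computes a logspace function. *)
Theorem logspace_program (c : cmd) (s0 : S) (f : seq bool -> seq bool) :
  (forall x, exists st, exec x (size x).+2 c (Store s0 0 (fun=> 0) [::]) st /\
    sout st = f x) -> logspace f.
Proof.
move=> run; exists (machine (comp 0 c) s0), 4 => x.
have [st [ex stf]] := run x.
have ca : code_at (comp 0 c) 0 (comp 0 c) by split.
have [_ [U [_ _ [m [mE mW]]]]] :=
  exec_reach s0 ex isT ca (U := 0) (fun=> isT) isT.
rewrite add0n in mE mW.
set M := machine _ _ in mE mW *.
have s1 : step x (initial M) =
    conf (comp 0 c) s0 0 0 s0 0 [::] (tape 0 (fun=> 0)) 0.
  rewrite /step /= /initial /conf min0n; congr Config.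
  apply/funext => -[|j] //; rewrite /upd //=; congr (_, _, _).
  by apply/ffunP => i; rewrite !ffunE bitn_ge // expn_gt0.
have run1 k : iter k.+1 (step x) (initial M) =
    iter k (step x) (conf (comp 0 c) s0 0 0 s0 0 [::] (tape 0 (fun=> 0)) 0).
  by rewrite iterSr s1.
have hlt : thalt (cstate (iter m.+1 (step x) (initial M))).
  by rewrite run1 mE /= inordK // size_comp.
split; first by exists m.+1; split=> //; rewrite run1 mE.
(* Passing from [size x] to [(size x).+2] adds at most 2 to the logarithm, and [W] adds 2 more; the
   factor 4 absorbs both. *)
have sW : (trunc_log 2 (size x).+2).+2 <= 4 * (trunc_log 2 (size x)).+1.
  suff : trunc_log 2 (size x).+2 <= (trunc_log 2 (size x)).+2 by lia.
  case: (size x) => [|n]; first by [].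
  rewrite -ltnS; apply: (@leq_trans (trunc_log 2 (n.+1 * 4)).+1).
    by rewrite ltnS leq_trunc_log //; lia.
  have -> : n.+1 * 4 = 2 * (2 * n.+1) by lia.
  by rewrite !mul2n !trunc_log2_double // double_gt0.
have stay j : iter (j + m.+1) (step x) (initial M) = iter m.+1 (step x) (initial M).
  by elim: j => // j IHj; rewrite addSn iterS IHj {1}/step hlt.
case=> [|k]; first by [].
apply: leq_trans sW; case: (leqP k m) => km; first by rewrite run1 mW.
have -> : k.+1 = (k - m) + m.+1 by lia.
by rewrite stay run1 mW.
Qed.

End Programs.

(** * Serialised trees and tables of tree transducers *)

Definition hdr (k m : nat) : seq bool := true :: unary k ++ unary m.

Lemma ser_node k ts :
  ser (node k ts) = hdr k (size ts) ++ flatten (map ser ts).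
Proof. by rewrite /= /hdr /= -catA. Qed.

Lemma hdrE k m : hdr k m = true :: unary k ++ unary m.
Proof. by []. Qed.

Opaque hdr.

(** Trees are nested in lists, so the induction hypothesis for the children has to be built by an
    inner recursion on the list. *)
Definition tree_ind (P : tree -> Prop) (HL : forall n, P (leaf n))
    (HN : forall k ts, (forall t, List.In t ts -> P t) -> P (node k ts)) :
    forall t, P t :=
  fix F t := match t with
    | GenTree.Leaf n => HL n
    | GenTree.Node k ts => HN k ts ((fix G (ts : seq tree) :
        forall t, List.In t ts -> P t :=
        match ts with
        | [::] => fun _ H => match H with end
        | u :: us => fun t H => match H with
           | or_introl e => match e in _ = v return P v with erefl => F u end
           | or_intror H' => G us t H' end
        end) ts)
    end.

Notation in_0 := (or_introl erefl).
Notation in_1 := (or_intror in_0).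
Notation in_2 := (or_intror in_1).

Ltac arity km := move: km; rewrite !inE !xpair_eqE /=; lia.

Fixpoint ntok (t : tree) : nat :=
  match t with
  | GenTree.Leaf _ => 1
  | GenTree.Node _ ts => (sumn (map ntok ts)).+1
  end.

Lemma unary_cat n m z z' :
  unary n ++ z = unary m ++ z' -> n = m /\ z = z'.
Proof.
rewrite /unary -!cats1 -!catA /=.
by elim: n m => [|n IHn] [|m] //= [] // /IHn[-> ->].
Qed.

(** Unary numbers are self-delimiting, and the arity in a header tells how many codes follow; so
    both sides are parsed in the same way. *)
Lemma ser_cat t u z z' : ser t ++ z = ser u ++ z' -> t = u /\ z = z'.
Proof.
elim/tree_ind: t u z z' => [n|k ts IH] [m|l us] z z'.
- by move=> [] /unary_cat [-> ->].
- by [].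
- by [].
rewrite !ser_node !hdrE /= => -[]; rewrite -!catA.
move=> /unary_cat[-> /unary_cat[sz]].
suff : flatten (map ser ts) ++ z = flatten (map ser us) ++ z' ->
    ts = us /\ z = z' by move=> H /H[-> ->].
elim: ts us sz z z' IH => [|t ts IHts] [|u us] //= [sz] z z' IH.
rewrite -!catA => /IH[|-> /(IHts _ sz)]; first by left.
by case=> [v vts|-> ->] //; apply: IH; right.
Qed.

Lemma ser_inj : injective ser.
Proof.
by move=> t u e; have [] := @ser_cat t u [::] [::]; rewrite ?cats0.
Qed.

(** Tags, arities, child indices and orders that a table has to distinguish are all below 9; larger
    values are identified to keep the control finite. *)
Definition cap n := minn n 9.

(** The output at a leaf of value [n]: each pair contributes a constant string and [n] copies of
    another one. It is locked because the strings are fixed but large. *)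
Definition seval (g : seq (seq bool * seq bool)) (n : nat) : seq bool :=
  locked (flatten [seq ab.1 ++ flatten (nseq n ab.2) | ab <- g]).

(** Enough for the pairing [mc] of tables with 18 and 20 states and its start state. *)
Definition nstates := 40.

(* A top-down tree-to-string transducer. [delta q k j p l] is the state of
   child [j] of a node with label [k] in state [q]; [p] is the value of the
   preceding sibling, when it is a leaf, and [l] tells whether the child is the
   last one. Labels, arities, indices and values are capped. *)
Record table := Table {
  delta : nat -> nat -> nat -> nat -> bool -> nat;
  okL : nat -> nat -> bool;
  okN : nat -> nat -> nat -> bool;
  outL : nat -> seq (seq bool * seq bool);
  outN : nat -> nat -> nat -> seq bool;
  deltaP : forall q k j p l, delta q k j p l < nstates }.

Definition lval (t : tree) : nat := if t is GenTree.Leaf n then cap n else 0.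

Section Children.
Variables (R : Type) (e : R) (op : R -> R -> R) (f : nat -> tree -> R).
Variable st : nat -> nat -> bool -> nat.

Fixpoint children (j p : nat) (ts : seq tree) : R :=
  match ts with
  | [::] => e
  | u :: us => op (f (st (cap j) p (nilp us)) u) (children j.+1 (lval u) us)
  end.

End Children.

Fixpoint trav (T : table) (q : nat) (t : tree) : seq bool :=
  match t with
  | GenTree.Leaf n => seval (outL T q) n
  | GenTree.Node k ts => outN T q (cap k) (cap (size ts)) ++
      children [::] cat (trav T) (delta T q (cap k)) 0 0 ts
  end.

Fixpoint okt (T : table) (q : nat) (t : tree) : bool :=
  match t with
  | GenTree.Leaf n => okL T q (cap n)
  | GenTree.Node k ts => okN T q (cap k) (cap (size ts)) &&
      children true andb (okt T) (delta T q (cap k)) 0 0 ts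
  end.

(** * Control fields and counters *)

Definition ctl : finType := {ffun 'I_14 -> 'I_nstates}.
Definition get (s : ctl) (i : 'I_14) : nat := s i.
Definition set1 (s : ctl) (i : 'I_14) (v : nat) : ctl :=
  [ffun j => if j == i then inord v else s j].

Lemma get_set s i v j : v < nstates ->
  get (set1 s i v) j = if j == i then v else get s j.
Proof.
move=> vn; rewrite /get /set1 ffunE; case: eqP => // _.
by rewrite inordK.
Qed.

Lemma get_lt s i : get s i < nstates. Proof. exact: ltn_ord. Qed.

Lemma cap_lt n : cap n < nstates. Proof. by rewrite /cap /nstates; lia. Qed.

(* Fields 0-5 are scratch. *)
Definition fsy := @Ordinal 14 0 isT.
Definition fnode := @Ordinal 14 1 isT.
Definition fk := @Ordinal 14 2 isT.
Definition fm := @Ordinal 14 3 isT.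
Definition fz := @Ordinal 14 4 isT.
Definition fgo := @Ordinal 14 5 isT.
(** The lasting fields: state at the current node, state and label of its parent, index of the node
    among its siblings, value of the preceding sibling, failure flag, value of the subtree skipped
    last, and whether the target of a walk still lies ahead. *)
Definition fq := @Ordinal 14 6 isT.
Definition fqp := @Ordinal 14 7 isT.
Definition fkp := @Ordinal 14 8 isT.
Definition fj := @Ordinal 14 9 isT.
Definition fpv := @Ordinal 14 10 isT.
Definition fbad := @Ordinal 14 11 isT.
Definition fpn := @Ordinal 14 12 isT.
Definition fw := @Ordinal 14 13 isT.

Definition agr (l : seq 'I_14) (s s' : ctl) :=
  forall i, i \notin l -> get s' i = get s i.

Lemma agr_refl l s : agr l s s. Proof. by []. Qed.
Lemma agr_trans l s1 s2 s3 : agr l s1 s2 -> agr l s2 s3 -> agr l s1 s3.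
Proof. by move=> h h' i il; rewrite h' // h. Qed.
Lemma agrW l l' s s' : agr l s s' -> all (mem l') l -> agr l' s s'.
Proof.
by move=> h /allP ll' i il'; apply: h; apply: contra il' => /ll'.
Qed.
Lemma agr_set l s s' i v : agr l s s' -> i \in l -> v < nstates ->
  agr l s (set1 s' i v).
Proof.
move=> h il vn j jl; rewrite get_set //; case: eqP => [ji|_]; last exact: h.
by rewrite ji il in jl.
Qed.

(** The counters: position of the next token, a copy of it, distance to the target of a walk,
    overshoot beyond the target, symbols to go back, subtrees still pending, and siblings from the
    current node on. *)
Definition cv (p t g h b d r : nat) : 'I_7 -> nat :=
  fun i => nth 0 [:: p; t; g; h; b; d; r] i.

Definition cP := @Ordinal 7 0 isT.
Definition cT := @Ordinal 7 1 isT.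
Definition cG := @Ordinal 7 2 isT.
Definition cH := @Ordinal 7 3 isT.
Definition cB := @Ordinal 7 4 isT.
Definition cD := @Ordinal 7 5 isT.
Definition cR := @Ordinal 7 6 isT.

Ltac cv_ext := by apply/funext => -[[|[|[|[|[|[|[|i]]]]]]] i7].

Lemma updP p t g h b d r v : upd (cv p t g h b d r) cP v = cv v t g h b d r.
Proof. cv_ext. Qed.
Lemma updT p t g h b d r v : upd (cv p t g h b d r) cT v = cv p v g h b d r.
Proof. cv_ext. Qed.
Lemma updG p t g h b d r v : upd (cv p t g h b d r) cG v = cv p t v h b d r.
Proof. cv_ext. Qed.
Lemma updH p t g h b d r v : upd (cv p t g h b d r) cH v = cv p t g v b d r.
Proof. cv_ext. Qed.
Lemma updBk p t g h b d r v : upd (cv p t g h b d r) cB v = cv p t g h v d r.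
Proof. cv_ext. Qed.
Lemma updD p t g h b d r v : upd (cv p t g h b d r) cD v = cv p t g h b v r.
Proof. cv_ext. Qed.
Lemma updR p t g h b d r v : upd (cv p t g h b d r) cR v = cv p t g h b d v.
Proof. cv_ext. Qed.

Notation prog := (cmd 7 ctl).
Notation St := (@Store 7 ctl).

Definition icode (a : isymbol) : nat :=
  match a with LEnd => 0 | REnd => 1 | Bit b => 2 + b end.

Lemma icode_lt a : icode a < nstates. Proof. by case: a => // -[]. Qed.

Definition rdsym : prog := CAct 7 (fun s a => (set1 s fsy (icode a), MStay, None)).
Definition mv (m : move) : prog := CAct 7 (fun s _ => (s, m, None)).
Definition ups (g : ctl -> ctl) : prog := CAct 7 (fun s _ => (g s, MStay, None)).
Definition dec (i : 'I_7) (f : 'I_14) : prog :=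
  CDec i (fun s b => set1 s f (b : nat)).
Definition is_ (i : 'I_14) (v : nat) (s : ctl) : bool := get s i == v.
Notation "a ;; b" := (CSeq a b) (at level 60, right associativity).

Section Run.
Variable x : seq bool.
Let N := (size x).+2.
Notation ex := (exec x N).

Definition rc (z : seq bool) : nat := if z is b :: _ then 2 + b else 1.

Lemma rc_lt z : rc z < nstates. Proof. by case: z => // -[]. Qed.

Lemma read_at y z : x = y ++ z ->
  icode (read_input x (size y).+1) = rc z.
Proof.
move=> ->; rewrite /= onth_cat ltnn subnn; by case: z.
Qed.

Lemma ex_rd y z s c w : x = y ++ z ->
  ex rdsym (St s (size y).+1 c w) (St (set1 s fsy (rc z)) (size y).+1 c w).
Proof.
move=> xe; have := EAct x N
  (fun s a => (set1 s fsy (icode a), MStay, None)) s (size y).+1 c w.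
rewrite (read_at xe) /=.
by rewrite (_ : minn _ _ = (size y).+1) // xe size_cat; lia.
Qed.

Lemma ex_mv m s h c w :
  ex (mv m) (St s h c w) (St s (minn (shift m h) (size x).+1) c w).
Proof. exact: (EAct x N (fun s _ => (s, m, None)) s h c w). Qed.

Lemma ex_mvR y b z s c w : x = y ++ b :: z ->
  ex (mv MRight) (St s (size y).+1 c w) (St s (size (rcons y b)).+1 c w).
Proof.
move=> xe; have := ex_mv MRight s (size y).+1 c w; rewrite /= size_rcons.
by rewrite (_ : minn _ _ = (size y).+2) // xe size_cat /=; lia.
Qed.

Lemma ex_ups g s h c w : h <= (size x).+1 ->
  ex (ups g) (St s h c w) (St (g s) h c w).
Proof.
move=> hx; have := EAct x N (fun s _ => (g s, MStay, None)) s h c w => /=.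
by rewrite (minn_idPl hx).
Qed.

Lemma ex_dec i f s h c w :
  ex (dec i f) (St s h c w) (St (set1 s f (0 < c i : nat)) h (upd c i (c i).-1) w).
Proof. exact: (EDec x N i (fun s b => set1 s f (b : nat))). Qed.

(** Some rounds of a loop whose test may still succeed at the end. Unlike complete executions of
    [CWhile], such runs can be concatenated. *)
Inductive loops (b : ctl -> bool) (c : prog) : store 7 ctl -> store 7 ctl -> Prop :=
  | Loop0 st : loops b c st st
  | LoopS st st1 st2 : b (sctl st) -> ex c st st1 -> loops b c st1 st2 ->
      loops b c st st2.

Lemma loops_trans b c st st1 st2 :
  loops b c st st1 -> loops b c st1 st2 -> loops b c st st2.
Proof. by elim=> // st' st'1 st'2 bs e _ IH /IH; apply: LoopS. Qed.

Lemma loops_while b c st st1 :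
  loops b c st st1 -> ~~ b (sctl st1) -> ex (CWhile b c) st st1.
Proof.
elim=> [st0 nb|st0 st01 st2 bs e _ IH nb]; first exact: EWhileF.
by apply: EWhileT bs e _; apply: IH.
Qed.

Lemma at_bound y z : x = y ++ z -> (size y).+1 <= (size x).+1.
Proof. by move=> ->; rewrite size_cat; lia. Qed.

(** * Reading tokens, and checking that the input is a tree *)

Section Token.
Variables (hook mh : prog).

(** [hook] runs once per input symbol, and [mh] in [rdtok] once per child announced by a header.
    Each use of the reader keeps its own counters through them; [Phi t d] is their content after [t]
    symbols and [d] children. *)
Definition unary_rd (f : 'I_14) (body : prog) : prog :=
  rdsym ;; CWhile (is_ fsy 3) (ups (fun s => set1 s f (cap (get s f).+1)) ;;
    body ;; hook ;; mv MRight ;; rdsym) ;;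
  CIf (is_ fsy 1) (ups (fun s => set1 s fbad 1)) (CSkip _ _) ;;
  hook ;; mv MRight.

Definition rdtok : prog :=
  rdsym ;; hook ;; mv MRight ;;
  ups (fun s => set1 (set1 (set1 s fnode (get s fsy == 3)) fk 0) fm 0) ;;
  unary_rd fk (CSkip _ _) ;;
  CIf (is_ fnode 1) (unary_rd fm mh) (CSkip _ _).

Variable Phi : nat -> nat -> 'I_7 -> nat.
Variables tm dm : nat.
Hypothesis hookP : forall t d s h w, t < tm -> d <= dm -> h <= (size x).+1 ->
  exists2 s', agr [:: fz] s s' &
    ex hook (St s h (Phi t d) w) (St s' h (Phi t.+1 d) w).
Hypothesis mhP : forall t d s h w, t <= tm -> d < dm ->
  ex mh (St s h (Phi t d) w) (St s h (Phi t d.+1) w).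

Lemma ex_unary (f : 'I_14) body e y n z s t d w : x = y ++ unary n ++ z ->
  f \in [:: fk; fm] -> t + n < tm -> d + e * n <= dm ->
  (forall t d s h w, t <= tm -> d + e <= dm ->
     ex body (St s h (Phi t d) w) (St s h (Phi t (d + e)) w)) ->
  get s f = cap (get s f) ->
  exists s', [/\ agr [:: fz; fsy; f] s s', get s' f = cap (get s f + n) &
    ex (unary_rd f body) (St s (size y).+1 (Phi t d) w)
      (St s' (size (y ++ unary n)).+1 (Phi (t + n).+1 (d + e * n)) w)].
Proof.
move=> xe ff tn dn bodyP.
have fsyf : (fsy == f) = false by move: ff; rewrite !inE => /orP[]/eqP->.
have fzf : (f == fz) = false by move: ff; rewrite !inE => /orP[]/eqP->.
have loop : get s f = cap (get s f) ->
    exists s', [/\ agr [:: fz; fsy; f] s s', get s' f = cap (get s f + n),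
      get s' fsy = 2 &
    ex (CWhile (is_ fsy 3) (ups (fun s => set1 s f (cap (get s f).+1)) ;;
    body ;; hook ;; mv MRight ;; rdsym)) (St (set1 s fsy (rc (unary n ++ z)))
      (size y).+1 (Phi t d) w)
      (St s' (size (y ++ nseq n true)).+1 (Phi (t + n) (d + e * n)) w)].
  elim: n y s t d xe tn dn => [|n IHn] y s t d xe tn dn sf.
    exists (set1 s fsy 2); split.
    - by apply: agr_set => //; rewrite !inE eqxx orbT.
    - by rewrite get_set // eq_sym fsyf addn0.
    - by rewrite get_set.
    by rewrite cats0 addn0 muln0 addn0; apply: EWhileF; rewrite /is_ get_set.
  rewrite mulnS addnA in dn.
  have xe' : x = rcons y true ++ unary n ++ z by rewrite xe cat_rcons.
  set s1 := set1 s fsy _; set s2 := set1 s1 f (cap (get s1 f).+1).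
  have tt : t < tm by lia.
  have dd : d + e <= dm by lia.
  have [s3 a3 e3] := hookP s2 w tt dd (at_bound xe).
  have f3 : get s3 f = cap (get s f).+1.
    rewrite (a3 f) ?inE ?fzf // get_set ?cap_lt // eqxx.
    by rewrite get_set ?rc_lt // eq_sym fsyf.
  have [|||s' [a' f' sy' e']] := IHn (rcons y true) s3 t.+1 (d + e) xe'.
  - by rewrite addSnnS.
  - by [].
  - by rewrite f3 /cap; lia.
  exists s'; split=> //.
  - apply: agr_trans a'; apply: (@agr_trans _ _ s2); last exact: agrW a3 _.
    apply: agr_set; rewrite ?inE ?eqxx ?orbT ?cap_lt //.
    by apply: agr_set; rewrite ?inE ?eqxx ?orbT ?rc_lt.
  - by rewrite f' f3 sf /cap; lia.
  have -> : y ++ nseq n.+1 true = rcons y true ++ nseq n true by rewrite cat_rcons.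
  rewrite -addSnnS mulnS addnA.
  apply: EWhileT e'; first by rewrite /is_ get_set // rc_lt.
  apply: ESeq (ex_ups _ _ _ _ (at_bound xe)) _.
  apply: ESeq (bodyP _ _ _ _ _ (ltnW tt) dd) _.
  apply: ESeq e3 _; apply: ESeq (ex_mvR _ _ _ xe) _.
  exact: ex_rd xe'.
move=> sf; have [s1 [a1 f1 sy1 e1]] := loop sf.
have tt : t + n < tm by lia.
have xe1 : x = (y ++ nseq n true) ++ false :: z.
  by rewrite xe /unary -cats1 -!catA.
have [s2 a2 e2] := hookP s1 w tt dn (at_bound xe1).
exists s2; split.
- by apply: agr_trans a1 _; apply: agrW a2 _.
- by rewrite (a2 f) ?inE ?fzf.
apply: ESeq (ex_rd _ _ _ xe) _; apply: ESeq e1 _.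
apply: (ESeq (st1 := St s1 (size (y ++ nseq n true)).+1 (Phi (t + n) (d + e * n)) w)).
  by apply: EIfF; [rewrite /is_ sy1|apply: ESkip].
apply: ESeq e2 _; have := ex_mvR s2 (Phi (t + n).+1 (d + e * n)) w xe1.
by rewrite rcons_cat.
Qed.

Lemma ex_rdtok_leaf y n z s t d w : x = y ++ ser (leaf n) ++ z ->
  t + size (ser (leaf n)) <= tm -> d <= dm ->
  exists s', [/\ agr [:: fz; fsy; fnode; fk; fm] s s', get s' fnode = 0,
    get s' fk = cap n, get s' fm = 0 &
    ex rdtok (St s (size y).+1 (Phi t d) w)
      (St s' (size (y ++ ser (leaf n))).+1
        (Phi (t + size (ser (leaf n))) d) w)].
Proof.
rewrite /= => xe tn dn.
have xe1 : x = rcons y false ++ unary n ++ z by rewrite xe cat_rcons.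
set s1 := set1 s fsy 2.
have tt : t < tm by lia.
have [s2 a2 e2] := hookP s1 w tt dn (at_bound xe).
set s3 := set1 (set1 (set1 s2 fnode (get s2 fsy == 3)) fk 0) fm 0.
have sy2 : get s2 fsy = 2 by rewrite (a2 fsy) // get_set.
have n1 : get s2 fsy == 3 < nstates by rewrite sy2.
have sz : size (unary n) = n.+1 by rewrite size_rcons size_nseq.
have [|||||s4 [a4 f4 e4]] := @ex_unary fk (CSkip _ _) 0 _ n z s3 t.+1 d w xe1.
- by [].
- by rewrite sz in tn; lia.
- by rewrite addn0.
- by move=> *; rewrite addn0; apply: ESkip.
- by rewrite !get_set.
exists s4; split.
- apply: agr_trans (agrW a4 _) => //; do 3 apply: agr_set => //.
  by apply: agr_trans (agrW a2 _) => //; apply: agr_set.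
- by rewrite (a4 fnode) // !get_set // sy2.
- by rewrite f4 !get_set.
- by rewrite (a4 fm) // !get_set.
apply: ESeq (ex_rd _ _ _ xe) _; apply: ESeq e2 _.
apply: ESeq (ex_mvR _ _ _ xe) _; apply: ESeq (ex_ups _ _ _ _ (at_bound xe1)) _.
rewrite cat_rcons mul0n addn0 in e4.
have -> : t + (size (unary n)).+1 = (t.+1 + n).+1 by rewrite sz; lia.
apply: ESeq e4 _.
by apply: EIfF; [rewrite /is_ (a4 fnode) // !get_set // sy2|apply: ESkip].
Qed.

Lemma ex_rdtok_node y k m z s t d w : x = y ++ hdr k m ++ z ->
  t + size (hdr k m) <= tm -> d + m <= dm ->
  exists s', [/\ agr [:: fz; fsy; fnode; fk; fm] s s', get s' fnode = 1,
    get s' fk = cap k, get s' fm = cap m &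
    ex rdtok (St s (size y).+1 (Phi t d) w)
      (St s' (size (y ++ hdr k m)).+1 (Phi (t + size (hdr k m)) (d + m)) w)].
Proof.
rewrite hdrE /= => xe tn dn.
have xe1 : x = rcons y true ++ unary k ++ (unary m ++ z).
  by rewrite xe cat_rcons -!catA.
have xe2 : x = (rcons y true ++ unary k) ++ unary m ++ z by rewrite xe1 catA.
set s1 := set1 s fsy 3.
have tt : t < tm by lia.
have dd : d <= dm by lia.
have [s2 a2 e2] := hookP s1 w tt dd (at_bound xe).
set s3 := set1 (set1 (set1 s2 fnode (get s2 fsy == 3)) fk 0) fm 0.
have sy2 : get s2 fsy = 3 by rewrite (a2 fsy) // get_set.
have n1 : get s2 fsy == 3 < nstates by rewrite sy2.
have sz i : size (unary i) = i.+1 by rewrite size_rcons size_nseq.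
rewrite size_cat !sz in tn *.
have [|||||s4 [a4 f4 e4]] :=
  @ex_unary fk (CSkip _ _) 0 _ k (unary m ++ z) s3 t.+1 d w xe1.
- by [].
- by lia.
- by rewrite addn0; lia.
- by move=> *; rewrite addn0; apply: ESkip.
- by rewrite !get_set.
have [|||||s5 [a5 f5 e5]] :=
  @ex_unary fm mh 1 _ m z s4 (t.+1 + k).+1 (d + 0 * k) w xe2.
- by [].
- by lia.
- by lia.
- by move=> *; rewrite addn1; apply: mhP => //; lia.
- by rewrite (a4 fm) // !get_set.
exists s5; split.
- apply: agr_trans (agrW a5 _) => //; apply: agr_trans (agrW a4 _) => //.
  do 3 apply: agr_set => //.
  by apply: agr_trans (agrW a2 _) => //; apply: agr_set.
- by rewrite (a5 fnode) // (a4 fnode) // !get_set // sy2.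
- by rewrite (a5 fk) // f4 !get_set.
- by rewrite f5 (a4 fm) // !get_set.
apply: ESeq (ex_rd _ _ _ xe) _; apply: ESeq e2 _.
apply: ESeq (ex_mvR _ _ _ xe) _; apply: ESeq (ex_ups _ _ _ _ (at_bound xe1)) _.
apply: ESeq e4 _; apply: EIfT.
  by rewrite /is_ (a4 fnode) // !get_set // sy2.
move: e5; rewrite -catA !cat_rcons mul0n addn0 mul1n.
by have -> : (((t.+1 + k).+1 + m).+1 = t + (k.+1 + m.+1).+1) by lia.
Qed.

Lemma ex_unary_eof (f : 'I_14) body e y n s t d w : x = y ++ nseq n true ->
  f \in [:: fk; fm] -> t + n < tm -> d + e * n <= dm ->
  (forall t d s h w, t <= tm -> d + e <= dm ->
     ex body (St s h (Phi t d) w) (St s h (Phi t (d + e)) w)) ->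
  exists s', [/\ agr [:: fz; fsy; f; fbad] s s', get s' fbad = 1 &
    ex (unary_rd f body) (St s (size y).+1 (Phi t d) w)
      (St s' (size x).+1 (Phi (t + n).+1 (d + e * n)) w)].
Proof.
move=> xe ff tn dn bodyP.
have fsyf : (fsy == f) = false by move: ff; rewrite !inE => /orP[]/eqP->.
have loop : exists s', [/\ agr [:: fz; fsy; f; fbad] s s', get s' fsy = 1 &
    ex (CWhile (is_ fsy 3) (ups (fun s => set1 s f (cap (get s f).+1)) ;;
    body ;; hook ;; mv MRight ;; rdsym)) (St (set1 s fsy (rc (nseq n true)))
      (size y).+1 (Phi t d) w)
      (St s' (size x).+1 (Phi (t + n) (d + e * n)) w)].
  elim: n y s t d xe tn dn => [|n IHn] y s t d xe tn dn.
    exists (set1 s fsy 1); split.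
    - by apply: agr_set => //; rewrite !inE eqxx orbT.
    - by rewrite get_set.
    rewrite xe cats0 addn0 muln0 addn0.
    by apply: EWhileF; rewrite /is_ get_set.
  rewrite mulnS addnA in dn.
  have xe' : x = rcons y true ++ nseq n true by rewrite xe cat_rcons.
  set s1 := set1 s fsy _; set s2 := set1 s1 f (cap (get s1 f).+1).
  have tt : t < tm by lia.
  have dd : d + e <= dm by lia.
  have [s3 a3 e3] := hookP s2 w tt dd (at_bound xe).
  have [||s' [a' sy' e']] := IHn (rcons y true) s3 t.+1 (d + e) xe'.
  - by rewrite addSnnS.
  - by [].
  exists s'; split=> //.
    apply: agr_trans a'; apply: (@agr_trans _ _ s2); last exact: agrW a3 _.
    apply: agr_set; rewrite ?inE ?eqxx ?orbT ?cap_lt //.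
    by apply: agr_set; rewrite ?inE ?eqxx ?orbT ?rc_lt.
  rewrite -addSnnS mulnS addnA.
  apply: EWhileT e'; first by rewrite /is_ get_set // rc_lt.
  apply: ESeq (ex_ups _ _ _ _ (at_bound xe)) _.
  apply: ESeq (bodyP _ _ _ _ _ (ltnW tt) dd) _.
  apply: ESeq e3 _; apply: ESeq (ex_mvR _ _ _ xe) _.
  by have := ex_rd s3 (Phi t.+1 (d + e)) w (z := nseq n true) xe'; apply.
have [s1 [a1 sy1 e1]] := loop.
have tt : t + n < tm by lia.
have [s2 a2 e2] := hookP (set1 s1 fbad 1) w tt dn (leqnn _).
exists s2; split.
- apply: agr_trans (agrW a2 _) => //; apply: agr_set => //.
  by rewrite !inE eqxx !orbT.
- by rewrite (a2 fbad) // get_set.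
apply: ESeq (ex_rd _ _ _ xe) _; apply: ESeq e1 _.
apply: (ESeq (st1 := St (set1 s1 fbad 1) (size x).+1 (Phi (t + n) (d + e * n)) w)).
  by apply: EIfT; [rewrite /is_ sy1|apply: ex_ups].
apply: ESeq e2 _; have := ex_mv MRight s2 (size x).+1 (Phi (t + n).+1 (d + e * n)) w.
by rewrite /= (_ : minn _ _ = (size x).+1) //; lia.
Qed.

End Token.

Lemma unaryP (z : seq bool) :
  (exists n z', z = unary n ++ z') \/ z = nseq (size z) true.
Proof.
elim: z => [|[] z [[n [z' ->]]|e]]; first by right.
- by left; exists n.+1, z'.
- by right; rewrite {1}e.
- by left; exists 0, (unary n ++ z').
by left; exists 0, z.
Qed.

(** A forest is read without a stack: [cD] counts the trees pending after the current one, a header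
    adds its arity, and every token takes one off. *)
Definition tokloop (hook : prog) : prog :=
  CWhile (is_ fgo 1) (rdtok hook (CInc _ cD) ;; dec cD fgo).

Definition Lsk := [:: fz; fsy; fnode; fk; fm; fgo].

Section Forest.
Variables (hook : prog) (Phi : nat -> nat -> 'I_7 -> nat) (tm : nat).
Hypothesis hookP : forall t d s h w, t < tm -> d <= N -> h <= (size x).+1 ->
  exists2 s', agr [:: fz] s s' &
    ex hook (St s h (Phi t d) w) (St s' h (Phi t.+1 d) w).
Hypothesis PhiD : forall t d, Phi t d cD = d.
Hypothesis PhiU : forall t d d', upd (Phi t d) cD d' = Phi t d'.

Let mhP t d s h w : t <= tm -> d < N ->
  ex (CInc _ cD) (St s h (Phi t d) w) (St s h (Phi t d.+1) w).
Proof.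
move=> _ dN; have := EInc x (i := cD) s h (N := N) (c := Phi t d) w.
by rewrite PhiD PhiU; apply.
Qed.

Lemma ser_size t : 1 < size (ser t).
Proof.
by case: t => [n|k ts]; rewrite /= ?size_cat size_rcons ?addnS ?addSn.
Qed.

Lemma forest_size f : size f <= size (flatten (map ser f)).
Proof.
by elim: f => //= t f IHf; rewrite size_cat; have := ser_size t; lia.
Qed.

Lemma ex_dec_go s h t d w :
  ex (dec cD fgo) (St s h (Phi t d) w)
    (St (set1 s fgo (0 < d : nat)) h (Phi t d.-1) w).
Proof. by have := ex_dec cD fgo s h (Phi t d) w; rewrite PhiD PhiU. Qed.

Lemma bool_lt (b : bool) : b < nstates. Proof. by case: b. Qed.

(** Reading a header replaces the first tree of the forest by its children, so the induction is on
    the number of tokens. *)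
Lemma ex_tokloop y f z s t w : x = y ++ flatten (map ser f) ++ z ->
  t + size (flatten (map ser f)) <= tm -> get s fgo = (0 < size f) ->
  exists2 s', agr Lsk s s' &
    ex (tokloop hook) (St s (size y).+1 (Phi t (size f).-1) w)
      (St s' (size (y ++ flatten (map ser f))).+1
         (Phi (t + size (flatten (map ser f))) 0) w).
Proof.
move: {2}(sumn _) (leqnn (sumn (map ntok f))) => n.
elim: n f y s t => [|n IHn] [|u f] y s t //=.
- move=> _ _ _ s0; exists s => //; rewrite cats0 addn0.
  by apply: EWhileF; rewrite /is_ s0.
- by case: u => [m|k ts] /=.
- move=> _ _ _ s0; exists s => //; rewrite cats0 addn0.
  by apply: EWhileF; rewrite /is_ s0.
move=> un xe tn s0.
have step g m v s1 : size g = size f + m -> x = (y ++ v) ++ flatten (map ser g) ++ z ->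
    sumn (map ntok g) <= n -> t + size v + size (flatten (map ser g)) <= tm ->
    agr Lsk s s1 -> 
    ex (rdtok hook (CInc _ cD)) (St s (size y).+1 (Phi t (size f)) w)
      (St s1 (size (y ++ v)).+1 (Phi (t + size v) (size f + m)) w) ->
    exists2 s', agr Lsk s s' &
    ex (tokloop hook) (St s (size y).+1 (Phi t (size f)) w)
      (St s' (size (y ++ v ++ flatten (map ser g))).+1
         (Phi (t + size (v ++ flatten (map ser g))) 0) w).
  move=> sg xg gn tg a1 e1.
  have [|s' a' e'] := IHn g (y ++ v) (set1 s1 fgo (0 < size f + m : nat))
    (t + size v) gn xg tg.
    by rewrite get_set ?bool_lt // sg.
  exists s'.
    by apply: agr_trans a'; apply: agr_set => //; rewrite bool_lt.
  apply: EWhileT; first by rewrite /is_ s0.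
    by apply: ESeq e1 _; apply: ex_dec_go.
  by rewrite sg in e'; rewrite [size (v ++ _)]size_cat addnA catA.
have fx : size f <= N.
  have := forest_size f; have := congr1 size xe; rewrite !size_cat /N; lia.
case: u un xe tn => [m|k ts] un xe tn.
  have xe1 : x = y ++ ser (leaf m) ++ (flatten (map ser f) ++ z).
    by rewrite xe -catA.
  have [|s1 [a1 _ _ _ e1]] := ex_rdtok_leaf (CInc _ cD) hookP s w xe1 _ fx (t := t).
    by move: tn; rewrite !size_cat; lia.
  apply: (step f 0 (ser (leaf m)) s1); rewrite ?addn0 //.
  - by rewrite xe -!catA.
  - by move: tn; rewrite size_cat; lia.
  - exact: agrW a1 _.
rewrite ser_node -!catA in xe tn *.
have [||s1 [a1 _ _ _ e1]] := ex_rdtok_node hookP mhP s w xe (t := t) (d := size f).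
- by move: tn; rewrite !size_cat; lia.
- have := forest_size f; have := forest_size ts; have := congr1 size xe.
  by rewrite !size_cat /N; lia.
have := step (ts ++ f) (size ts) (hdr k (size ts)) s1.
rewrite map_cat flatten_cat -!catA; apply=> //; first by rewrite size_cat addnC.
- by move: un; rewrite /= map_cat sumn_cat; lia.
- by move: tn; rewrite !size_cat; lia.
- exact: agrW a1 _.
Qed.

End Forest.

Definition nohook : prog := CSkip _ _.

Section Valid.
Variable c : 'I_7 -> nat.
Let Phi (t d : nat) := upd c cD d.

Let hookP t d s h w : t < (size x).+4 -> d <= N -> h <= (size x).+1 ->
  exists2 s', agr [:: fz] s s' &
    ex nohook (St s h (Phi t d) w) (St s' h (Phi t.+1 d) w).
Proof. by move=> _ _ _; exists s => //; apply: ESkip. Qed.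
Let PhiD t d : Phi t d cD = d. Proof. by rewrite /Phi updE. Qed.
Let PhiU t d d' : upd (Phi t d) cD d' = Phi t d'.
Proof. by rewrite /Phi upd_upd. Qed.
Let mhP t d s h w : t <= (size x).+4 -> d < N ->
  ex (CInc _ cD) (St s h (Phi t d) w) (St s h (Phi t d.+1) w).
Proof.
move=> _ dN; have := EInc x (i := cD) s h (N := N) (c := Phi t d) w.
by rewrite PhiD PhiU; apply.
Qed.
Let skipP t d s h w : t <= (size x).+4 -> d + 0 <= N ->
  ex (CSkip _ _) (St s h (Phi t d) w) (St s h (Phi t (d + 0)) w).
Proof. by move=> *; rewrite addn0; apply: ESkip. Qed.

(** Without a complete token the reader runs to the right marker. The children announced by a
    truncated header have been counted by then; [m <= size z] keeps them within the bound of the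
    counters. *)
Lemma ex_rdtok_bad y z s d w : x = y ++ z -> d + size z <= N ->
  (forall n z', z <> ser (leaf n) ++ z') -> (forall k m z', z <> hdr k m ++ z') ->
  exists s' m, [/\ agr (fbad :: Lsk) s s', get s' fbad = 1, get s' fgo = get s fgo,
    m <= size z &
    ex (rdtok nohook (CInc _ cD)) (St s (size y).+1 (Phi 0 d) w)
      (St s' (size x).+1 (Phi 0 (d + m)) w)].
Proof.
move=> xe dN nl nz; have sx := congr1 size xe; rewrite size_cat in sx.
set s1 := set1 s fsy (rc z).
set s3 := set1 (set1 (set1 s1 fnode (get s1 fsy == 3)) fk 0) fm 0.
have a3 : agr (fbad :: Lsk) s s3.
  by rewrite /s3 /s1; repeat (apply: agr_set => //; rewrite ?bool_lt ?rc_lt //).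
have n3 : get s3 fnode = (rc z == 3).
  by rewrite !get_set ?bool_lt ?rc_lt.
have pre h c' st : ex (mv MRight) (St s1 (size y).+1 (Phi 0 d) w)
    (St s1 h (Phi 0 d) w) -> h <= (size x).+1 ->
    ex (unary_rd nohook fk (CSkip _ _) ;; c') (St s3 h (Phi 0 d) w) st ->
    ex (rdsym ;; nohook ;; mv MRight ;;
      ups (fun s => set1 (set1 (set1 s fnode (get s fsy == 3)) fk 0) fm 0) ;;
      unary_rd nohook fk (CSkip _ _) ;; c') (St s (size y).+1 (Phi 0 d) w) st.
  move=> e1 hx e2; apply: ESeq (ex_rd _ _ _ xe) _.
  by apply: ESeq (ESkip _ _ _) _; apply: ESeq e1 _; apply: ESeq (ex_ups _ _ _ _ hx) _.
have eof y1 n : x = y1 ++ nseq n true -> rc z != 3 ->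
    ex (mv MRight) (St s1 (size y).+1 (Phi 0 d) w)
      (St s1 (size y1).+1 (Phi 0 d) w) ->
  exists s' m, [/\ agr (fbad :: Lsk) s s', get s' fbad = 1, get s' fgo = get s fgo,
    m <= size z &
    ex (rdtok nohook (CInc _ cD)) (St s (size y).+1 (Phi 0 d) w)
      (St s' (size x).+1 (Phi 0 (d + m)) w)].
  move=> xe1 z3 e1.
  have [||||s4 [a4 b4 e4]] := @ex_unary_eof nohook Phi _ N hookP fk (CSkip _ _) 0
    y1 n s3 0 d w xe1.
  - by [].
  - by have := congr1 size xe1; rewrite size_cat size_nseq; lia.
  - by lia.
  - exact: skipP.
  exists s4, 0; split=> //.
  - by apply: agr_trans a3 _; apply: agrW a4 _.
  - by rewrite (a4 fgo) // !get_set ?bool_lt ?rc_lt.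
  rewrite mul0n addn0 in e4; rewrite addn0.
  apply: pre e1 (at_bound xe1) _; apply: ESeq e4 _.
  apply: EIfF; last exact: ESkip.
  by rewrite /is_ (a4 fnode) // n3 (negbTE z3).
case: z @s1 @s3 a3 n3 pre eof xe dN nl nz sx => [|[] z] s1 s3 a3 n3 pre eof xe dN nl nz sx.
- apply: (eof x 0) => //; first by rewrite cats0.
  have := ex_mv MRight s1 (size y).+1 (Phi 0 d) w.
  by rewrite /= (_ : minn _ _ = (size x).+1) //; rewrite /= in sx; lia.
- have xe1 : x = rcons y true ++ z by rewrite cat_rcons.
  have e1 := ex_mvR s1 (Phi 0 d) w xe.
  have [[k [z' zE]]|zE] := unaryP z; last first.
    have xe2 : x = rcons y true ++ nseq (size z) true by rewrite -zE.
    have [||||s4 [a4 b4 e4]] := @ex_unary_eof nohook Phi _ N hookP fk (CSkip _ _)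
      0 _ _ s3 0 d w xe2.
    - by [].
    - by rewrite /= in sx; lia.
    - by rewrite /= in dN; lia.
    - exact: skipP.
    have xe3 : x = x ++ nseq 0 true by rewrite cats0.
    have [||||s5 [a5 b5 e5]] := @ex_unary_eof nohook Phi _ N hookP fm
      (CInc _ cD) 1 _ _ s4 0 d w xe3.
    - by [].
    - by [].
    - by lia.
    - by move=> t' d' *; rewrite addn1; apply: mhP => //; lia.
    exists s5, 0; split=> //.
    - apply: agr_trans a3 _.
    by apply: (@agr_trans _ _ s4); [exact: agrW a4 _|exact: agrW a5 _].
    - by rewrite (a5 fgo) // (a4 fgo) // !get_set ?bool_lt ?rc_lt.
    rewrite mul0n addn0 in e4.
    apply: pre e1 (at_bound xe1) _; apply: ESeq e4 _.
    by apply: EIfT; [rewrite /is_ (a4 fnode) // n3|exact: e5].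
  have xe2 : x = rcons y true ++ unary k ++ z' by rewrite -zE.
  have xe3 : x = (rcons y true ++ unary k) ++ z' by rewrite xe2 catA.
  have sz := congr1 size zE; rewrite size_cat size_rcons size_nseq in sz.
  have [|||||s4 [a4 f4 e4]] := @ex_unary nohook Phi _ N hookP fk (CSkip _ _)
    0 _ _ z' s3 0 d w xe2.
  - by [].
  - by rewrite /= in sx; lia.
  - by rewrite /= in dN; lia.
  - exact: skipP.
  - by rewrite !get_set ?bool_lt ?rc_lt.
  have [[m [z2 zE2]]|zE2] := unaryP z'.
    by case: (nz k m z2); rewrite zE zE2 hdrE /= -catA.
  have xe4 : x = (rcons y true ++ unary k) ++ nseq (size z') true by rewrite -zE2.
  have [||||s5 [a5 b5 e5]] := @ex_unary_eof nohook Phi _ N hookP fm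
      (CInc _ cD) 1 _ _ s4 0 d w xe4.
  - by [].
  - by rewrite /= in sx; lia.
  - by rewrite /= in dN; lia.
  - by move=> t' d' *; rewrite addn1; apply: mhP => //; lia.
  exists s5, (size z'); split=> //.
  - apply: agr_trans a3 _.
    by apply: (@agr_trans _ _ s4); [exact: agrW a4 _|exact: agrW a5 _].
  - by rewrite (a5 fgo) // (a4 fgo) // !get_set ?bool_lt ?rc_lt.
  - by rewrite /=; lia.
  rewrite mul0n addn0 in e4.
  apply: pre e1 (at_bound xe1) _; apply: ESeq e4 _.
  by apply: EIfT; [rewrite /is_ (a4 fnode) // n3|move: e5; rewrite mul1n].
have xe1 : x = rcons y false ++ z by rewrite cat_rcons.
have e1 := ex_mvR s1 (Phi 0 d) w xe.
have [[k [z' zE]]|zE] := unaryP z.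
  by case: (nl k z'); rewrite zE /= /unary.
have [] // := eof (rcons y false) (size z); first by rewrite -zE.
by move=> s' [m h]; exists s', m.
Qed.

Definition forest d z := exists f z', size f = d.+1 /\ z = flatten (map ser f) ++ z'.

Lemma tokP z : [\/ exists n z', z = ser (leaf n) ++ z',
    exists k m z', z = hdr k m ++ z' |
    (forall n z', z <> ser (leaf n) ++ z') /\ (forall k m z', z <> hdr k m ++ z')].
Proof.
have [h|nl] := pselect (exists n z', z = ser (leaf n) ++ z'); first by constructor 1.
have [h|nh] := pselect (exists k m z', z = hdr k m ++ z'); first by constructor 2.
constructor 3; split; first by move=> n z' e; apply: nl; exists n, z'.
by move=> k m z' e; apply: nh; exists k, m, z'.
Qed.

Lemma forest_leaf d n z :
  forest d (ser (leaf n) ++ z) -> if d is d'.+1 then forest d' z else True.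
Proof.
case: d => // d [[|u f] [z' [//= [sf] e]]].
have : ser (leaf n) ++ z = ser u ++ (flatten (map ser f) ++ z') by rewrite catA.
by case/ser_cat => _ ->; exists f, z'.
Qed.

Lemma forest_node d k m z :
  forest d (hdr k m ++ z) -> d + m = 0 \/ exists2 d', d + m = d'.+1 & forest d' z.
Proof.
move=> [[|u f] [z' [//= [sf] e]]].
case: u e => [n|l us]; rewrite ?ser_node -!catA !hdrE //= => -[]; rewrite -!catA.
case/unary_cat=> _ /unary_cat[mE zE].
case E: (d + m) => [|d']; first by left.
right; exists d' => //; exists (us ++ f), z'; rewrite size_cat -mE sf -E addnC.
by split=> //; rewrite zE map_cat flatten_cat -catA.
Qed.

(** The loop ends on every input: after a failure it stays at the right marker and runs [cD] down. A
    unit of [cD] never exceeds the input consumed for it, so [size z + d] decreases in every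
    round. *)
Lemma ex_valid n z y d s w : size z + d < n -> x = y ++ z -> d + size z <= N ->
  get s fgo = 1 ->
  exists s' h, [/\ agr (fbad :: Lsk) s s',
    ex (tokloop nohook) (St s (size y).+1 (Phi 0 d) w) (St s' h (Phi 0 0) w) &
    get s' fbad = 1 /\ ~ forest d z \/
    get s' fbad = get s fbad /\ exists f z', [/\ size f = d.+1,
      z = flatten (map ser f) ++ z' & h = (size (y ++ flatten (map ser f))).+1]].
Proof.
elim: n z y d s => // n IHn z y d s zn xe dN s0.
have [[m [z' zE]]|[k [m [z' zE]]]|[nl nh]] := tokP z.
- subst z; have sz := ser_size (leaf m); rewrite size_cat in zn dN.
  have tt : 0 + size (ser (leaf m)) <= (size x).+4 by rewrite xe !size_cat; lia.
  have dd : d <= N by lia.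
  have [s1 [a1 _ _ _ e1]] := ex_rdtok_leaf (CInc _ cD) hookP s w xe tt dd.
  have a1' : agr (fbad :: Lsk) s (set1 s1 fgo (0 < d : nat)).
    by apply: agr_set; rewrite ?bool_lt //; apply: agrW a1 _.
  have e1' : ex (rdtok nohook (CInc ctl cD);; dec cD fgo)
     (St s (size y).+1 (Phi 0 d) w)
     (St (set1 s1 fgo (0 < d : nat)) (size (y ++ ser (leaf m))).+1 (Phi 0 d.-1) w).
    by apply: ESeq e1 _; apply: (ex_dec_go PhiD PhiU).
  case: d dN zn dd e1 e1' a1' => [|d] dN zn dd e1 e1' a1'.
    exists (set1 s1 fgo 0), (size (y ++ ser (leaf m))).+1; split=> //.
      apply: EWhileT e1' _; rewrite /is_ ?s0 //.
      by apply: EWhileF; rewrite /= get_set.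
    right; split; first by rewrite get_set // (a1 fbad).
    by exists [:: leaf m], z'; rewrite /= cats0.
  have xe' : x = (y ++ ser (leaf m)) ++ z' by rewrite -catA.
  have [|||s' [h [a' e' H]]] := IHn z' _ d (set1 s1 fgo 1) _ xe'.
  - by lia.
  - by lia.
  - by rewrite get_set.
  exists s', h; split.
  - exact: agr_trans a1' a'.
  - by apply: EWhileT e1' e'; rewrite /is_ s0.
  case: H => [[b nf]|[b [f [z2 [fd fE h2]]]]].
    by left; split=> // /forest_leaf.
  right; split; first by rewrite b get_set // (a1 fbad).
  by exists (leaf m :: f), z2; rewrite /= fd fE h2 -!catA.
- subst z; have sz : size (hdr k m) = k + m + 3.
    by rewrite hdrE /= size_cat !size_rcons !size_nseq; lia.
  rewrite size_cat sz in zn dN.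
  have tt : 0 + size (hdr k m) <= (size x).+4 by rewrite xe !size_cat; lia.
  have dd : d + m <= N by lia.
  have [s1 [a1 _ _ _ e1]] := ex_rdtok_node hookP mhP s w xe tt dd.
  have a1' : agr (fbad :: Lsk) s (set1 s1 fgo (0 < d + m : nat)).
    by apply: agr_set; rewrite ?bool_lt //; apply: agrW a1 _.
  have e1' : ex (rdtok nohook (CInc ctl cD);; dec cD fgo)
     (St s (size y).+1 (Phi 0 d) w)
     (St (set1 s1 fgo (0 < d + m : nat)) (size (y ++ hdr k m)).+1
       (Phi 0 (d + m).-1) w).
    by apply: ESeq e1 _; apply: (ex_dec_go PhiD PhiU).
  case E: (d + m) e1' a1' => [|d'] e1' a1'.
    exists (set1 s1 fgo 0), (size (y ++ hdr k m)).+1; split=> //.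
      apply: EWhileT e1' _; rewrite /is_ ?s0 //.
      by apply: EWhileF; rewrite /= get_set.
    right; split; first by rewrite get_set // (a1 fbad).
    have [d0 m0] : d = 0 /\ m = 0 by lia.
    have fE : flatten (map ser [:: node k [::]]) = hdr k m by rewrite m0 hdrE /= !cats0.
    by exists [:: node k [::]], z'; rewrite fE d0.
  have xe' : x = (y ++ hdr k m) ++ z' by rewrite -catA.
  have [|||s' [h [a' e' H]]] := IHn z' _ d' (set1 s1 fgo 1) _ xe'.
  - by lia.
  - by lia.
  - by rewrite get_set.
  exists s', h; split.
  - exact: agr_trans a1' a'.
  - by apply: EWhileT e1' e'; rewrite /is_ s0.
  case: H => [[b nf]|[b [f [z2 [fd fE h2]]]]].
    left; split=> // /forest_node[|[d2]]; first by lia.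
    by rewrite E => -[<-].
  right; split; first by rewrite b get_set // (a1 fbad).
  exists (node k (take m f) :: drop m f), z2.
  have sm : size (take m f) = m by rewrite size_takel // fd; lia.
  have gE : flatten (map ser (node k (take m f) :: drop m f)) =
      hdr k m ++ flatten (map ser f).
    have -> : flatten (map ser f) = flatten (map ser (take m f)) ++
        flatten (map ser (drop m f)) by rewrite -flatten_cat -map_cat cat_take_drop.
    by rewrite catA -[in hdr k m]sm -ser_node.
  rewrite gE -catA h2 fE -catA; split=> //.
  by rewrite /= size_drop fd; lia.
have nf : ~ forest d z.
  case=> -[|u f] [z' [// _]]; rewrite map_cons [flatten _]/= -catA.
  by case: u => [i|k ts]; [exact: nl|rewrite ser_node -catA; exact: nh].
have [s1 [m [a1 b1 g1 mz e1]]] := ex_rdtok_bad s w xe dN nl nh.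
have e1' : ex (rdtok nohook (CInc ctl cD);; dec cD fgo)
     (St s (size y).+1 (Phi 0 d) w)
     (St (set1 s1 fgo (0 < d + m : nat)) (size x).+1 (Phi 0 (d + m).-1) w).
  by apply: ESeq e1 _; apply: (ex_dec_go PhiD PhiU).
have a1' : agr (fbad :: Lsk) s (set1 s1 fgo (0 < d + m : nat)).
  by apply: agr_set; rewrite ?bool_lt.
case E: (d + m) e1' a1' => [|d'] e1' a1'.
  exists (set1 s1 fgo 0), (size x).+1; split=> //.
    apply: EWhileT e1' _; rewrite /is_ ?s0 //.
    by apply: EWhileF; rewrite /= get_set.
  by left; rewrite get_set.
have xe' : x = x ++ [::] by rewrite cats0.
have [|||s' [h [a' e' H]]] := IHn [::] x d' (set1 s1 fgo 1) _ xe'.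
- by rewrite /=; lia.
- by rewrite /=; lia.
- by rewrite get_set.
exists s', h; split.
- exact: agr_trans a1' a'.
- by apply: EWhileT e1' e'; rewrite /is_ s0.
left; split=> //; case: H => [[b _]|[b _]] //.
by rewrite b get_set.
Qed.

End Valid.

(** * Draining counters, moving the head, writing strings *)

Definition drain (i : 'I_7) (body : prog) : prog :=
  dec i fz ;; CWhile (is_ fz 1) (body ;; dec i fz).

Lemma ex_drain i body L (C : nat -> 'I_7 -> nat) (hd : nat -> nat) M s w :
  (forall n, C n i = n) -> fz \in L ->
  (forall n s, n < M -> exists2 s', agr L s s' &
    ex body (St s (hd n.+1) (upd (C n.+1) i n) w) (St s' (hd n) (C n) w)) ->
  exists2 s', agr L s s' &
    ex (drain i body) (St s (hd M) (C M) w) (St s' (hd 0) (C 0) w).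
Proof.
move=> Ci zL bodyP.
have dE n s0 : ex (dec i fz) (St s0 (hd n) (C n) w)
    (St (set1 s0 fz (0 < n : nat)) (hd n) (upd (C n) i n.-1) w).
  by have := ex_dec i fz s0 (hd n) (C n) w; rewrite Ci.
suff [s' a' e'] : exists2 s', agr L (set1 s fz (0 < M : nat)) s' &
    ex (CWhile (is_ fz 1) (body ;; dec i fz))
    (St (set1 s fz (0 < M : nat)) (hd M) (upd (C M) i M.-1) w) (St s' (hd 0) (C 0) w).
  exists s'; last by apply: ESeq (dE _ _) e'.
  by apply: agr_trans a'; apply: agr_set; rewrite ?bool_lt.
elim: M s bodyP => [|M IHM] s bodyP.
  exists (set1 s fz 0) => //; have -> : upd (C 0) i 0 = C 0.
    by have := upd_same (C 0) i; rewrite Ci.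
  by apply: EWhileF; rewrite /is_ get_set.
have [s1 a1 e1] := bodyP M (set1 s fz 1) (ltnSn _).
have [s2 a2 e2] := IHM s1 (fun n s nM => bodyP n s (ltnW nM)).
exists s2.
  apply: agr_trans a1 _; apply: agr_trans a2.
  by apply: agr_set; rewrite ?bool_lt.
apply: EWhileT; first by rewrite /is_ get_set.
  by apply: ESeq e1 (dE _ _).
by [].
Qed.

Lemma ex_clear i s h c w :
  exists2 s', agr [:: fz] s s' &
    ex (drain i (CSkip _ _)) (St s h c w) (St s' h (upd c i 0) w).
Proof.
have [|||s' a' e'] := @ex_drain i (CSkip _ _) [:: fz] (fun n => upd c i n)
  (fun=> h) (c i) s w.
- by move=> n; rewrite updE.
- by [].
- by move=> n s0 _; exists s0 => //; rewrite upd_upd; apply: ESkip.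
by exists s' => //; move: e'; rewrite upd_same.
Qed.

Definition home : prog :=
  rdsym ;; CWhile (fun s => get s fsy != 0) (mv MLeft ;; rdsym) ;; mv MRight.

Lemma ex_home s h c w : h <= (size x).+1 ->
  exists2 s', agr [:: fsy] s s' & ex home (St s h c w) (St s' 1 c w).
Proof.
move=> hx.
have rdE s0 h0 : h0 <= (size x).+1 -> ex rdsym (St s0 h0 c w)
    (St (set1 s0 fsy (icode (read_input x h0))) h0 c w).
  move=> h0x; have := EAct x N
    (fun s a => (set1 s fsy (icode a), MStay, None)) s0 h0 c w.
  by rewrite /= (minn_idPl h0x).
have loop h0 s0 : h0 <= (size x).+1 -> exists2 s', agr [:: fsy] s0 s' &
    ex (CWhile (fun s => get s fsy != 0) (mv MLeft ;; rdsym))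
      (St (set1 s0 fsy (icode (read_input x h0))) h0 c w) (St s' 0 c w).
  elim: h0 s0 => [|h0 IH] s0 h0x.
    exists (set1 s0 fsy 0); first exact: agr_set.
    by apply: EWhileF; rewrite get_set.
  have [s' a' e'] := IH (set1 s0 fsy (icode (read_input x h0.+1))) (ltnW h0x).
  exists s'; first by apply: agr_trans a'; apply: agr_set => //; exact: icode_lt.
  apply: EWhileT e'.
    by rewrite get_set ?icode_lt //= ; case: (onth x h0) => // -[].
  apply: ESeq (rdE _ _ (ltnW h0x)).
  have := ex_mv MLeft (set1 s0 fsy (icode (read_input x h0.+1))) h0.+1 c w.
  by rewrite [minn _ _](minn_idPl _) //= ltnW.
have [s' a' e'] := loop h s hx.
exists s' => //; apply: ESeq (rdE _ _ hx) _; apply: ESeq e' _.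
by have := ex_mv MRight s' 0 c w; rewrite [minn _ _](minn_idPl _).
Qed.

(** The control is finite, so the strings [f s] have bounded length, and the program is a fixed
    sequence of actions; positions past the end of [f s] write nothing. *)
Definition emitS (f : ctl -> seq bool) : prog :=
  foldr (fun i c => CAct 7 (fun s _ => (s, MStay, onth (f s) i)) ;; c)
    (CSkip _ _) (iota 0 (\max_(s : ctl) size (f s))).

Lemma ex_emitS f s h c w : h <= (size x).+1 ->
  ex (emitS f) (St s h c w) (St s h c (w ++ f s)).
Proof.
move=> hx; rewrite /emitS; move: (\max_(s : ctl) _) (leq_bigmax s
  (F := fun s => size (f s))) => L fL.
suff H i n w0 : i + n = L -> ex
    (foldr (fun i c => CAct 7 (fun s _ => (s, MStay, onth (f s) i)) ;; c)
    (CSkip _ _) (iota i n)) (St s h c w0) (St s h c (w0 ++ drop i (f s))).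
  by have := H 0 L w; rewrite drop0; apply.
elim: n i w0 => [|n IHn] i w0 iL /=.
  by rewrite drop_oversize ?cats0; [apply: ESkip|lia].
apply: ESeq (EAct _ _ _ _ _ _ _) _; rewrite /= (minn_idPl hx).
have := IHn i.+1 (emit (onth (f s) i) w0); rewrite addSnnS => /(_ iL).
case E: (onth (f s) i) => [b|].
  have ilt : i < size (f s) by rewrite -onthTE E.
  by rewrite (drop_nth false ilt) (@onth_nth _ false _ _ _ E) /= -cats1 -catA.
have ige : size (f s) <= i by rewrite -onthNE E.
by rewrite !drop_oversize // ltnW.
Qed.

Lemma ex_inc i s h c w : c i < N ->
  ex (CInc _ i) (St s h c w) (St s h (upd c i (c i).+1) w).
Proof. exact: EInc. Qed.

Section Counters.
Variables (s : ctl) (h p t g k b d r : nat) (w : seq bool).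
Notation c0 := (St s h (cv p t g k b d r) w).

Lemma ex_incP : p < N -> ex (CInc _ cP) c0
  (St s h (cv p.+1 t g k b d r) w).
Proof. by move=> l; have := @ex_inc cP s h (cv p t g k b d r) w l; rewrite updP. Qed.

Lemma ex_incT : t < N -> ex (CInc _ cT) c0
  (St s h (cv p t.+1 g k b d r) w).
Proof. by move=> l; have := @ex_inc cT s h (cv p t g k b d r) w l; rewrite updT. Qed.

Lemma ex_decG f : ex (dec cG f) c0
  (St (set1 s f (0 < g : nat)) h (cv p t g.-1 k b d r) w).
Proof. by have := ex_dec cG f s h (cv p t g k b d r) w; rewrite updG. Qed.

Lemma ex_incG : g < N -> ex (CInc _ cG) c0
  (St s h (cv p t g.+1 k b d r) w).
Proof. by move=> l; have := @ex_inc cG s h (cv p t g k b d r) w l; rewrite updG. Qed.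

Lemma ex_decH f : ex (dec cH f) c0
  (St (set1 s f (0 < k : nat)) h (cv p t g k.-1 b d r) w).
Proof. by have := ex_dec cH f s h (cv p t g k b d r) w; rewrite updH. Qed.

Lemma ex_incH : k < N -> ex (CInc _ cH) c0
  (St s h (cv p t g k.+1 b d r) w).
Proof. by move=> l; have := @ex_inc cH s h (cv p t g k b d r) w l; rewrite updH. Qed.

Lemma ex_incB : b < N -> ex (CInc _ cB) c0
  (St s h (cv p t g k b.+1 d r) w).
Proof. by move=> l; have := @ex_inc cB s h (cv p t g k b d r) w l; rewrite updBk. Qed.

Lemma ex_decR f : ex (dec cR f) c0
  (St (set1 s f (0 < r : nat)) h (cv p t g k b d r.-1) w).
Proof. by have := ex_dec cR f s h (cv p t g k b d r) w; rewrite updR. Qed.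

Lemma ex_incR : r < N -> ex (CInc _ cR) c0
  (St s h (cv p t g k b d r.+1) w).
Proof. by move=> l; have := @ex_inc cR s h (cv p t g k b d r) w l; rewrite updR. Qed.

End Counters.

(** * Walking from the root to a node *)

Definition sk_hook : prog :=
  CInc _ cB ;; dec cG fz ;; CIf (is_ fz 0) (CInc _ cH) (CSkip _ _).

(** Passes over one subtree and measures it against the distance in [cG]: afterwards [cH] is
    positive exactly if the target lies strictly before the end of the subtree. *)
Definition skip : prog :=
  rdtok sk_hook (CInc _ cD) ;;
  ups (fun s => set1 s fpn (if get s fnode == 0 then get s fk else 0)) ;;
  dec cD fgo ;; tokloop sk_hook.

Lemma ex_skip y u z s P T g R w : x = y ++ ser u ++ z ->
  exists s', [/\ agr (fpn :: Lsk) s s', get s' fpn = lval u &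
    ex skip (St s (size y).+1 (cv P T g 0 0 0 R) w)
      (St s' (size (y ++ ser u)).+1
         (cv P T (g - size (ser u)) (size (ser u) - g) (size (ser u)) 0 R) w)].
Proof.
move=> xe; have sx := congr1 size xe; rewrite !size_cat in sx.
pose Phi t d := cv P T (g - t) (t - g) t d R.
have hookP t d s0 h w0 : t < N -> d <= N -> h <= (size x).+1 ->
    exists2 s', agr [:: fz] s0 s' &
    ex sk_hook (St s0 h (Phi t d) w0) (St s' h (Phi t.+1 d) w0).
  move=> tN _ hx; exists (set1 s0 fz (0 < g - t : nat)).
    by apply: agr_set; rewrite ?bool_lt.
  apply: ESeq (ex_incB _ _ _ _ _ _ _ _ _ tN) _.
  apply: ESeq (ex_decG _ _ _ _ _ _ _ _ _ _ _) _.
  case: (ltnP 0 (g - t)) => gt.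
    apply: EIfF; first by rewrite /is_ get_set.
    have -> : Phi t.+1 d = cv P T (g - t).-1 (t - g) t.+1 d R.
      by rewrite /Phi; congr cv; lia.
    exact: ESkip.
  apply: EIfT; first by rewrite /is_ get_set.
  have -> : Phi t.+1 d = cv P T (g - t).-1 (t - g).+1 t.+1 d R.
    by rewrite /Phi; congr cv; lia.
  by apply: ex_incH; lia.
have PhiD t d : Phi t d cD = d by [].
have PhiU t d d' : upd (Phi t d) cD d' = Phi t d' by rewrite /Phi updD.
have mhP t d s0 h w0 : t <= N -> d < N ->
    ex (CInc _ cD) (St s0 h (Phi t d) w0) (St s0 h (Phi t d.+1) w0).
  by move=> _ dN; rewrite -(PhiU t d d.+1); apply: (EInc x (i := cD)).
have P0 : cv P T g 0 0 0 R = Phi 0 0 by rewrite /Phi subn0.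
rewrite P0 -/(Phi _ _).
have tt : 0 + size (ser u) <= N by rewrite /N; lia.
case: u xe tt {sx} => [n|k ts] xe tt.
  have [s1 [a1 n1 k1 _ e1]] := ex_rdtok_leaf (CInc _ cD) hookP s w xe tt (leq0n _).
  exists (set1 (set1 s1 fpn (cap n)) fgo 0); split.
  - apply: agr_set => //; apply: agr_set; rewrite ?cap_lt //; exact: agrW a1 _.
  - by rewrite !get_set ?cap_lt.
  have xe' : x = (y ++ ser (leaf n)) ++ z by rewrite -catA.
  apply: ESeq e1 _; apply: ESeq (ex_ups _ _ _ _ (at_bound xe')) _.
  rewrite n1 k1 /=; apply: ESeq (ex_dec_go PhiD PhiU _ _ _ _ _) _.
  by apply: EWhileF; rewrite /is_ get_set.
rewrite ser_node -catA in xe tt *.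
have dd : 0 + size ts <= N.
  have := forest_size ts; have := congr1 size xe; rewrite !size_cat /N; lia.
have tt1 : 0 + size (hdr k (size ts)) <= N by move: tt; rewrite size_cat; lia.
have [s1 [a1 n1 k1 _ e1]] := ex_rdtok_node hookP mhP s w xe tt1 dd.
have xe' : x = (y ++ hdr k (size ts)) ++ flatten (map ser ts) ++ z.
  by rewrite -catA.
have [||s2 a2 e2] := ex_tokloop hookP PhiD PhiU
  (s := set1 (set1 s1 fpn 0) fgo (0 < size ts : nat)) w xe'
  (t := size (hdr k (size ts))).
- by move: tt; rewrite size_cat.
- by rewrite get_set ?bool_lt.
exists s2; split.
- apply: agr_trans (agrW a2 _) => //.
  apply: agr_set; rewrite ?bool_lt //; apply: agr_set => //; exact: agrW a1 _.
- by rewrite (a2 fpn) // !get_set ?bool_lt.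
apply: ESeq e1 _; apply: ESeq (ex_ups _ _ _ _ (at_bound xe')) _.
have -> : (if get s1 fnode == 0 then get s1 fk else 0) = 0 by rewrite n1.
apply: ESeq (ex_dec_go PhiD PhiU _ _ _ _ _) _.
by rewrite [size (hdr _ _ ++ _)]size_cat catA.
Qed.

(** [cR] counts the siblings from the current node on, so the node is the last one if the second
    decrement fails. The counter is restored before the state is computed. *)
Definition setlast (T : table) : prog :=
  dec cR fnode ;; dec cR fz ;; CIf (is_ fz 1) (CInc _ cR) (CSkip _ _) ;;
  CIf (is_ fnode 1) (CInc _ cR) (CSkip _ _) ;;
  ups (fun s => set1 s fq (delta T (get s fqp) (get s fkp) (get s fj) (get s fpv)
    (get s fz == 0))).

Lemma ex_setlast T s h P T0 G H B D r w : r < N -> h <= (size x).+1 ->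
  exists s', [/\ agr [:: fz; fnode; fq] s s',
    get s' fq = delta T (get s fqp) (get s fkp) (get s fj) (get s fpv) (r == 0) &
    ex (setlast T) (St s h (cv P T0 G H B D r.+1) w)
      (St s' h (cv P T0 G H B D r.+1) w)].
Proof.
move=> rN hx; set s1 := set1 (set1 s fnode 1) fz (0 < r : nat).
exists (set1 s1 fq (delta T (get s1 fqp) (get s1 fkp) (get s1 fj) (get s1 fpv)
  (get s1 fz == 0))); split.
- do 3 (apply: agr_set; rewrite ?bool_lt ?deltaP //).
- by rewrite !get_set ?bool_lt ?deltaP //=; case: r {rN s1}.
do 2 (apply: ESeq (ex_decR _ _ _ _ _ _ _ _ _ _ _) _).
apply: (ESeq (st1 := St s1 h (cv P T0 G H B D r) w)).
  rewrite /s1; case: r rN {s1} => [|r] rN.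
    by apply: EIfF; [rewrite /is_ get_set|apply: ESkip].
  apply: EIfT; first by rewrite /is_ get_set.
  by apply: ex_incR; lia.
apply: (ESeq (st1 := St s1 h (cv P T0 G H B D r.+1) w)).
  apply: EIfT; first by rewrite /is_ !get_set ?bool_lt.
  exact: ex_incR.
exact: ex_ups.
Qed.

(** Inverts [skip] from the counters alone: on the way back the overshoot is first taken off [cH],
    and the remaining symbols are put back into [cG]. *)
Definition rewind : prog := drain cB
  (mv MLeft ;; dec cH fgo ;; CIf (is_ fgo 1) (CSkip _ _) (CInc _ cG)).

(** One step of a walk. The subtree at hand is skipped; if the target was inside, the head returns
    and enters it, with the current node as the new parent; otherwise the head now stands at the
    next sibling. *)
Definition wbody (T : table) : prog :=
  skip ;; dec cH fz ;;
  CIf (is_ fz 1)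
    (CInc _ cH ;; rewind ;; drain cR (CSkip _ _) ;;
     rdtok (dec cG fz) (CInc _ cR) ;;
     ups (fun s => set1 (set1 (set1 (set1 s fqp (get s fq)) fkp (get s fk)) fj 0) fpv 0))
    (drain cB (CSkip _ _) ;; dec cR fz ;;
     ups (fun s => set1 (set1 s fj (cap (get s fj).+1)) fpv (get s fpn))) ;;
  setlast T.

Lemma ex_wbody_sib T y u z s P T0 g r w : x = y ++ ser u ++ z ->
  size (ser u) <= g -> r.+1 < N ->
  exists s', [/\ [/\ get s' fqp = get s fqp, get s' fkp = get s fkp,
      get s' fbad = get s fbad & get s' fj = cap (get s fj).+1],
    get s' fpv = lval u,
    get s' fq = delta T (get s fqp) (get s fkp) (cap (get s fj).+1) (lval u) (r == 0) &
    ex (wbody T) (St s (size y).+1 (cv P T0 g 0 0 0 r.+2) w)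
      (St s' (size (y ++ ser u)).+1 (cv P T0 (g - size (ser u)) 0 0 0 r.+1) w)].
Proof.
move=> xe ug rN; have xe' : x = (y ++ ser u) ++ z by rewrite -catA.
have hx := at_bound xe'.
have [s1 [a1 p1 e1]] := ex_skip s P T0 g r.+2 w xe.
have [s2 a2 e2] := ex_clear cB (set1 s1 fz 0) (size (y ++ ser u)).+1
  (cv P T0 (g - size (ser u)) 0 (size (ser u)) 0 r.+2) w.
set s3 := set1 s2 fz 1.
set s4 := set1 (set1 s3 fj (cap (get s3 fj).+1)) fpv (get s3 fpn).
have rN' : r < N by lia.
have [s5 [a5 q5 e5]] := ex_setlast T s4 P T0 (g - size (ser u)) 0 0 0 w rN' hx.
have old i : i \notin fpn :: Lsk -> get s3 i = get s i.
  move=> iL; rewrite -(a1 i iL); move: iL; rewrite !inE !negb_or.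
  case/and5P=> _ i1 _ _ _.
  by rewrite get_set // (negbTE i1) (a2 i) ?inE // get_set // (negbTE i1).
have pn3 : get s3 fpn = lval u by rewrite get_set // (a2 fpn) // get_set.
have old4 i : i \notin [:: fj, fpv, fpn & Lsk] -> get s4 i = get s i.
  rewrite !inE !negb_or => /and5P[i1 i2 i3 i4 i5].
  rewrite /s4 get_set ?get_lt // (negbTE i2) get_set ?cap_lt // (negbTE i1).
  by rewrite old // !inE !negb_or i3 i4.
have j4 : get s4 fj = cap (get s fj).+1.
  by rewrite /s4 get_set ?get_lt //= get_set ?cap_lt //= old.
have p4 : get s4 fpv = lval u by rewrite get_set ?get_lt.
exists s5; split.
- by split; [rewrite (a5 fqp) // old4|rewrite (a5 fkp) // old4|rewrite (a5 fbad) // old4|rewrite (a5 fj)].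
- by rewrite (a5 fpv).
- by rewrite q5 j4 p4 !old4.
apply: ESeq e1 _; have -> : size (ser u) - g = 0 by lia.
apply: ESeq (ex_decH _ _ _ _ _ _ _ _ _ _ _) _.
apply: ESeq e5; apply: EIfF; first by rewrite /is_ get_set.
rewrite updBk in e2; apply: ESeq e2 _.
by apply: ESeq (ex_decR _ _ _ _ _ _ _ _ _ _ _) _; apply: ex_ups.
Qed.

Lemma ex_rewind y v z s P T0 g R w : x = y ++ v ++ z -> g < size v ->
  exists2 s', agr [:: fz; fgo] s s' &
    ex rewind (St s (size (y ++ v)).+1 (cv P T0 0 (size v - g) (size v) 0 R) w)
      (St s' (size y).+1 (cv P T0 g 0 0 0 R) w).
Proof.
move=> xe gv; have sx := congr1 size xe; rewrite !size_cat in sx.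
pose C n := cv P T0 (g - n) (n - g) n 0 R.
have [||| s' a' e'] := @ex_drain cB
  (mv MLeft ;; dec cH fgo ;; CIf (is_ fgo 1) (CSkip _ _) (CInc _ cG))
  [:: fz; fgo] C (fun n => (size y + n).+1) (size v) s w.
- by [].
- by [].
- move=> n s0 nv; exists (set1 s0 fgo (0 < n.+1 - g : nat)).
    by apply: agr_set; rewrite ?bool_lt.
  have := ex_mv MLeft s0 (size y + n.+1).+1 (upd (C n.+1) cB n) w.
  rewrite [shift _ _]/= (minn_idPl _); last by lia.
  rewrite addnS => e; apply: ESeq e _; rewrite updBk.
  apply: ESeq (ex_decH _ _ _ _ _ _ _ _ _ _ _) _.
  case: (ltnP 0 (n.+1 - g)) => ng.
    apply: EIfT; first by rewrite /is_ get_set.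
    have -> : C n = cv P T0 (g - n.+1) (n.+1 - g).-1 n 0 R.
      by rewrite /C; congr cv; lia.
    exact: ESkip.
  apply: EIfF; first by rewrite /is_ get_set.
  have -> : C n = cv P T0 (g - n.+1).+1 (n.+1 - g).-1 n 0 R.
    by rewrite /C; congr cv; lia.
  by apply: ex_incG; lia.
exists s' => //; move: e'; rewrite /C -size_cat addn0 subn0.
by rewrite (_ : g - size v = 0) //; lia.
Qed.

Lemma ex_wbody_enter T y k ts z s P T0 g r w : x = y ++ ser (node k ts) ++ z ->
  size (hdr k (size ts)) <= g < size (ser (node k ts)) -> 0 < size ts ->
  exists s', [/\ [/\ get s' fqp = get s fq, get s' fkp = cap k,
      get s' fbad = get s fbad & get s' fj = 0],
    get s' fpv = 0,
    get s' fq = delta T (get s fq) (cap k) 0 0 (size ts == 1) &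
    ex (wbody T) (St s (size y).+1 (cv P T0 g 0 0 0 r) w)
      (St s' (size (y ++ hdr k (size ts))).+1
        (cv P T0 (g - size (hdr k (size ts))) 0 0 0 (size ts)) w)].
Proof.
move=> xe /andP[hg gu] ts0; have sx := congr1 size xe; rewrite !size_cat in sx.
have [s1 [a1 _ e1]] := ex_skip s P T0 g r w xe.
have [s2 a2 e2] := ex_rewind (set1 s1 fz 1) P T0 r w xe gu.
have [s3 a3 e3] := ex_clear cR s2 (size y).+1 (cv P T0 g 0 0 0 r) w.
pose Phi t d := cv P T0 (g - t) 0 0 0 d.
have hookP t d s0 h w0 : t < N -> d <= N -> h <= (size x).+1 ->
    exists2 s', agr [:: fz] s0 s' &
    ex (dec cG fz) (St s0 h (Phi t d) w0) (St s' h (Phi t.+1 d) w0).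
  move=> _ _ _; exists (set1 s0 fz (0 < g - t : nat)).
    by apply: agr_set; rewrite ?bool_lt.
  have := ex_decG s0 h P T0 (g - t) 0 0 0 d w0 fz.
  by rewrite -subn1 -subnDA addn1.
have mhP t d s0 h w0 : t <= N -> d < N ->
    ex (CInc _ cR) (St s0 h (Phi t d) w0) (St s0 h (Phi t d.+1) w0).
  by move=> _; apply: ex_incR.
have xe1 := xe; rewrite ser_node -catA in xe1.
have fs := forest_size ts.
have sz1 := congr1 size xe1; rewrite !size_cat in sz1.
have tt : 0 + size (hdr k (size ts)) <= N by rewrite /N; lia.
have dd : 0 + size ts <= N by rewrite /N; lia.
have [s4 [a4 n4 k4 m4 e4]] := ex_rdtok_node hookP mhP s3 w xe1 tt dd.
set s5 := set1 (set1 (set1 (set1 s4 fqp (get s4 fq)) fkp (get s4 fk)) fj 0) fpv 0.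
have xe2 : x = (y ++ hdr k (size ts)) ++ flatten (map ser ts) ++ z.
  by rewrite -catA.
have tN : (size ts).-1 < N by rewrite /N; lia.
have [s6 [a6 q6 e6]] :=
  ex_setlast T s5 P T0 (g - size (hdr k (size ts))) 0 0 0 w tN (at_bound xe2).
rewrite prednK // in e6.
have old i : i \notin fpn :: Lsk -> get s4 i = get s i.
  move=> iL; rewrite -(a1 i iL); move: iL; rewrite !inE !negb_or.
  case/and5P=> _ i1 i2 i3 /and3P[i4 i5 i6].
  rewrite (a4 i) ?inE ?negb_or ?i1 ?i2 ?i3 ?i4 ?i5 // (a3 i) ?inE //.
  by rewrite (a2 i) ?inE ?negb_or ?i1 // get_set // (negbTE i1).
have t1 : ((size ts).-1 == 0) = (size ts == 1) by case: (size ts) ts0.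
exists s6; split.
- by split; rewrite (a6 _) // /s5 !get_set ?get_lt //= ?old.
- by rewrite (a6 _) // /s5 !get_set ?get_lt.
- by rewrite q6 /s5 !get_set ?get_lt //= old // k4 t1.
have sg : size (ser (node k ts)) - g = (size (ser (node k ts)) - g).-1.+1 by lia.
have g0 : g - size (ser (node k ts)) = 0 by lia.
rewrite g0 sg in e1; rewrite sg in e2.
apply: ESeq e1 _; apply: ESeq (ex_decH _ _ _ _ _ _ _ _ _ _ _) _.
apply: ESeq e6; apply: EIfT; first by rewrite /is_ get_set.
apply: (ESeq (ex_incH _ _ _ _ _ _ _ _ _ _)); first by rewrite /N; lia.
apply: ESeq e2 _; apply: ESeq e3 _; rewrite updR.
have -> : cv P T0 g 0 0 0 0 = Phi 0 0 by rewrite /Phi subn0.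
apply: ESeq e4 _.
exact: ex_ups (at_bound xe2).
Qed.

Definition test : prog := dec cG fw ;; CIf (is_ fw 1) (CInc _ cG) (CSkip _ _).

Lemma ex_test s h p t g k b d r w : g <= N ->
  ex test (St s h (cv p t g k b d r) w)
    (St (set1 s fw (0 < g : nat)) h (cv p t g k b d r) w).
Proof.
move=> gN; apply: ESeq (ex_decG _ _ _ _ _ _ _ _ _ _ _) _.
case: g gN => [|g] gN; first by apply: EIfF; [rewrite /is_ get_set|apply: ESkip].
by apply: EIfT; [rewrite /is_ get_set|apply: ex_incG].
Qed.

Section Walk.
Variables (T : table) (t0 : tree) (z0 : seq bool).
Hypothesis x0 : x = ser t0.

Inductive At : seq bool -> tree -> nat -> Prop :=
  | AtRoot : At [::] t0 0
  | AtChild y k l u r q : At y (node k (l ++ u :: r)) q ->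
      At (y ++ hdr k (size (l ++ u :: r)) ++ flatten (map ser l)) u
        (delta T q (cap k) (cap (size l)) (last 0 (map lval l)) (nilp r)).

Lemma At_cat y u q : At y u q -> exists z, x = y ++ ser u ++ z.
Proof.
elim=> {y u q} [|y k l u r q _ [z ->]]; first by exists [::]; rewrite x0 cats0.
exists (flatten (map ser r) ++ z).
by rewrite ser_node map_cat flatten_cat /= -!catA.
Qed.

Lemma walk_at y u q P s0 r0 w : At y u q -> size y <= P < size y + size (ser u) ->
  get s0 fq = 0 -> get s0 fw = (0 < P) ->
  exists s' r, [/\ get s' fq = q, get s' fw = (0 < P - size y),
    get s' fbad = get s0 fbad & loops (is_ fw 1) (wbody T ;; test)
      (St s0 1 (cv P 0 P 0 0 0 r0) w)
      (St s' (size y).+1 (cv P 0 (P - size y) 0 0 0 r) w)].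
Proof.
move=> a; elim: a P => {y u q} [|y k l u r q a IH] P Pu q0 w0.
  by exists s0, r0; rewrite subn0; split=> //; apply: Loop0.
have [z xe] := At_cat a.
set hd := hdr k _ in Pu *.
have szn : size (ser (node k (l ++ u :: r))) = size hd +
    size (flatten (map ser l)) + size (ser u) + size (flatten (map ser r)).
  by rewrite ser_node -/hd map_cat flatten_cat /= !(size_cat (_ : seq bool)); lia.
have hd0 : 0 < size hd by rewrite /hd hdrE.
rewrite !size_cat in Pu.
have [||| s1 [r1 [q1 w1 b1 lp1]]] := IH P => //; first by lia.
have P1 : 0 < P - size y by lia.
have PN : P < N by have := congr1 size xe; rewrite !size_cat /N; lia.
(* The walk along the siblings, by induction on the part [l1] already passed. *)
have step l1 l2 : l = l1 ++ l2 ->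
  exists s', [/\ [/\ get s' fqp = q, get s' fkp = cap k,
      get s' fbad = get s0 fbad & get s' fj = cap (size l1)],
    get s' fpv = last 0 (map lval l1),
    get s' fq = delta T q (cap k) (cap (size l1)) (last 0 (map lval l1))
      (nilp (behead (l2 ++ u :: r))),
    get s' fw = (0 < P - size (y ++ hd ++ flatten (map ser l1))) &
    loops (is_ fw 1) (wbody T ;; test) (St s0 1 (cv P 0 P 0 0 0 r0) w)
      (St s' (size (y ++ hd ++ flatten (map ser l1))).+1
        (cv P 0 (P - size (y ++ hd ++ flatten (map ser l1))) 0 0 0
          (size (l2 ++ u :: r))) w)].
  elim/last_ind: l1 l2 => [|l1 v IHl] l2 lE.
    have -> : l2 = l by rewrite lE.
    have [||s2 [[qp2 kp2 b2 j2] pv2 q2 e2]] :=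
      ex_wbody_enter T s1 P 0 r1 w xe (g := P - size y).
    - by rewrite -/hd szn; apply/andP; split; lia.
    - by rewrite size_cat /= addnS.
    exists (set1 s2 fw (0 < P - size y - size hd : nat)); split.
    - by split; rewrite get_set ?bool_lt //= ?qp2 ?b2.
    - by rewrite get_set ?bool_lt.
    - rewrite get_set ?bool_lt //= q2 q1 /=; congr delta.
      by case: (l) => [|? []]; rewrite //= ; case: (r).
    - by rewrite get_set ?bool_lt //= cats0 size_cat subnDA.
    apply: loops_trans lp1 _; apply: LoopS (Loop0 _ _ _).
      by rewrite /is_ w1 P1.
    rewrite -/hd in e2; rewrite [flatten _]/= cats0 [size (y ++ hd)]size_cat.
    rewrite [size (y ++ hd)]size_cat in e2; rewrite subnDA.
    by apply: ESeq e2 _; apply: ex_test; lia.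
  rewrite cat_rcons in lE.
  have [s2 [[qp2 kp2 b2 j2] pv2 q2 w2 lp2]] := IHl _ lE.
  set y2 := y ++ hd ++ flatten (map ser l1) in w2 lp2 *.
  have yE : y ++ hd ++ flatten (map ser (rcons l1 v)) = y2 ++ ser v.
    by rewrite map_rcons flatten_rcons /y2 -!catA.
  rewrite yE.
  have sl : size (flatten (map ser l)) = size (flatten (map ser l1)) +
      size (ser v) + size (flatten (map ser l2)).
    by rewrite lE map_cat flatten_cat /= !size_cat addnA.
  have sy2 : size y2 = size y + (size hd + size (flatten (map ser l1))).
    by rewrite !size_cat.
  have xe2 : x = y2 ++ ser v ++ (flatten (map ser (l2 ++ u :: r)) ++ z).
    rewrite xe ser_node -/hd lE /y2 !map_cat !flatten_cat /=.
    by rewrite ?map_cat ?flatten_cat /= -!catA.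
  have v0 := ser_size v; have u0 := ser_size u.
  have sN : size (l2 ++ u :: r) < N.
    have := forest_size (l2 ++ u :: r); have := congr1 size xe2.
    by rewrite !size_cat /N; lia.
  have [||s3 [[qp3 kp3 b3 j3] pv3 q3 e3]] :=
    ex_wbody_sib T s2 P 0 w xe2 (g := P - size y2) (r := (size (l2 ++ r))).
  - by lia.
  - by move: sN; rewrite !size_cat /= addnS.
  exists (set1 s3 fw (0 < P - size y2 - size (ser v) : nat)).
  have cS : cap (cap (size l1)).+1 = cap (size (rcons l1 v)).
    by rewrite size_rcons /cap; lia.
  split.
  - by split; rewrite get_set ?bool_lt //= ?qp3 ?kp3 ?b3 ?j3 ?j2.
  - by rewrite get_set ?bool_lt //= pv3 map_rcons last_rcons.
  - rewrite get_set ?bool_lt //= q3 qp2 kp2 j2 cS map_rcons last_rcons.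
    by congr delta; case: (l2) => [|? []]; case: (r).
  - by rewrite get_set ?bool_lt //= size_cat subnDA.
  apply: loops_trans lp2 _; apply: LoopS (Loop0 _ _ _).
    have P2 : 0 < P - size y2 by lia.
    by rewrite /is_ /= w2 P2.
  have -> : size ((v :: l2) ++ u :: r) = (size (l2 ++ r)).+2.
    by rewrite !size_cat /= addnS.
  apply: ESeq e3 _.
  have -> : size (l2 ++ u :: r) = (size (l2 ++ r)).+1.
    by rewrite !size_cat /= addnS.
  have -> : P - size (y2 ++ ser v) = P - size y2 - size (ser v).
    by rewrite size_cat subnDA.
  by apply: ex_test; lia.
have [s' [[_ _ b' _] _ q' w' lp']] := step l [::] (esym (cats0 l)).
by exists s', (size ([::] ++ u :: r)); split.
Qed.

(** Draining [cP] into [cG] destroys the position, which is then restored from the copy in [cT]. *)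
Definition walk : prog :=
  home ;; drain cP (CInc _ cG ;; CInc _ cT) ;; drain cT (CInc _ cP) ;;
  ups (fun s => set1 s fq 0) ;; test ;; CWhile (is_ fw 1) (wbody T ;; test).

Lemma ex_walk y u q s r h w : At y u q -> h <= (size x).+1 ->
  exists s' r', [/\ get s' fq = q, get s' fbad = get s fbad &
    ex walk (St s h (cv (size y) 0 0 0 0 0 r) w)
      (St s' (size y).+1 (cv (size y) 0 0 0 0 0 r') w)].
Proof.
move=> a hx; have [z xe] := At_cat a.
have yN : size y < N by have := congr1 size xe; rewrite size_cat /N; lia.
have [s1 a1 e1] := ex_home s (cv (size y) 0 0 0 0 0 r) w hx.
have [|||s2 a2 e2] := @ex_drain cP (CInc _ cG ;; CInc _ cT) [:: fz]
  (fun n => cv n (size y - n) (size y - n) 0 0 0 r) (fun=> 1) (size y) s1 w.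
- by [].
- by [].
- move=> n s0 ny; exists s0 => //; rewrite updP.
  apply: ESeq (ex_incG _ _ _ _ _ _ _ _ _ _) _; first by lia.
  have -> : cv n (size y - n) (size y - n) 0 0 0 r =
    cv n (size y - n.+1).+1 (size y - n.+1).+1 0 0 0 r by congr cv; lia.
  by apply: ex_incT; lia.
rewrite subnn subn0 in e2.
have [|||s3 a3 e3] := @ex_drain cT (CInc _ cP) [:: fz]
  (fun n => cv (size y - n) n (size y) 0 0 0 r) (fun=> 1) (size y) s2 w.
- by [].
- by [].
- move=> n s0 ny; exists s0 => //; rewrite updT.
  have -> : cv (size y - n) n (size y) 0 0 0 r =
    cv (size y - n.+1).+1 n (size y) 0 0 0 r by congr cv; lia.
  by apply: ex_incP; lia.
rewrite subnn subn0 in e3.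
set s4 := set1 (set1 s3 fq 0) fw (0 < size y : nat).
have [|||s5 [r5 [q5 w5 b5 lp5]]] := @walk_at y u q (size y) s4 r w a.
- by have := ser_size u; lia.
- by rewrite /s4 get_set ?bool_lt //= get_set.
- by rewrite /s4 get_set ?bool_lt.
exists s5, r5; split=> //.
  rewrite b5 /s4 get_set ?bool_lt //= get_set //= (a3 fbad) // (a2 fbad) //.
  by rewrite (a1 fbad).
apply: ESeq e1 _; apply: ESeq e2 _; apply: ESeq e3 _.
apply: ESeq (ex_ups _ _ _ _ _) _ => //.
apply: ESeq (ex_test _ _ _ _ _ _ _ _ _ (ltnW yN)) _.
rewrite subnn in lp5 w5; apply: loops_while lp5 _.
by rewrite /is_ w5.
Qed.

(** * Output at a node, and traversal of the whole tree *)

Definition leafseg (A B : ctl -> seq bool) : prog :=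
  emitS A ;; mv MLeft ;; mv MLeft ;; rdsym ;;
  CWhile (is_ fsy 3) (emitS B ;; mv MLeft ;; rdsym) ;;
  mv MRight ;; rdsym ;; CWhile (is_ fsy 3) (mv MRight ;; rdsym) ;; mv MRight.

(** The value of a leaf exceeds the finite control, so the unary number is read again, backwards up
    to its tag, once for each pair of strings; then the head returns to the end of the leaf. *)
Lemma ex_leafseg A B y n z s c w : x = y ++ ser (leaf n) ++ z ->
  (forall s s', agr [:: fsy] s s' -> B s' = B s) ->
  exists2 s', agr [:: fsy] s s' &
    ex (leafseg A B) (St s (size (y ++ ser (leaf n))).+1 c w)
      (St s' (size (y ++ ser (leaf n))).+1 c (w ++ A s ++ flatten (nseq n (B s)))).
Proof.
move=> xe Bs; have xe0 : x = (y ++ ser (leaf n)) ++ z by rewrite -catA.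
pose pre i := y ++ false :: nseq i true.
have preS i : pre i.+1 = rcons (pre i) true.
  by rewrite /pre rcons_cat /=; congr (_ ++ _ :: _); elim: i => //= i ->.
have sE : y ++ ser (leaf n) = rcons (pre n) false.
  by rewrite /pre rcons_cat.
have xp i : i <= n -> x = pre i ++ unary (n - i) ++ z.
  move=> ile; rewrite xe /pre -catA /=; congr (_ ++ _ :: _).
  rewrite catA /unary -rcons_cat; congr (rcons _ _ ++ _).
  by rewrite cat_nseq /ncons -iterD subnKC.
have rdp i s0 c0 w0 : i <= n -> ex rdsym (St s0 (size (pre i)) c0 w0)
    (St (set1 s0 fsy (if i == 0 then 2 else 3)) (size (pre i)) c0 w0).
  case: i => [|i] ile.
    have xi : x = y ++ false :: (unary n ++ z).
      by have := xp 0 ile; rewrite /pre -catA subn0.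
    have -> : size (pre 0) = (size y).+1 by rewrite /pre size_cat /= addn1.
    exact: (ex_rd s0 c0 w0 xi).
  have xi := xp i (ltnW ile); have iE : n - i = (n - i.+1).+1 by lia.
  rewrite iE in xi.
  by rewrite preS size_rcons; apply: (ex_rd s0 c0 w0 xi).
have left i s0 w0 : i <= n -> agr [:: fsy] s s0 -> exists2 s', agr [:: fsy] s s' &
    ex (CWhile (is_ fsy 3) (emitS B ;; mv MLeft ;; rdsym))
      (St (set1 s0 fsy (if i == 0 then 2 else 3)) (size (pre i)) c w0)
      (St s' (size (pre 0)) c (w0 ++ flatten (nseq i (B s)))).
  elim: i s0 w0 => [|i IHi] s0 w0 ile a0.
    exists (set1 s0 fsy 2); first exact: agr_set.
    by rewrite cats0; apply: EWhileF; rewrite /is_ get_set.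
  have a1 : agr [:: fsy] s (set1 s0 fsy 3) by apply: agr_set.
  have [s' a' e'] := IHi (set1 s0 fsy 3) (w0 ++ B s) (ltnW ile) a1.
  exists s' => //; apply: EWhileT; first by rewrite /is_ get_set.
    have hx : size (pre i.+1) <= (size x).+1.
      by rewrite (xp i.+1 ile) size_cat; lia.
    apply: ESeq (ex_emitS _ _ _ _ hx) _; rewrite (Bs _ _ a1).
    have := ex_mv MLeft (set1 s0 fsy 3) (size (pre i.+1)) c (w0 ++ B s).
    rewrite preS size_rcons /= (minn_idPl _); last first.
      by have := hx; rewrite preS size_rcons => /ltnW.
    by move/ESeq; apply; apply: rdp; exact: ltnW.
  by rewrite /= catA.
have right i s0 w0 : i <= n -> agr [:: fsy] s s0 -> exists2 s', agr [:: fsy] s s' &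
    ex (CWhile (is_ fsy 3) (mv MRight ;; rdsym))
      (St (set1 s0 fsy (rc (unary (n - i) ++ z))) (size (pre i)).+1 c w0)
      (St s' (size (pre n)).+1 c w0).
  move E: (n - i) => m; elim: m i E s0 => [|m IHm] i E s0 ile a0.
    have -> : i = n by lia.
    exists (set1 s0 fsy 2); first exact: agr_set.
    by apply: EWhileF; rewrite /is_ get_set.
  have iln : i < n by lia.
  have a1 : agr [:: fsy] s (set1 s0 fsy 3) by apply: agr_set.
  have [|s' a' e'] := IHm i.+1 _ (set1 s0 fsy 3) iln a1; first by lia.
  exists s' => //; apply: EWhileT e'; first by rewrite /is_ get_set.
  have xi := xp i ile; rewrite E in xi.
  apply: ESeq (ex_mvR _ _ _ xi) _; rewrite -preS.
  by have := ex_rd (set1 s0 fsy 3) c w0 (xp i.+1 iln); rewrite (_ : n - i.+1 = m) //; lia.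
have hx : size (rcons (pre n) false) <= size x.
  have := congr1 size (xp n (leqnn n)).
  by rewrite subnn size_cat size_rcons [size (unary 0 ++ z)]/=; lia.
rewrite size_rcons in hx.
set sL := set1 s fsy (if n == 0 then 2 else 3).
have [|s1 a1 e1] := left n s (w ++ A s) (leqnn n); first exact: agr_refl.
have [s2 a2 e2] := right 0 s1 (w ++ A s ++ flatten (nseq n (B s))) (leq0n n) a1.
exists s2 => //; rewrite sE size_rcons.
apply: ESeq (ex_emitS _ _ _ _ _) _; first by lia.
have := ex_mv MLeft s (size (pre n)).+2 c (w ++ A s).
rewrite /= (minn_idPl _); last by lia.
move/ESeq; apply.
have := ex_mv MLeft s (size (pre n)).+1 c (w ++ A s).
rewrite /= (minn_idPl _); last by lia.
move/ESeq; apply; apply: ESeq (rdp n _ _ _ (leqnn n)) _.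
apply: ESeq e1 _; rewrite -catA.
have hx0 : size (pre 0) <= size (pre n) by rewrite /pre !size_cat /=; lia.
have := ex_mv MRight s1 (size (pre 0)) c (w ++ A s ++ flatten (nseq n (B s))).
rewrite /= (minn_idPl _); last by lia.
move/ESeq; apply; apply: ESeq (ex_rd _ _ _ (xp 0 (leq0n n))) _.
apply: ESeq e2 _.
have := ex_mv MRight s2 (size (pre n)).+1 c (w ++ A s ++ flatten (nseq n (B s))).
by rewrite /= (minn_idPl _) //; lia.
Qed.

Definition segs (s : ctl) := outL T (get s fq).
Definition leafemit : prog :=
  foldr (fun i c => leafseg (fun s => (nth ([::], [::]) (segs s) i).1)
      (fun s => (nth ([::], [::]) (segs s) i).2) ;; c)
    (CSkip _ _) (iota 0 (\max_(s : ctl) size (segs s))).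

Lemma ex_leafemit y n z s c w : x = y ++ ser (leaf n) ++ z ->
  exists2 s', agr [:: fsy] s s' &
    ex leafemit (St s (size (y ++ ser (leaf n))).+1 c w)
      (St s' (size (y ++ ser (leaf n))).+1 c (w ++ seval (outL T (get s fq)) n)).
Proof.
move=> xe; rewrite /leafemit; move: (\max_(s : ctl) _) (leq_bigmax s
  (F := fun s => size (segs s))) => L; rewrite {1}/segs.
move E: (outL T (get s fq)) => g gL.
suff H i m s0 w0 : i + m = L -> agr [:: fsy] s s0 -> exists2 s', agr [:: fsy] s s' &
    ex (foldr (fun i c => leafseg (fun s => (nth ([::], [::]) (segs s) i).1)
      (fun s => (nth ([::], [::]) (segs s) i).2) ;; c) (CSkip _ _) (iota i m))
      (St s0 (size (y ++ ser (leaf n))).+1 c w0)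
      (St s' (size (y ++ ser (leaf n))).+1 c (w0 ++ seval (drop i g) n)).
  by have [//||s' a' e'] := H 0 L s w; [exact: agr_refl|exists s'; rewrite ?drop0 in e' *].
elim: m i s0 w0 => [|m IHm] i s0 w0 iL a0 /=.
  by exists s0 => //; rewrite drop_oversize /seval -?lock ?cats0; [apply: ESkip|lia].
have sgE s1 s2 : agr [:: fsy] s1 s2 -> segs s2 = segs s1.
  by move=> a12; rewrite /segs (a12 fq).
have [|s1 a1 e1] := @ex_leafseg (fun s => (nth ([::], [::]) (segs s) i).1)
  (fun s => (nth ([::], [::]) (segs s) i).2) y n z s0 c w0 xe.
  by move=> s1 s2 a12; rewrite (sgE _ _ a12).
have [||s2 a2 e2] := IHm i.+1 s1
  (w0 ++ (nth ([::], [::]) (segs s0) i).1 ++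
     flatten (nseq n (nth ([::], [::]) (segs s0) i).2)); first by lia.
  exact: agr_trans a0 a1.
exists s2 => //; apply: ESeq e1 _; move: e2.
rewrite (sgE _ _ a0) /segs E; case: (ltnP i (size g)) => ig.
  by rewrite (drop_nth ([::], [::]) ig) /seval -!lock /= -!catA.
rewrite nth_default // !drop_oversize // 1?ltnW //= /seval -!lock /=.
suff -> : flatten (nseq n ([::] : seq bool)) = [::] by rewrite !cats0.
by elim: (n).
Qed.

(** [e] selects the kind of a pass: a checking pass may raise the flag, a writing pass leaves it
    alone. *)
Definition tbad (e : bool) (b : nat) (ok : bool) : nat :=
  if e || ok then b else 1.

Lemma tbad_tbad e b ok ok' : tbad e (tbad e b ok) ok' = tbad e b (ok && ok').
Proof. by rewrite /tbad; case: e ok ok' => [] [] []. Qed.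

Definition process (e : bool) : prog :=
  rdtok (CInc _ cP) (CSkip _ _) ;;
  if e then CIf (is_ fnode 1)
    (emitS (fun s => outN T (get s fq) (get s fk) (get s fm))) leafemit
  else ups (fun s => set1 s fbad
    (if (if get s fnode == 1 then okN T (get s fq) (get s fk) (get s fm)
        else okL T (get s fq) (get s fk)) then get s fbad else 1)).

Definition tokout q t := match t with
  | GenTree.Leaf n => seval (outL T q) n
  | GenTree.Node k ts => outN T q (cap k) (cap (size ts)) end.
Definition tokok q t := match t with
  | GenTree.Leaf n => okL T q (cap n)
  | GenTree.Node k ts => okN T q (cap k) (cap (size ts)) end.
Definition toksize t := match t with
  | GenTree.Leaf n => size (ser (leaf n))
  | GenTree.Node k ts => size (hdr k (size ts)) end.

Lemma ex_process e y u z s r w : x = y ++ ser u ++ z ->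
  exists2 s', get s' fbad = tbad e (get s fbad) (tokok (get s fq) u) &
    ex (process e) (St s (size y).+1 (cv (size y) 0 0 0 0 0 r) w)
      (St s' (size y + toksize u).+1 (cv (size y + toksize u) 0 0 0 0 0 r)
        (if e then w ++ tokout (get s fq) u else w)).
Proof.
move=> xe; have sx := congr1 size xe; rewrite !size_cat in sx.
pose Phi t (d : nat) := cv (size y + t) 0 0 0 0 0 r.
have hookP t d s0 h w0 : t < N - size y -> d <= 100 * N -> h <= (size x).+1 ->
    exists2 s', agr [:: fz] s0 s' &
    ex (CInc _ cP) (St s0 h (Phi t d) w0) (St s' h (Phi t.+1 d) w0).
  move=> tN _ _; exists s0 => //; rewrite /Phi addnS; apply: ex_incP; lia.
have mhP t d s0 h w0 : t <= N - size y -> d < 100 * N ->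
    ex (CSkip _ _) (St s0 h (Phi t d) w0) (St s0 h (Phi t d.+1) w0).
  by move=> _ _; apply: ESkip.
have -> : cv (size y) 0 0 0 0 0 r = Phi 0 0 by rewrite /Phi addn0.
case: u xe sx => [n|k ts] xe sx.
  have tt : 0 + size (ser (leaf n)) <= N - size y by rewrite /N; lia.
  have [s1 [a1 n1 k1 m1 e1]] := ex_rdtok_leaf (CSkip _ _) hookP s w xe tt (leq0n _).
  have xe1 : x = (y ++ ser (leaf n)) ++ z by rewrite -catA.
  case: e.
    have [s2 a2 e2] := ex_leafemit s1 (Phi (0 + size (ser (leaf n))) 0) w xe.
    exists s2; first by rewrite (a2 fbad) // (a1 fbad).
    apply: ESeq e1 _; rewrite (a1 fq) // -size_cat in e2 *.
    by apply: EIfF; [rewrite /is_ n1|rewrite size_cat; move: e2; rewrite size_cat].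
  exists (set1 s1 fbad (if okL T (get s1 fq) (get s1 fk) then get s1 fbad else 1)).
    by rewrite get_set; [rewrite /= (a1 fbad) // (a1 fq) // k1|case: ifP => _; rewrite ?get_lt].
  apply: ESeq e1 _.
  rewrite -[toksize (leaf n)]/(size (ser (leaf n))) -size_cat.
  have := ex_ups (fun s => set1 s fbad
    (if (if get s fnode == 1 then okN T (get s fq) (get s fk) (get s fm)
        else okL T (get s fq) (get s fk)) then get s fbad else 1)) s1
    (Phi (0 + size (ser (leaf n))) 0) w (at_bound xe1).
  by rewrite n1 /Phi size_cat.
rewrite ser_node -catA in xe.
have fs := forest_size ts; have sx1 := congr1 size xe; rewrite !size_cat in sx1.
have tt : 0 + size (hdr k (size ts)) <= N - size y by rewrite /N; lia.
have dd : 0 + size ts <= 100 * N by rewrite /N; lia.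
have [s1 [a1 n1 k1 m1 e1]] := ex_rdtok_node hookP mhP s w xe tt dd.
have xe1 : x = (y ++ hdr k (size ts)) ++ flatten (map ser ts) ++ z by rewrite -catA.
rewrite -[toksize (node k ts)]/(size (hdr k (size ts))) -size_cat.
case: e.
  exists s1; first by rewrite (a1 fbad).
  apply: ESeq e1 _; apply: EIfT; first by rewrite /is_ n1.
  have := ex_emitS (fun s => outN T (get s fq) (get s fk) (get s fm)) s1
    (Phi (0 + size (hdr k (size ts))) (0 + size ts)) w (at_bound xe1).
  by rewrite /= (a1 fq) // k1 m1 /Phi size_cat.
exists (set1 s1 fbad (if okN T (get s1 fq) (get s1 fk) (get s1 fm)
    then get s1 fbad else 1)).
  by rewrite get_set; [rewrite /= (a1 fbad) // (a1 fq) // k1 m1|case: ifP => _; rewrite ?get_lt].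
apply: ESeq e1 _.
have := ex_ups (fun s => set1 s fbad
    (if (if get s fnode == 1 then okN T (get s fq) (get s fk) (get s fm)
        else okL T (get s fq) (get s fk)) then get s fbad else 1)) s1
    (Phi (0 + size (hdr k (size ts))) (0 + size ts)) w (at_bound xe1).
by rewrite n1 /Phi size_cat.
Qed.

Definition more (s : ctl) : bool := get s fsy != 1.

(** One token of a traversal in preorder. Its position is all that is remembered between tokens; the
    state is found again by a walk. *)
Definition step1 (e : bool) : prog := walk ;; process e ;; rdsym.

Lemma ex_step1 e y u q s r w : At y u q ->
  exists s' r', [/\ get s' fbad = tbad e (get s fbad) (tokok q u),
    forall y' z, x = y' ++ z -> size y' = size y + toksize u -> get s' fsy = rc z &
    ex (step1 e) (St s (size y).+1 (cv (size y) 0 0 0 0 0 r) w)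
      (St s' (size y + toksize u).+1 (cv (size y + toksize u) 0 0 0 0 0 r')
        (if e then w ++ tokout q u else w))].
Proof.
move=> a; have [z xe] := At_cat a.
have [s1 [r1 [q1 b1 e1]]] := ex_walk s r w a (at_bound xe).
have [s2 b2 e2] := ex_process e s1 r1 w xe.
have tx : toksize u <= size (ser u).
  by case: (u) => [n|k ts] //; rewrite ser_node size_cat leq_addr.
pose y' := take (size y + toksize u) x; pose z' := drop (size y + toksize u) x.
have xe' : x = y' ++ z' by rewrite cat_take_drop.
have sy' : size y' = size y + toksize u.
  by rewrite size_takel //; have := congr1 size xe; rewrite !size_cat; lia.
have e3 := ex_rd s2 (cv (size y') 0 0 0 0 0 r1)
  (if e then w ++ tokout (get s1 fq) u else w) xe'.
rewrite sy' in e3.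
exists (set1 s2 fsy (rc z')), r1; split.
- by rewrite get_set ?rc_lt //= b2 b1 q1.
- move=> y2 z2 xe2 sy2; rewrite get_set ?rc_lt //=; congr rc.
  by rewrite /z' xe2 drop_size_cat.
by rewrite -q1; apply: ESeq e1 _; apply: ESeq e2 _.
Qed.

Lemma rc_ser u z : rc (ser u ++ z) != 1.
Proof. by case: u. Qed.

Lemma ex_pass e u y q s r w : At y u q -> get s fsy != 1 ->
  exists s' r', [/\ get s' fbad = tbad e (get s fbad) (okt T q u),
    forall z, x = (y ++ ser u) ++ z -> get s' fsy = rc z &
    loops more (step1 e) (St s (size y).+1 (cv (size y) 0 0 0 0 0 r) w)
      (St s' (size (y ++ ser u)).+1 (cv (size (y ++ ser u)) 0 0 0 0 0 r')
        (if e then w ++ trav T q u else w))].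
Proof.
elim/tree_ind: u y q s r w => [n|k ts IH] y q s r w a s1.
  have [s' [r' [b' z' e']]] := ex_step1 e s r w a.
  exists s', r'; split=> //.
    by move=> z xe; apply: z' xe _; rewrite size_cat.
  by rewrite size_cat; apply: LoopS s1 e' (Loop0 _ _ _).
have [s' [r' [b' z' e']]] := ex_step1 e s r w a.
have [z0' xe] := At_cat a.
have H l2 l1 s2 r2 w2 : ts = l1 ++ l2 ->
  (forall z, x = (y ++ hdr k (size ts) ++ flatten (map ser l1)) ++ z ->
     get s2 fsy = rc z) ->
  exists s3 r3, [/\ get s3 fbad = tbad e (get s2 fbad) (children true andb (okt T)
      (delta T q (cap k)) (size l1) (last 0 (map lval l1)) l2),
    forall z, x = (y ++ hdr k (size ts) ++ flatten (map ser ts)) ++ z ->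
      get s3 fsy = rc z &
    loops more (step1 e)
      (St s2 (size (y ++ hdr k (size ts) ++ flatten (map ser l1))).+1
        (cv (size (y ++ hdr k (size ts) ++ flatten (map ser l1))) 0 0 0 0 0 r2) w2)
      (St s3 (size (y ++ hdr k (size ts) ++ flatten (map ser ts))).+1
        (cv (size (y ++ hdr k (size ts) ++ flatten (map ser ts))) 0 0 0 0 0 r3)
        (if e then w2 ++ children [::] cat (trav T)
           (delta T q (cap k)) (size l1) (last 0 (map lval l1)) l2 else w2))].
  elim: l2 l1 s2 r2 w2 => [|v l2 IHl] l1 s2 r2 w2 tsE sy2.
    rewrite cats0 in tsE; rewrite -tsE in sy2 *; exists s2, r2; split=> //.
      by rewrite /tbad orbT.
    by rewrite /= cats0; case: (e); apply: Loop0.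
  have av := AtChild (r := l2) (u := v) (l := l1) (y := y) (k := k) (q := q).
  rewrite -tsE in av; have {}av := av a.
  have [zv xv] := At_cat av.
  have v1 : get s2 fsy != 1 by rewrite (sy2 _ xv) rc_ser.
  have vin : List.In v ts by rewrite tsE; apply: List.in_elt.
  have [s3 [r3 [b3 z3 lp3]]] := IH v vin _ _ s2 r2 w2 av v1.
  have yE : y ++ hdr k (size ts) ++ flatten (map ser (rcons l1 v)) =
      (y ++ hdr k (size ts) ++ flatten (map ser l1)) ++ ser v.
    by rewrite map_rcons flatten_rcons -!catA.
  have [||s4 [r4 [b4 z4 lp4]]] := IHl (rcons l1 v) s3 r3
    (if e then w2 ++ trav T (delta T q (cap k) (cap (size l1))
       (last 0 (map lval l1)) (nilp l2)) v else w2).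
  - by rewrite cat_rcons.
  - by rewrite yE.
  exists s4, r4; split=> //.
    by rewrite b4 b3 tbad_tbad size_rcons map_rcons last_rcons.
  apply: loops_trans lp3 _; move: lp4; rewrite yE size_rcons map_rcons last_rcons.
  by case: (e); rewrite //= -[(w2 ++ _) ++ _]catA.
rewrite -[toksize _]/(size (hdr k (size ts))) -size_cat in z' e'.
have [||s3 [r3 [b3 z3 lp3]]] := H ts [::] s' r'
  (if e then w ++ tokout q (node k ts) else w).
- by [].
- by move=> z; rewrite cats0 => xz; apply: z' xz _.
exists s3, r3; split.
- by rewrite b3 b' tbad_tbad.
- by move=> z; rewrite ser_node; apply: z3.
rewrite /= cats0 in lp3; apply: LoopS s1 e' _; rewrite ser_node.
by move: lp3; case: (e); rewrite //= -[(w ++ _) ++ _]catA.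
Qed.

Definition pass (e : bool) : prog :=
  drain cP (CSkip _ _) ;; home ;; rdsym ;; CWhile more (step1 e).

Lemma ex_passes e s h p r w : h <= (size x).+1 ->
  exists s' p' r', [/\ get s' fbad = tbad e (get s fbad) (okt T 0 t0) &
    ex (pass e) (St s h (cv p 0 0 0 0 0 r) w)
      (St s' (size x).+1 (cv p' 0 0 0 0 0 r') (if e then w ++ trav T 0 t0 else w))].
Proof.
move=> hx.
have [s1 a1 e1] := ex_clear cP s h (cv p 0 0 0 0 0 r) w; rewrite updP in e1.
have [s2 a2 e2] := ex_home s1 (cv 0 0 0 0 0 0 r) w hx.
have xe : x = [::] ++ x by [].
have e3 := ex_rd s2 (cv 0 0 0 0 0 0 r) w xe.
set s3 := set1 s2 fsy (rc x) in e3.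
have sy3 : get s3 fsy != 1.
  by rewrite get_set ?rc_lt //= x0 -[ser t0]cats0 rc_ser.
have [s4 [r4 [b4 z4 lp4]]] := ex_pass e r w AtRoot sy3.
exists s4, (size x), r4; split.
  by rewrite b4 get_set ?rc_lt //= (a2 fbad) // (a1 fbad).
apply: ESeq e1 _; apply: ESeq e2 _; apply: ESeq e3 _.
rewrite /= -x0 in lp4; apply: loops_while lp4 _.
by rewrite /more /= (z4 [::]) //= -x0 cats0.
Qed.

End Walk.

(** The output cannot be taken back, so nothing is written before all checks are done. Rejected
    inputs give the empty word, which is the code of no tree. *)
Definition program (chk : table) (ps : seq (seq bool * table)) (fin : seq bool) : prog :=
  home ;; ups (fun s => set1 s fgo 1) ;; tokloop nohook ;; rdsym ;;
  CIf (is_ fsy 1) (CSkip _ _) (ups (fun s => set1 s fbad 1)) ;;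
  CIf (is_ fbad 1) (CSkip _ _)
    (pass chk false ;; CIf (is_ fbad 1) (CSkip _ _)
      (foldr (fun p c => emitS (fun=> p.1) ;; pass p.2 true ;; c)
        (emitS (fun=> fin)) ps)).

Lemma ex_program chk ps fin : exists2 st, 
  ex (program chk ps fin) (St [ffun=> inord 0] 0 (fun=> 0) [::]) st &
  (forall t, x = ser t -> okt chk 0 t ->
     sout st = flatten [seq p.1 ++ trav p.2 0 t | p <- ps] ++ fin) /\
  ((forall t, x = ser t -> ~ okt chk 0 t) -> sout st = [::]).
Proof.
set s0 : ctl := [ffun=> _].
have g0 i : get s0 i = 0 by rewrite /get ffunE inordK.
have [s1 a1 e1] := ex_home s0 (fun=> 0) [::] (leq0n _).
set s2 := set1 s1 fgo 1.
have xe : x = [::] ++ x by [].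
have [||s3 [h3 [a3 e3 H3]]] := @ex_valid (fun=> 0) _ x [::] 0 s2 [::] (ltnSn _) xe.
- by rewrite /N; lia.
- by rewrite get_set.
have c0 : upd (fun=> 0) cD 0 = cv 0 0 0 0 0 0 0.
  by apply/funext => -[[|[|[|[|[|[|[|i]]]]]]] i7].
have c1 : (fun=> 0) = cv 0 0 0 0 0 0 0.
  by apply/funext => -[[|[|[|[|[|[|[|i]]]]]]] i7].
rewrite c0 -{1}c1 in e3.
have e4 := EAct x N (fun s a => (set1 s fsy (icode a), MStay, None)) s3 h3
  (cv 0 0 0 0 0 0 0) [::].
have reject s4 : get s4 fbad = 1 -> (forall t, x <> ser t) ->
  ex (CIf (is_ fsy 1) (CSkip _ _) (ups (fun s => set1 s fbad 1)))
    (St (set1 s3 fsy (icode (read_input x h3))) (minn h3 (size x).+1)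
       (cv 0 0 0 0 0 0 0) [::])
    (St s4 (minn h3 (size x).+1) (cv 0 0 0 0 0 0 0) [::]) ->
  exists2 st,
  ex (program chk ps fin) (St s0 0 (fun=> 0) [::]) st &
  (forall t, x = ser t -> okt chk 0 t ->
     sout st = flatten [seq p.1 ++ trav p.2 0 t | p <- ps] ++ fin) /\
  ((forall t, x = ser t -> ~ okt chk 0 t) -> sout st = [::]).
  move=> b4 nx e5; exists (St s4 (minn h3 (size x).+1) (cv 0 0 0 0 0 0 0) [::]).
    apply: ESeq e1 _; apply: ESeq (ex_ups _ _ _ _ _) _ => //.
    apply: ESeq e3 _; apply: ESeq e4 _; apply: ESeq e5 _.
    by apply: EIfT; [rewrite /is_ b4|apply: ESkip].
  by split=> // t /nx.
case: H3 => [[b3 nf]|[b3 [f [z' [f1 fx h3E]]]]].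
  have nx t : x <> ser t by move=> xt; apply: nf; exists [:: t], [::]; rewrite /= !cats0.
  case sy: (icode (read_input x h3) == 1).
    apply: (reject (set1 s3 fsy (icode (read_input x h3)))) => //.
      by rewrite get_set ?icode_lt.
    by apply: EIfT; [rewrite /is_ get_set ?icode_lt|apply: ESkip].
  apply: (reject (set1 (set1 s3 fsy (icode (read_input x h3))) fbad 1)) => //.
    by rewrite get_set.
  apply: EIfF; first by rewrite /is_ get_set ?icode_lt //= sy.
  by apply: ex_ups; exact: geq_minr.
case: f f1 fx h3E => [//|t [|//]] _; rewrite [flatten _]/= !cats0 => fx h3E.
have rE : icode (read_input x h3) = rc z' by rewrite h3E; exact: read_at.
have hx : h3 <= (size x).+1 by rewrite h3E; exact: (at_bound fx).
case: z' fx rE => [|b z'] fx rE; last first.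
  apply: (reject (set1 (set1 s3 fsy (icode (read_input x h3))) fbad 1)).
  - by rewrite get_set.
  - move=> t'; rewrite fx -[RHS]cats0 => /esym/ser_cat[_]; by [].
  apply: EIfF; first by rewrite /is_ get_set ?icode_lt //= rE; case: (b).
  by apply: ex_ups; exact: geq_minr.
rewrite cats0 in fx; rewrite (minn_idPl hx) in e4.
set s4 := set1 s3 fsy (icode (read_input x h3)) in e4.
have b4 : get s4 fbad = 0 by rewrite get_set ?icode_lt //= b3 get_set //= (a1 fbad) // g0.
have [s5 [p5 [r5 [b5 e5]]]] := ex_passes chk fx false s4 0 0 [::] hx.
have pre st : ex (CIf (is_ fbad 1) (CSkip _ _)
      (foldr (fun p c => emitS (fun=> p.1) ;; pass p.2 true ;; c)
        (emitS (fun=> fin)) ps)) (St s5 (size x).+1 (cv p5 0 0 0 0 0 r5) [::]) st ->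
    ex (program chk ps fin) (St s0 0 (fun=> 0) [::]) st.
  move=> e6; apply: ESeq e1 _; apply: ESeq (ex_ups _ _ _ _ _) _ => //.
  apply: ESeq e3 _; apply: ESeq e4 _.
  apply: (ESeq (st1 := St s4 h3 (cv 0 0 0 0 0 0 0) [::])).
    by apply: EIfT; [rewrite /is_ get_set ?icode_lt // rE|apply: ESkip].
  by apply: EIfF; [rewrite /is_ b4|apply: ESeq e5 e6].
rewrite b4 in b5; case ok: (okt chk 0 t) b5 => b5; last first.
  exists (St s5 (size x).+1 (cv p5 0 0 0 0 0 r5) [::]).
    by apply: pre; apply: EIfT; [rewrite /is_ b5|apply: ESkip].
  by split=> // t'; rewrite fx => /ser_inj <-; rewrite ok.
have out l s6 p6 r6 w : exists2 st, ex (foldr (fun p c =>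
      emitS (fun=> p.1) ;; pass p.2 true ;; c) (emitS (fun=> fin)) l)
      (St s6 (size x).+1 (cv p6 0 0 0 0 0 r6) w) st &
    sout st = w ++ flatten [seq p.1 ++ trav p.2 0 t | p <- l] ++ fin.
  elim: l s6 p6 r6 w => [|p l IHl] s6 p6 r6 w /=.
    by exists (St s6 (size x).+1 (cv p6 0 0 0 0 0 r6) (w ++ fin)); first exact: ex_emitS.
  have [s7 [p7 [r7 [_ e7]]]] := ex_passes p.2 fx true s6 p6 r6 (w ++ p.1) (leqnn _).
  have [st e8 o8] := IHl s7 p7 r7 ((w ++ p.1) ++ trav p.2 0 t).
  exists st; last by rewrite o8 -!catA.
  by apply: ESeq (ex_emitS _ _ _ _ (leqnn _)) _; apply: ESeq e7 e8.
have [st e6 o6] := out ps s5 p5 r5 [::].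
exists st; first by apply: pre; apply: EIfF; [rewrite /is_ b5|].
split; first by move=> t'; rewrite fx => /ser_inj <- _.
by move=> /(_ t fx); rewrite ok => /(_ isT).
Qed.

End Run.

(** The form of every reduction below: fixed strings alternate with passes over the same input,
    behind the check [chk]. Conjuncts of the output are thus written by separate passes. *)
Theorem logspace_trav (chk : table) (ps : seq (seq bool * table)) (fin : seq bool) :
  exists2 f, logspace f & forall w,
    (forall t, w = ser t -> okt chk 0 t ->
       f w = flatten [seq p.1 ++ trav p.2 0 t | p <- ps] ++ fin) /\
    ((forall t, w = ser t -> ~ okt chk 0 t) -> f w = [::]).
Proof.
have run x : {st | exec x (size x).+2 (program chk ps fin)
    (St [ffun=> inord 0] 0 (fun=> 0) [::]) st /\
  ((forall t, x = ser t -> okt chk 0 t ->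
     sout st = flatten [seq p.1 ++ trav p.2 0 t | p <- ps] ++ fin) /\
  ((forall t, x = ser t -> ~ okt chk 0 t) -> sout st = [::]))}.
  by apply: cid; have [st e1 e2] := ex_program x chk ps fin; exists st.
exists (fun x => sout (projT1 (run x))); last by move=> w; case: (run w) => st [].
apply: (@logspace_program _ _ (program chk ps fin) [ffun=> inord 0]) => x.
exists (projT1 (run x)); split=> //.
by case: (run x) => st [].
Qed.

(** * Arithmetic: pairing, numerals, and lowering the order *)

Local Open Scope classical_set_scope.
(** Unlike the pairing of Cantor, this is a polynomial with natural coefficients, hence a term of
    arithmetic. *)
Definition pairn (a b : nat) : nat := (a + b) * (a + b) + a.

Lemma pairn_inj a b c d : pairn a b = pairn c d -> a = c /\ b = d.
Proof.
rewrite /pairn => e; have : a + b = c + d; last by lia.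
by case: (ltngtP (a + b) (c + d)) => // lt_; nia.
Qed.

Definition tp (a b : term) : term := TAdd (TMul (TAdd a b) (TAdd a b)) a.

Lemma term_val_tp v a b : term_val v (tp a b) = pairn (term_val v a) (term_val v b).
Proof. by []. Qed.

Opaque tp pairn.

Definition AImp (a b : arith) := AOr (ANot a) b.
Definition AIff (a b : arith) := AAnd (AImp a b) (AImp b a).
Arguments AImp : simpl never.
Arguments AIff : simpl never.

Definition num (n : nat) : term := iter n (TAdd TOne) TZero.

Lemma term_val_num v n : term_val v (num n) = n.
Proof. by elim: n => //= n ->. Qed.

(** A name [n] of the source becomes the value of the register [r]. The translations thus use a
    fixed set of variables, and [n] enters the output only through a numeral, which is a repeated
    string. *)
Definition letn (r n : nat) (f : arith) : arith :=
  AEx O1 r (AAnd (AEq (TVar r) (num n)) f).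
Arguments letn : simpl never.

Section Gsat.
Variables (P : Type) (B : P -> set nat).

(* [arith_sat], except that the variables of order 2 range over [P], whose
   elements denote sets of numbers via [B]. *)
Fixpoint gsat (v1 : nat -> nat) (v2 : nat -> P) (v3 : nat -> set P)
    (f : arith) : Prop :=
  match f with
  | AEq t u => term_val v1 t = term_val v1 u
  | ALe t u => term_val v1 t <= term_val v1 u
  | AIn2 t x => B (v2 x) (term_val v1 t)
  | AIn3 x y => v3 y (v2 x)
  | ANot f => ~ gsat v1 v2 v3 f
  | AAnd f g => gsat v1 v2 v3 f /\ gsat v1 v2 v3 g
  | AOr f g => gsat v1 v2 v3 f \/ gsat v1 v2 v3 g
  | AEx O1 x f => exists a, gsat (upd v1 x a) v2 v3 f
  | AEx O2 x f => exists a, gsat v1 (upd v2 x a) v3 f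
  | AEx O3 x f => exists a, gsat v1 v2 (upd v3 x a) f
  | AAll O1 x f => forall a, gsat (upd v1 x a) v2 v3 f
  | AAll O2 x f => forall a, gsat v1 (upd v2 x a) v3 f
  | AAll O3 x f => forall a, gsat v1 v2 (upd v3 x a) f
  end.

Lemma gimp v1 v2 v3 a b :
  gsat v1 v2 v3 (AImp a b) <-> (gsat v1 v2 v3 a -> gsat v1 v2 v3 b).
Proof.
split=> [[na|hb] ha //|h]; have [ha|na] := pselect (gsat v1 v2 v3 a).
  by right; apply: h.
by left.
Qed.

Lemma gall1 v1 v2 v3 x f :
  gsat v1 v2 v3 (AAll O1 x f) <-> forall a, gsat (upd v1 x a) v2 v3 f.
Proof. by []. Qed.
Lemma gall2 v1 v2 v3 x f :
  gsat v1 v2 v3 (AAll O2 x f) <-> forall a, gsat v1 (upd v2 x a) v3 f.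
Proof. by []. Qed.
Lemma gall3 v1 v2 v3 x f :
  gsat v1 v2 v3 (AAll O3 x f) <-> forall a, gsat v1 v2 (upd v3 x a) f.
Proof. by []. Qed.
Lemma gex1 v1 v2 v3 x f :
  gsat v1 v2 v3 (AEx O1 x f) <-> exists a, gsat (upd v1 x a) v2 v3 f.
Proof. by []. Qed.
Lemma gex2 v1 v2 v3 x f :
  gsat v1 v2 v3 (AEx O2 x f) <-> exists a, gsat v1 (upd v2 x a) v3 f.
Proof. by []. Qed.
Lemma gex3 v1 v2 v3 x f :
  gsat v1 v2 v3 (AEx O3 x f) <-> exists a, gsat v1 v2 (upd v3 x a) f.
Proof. by []. Qed.
Lemma gand v1 v2 v3 f g :
  gsat v1 v2 v3 (AAnd f g) <-> gsat v1 v2 v3 f /\ gsat v1 v2 v3 g.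
Proof. by []. Qed.

Lemma gor v1 v2 v3 f g :
  gsat v1 v2 v3 (AOr f g) <-> gsat v1 v2 v3 f \/ gsat v1 v2 v3 g.
Proof. by []. Qed.
Lemma gnot v1 v2 v3 f : gsat v1 v2 v3 (ANot f) <-> ~ gsat v1 v2 v3 f.
Proof. by []. Qed.
Lemma gin3 v1 v2 v3 x y : gsat v1 v2 v3 (AIn3 x y) <-> v3 y (v2 x).
Proof. by []. Qed.

Lemma gin2 v1 v2 v3 t x :
  gsat v1 v2 v3 (AIn2 t x) <-> B (v2 x) (term_val v1 t).
Proof. by []. Qed.

Lemma giff v1 v2 v3 a b :
  gsat v1 v2 v3 (AIff a b) <-> (gsat v1 v2 v3 a <-> gsat v1 v2 v3 b).
Proof.
by split=> [[/gimp h /gimp h']|[h h']] //; split; apply/gimp.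
Qed.

Lemma gletn v1 v2 v3 r n f :
  gsat v1 v2 v3 (letn r n f) <-> gsat (upd v1 r n) v2 v3 f.
Proof.
rewrite /letn /=; split=> [[a []]|h].
  by rewrite updE term_val_num => ->.
by exists n; rewrite updE term_val_num.
Qed.
End Gsat.

Lemma gsat_id v1 v2 v3 f :
  gsat (P := set nat) id v1 v2 v3 f <-> arith_sat v1 v2 v3 f.
Proof. by elim: f v1 v2 v3. Qed.

Fixpoint tcmp (t : term) : term :=
  match t with
  | TVar x => TVar x.*2
  | TZero => TZero
  | TOne => TOne
  | TAdd t u => TAdd (tcmp t) (tcmp u)
  | TMul t u => TMul (tcmp t) (tcmp u)
  end.

(* Replaces variables of order 2 by indices of rows of a binary relation, which
   is the second-order variable 0, and lowers the order of the others. *)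
Fixpoint cmp (f : arith) : arith :=
  match f with
  | AEq t u => AEq (tcmp t) (tcmp u)
  | ALe t u => ALe (tcmp t) (tcmp u)
  | AIn2 t x => AIn2 (tp (TVar x.*2.+1) (tcmp t)) 0
  | AIn3 x y => AIn2 (TVar x.*2.+1) y.+1
  | ANot f => ANot (cmp f)
  | AAnd f g => AAnd (cmp f) (cmp g)
  | AOr f g => AOr (cmp f) (cmp g)
  | AEx O1 x f => AEx O1 x.*2 (cmp f)
  | AEx O2 x f => AEx O1 x.*2.+1 (cmp f)
  | AEx O3 x f => AEx O2 x.+1 (cmp f)
  | AAll O1 x f => AAll O1 x.*2 (cmp f)
  | AAll O2 x f => AAll O1 x.*2.+1 (cmp f)
  | AAll O3 x f => AAll O2 x.+1 (cmp f)
  end.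

(** Variables of order 1 move to even indices, and the row indices that replace variables of order 2
    to odd ones. *)
Definition comb (v1 v2 : nat -> nat) (n : nat) : nat :=
  if odd n then v2 n./2 else v1 n./2.
Definition comb2 (C : set nat) (v3 : nat -> set nat) (n : nat) : set nat :=
  if n is y.+1 then v3 y else C.

Lemma comb_even v1 v2 x : comb v1 v2 x.*2 = v1 x.
Proof. by rewrite /comb odd_double doubleK. Qed.
Lemma comb_odd v1 v2 x : comb v1 v2 x.*2.+1 = v2 x.
Proof. by rewrite /comb /= odd_double uphalf_double. Qed.
Lemma upd_even v1 v2 x a : upd (comb v1 v2) x.*2 a = comb (upd v1 x a) v2.
Proof.
apply/funext => n; rewrite /upd /comb.
case: eqP => [->|nx]; first by rewrite odd_double doubleK eqxx.
case o: (odd n) => //; case: eqP => // nx'; case: nx.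
by rewrite -nx' -[LHS]odd_double_half o.
Qed.
Lemma upd_odd v1 v2 x a : upd (comb v1 v2) x.*2.+1 a = comb v1 (upd v2 x a).
Proof.
apply/funext => n; rewrite /upd /comb.
case: eqP => [->|nx]; first by rewrite /= odd_double uphalf_double eqxx.
case o: (odd n) => //; case: eqP => // nx'; case: nx.
by rewrite -nx' -[LHS]odd_double_half o.
Qed.
Lemma upd_comb2 C v3 x a : upd (comb2 C v3) x.+1 a = comb2 C (upd v3 x a).
Proof. by apply/funext => -[|n] //; rewrite /upd /= eqSS. Qed.

Lemma cmpP (C : set nat) u3 v1 v2 v3 f :
  arith_sat (comb v1 v2) (comb2 C v3) u3 (cmp f) <->
  gsat (fun e => [set m | C (pairn e m)]) v1 v2 v3 f.
Proof.
have tE v t : term_val (comb v v2) (tcmp t) = term_val v t.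
  by elim: t => //= [x|t -> u ->|t -> u ->] //; rewrite comb_even.
have {}tE v v' t : term_val (comb v v') (tcmp t) = term_val v t.
  by elim: t => //= [x|t -> u ->|t -> u ->] //; rewrite comb_even.
elim: f v1 v2 v3 {tE} (tE) => /=.
- by move=> t u v1 v2 v3 tE; rewrite !tE.
- by move=> t u v1 v2 v3 tE; rewrite !tE.
- by move=> t x v1 v2 v3 tE; rewrite term_val_tp tE /= comb_odd.
- by move=> x y v1 v2 v3 tE; rewrite comb_odd.
- by move=> f IH v1 v2 v3 tE; rewrite IH.
- by move=> f IHf g IHg v1 v2 v3 tE; rewrite IHf // IHg.
- by move=> f IHf g IHg v1 v2 v3 tE; rewrite IHf // IHg.
- move=> [] x f IH v1 v2 v3 tE /=; split=> -[a h]; exists a; move: h;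
  by rewrite ?upd_even ?upd_odd ?upd_comb2 IH.
by move=> [] x f IH v1 v2 v3 tE /=; split=> h a; move: (h a);
  rewrite ?upd_even ?upd_odd ?upd_comb2 IH.
Qed.

Lemma cmp_second_order f : second_order (cmp f).
Proof. by elim: f => //= [f hf g hg|f hf g hg|[] x f hf|[] x f hf] //=; rewrite ?hf ?hg. Qed.

(** * Free variables of arithmetic formulas *)

Notation vars := (Defs.order -> nat -> bool).

Fixpoint tin (R : vars) (t : term) : bool :=
  match t with
  | TVar x => R O1 x
  | TZero | TOne => true
  | TAdd t u | TMul t u => tin R t && tin R u
  end.

Definition ext (R : vars) (o : Defs.order) (x : nat) o' x' : bool :=
  ((order_nat o == order_nat o') && (x == x')) || R o' x'.

(** With a predicate in place of a list of variables, closedness of a large concrete formula is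
    decided by simplification. *)
Fixpoint fvin (R : vars) (f : arith) : bool :=
  match f with
  | AEq t u | ALe t u => tin R t && tin R u
  | AIn2 t x => R O2 x && tin R t
  | AIn3 x y => R O2 x && R O3 y
  | ANot f => fvin R f
  | AAnd f g | AOr f g => fvin R f && fvin R g
  | AEx o x f | AAll o x f => fvin (ext R o x) f
  end.

Lemma tin_tp R a b : tin R (tp a b) = tin R a && tin R b.
Proof.
rewrite -[tin R (tp a b)]/(((tin R a && tin R b) && (tin R a && tin R b)) && tin R a).
by case: (tin R a) (tin R b) => [] [].
Qed.

Lemma tinP R t : tin R t = all (R O1) (term_vars t).
Proof.
by elim: t => //= [x|t -> u ->|t -> u ->]; rewrite ?all_cat ?andbT.
Qed.

Lemma tin_num R n : tin R (num n).
Proof. by elim: n. Qed.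

Lemma fvin_letn R r n f : fvin R (letn r n f) = fvin (ext R O1 r) f.
Proof.
by rewrite /letn /= tin_num /ext /= eqxx.
Qed.

Lemma fvinP R f : fvin R f = all (fun v => R v.1 v.2) (arith_free f).
Proof.
have tE t u Q : tin Q t && tin Q u =
    all (fun v => Q v.1 v.2) [seq (O1, x) | x <- term_vars t ++ term_vars u].
  by rewrite !tinP all_map -all_cat.
elim: f R => //= [t x|x y|f IHf g IHg|f IHf g IHg|o x f IH|o x f IH] R.
- by rewrite tinP all_map.
- by rewrite andbT.
- by rewrite IHf IHg all_cat.
- by rewrite IHf IHg all_cat.
- rewrite IH all_filter; apply: eq_all => -[o' x'] /=; rewrite /ext xpair_eqE.
  rewrite -(inj_eq order_nat_inj) [order_nat o' == _]eq_sym [x' == _]eq_sym.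
  by case: (_ && _).
rewrite IH all_filter; apply: eq_all => -[o' x'] /=; rewrite /ext xpair_eqE.
rewrite -(inj_eq order_nat_inj) [order_nat o' == _]eq_sym [x' == _]eq_sym.
by case: (_ && _).
Qed.

Lemma fvin_closed f : fvin (fun _ _ => false) f -> arith_free f = [::].
Proof. by rewrite fvinP; case: (arith_free f). Qed.

Lemma fvin_cmp (R R' : vars) f : fvin R f -> R' O2 0 ->
  (forall x, R O1 x -> R' O1 x.*2) -> (forall x, R O2 x -> R' O1 x.*2.+1) ->
  (forall x, R O3 x -> R' O2 x.+1) -> fvin R' (cmp f).
Proof.
elim: f R R' => /=.
all: have tE (R R' : vars) t : (forall x, R O1 x -> R' O1 x.*2) -> tin R t -> tin R' (tcmp t)
  by move=> h; elim: t => //= [t IHt u IHu|t IHt u IHu] /andP[/IHt-> /IHu->].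
- by move=> t u R R' /andP[h h'] r0 r1 r2 r3; rewrite !(tE R).
- by move=> t u R R' /andP[h h'] r0 r1 r2 r3; rewrite !(tE R).
- by move=> t x R R' /andP[h h'] r0 r1 r2 r3; rewrite r0 tin_tp /= r2 // (tE R).
- by move=> x y R R' /andP[h h'] r0 r1 r2 r3; rewrite r2 // r3.
- by [].
- by move=> f IHf g IHg R R' /andP[h h'] r0 r1 r2 r3; rewrite (IHf R) ?(IHg R).
- by move=> f IHf g IHg R R' /andP[h h'] r0 r1 r2 r3; rewrite (IHf R) ?(IHg R).
- move=> o x f IH R R' h r0 r1 r2 r3.
  case: o h => h; apply: IH h _ _ _ _ => [|y|y|y]; rewrite /ext /= ?r0 ?orbT //.
  all: first [move=> h; by first [rewrite (r1 _ h) ?orbT|rewrite (r2 _ h) ?orbT|rewrite (r3 _ h) ?orbT]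
    | move=> /predU1P[->|h]; [by rewrite eqxx|by first [rewrite (r1 _ h) ?orbT|rewrite (r2 _ h) ?orbT|rewrite (r3 _ h) ?orbT]] | idtac].
move=> o x f IH R R' h r0 r1 r2 r3.
case: o h => h; apply: IH h _ _ _ _ => [|y|y|y]; rewrite /ext /= ?r0 ?orbT //.
all: first [move=> h; by first [rewrite (r1 _ h) ?orbT|rewrite (r2 _ h) ?orbT|rewrite (r3 _ h) ?orbT]
    | move=> /predU1P[->|h]; [by rewrite eqxx|by first [rewrite (r1 _ h) ?orbT|rewrite (r2 _ h) ?orbT|rewrite (r3 _ h) ?orbT]] | idtac].
Qed.

(** * Assignments as sets of numbers *)

Definition rasg := nat -> option (trace * nat).

(** Row 0 of a value holds its position alone, and row [j.+1] the propositions at time [j]. Row 0 is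
    never empty for a defined value, which tells it apart from [None]. *)
Definition rmem (o : option (trace * nat)) (a b : nat) : Prop :=
  if o is Some (t, n) then if a is j.+1 then t j b else b = n else False.

Definition code (s : rasg) : set nat :=
  [set m | exists x a b, m = pairn x (pairn a b) /\ rmem (s x) a b].

Lemma codeE s x a b : code s (pairn x (pairn a b)) <-> rmem (s x) a b.
Proof.
split=> [[x' [a' [b' [e h]]]]|h]; last by exists x, a, b.
by have [-> /pairn_inj[-> ->]] := pairn_inj e.
Qed.

Lemma rmem_inj o o' : (forall a b, rmem o a b <-> rmem o' a b) -> o = o'.
Proof.
case: o o' => [[t n]|] [[t' n']|] // h.
- have -> : n = n' by have /= [/(_ erefl)] := h 0 n.
  congr (Some (_, _)); apply/funext => j; apply/funext => b.
  by have /= [h1 h2] := h j.+1 b; apply/idP/idP.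
- by have /= [/(_ erefl)] := h 0 n.
by have /= [_ /(_ erefl)] := h 0 n'.
Qed.

Lemma code_ext s s' : (forall x a b, code s (pairn x (pairn a b)) <->
  code s' (pairn x (pairn a b))) -> s = s'.
Proof.
move=> h; apply/funext => x; apply: rmem_inj => a b.
by rewrite -!codeE.
Qed.

Lemma code_inj : injective code.
Proof. by move=> s s' e; apply: code_ext => x a b; rewrite e. Qed.

(** A trace is the assignment of an element on it to the variable 0, so that traces, elements and
    assignments are points of one kind. *)
Definition tr (t : trace) (n : nat) : rasg := fun x => if x == 0 then Some (t, n) else None.

Lemma tr_inj t t' n n' : tr t n = tr t' n' -> t = t' /\ n = n'.
Proof. by move/(congr1 (fun f => f 0)) => /= -[-> ->]. Qed.

Lemma upd_tr t n t' n' : upd (tr t n) 0 (Some (t', n')) = tr t' n'.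
Proof. by apply/funext => x; rewrite /upd /tr; case: eqP. Qed.

Definition finsupp (s : rasg) := exists N, forall x, N <= x -> s x = None.

Lemma finsupp_upd s x d : finsupp s -> finsupp (upd s x d).
Proof.
move=> [N sN]; exists (maxn N x.+1) => y; rewrite geq_max => /andP[Ny xy].
by rewrite /upd gtn_eqF // sN.
Qed.

Notation V := TVar.
Definition memA (p : nat) (x a b : term) : arith := AIn2 (tp x (tp a b)) p.

Lemma gmem (P : Type) (B : P -> set nat) v1 v2 v3 p x a b :
  gsat B v1 v2 v3 (memA p x a b) <->
  B (v2 p) (pairn (term_val v1 x) (pairn (term_val v1 a) (term_val v1 b))).
Proof. by rewrite /memA gin2 !term_val_tp. Qed.

(** Membership of the number in register 20 in the code of the assignment [p] updated at [x]: row 0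
    of the new value is [n], the other rows are those of the trace [t], whose own position is
    ignored. *)
Definition updB (p : nat) (x : term) (t : nat) (n : term) : arith :=
  AEx O1 21 (AEx O1 22 (AEx O1 23 (AAnd
    (AEq (V 20) (tp (V 21) (tp (V 22) (V 23))))
    (AOr (AAnd (ANot (AEq (V 21) x)) (AIn2 (V 20) p))
         (AAnd (AEq (V 21) x)
           (AOr (AAnd (AEq (V 22) TZero) (AEq (V 23) n))
                (AAnd (ANot (AEq (V 22) TZero))
                      (memA t TZero (V 22) (V 23))))))))).

Definition updF (p : nat) (x : term) (t : nat) (n : term) (p' : nat) : arith :=
  AAll O1 20 (AIff (AIn2 (V 20) p') (updB p x t n)).

(** Membership of the number in register 20 in the code of the trace [p] without its first [n]
    letters, with position 0. *)
Definition sufB (p : nat) (n : term) : arith :=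
  AOr (AEq (V 20) (tp TZero (tp TZero TZero)))
    (AEx O1 22 (AEx O1 23 (AAnd
      (AEq (V 20) (tp TZero (tp (TAdd (V 22) TOne) (V 23))))
      (memA p TZero (TAdd (TAdd n (V 22)) TOne) (V 23))))).

Definition sufF (p : nat) (n : term) (p' : nat) : arith :=
  AAll O1 20 (AIff (AIn2 (V 20) p') (sufB p n)).

Definition emptyF (p : nat) : arith := AAll O1 20 (ANot (AIn2 (V 20) p)).

Definition eqF (p q : nat) : arith :=
  AAll O1 20 (AIff (AIn2 (V 20) p) (AIn2 (V 20) q)).

Definition eqT (X Y : nat) : arith := AAll O2 9 (AIff (AIn3 9 X) (AIn3 9 Y)).

Definition secF (p : nat) (x : term) (q : nat) (y : term) : arith :=
  AAll O1 22 (AAll O1 23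
    (AIff (memA p x (V 22) (V 23)) (memA q y (V 22) (V 23)))).

Definition tfrom (t : trace) (n : nat) : trace := fun j => t (n + j).

Arguments updF : simpl never.
Arguments sufF : simpl never.
Arguments secF : simpl never.
Arguments eqT : simpl never.

Section Points.
Variables (P : Type) (B : P -> set nat).
Definition pt (p : P) (s : rasg) : Prop := B p = code s.
Variables (v1 : nat -> nat) (v2 : nat -> P) (v3 : nat -> set P).
Notation gs := (gsat B).

Lemma pt_inj p s s' : pt p s -> pt p s' -> s = s'.
Proof. by rewrite /pt => -> /code_inj. Qed.

Lemma pt_mem p s x a b : pt p s -> B p (pairn x (pairn a b)) <-> rmem (s x) a b.
Proof. by move=> ->; rewrite codeE. Qed.

Lemma set_ext (U : Type) (A C : set U) : (forall m, A m <-> C m) -> A = C.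
Proof. by move=> h; apply/funext => m; apply/propext. Qed.

Lemma updFP p x t n p' s tau xv nv k :
  pt (v2 p) s -> pt (v2 t) (tr tau k) ->
  (forall a b c d, term_val (upd (upd (upd (upd v1 20 a) 21 b) 22 c) 23 d) x = xv) ->
  (forall a b c d, term_val (upd (upd (upd (upd v1 20 a) 21 b) 22 c) 23 d) n = nv) ->
  gs v1 v2 v3 (updF p x t n p') <-> pt (v2 p') (upd s xv (Some (tau, nv))).
Proof.
move=> ps pt' xE nE.
have E m : gs (upd v1 20 m) v2 v3 (updB p x t n) <->
   code (upd s xv (Some (tau, nv))) m.
  split=> [[u [a [b]]]|[u [a [b [-> h]]]]].
    rewrite /= !term_val_tp xE nE /= => -[e h].
    have {e h} [-> h] : m = pairn u (pairn a b) /\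
      (u <> xv /\ B (v2 p) m \/ u = xv /\ (a = 0 /\ b = nv \/ a <> 0 /\
         B (v2 t) (pairn 0 (pairn a b)))) by [].
    apply/codeE; rewrite /upd; case: (u =P xv) h => [->|ux] [[h1 h2]|[h1]] //.
    - case=> [[-> ->]//|[]]; case: a => // a _.
      by rewrite (pt_mem _ _ _ pt').
    - by move: h2; rewrite (pt_mem _ _ _ ps).
  exists u, a, b; rewrite /= !term_val_tp xE nE; split=> //.
  rewrite -[_ \/ _]/(u <> xv /\ B (v2 p) (pairn u (pairn a b)) \/
     u = xv /\ (a = 0 /\ b = nv \/ a <> 0 /\ B (v2 t) (pairn 0 (pairn a b)))).
  move: h; rewrite /upd; case: (u =P xv) => [->|ux] h.
    right; split=> //; case: a h => [->|a h]; [by left|right].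
    by split=> //; rewrite (pt_mem _ _ _ pt').
  by left; split=> //; rewrite (pt_mem _ _ _ ps).
split=> [/gall1 h|h]; last by apply/gall1 => m; apply/giff; rewrite E -h.
by apply: set_ext => m; move: (h m) => /giff; rewrite E.
Qed.

Lemma sufFP p n p' tau nv k : pt (v2 p) (tr tau k) ->
  (forall a b c, term_val (upd (upd (upd v1 20 a) 22 b) 23 c) n = nv) ->
  gs v1 v2 v3 (sufF p n p') <-> pt (v2 p') (tr (tfrom tau nv) 0).
Proof.
move=> ps nE.
have E m : gs (upd v1 20 m) v2 v3 (sufB p n) <-> code (tr (tfrom tau nv) 0) m.
  split=> [[|[a [b]]]|[u [a [b [-> h]]]]].
  - rewrite /= !term_val_tp /= => e.
    have {e} -> : m = pairn 0 (pairn 0 0) by [].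
    by apply/codeE.
  - rewrite /= !term_val_tp /= nE => -[e h].
    have {e h} [-> h] : m = pairn 0 (pairn (a + 1) b) /\
      B (v2 p) (pairn 0 (pairn (nv + a + 1) b)) by [].
    apply/codeE; move: h; rewrite (pt_mem _ _ _ ps) /= !addn1.
    by [].
  move: h; rewrite /tr; case: (u =P 0) => [->|//].
  case: a => [->|a h]; [left|right]; rewrite /= ?term_val_tp //.
  exists a, b; rewrite /= !term_val_tp /= nE.
  rewrite -[_ /\ _]/(pairn 0 (pairn a.+1 b) = pairn 0 (pairn (a + 1) b) /\
    B (v2 p) (pairn 0 (pairn (nv + a + 1) b))).
  by rewrite (pt_mem _ _ _ ps) /= !addn1.
split=> [/gall1 h|h]; last by apply/gall1 => m; apply/giff; rewrite E -h.
by apply: set_ext => m; move: (h m) => /giff; rewrite E.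
Qed.

Lemma emptyFP p : gs v1 v2 v3 (emptyF p) <-> pt (v2 p) (fun=> None).
Proof.
split=> [h|h m /=]; last by rewrite h => -[x [a [b []]]].
apply: set_ext => m; split=> [hm|[x [a [b []]]]//].
by case: (h m).
Qed.

Lemma eqFP p q : gs v1 v2 v3 (eqF p q) <-> B (v2 p) = B (v2 q).
Proof.
split=> [/gall1 h|h]; last by apply/gall1 => m; apply/giff => /=; rewrite h.
by apply: set_ext => m; move: (h m) => /giff.
Qed.

Lemma eqTP X Y : gs v1 v2 v3 (eqT X Y) <-> v3 X = v3 Y.
Proof.
split=> [/gall2 h|h]; last by apply/gall2 => m; apply/giff => /=; rewrite h.
apply/funext => p; apply/propext; move: (h p) => /giff.
by rewrite /= updE.
Qed.

Lemma secFP p x q y s s' xv yv : pt (v2 p) s -> pt (v2 q) s' ->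
  (forall a b, term_val (upd (upd v1 22 a) 23 b) x = xv) ->
  (forall a b, term_val (upd (upd v1 22 a) 23 b) y = yv) ->
  gs v1 v2 v3 (secF p x q y) <-> s xv = s' yv.
Proof.
move=> ps pq xE yE; split=> [/gall1 h|e]; last apply/gall1 => a; last apply/gall1 => b.
  apply: rmem_inj => a b; move: (h a) => /gall1/(_ b)/giff.
  by rewrite /= !term_val_tp xE yE (pt_mem _ _ _ ps) (pt_mem _ _ _ pq).
apply/giff; rewrite /= !term_val_tp xE yE (pt_mem _ _ _ ps) (pt_mem _ _ _ pq).
by rewrite e.
Qed.

End Points.

Definition ratom (s : rasg) (a : atom) : Prop :=
  match a with
  | Eq x y => exists2 d, s x = Some d & s y = Some d
  | Le x y => exists t n m, [/\ s x = Some (t, n), s y = Some (t, m) & n <= m]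
  | Pred i x => exists t n, s x = Some (t, n) /\ t n i
  | Level x y => exists t t' n, s x = Some (t, n) /\ s y = Some (t', n)
  end.

Definition raw (T : set trace) (s : assignment T) : rasg :=
  fun x => omap (fun d => (val d.1, d.2)) (s x).

Lemma raw_eq T (s s' : assignment T) x y : raw s x = raw s' y <-> s x = s' y.
Proof.
rewrite /raw; case: (s x) (s' y) => [[t n]|] [[t' n']|] //=.
by split=> [[/val_inj -> ->]|[-> ->]].
Qed.

Lemma raw_upd T (s : assignment T) x (d : dom T) :
  raw (upd s x (Some d)) = upd (raw s) x (Some (val d.1, d.2)).
Proof. by apply/funext => y; rewrite /raw /upd; case: eqP. Qed.

Lemma ratom_raw T (s : assignment T) a : ratom (raw s) a <-> sat_atom s a.
Proof.
have rE x : raw s x = omap (fun d => (val d.1, d.2)) (s x) by [].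
case: a => [x y|x y|i x|x y] /=; rewrite !rE.
- case: (s x) (s y) => [[t n]|] [[t' n']|]; split=> -[] //= d; try by move=> [].
    by move=> [<-] [/val_inj -> ->]; exists (t, n).
  by move=> [<-] [-> ->]; exists (val t, n).
- split=> [[t [n [m []]]]|[t [n [m [-> -> nm]]]]]; last by exists (val t), n, m.
  case: (s x) (s y) => [[t1 n1]|] [[t2 n2]|] //= [<- <-] [/val_inj -> ->] nm.
  by exists t1, n1, m.
- split=> [[t [n []]]|[d -> h]]; last by exists (val d.1), d.2.
  by case: (s x) => [[t1 n1]|] //= [<- <-] h; exists (t1, n1).
split=> [[t [t' [n []]]]|[t [t' [n [-> ->]]]]]; last by exists (val t), (val t'), n.
by case: (s x) (s y) => [[t1 n1]|] [[t2 n2]|] //= [_ <-] [_ ->]; exists t1, t2, n1.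
Qed.

Definition defF (p : nat) (x : term) : arith :=
  AEx O1 22 (AEx O1 23 (memA p x (V 22) (V 23))).

Definition eqA := AAnd (defF 0 (V 0)) (secF 0 (V 0) 0 (V 1)).
(** Two elements lie on the same trace if their rows agree except for row 0. *)
Definition leA := AAnd
  (AEx O1 24 (AEx O1 25 (AAnd (memA 0 (V 0) TZero (V 24))
    (AAnd (memA 0 (V 1) TZero (V 25)) (ALe (V 24) (V 25))))))
  (AAll O1 22 (AAll O1 23 (AOr (AEq (V 22) TZero)
    (AIff (memA 0 (V 0) (V 22) (V 23)) (memA 0 (V 1) (V 22) (V 23)))))).
Definition predA := AEx O1 24 (AAnd (memA 0 (V 1) TZero (V 24))
  (memA 0 (V 1) (TAdd (V 24) TOne) (V 0))).
Definition levelA := AEx O1 24 (AAnd (memA 0 (V 0) TZero (V 24))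
  (memA 0 (V 1) TZero (V 24))).

Definition atomA (a : atom) : arith :=
  match a with
  | Eq x y => letn 0 x (letn 1 y eqA)
  | Le x y => letn 0 x (letn 1 y leA)
  | Pred i x => letn 0 i (letn 1 x predA)
  | Level x y => letn 0 x (letn 1 y levelA)
  end.

Section Points.
Variables (P : Type) (B : P -> set nat).
Notation gs := (gsat B).
Notation pt := (pt B).

Lemma defFP v1 v2 v3 p x s xv : pt (v2 p) s ->
  (forall a b, term_val (upd (upd v1 22 a) 23 b) x = xv) ->
  gs v1 v2 v3 (defF p x) <-> exists d, s xv = Some d.
Proof.
move=> ps xE; split=> [[a [b]]|[[t n] sx]].
  rewrite /= !term_val_tp xE (pt_mem _ _ _ ps).
  by case: (s xv) => // d _; exists d.
by exists 0, n; rewrite /= !term_val_tp xE (pt_mem _ _ _ ps) sx.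
Qed.

Lemma atomAP v1 v2 v3 s a : pt (v2 0) s -> gs v1 v2 v3 (atomA a) <-> ratom s a.
Proof.
move=> ps; case: a => [x y|x y|i x|x y]; rewrite [atomA _]/= !gletn.
- rewrite gand (@defFP _ _ _ _ _ s x) // (@secFP _ _ _ _ _ _ _ _ _ s s x y) //.
  by split=> [[[d sd] e]|[d -> ->]]; [exists d; rewrite -?e|split=> //; exists d].
- rewrite gand; split=> [[[n [m]]] h /gall1 e|[t [n [m [sx sy nm]]]]].
    move: h; rewrite /= !term_val_tp !(pt_mem _ _ _ ps) => -[h1 [h2 h3]].
    have {}e a b : rmem (s x) a.+1 b <-> rmem (s y) a.+1 b.
      have [e0|/giff] : gs (upd (upd (upd (upd v1 0 x) 1 y) 22 a.+1) 23 b) v2 v3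
          (AEq (V 22) TZero) \/ gs (upd (upd (upd (upd v1 0 x) 1 y) 22 a.+1) 23 b)
          v2 v3 (AIff (memA 0 (V 0) (V 22) (V 23)) (memA 0 (V 1) (V 22) (V 23))).
        exact: (e a.+1 b).
      - by have : a.+1 = 0 := e0.
      by rewrite /= !term_val_tp !(pt_mem _ _ _ ps).
    move: h1 h2 e; case: (s x) (s y) => [[t n']|] [[t' m']|] //= <- <- e.
    exists t, n, m; split=> //; congr (Some (_, _)); apply/funext => j.
    by apply/funext => b; apply/idP/idP => /e.
  split.
    exists n, m; rewrite /= !term_val_tp !(pt_mem _ _ _ ps).
    rewrite -[_ /\ _]/(rmem (s x) 0 n /\ rmem (s y) 0 m /\ n <= m).
    by rewrite sx sy.
  apply/gall1 => -[|a]; apply/gall1 => b; [by left|right; apply/giff].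
  rewrite /= !term_val_tp !(pt_mem _ _ _ ps).
  by rewrite -[_ <-> _]/(rmem (s x) a.+1 b <-> rmem (s y) a.+1 b) sx sy.
- split=> [[n]|[t [n [sx h]]]].
    rewrite /= !term_val_tp !(pt_mem _ _ _ ps).
    rewrite -[_ /\ _]/(rmem (s x) 0 n /\ rmem (s x) (n + 1) i) addn1.
    case: (s x) => [[t n']|]; last by case.
    by move=> [<- h]; exists t, n.
  exists n; rewrite /= !term_val_tp !(pt_mem _ _ _ ps).
  by rewrite -[_ /\ _]/(rmem (s x) 0 n /\ rmem (s x) (n + 1) i) addn1 sx.
split=> [[n]|[t [t' [n [sx sy]]]]].
  rewrite /= !term_val_tp !(pt_mem _ _ _ ps).
  rewrite -[_ /\ _]/(rmem (s x) 0 n /\ rmem (s y) 0 n).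
  case: (s x) (s y) => [[t n']|] [[t' m']|]; try by case.
  by move=> [<- <-]; exists t, t', n.
exists n; rewrite /= !term_val_tp !(pt_mem _ _ _ ps).
by rewrite -[_ /\ _]/(rmem (s x) 0 n /\ rmem (s y) 0 n) sx sy.
Qed.

End Points.

(** * First-order team logic *)

(** The third-order variable 0 holds the current team (for SO, the values of the relation variables)
    and 1 the trace set. A translated subformula always refers to 0, which is rebound here. *)
Definition becF (Y : nat) (f : arith) := AEx O3 0 (AAnd (eqT 0 Y) f).
Definition unF := AAll O2 9 (AIff (AIn3 9 0) (AOr (AIn3 9 2) (AIn3 9 3))).
Definition subU := AAll O2 2 (AImp (AIn3 2 2)
  (AEx O2 3 (AEx O2 4 (AEx O1 10 (AAnd (AIn3 3 0) (AAnd (AIn3 4 1)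
    (updF 3 (V 0) 4 (V 10) 2))))))).
(** In lax semantics a team results from an existential step exactly if all its members are updates
    of old members and each old member has at least one update in it. *)
Definition exF := AAnd subU (AAll O2 3 (AImp (AIn3 3 0)
  (AEx O2 2 (AEx O2 4 (AEx O1 10 (AAnd (AIn3 2 2) (AAnd (AIn3 4 1)
    (updF 3 (V 0) 4 (V 10) 2)))))))).
Definition allF := AAnd subU (AAll O2 3 (AImp (AIn3 3 0) (AAll O2 4 (AImp (AIn3 4 1)
  (AAll O1 10 (AEx O2 2 (AAnd (AIn3 2 2) (updF 3 (V 0) 4 (V 10) 2)))))))).

Definition depF (xs : seq nat) (y : nat) : arith :=
  foldr (fun x f => AOr (letn 0 x (ANot (secF 0 (V 0) 1 (V 0)))) f)
    (letn 0 y (secF 0 (V 0) 1 (V 0))) xs.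

(** The sign [b] of a literal is a number in its code; it is rendered as [b] further negations,
    which a leaf can write. *)
Fixpoint semFO (f : fo) : arith :=
  match f with
  | FLit b a => AAll O2 0 (AOr (ANot (AIn3 0 0)) (ANot (iter b ANot (atomA a))))
  | FDep xs y => AAll O2 0 (AAll O2 1 (AOr (ANot (AIn3 0 0)) (AOr (ANot (AIn3 1 0))
      (depF xs y))))
  | FNot f => ANot (semFO f)
  | FAnd f g => AAnd (semFO f) (semFO g)
  | FOr f g => AEx O3 2 (AEx O3 3 (AAnd unF
      (AAnd (becF 2 (semFO f)) (becF 3 (semFO g)))))
  | FEx x f => letn 0 x (AEx O3 2 (AAnd exF (becF 2 (semFO f))))
  | FAll x f => letn 0 x (AEx O3 2 (AAnd allF (becF 2 (semFO f))))
  end.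

Ltac fvs := do 6! (rewrite /= ?tin_tp ?fvin_letn ?tin_num /ext /=).

Lemma fvin_semFO f (R : vars) :
  R O3 0 -> R O3 1 -> fvin R (semFO f).
Proof.
elim: f R => [b a|xs y|f IH|f IHf g IHg|f IHf g IHg|x f IH|x f IH] R r0 r1.
- move: b a => [] [x y|x y|i x|x y]; rewrite /semFO /atomA /eqA /leA /predA /levelA /secF /defF /memA /AIff /AImp; fvs; by rewrite ?r0.
- rewrite [semFO _]/=; fvs; rewrite ?r0 /=.
  by elim: xs => [|x xs IHx]; rewrite /depF /secF /memA /AIff /AImp; fvs => //; rewrite ?IHx.
- exact: IH.
- by rewrite /= IHf ?IHg.
- by rewrite [semFO _]/= /unF /becF /eqT /AIff /AImp; fvs; rewrite IHf ?IHg ?r0 ?r1 ?orbT.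
- by rewrite [semFO _]/= /exF /becF /eqT /subU /updF /updB /memA /AIff /AImp; fvs; rewrite IH ?r0 ?r1 ?orbT.
by rewrite [semFO _]/= /allF /becF /eqT /subU /updF /updB /memA /AIff /AImp; fvs; rewrite IH ?r0 ?r1 ?orbT.
Qed.

Lemma unFP (P : Type) (B : P -> set nat) v1 v2 v3 :
  gsat B v1 v2 v3 unF <-> v3 0 = v3 2 `|` v3 3.
Proof.
split=> [/gall2 h|h]; last by apply/gall2 => p; apply/giff; rewrite gor !gin3 updE h.
apply/funext => p; apply/propext; move: (h p) => /giff.
by rewrite gor !gin3 updE.
Qed.

Lemma depFP (P : Type) (B : P -> set nat) v1 v2 v3 xs y s s' :
  pt B (v2 0) s -> pt B (v2 1) s' -> gsat B v1 v2 v3 (depF xs y) <->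
  ({in xs, forall x, s x = s' x} -> s y = s' y).
Proof.
move=> ps ps'; elim: xs => [|x xs IH].
  rewrite [depF _ _]/= gletn (@secFP _ _ _ _ _ _ _ _ _ s s' y y) //.
  by split=> // h; apply: h.
have -> : depF (x :: xs) y = AOr (letn 0 x (ANot (secF 0 (V 0) 1 (V 0)))) (depF xs y).
  by [].
have E : gsat B v1 v2 v3 (letn 0 x (ANot (secF 0 (V 0) 1 (V 0)))) <-> s x <> s' x.
  by rewrite gletn -(@secFP _ B (upd v1 0 x) v2 v3 0 (V 0) 1 (V 0) s s' x x).
split=> [[/E ne h|/IH h e]|h].
- by case: ne; apply: h; rewrite inE eqxx.
- by apply: h => z zx; apply: e; rewrite inE zx orbT.
have [e|ne] := pselect (s x = s' x); last by left; apply/E.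
by right; apply/IH => h'; apply: h => z; rewrite inE => /predU1P[->|/h'].
Qed.

Section SemFO.
Variables (P : Type) (B : P -> set nat) (T : set trace).
Notation gs := (gsat B).
Notation pt := (pt B).

(** Several points may denote the same assignment, for instance equal rows of a relation. A set of
    points thus represents traces or a team by a relation, not by a function. *)
Definition repT (Tm : set P) : Prop :=
  (forall p, Tm p -> exists2 t, T t & pt p (tr t 0)) /\
  (forall t, T t -> exists2 p, Tm p & pt p (tr t 0)).

Definition rep (X : set P) (S : set (assignment T)) : Prop :=
  (forall p, X p -> exists2 s, S s & pt p (raw s)) /\
  (forall s, S s -> exists2 p, X p & pt p (raw s)).

Hypothesis ptE : forall s : assignment T, finsupp (raw s) -> exists p, pt p (raw s).

Definition finS (S : set (assignment T)) := forall s, S s -> finsupp (raw s).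

Lemma gbec v1 v2 v3 Y f : Y != 0 ->
  gs v1 v2 v3 (becF Y f) <-> gs v1 v2 (upd v3 0 (v3 Y)) f.
Proof.
move=> Y0; split=> [[a [e h]]|h].
  have {}e := (eqTP B v1 v2 (upd v3 0 a) 0 Y).1 e.
  by move: h e; rewrite updE /upd (negbTE Y0) => h e; rewrite -e.
exists (v3 Y); split; last by [].
by apply/eqTP; rewrite updE /upd (negbTE Y0).
Qed.

Lemma subU_P v1 v2 v3 X S x Y : repT (v3 1) -> v3 0 = X -> rep X S -> v3 2 = Y ->
  v1 0 = x -> gs v1 v2 v3 subU <->
  forall p, Y p -> exists s (d : dom T), S s /\ pt p (raw (upd s x (Some d))).
Proof.
move=> [T1 T2] <- [S1 S2] <- <-; split=> [/gall2 h p Yp|h].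
  have /gimp/(_ Yp) := h p.
  case=> q [tau [n [Xq [Tt U]]]].
  have {}U : gs (upd v1 10 n) (upd (upd (upd v2 2 p) 3 q) 4 tau) v3
    (updF 3 (V 0) 4 (V 10) 2) by [].
  move: U; have [s Ss qs] := S1 _ Xq; have [t Tt' tt] := T1 _ Tt.
  rewrite (@updFP _ _ _ _ _ _ _ _ _ _ (raw s) t (v1 0) n 0) // => pp.
  by exists s, (exist _ t (mem_set Tt'), n); rewrite raw_upd.
apply/gall2 => p; apply/gimp => Yp; have [s [[t n] [Ss pp]]] := h p Yp.
have [q Xq qs] := S2 _ Ss; have [tau Tt tt] := T2 _ (set_valP t).
exists q, tau, n; split=> //; split=> //.
by rewrite (@updFP _ _ _ _ _ _ _ _ _ _ (raw s) (val t) (v1 0) n 0) // -(raw_upd _ _ (t, n)).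
Qed.

Lemma semFOP f v1 v2 v3 S : finS S -> rep (v3 0) S -> repT (v3 1) ->
  gs v1 v2 v3 (semFO f) <-> fo_sat S f.
Proof.
elim: f v1 v2 v3 S => [b a|xs y|f IH|f IHf g IHg|f IHf g IHg|x f IH|x f IH]
  v1 v2 v3 S fS [S1 S2] rT.
- have E p (s : assignment T) : pt p (raw s) -> gs v1 (upd v2 0 p) v3 (iter b ANot (atomA a)) <->
      if b then ~ sat_atom s a else sat_atom s a.
    by move=> ps; case: b; rewrite /= -ratom_raw (@atomAP _ _ _ _ _ (raw s)).
  split=> [/gall2 h s Ss|h].
    have [p Xp ps] := S2 _ Ss; have [//|] := h p.
    rewrite -/(gsat B) -[~ _]/(~ gs v1 (upd v2 0 p) v3 (iter b ANot (atomA a))).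
    by rewrite (E p s ps); case: (b) => // /contrapT.
  apply/gall2 => p; have [Xp|nXp] := pselect (v3 0 p); last by left.
  right; have [s Ss ps] := S1 _ Xp; move=> /(E _ _ ps); move: (h s Ss).
  by case: (b) => [//|h1 h2].
- split=> [/gall2 h s s' Ss Ss' e|h].
    have [p Xp ps] := S2 _ Ss; have [p' Xp' ps'] := S2 _ Ss'.
    have [//|[//|]] := h p p'.
    move=> U; have {}U : gs v1 (upd (upd v2 0 p) 1 p') v3 (depF xs y) by [].
    have {U}d := (depFP _ _ _ _ ps ps').1 U.
    by apply/raw_eq/d => z zx; apply/raw_eq/e.
  apply/gall2 => p; apply/gall2 => p'.
  have [Xp|] := pselect (v3 0 p); last by left.
  have [Xp'|] := pselect (v3 0 p'); last by right; left.
  right; right; have [s Ss ps] := S1 _ Xp; have [s' Ss' ps'] := S1 _ Xp'.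
  have : {in xs, forall x, raw s x = raw s' x} -> raw s y = raw s' y.
    by move=> d; apply/raw_eq/(h s s') => // z zx; apply/raw_eq/d.
  exact: (@depFP _ B v1 (upd (upd v2 0 p) 1 p') v3 xs y _ _ ps ps').2.
- by rewrite [semFO _]/= gnot (IH _ _ _ S).
- by rewrite [semFO _]/= gand (IHf _ _ _ S) // (IHg _ _ _ S).
- rewrite [semFO _]/= gex3.
  split=> [[X1 /gex3[X2 /gand[/unFP U /gand[]]]]|[R1 [R2 [SE h1 h2]]]].
    rewrite !gbec // => h1 h2.
    have {}U p : v3 0 p <-> X1 p \/ X2 p by rewrite -[v3 0]/(upd (upd v3 2 X1) 3 X2 0) U.
    pose R (Y : set P) := [set s | S s /\ exists2 p, Y p & pt p (raw s)].
    have repR Y : (forall p, Y p -> v3 0 p) -> rep Y (R Y).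
      move=> Y0; split=> [p Yp|s [_ //]].
      by have [s Ss ps] := S1 _ (Y0 _ Yp); exists s => //; split=> //; exists p.
    exists (R X1), (R X2); split.
    - apply: set_ext => s; split=> [Ss|[] []//].
      have [p Xp ps] := S2 _ Ss; move/U: Xp => [] Xp; [left|right];
      by split=> //; exists p.
    - by apply/(IHf v1 v2 (upd (upd (upd v3 2 X1) 3 X2) 0 X1)) => //;
        [move=> s [/fS]|apply: repR => p Xp; apply/U; left].
    - by apply/(IHg v1 v2 (upd (upd (upd v3 2 X1) 3 X2) 0 X2)) => //;
        [move=> s [/fS]|apply: repR => p Xp; apply/U; right].
  pose Y (R : set (assignment T)) := [set p | v3 0 p /\ exists2 s, R s & pt p (raw s)].
  have repY R : R `<=` S -> rep (Y R) R.
    move=> RS; split=> [p [_ //]|s Rs].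
    by have [p Xp ps] := S2 _ (RS _ Rs); exists p => //; split=> //; exists s.
  have R1S : R1 `<=` S by rewrite SE; left.
  have R2S : R2 `<=` S by rewrite SE; right.
  exists (Y R1); apply/gex3; exists (Y R2); apply/gand; split; last (apply/gand; split).
  - apply/unFP/funext => p; apply/propext; split=> [Xp|[] []//].
    have [s] := S1 _ Xp; rewrite SE => -[Rs|Rs] ps; [left|right];
    by split=> //; exists s.
  - apply/gbec => //; apply/(IHf v1 v2 (upd (upd (upd v3 2 _) 3 _) 0 (Y R1)) R1) => //.
      by move=> s /R1S/fS.
    exact: repY.
  apply/gbec => //; apply/(IHg v1 v2 (upd (upd (upd v3 2 _) 3 _) 0 (Y R2)) R2) => //.
    by move=> s /R2S/fS.
  exact: repY.
- rewrite [semFO _]/= gletn gex3.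
  split=> [[X' /gand[/gand[s1 /gall2 s2]]]|[F [F0 h]]].
    rewrite gbec // => h.
    have {}s1 := (@subU_P (upd v1 0 x) v2 (upd v3 2 X') _ S x X' rT erefl (conj S1 S2) erefl erefl).1 s1.
    (* The largest choice function compatible with the guessed team. *)
    pose F (s : assignment T) := [set d | exists2 p, X' p & pt p (raw (upd s x (Some d)))].
    exists F; split=> [s Ss|].
      have [p Xp ps] := S2 _ Ss.
      have /gimp/(_ Xp) [p' [tau [n [Xp' [Tt U]]]]] := s2 p.
      have {}U : gs (upd (upd v1 0 x) 10 n) (upd (upd (upd v2 3 p) 2 p') 4 tau)
        (upd v3 2 X') (updF 3 (V 0) 4 (V 10) 2) by [].
      move: U; have [t Tt' tt] := rT.1 _ Tt.
      rewrite (@updFP _ _ _ _ _ _ _ _ _ _ (raw s) t x n 0) // => pp.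
      by exists (exist _ t (mem_set Tt'), n), p' => //; rewrite raw_upd.
    apply/(IH _ _ _ _ _ _ _).1; last exact: h.
    + by move=> s' [s [d [Ss _ ->]]]; rewrite raw_upd; apply/finsupp_upd/fS.
    + split=> [p Xp|s' [s [d [Ss [p Xp pp] ->]]]]; last by exists p.
      have [s [d [Ss pp]]] := s1 p Xp.
      exists (upd s x (Some d)) => //; exists s, d; split=> //.
      by exists p.
    + exact: rT.
  pose S' : set (assignment T) := [set s' | exists s d, [/\ S s, F s d & s' = upd s x (Some d)]].
  pose X' := [set p | exists2 s, S' s & pt p (raw s)].
  have fS' : finS S'.
    by move=> s' [s [d [Ss _ ->]]]; rewrite raw_upd; apply/finsupp_upd/fS.
  have rX' : rep X' S'.
    split=> [p [s]|s Ss]; first by exists s.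
    by have [p ps] := ptE (fS' _ Ss); exists p => //; exists s.
  exists X'; apply/gand; split.
    apply/gand; split.
      apply/(@subU_P (upd v1 0 x) v2 (upd v3 2 X') _ S x X' rT erefl (conj S1 S2) erefl erefl) => p.
      by move=> [s' [s [d [Ss _ ->]]] pp]; exists s, d.
    apply/gall2 => p; apply/gimp => Xp; have [s Ss ps] := S1 _ Xp.
    have [d Fd] := F0 s Ss.
    have [p' Xp' pp'] : exists2 p', X' p' & pt p' (raw (upd s x (Some d))).
      by apply: rX'.2; exists s, d.
    have [tau Tt tt] := rT.2 _ (set_valP d.1).
    exists p', tau, d.2; split=> //; split=> //.
    by rewrite (@updFP _ _ _ _ _ _ _ _ _ _ (raw s) (val d.1) x d.2 0) // -(raw_upd _ _ d).
  apply/gbec => //; apply/(IH _ _ _ _ _ _ _).2; last exact: h.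
  + exact: fS'.
  + exact: rX'.
  exact: rT.
rewrite [semFO _]/= gletn gex3.
pose S' : set (assignment T) := [set s' | exists s d, S s /\ s' = upd s x (Some d)].
have fS' : finS S'.
  by move=> s' [s [d [Ss ->]]]; rewrite raw_upd; apply/finsupp_upd/fS.
split=> [[X' /gand[/gand[s1 /gall2 s2]]]|h].
  rewrite gbec // => h.
  have {}s1 := (@subU_P (upd v1 0 x) v2 (upd v3 2 X') _ S x X' rT erefl (conj S1 S2) erefl erefl).1 s1.
  apply/(IH _ _ _ S' _ _ _).1; last exact: h.
  + exact: fS'.
  + split=> [p Xp|s' [s [d [Ss ->]]]].
      by have [s [d [Ss pp]]] := s1 p Xp; exists (upd s x (Some d)) => //; exists s, d.
    have [p Xp ps] := S2 _ Ss; have [tau Tt tt] := rT.2 _ (set_valP d.1).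
    have /gimp/(_ Xp)/gall2/(_ tau)/gimp/(_ Tt)/gall1/(_ d.2) [p' [Xp' U]] := s2 p.
    have {}U : gs (upd (upd v1 0 x) 10 d.2) (upd (upd (upd v2 3 p) 4 tau) 2 p')
        (upd v3 2 X') (updF 3 (V 0) 4 (V 10) 2) by [].
    move: U; rewrite (@updFP _ _ _ _ _ _ _ _ _ _ (raw s) (val d.1) x d.2 0) // => pp.
    by exists p' => //; rewrite raw_upd.
  exact: rT.
pose X' := [set p | exists2 s, S' s & pt p (raw s)].
have rX' : rep X' S'.
  split=> [p [s]|s Ss]; first by exists s.
  by have [p ps] := ptE (fS' _ Ss); exists p => //; exists s.
exists X'; apply/gand; split.
  apply/gand; split.
    apply/(@subU_P (upd v1 0 x) v2 (upd v3 2 X') _ S x X' rT erefl (conj S1 S2) erefl erefl) => p.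
    by move=> [s' [s [d [Ss ->]]] pp]; exists s, d.
  apply/gall2 => p; apply/gimp => Xp; have [s Ss ps] := S1 _ Xp.
  apply/gall2 => tau; apply/gimp => Tt; apply/gall1 => n.
  have [t Tt' tt] := rT.1 _ Tt; pose d : dom T := (exist _ t (mem_set Tt'), n).
  have [p' Xp' pp'] : exists2 p', X' p' & pt p' (raw (upd s x (Some d))).
    by apply: rX'.2; exists s, d.
  exists p'; split=> //.
  by rewrite (@updFP _ _ _ _ _ _ _ _ _ _ (raw s) t x n 0) // -(raw_upd _ _ d).
apply/gbec => //; apply/(IH _ _ _ S' _ _ _).2; last exact: h.
+ exact: fS'.
+ exact: rX'.
exact: rT.
Qed.

End SemFO.

(** * Second-order logic *)

(** A set of numbers codes a trace exactly if cutting off no letter leaves it unchanged. *)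
Definition wfF (p : nat) : arith := sufF p TZero p.

Lemma wfFP (P : Type) (B : P -> set nat) v1 v2 v3 p :
  gsat B v1 v2 v3 (wfF p) <-> exists t, pt B (v2 p) (tr t 0).
Proof.
split=> [/gall1 h|[t h]]; last by apply/(@sufFP _ B _ _ _ p _ p t 0 0).
pose t : trace := fun j b => `[< B (v2 p) (pairn 0 (pairn j.+1 b)) >].
have E m : B (v2 p) m <-> m = pairn 0 (pairn 0 0) \/ exists a b,
    m = pairn 0 (pairn (a + 1) b) /\ B (v2 p) (pairn 0 (pairn (0 + a + 1) b)).
  have /giff := h m; rewrite gin2 gor => ->.
  split=> [[e|/gex1[a /gex1[b /gand[e /gmem h']]]]|[->|[a [b [e h']]]]].
  - by left; move: e; rewrite /= !term_val_tp.
  - by right; exists a, b; move: e h'; rewrite /= !term_val_tp.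
  - by left; rewrite /= !term_val_tp.
  right; apply/gex1; exists a; apply/gex1; exists b; apply/gand; split; last exact/gmem.
  by rewrite /= !term_val_tp.
exists t; apply: set_ext => m; split=> [|[x [a [b [-> ]]]]].
  rewrite E => -[->|[a [b [-> h2]]]]; first exact/codeE.
  by apply/codeE; rewrite addn1 /=; apply/asboolP; rewrite -addn1.
rewrite /tr; case: eqP => [->|//]; case: a => [->|a /asboolP //].
by apply/E; left.
Qed.

(** All relation variables share one set of points. A tuple of the variable with index [i] and arity
    [k] is a point with positions [i] and [k] at the variables 0 and 1, and with the tuple at the
    variables from 2 on. *)
Definition taggedF (p : nat) : arith :=
  AAnd (AAll O1 20 (AIff (memA p TZero TZero (V 20)) (AEq (V 20) (V 0))))
       (AAll O1 20 (AIff (memA p TOne TZero (V 20)) (AEq (V 20) (V 1)))).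

(** Register 1 counts the arguments, and after the last one it is the arity that [taggedF] compares.
    It is increased by way of register 3, since the new value must be computed before the name 1 is
    bound again. *)
Definition argF (x : nat) (f : arith) : arith :=
  AAnd (letn 2 x (AAnd (defF 0 (V 2)) (secF 1 (TAdd (TAdd TOne TOne) (V 1)) 0 (V 2))))
    (AEx O1 3 (AAnd (AEq (V 3) (TAdd (V 1) TOne))
      (AEx O1 1 (AAnd (AEq (V 1) (V 3)) f)))).

Definition relF (i : nat) (xs : seq nat) : arith :=
  letn 0 i (AEx O2 1 (AAnd (AIn3 1 0) (letn 1 0 (foldr argF (taggedF 1) xs)))).

Definition exptF : arith :=
  AEx O2 4 (AEx O1 10 (AAnd (AIn3 4 1) (updF 0 (V 0) 4 (V 10) 1))).
Definition exrF : arith :=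
  AAll O2 1 (AOr (taggedF 1) (AIff (AIn3 1 2) (AIn3 1 0))).

Fixpoint semSO (f : so) : arith :=
  match f with
  | SAtom a => atomA a
  | SRel i xs => relF i xs
  | SNot f => ANot (semSO f)
  | SAnd f g => AAnd (semSO f) (semSO g)
  | SOr f g => AOr (semSO f) (semSO g)
  | SEx x f => letn 0 x (AEx O2 1 (AAnd exptF
      (AEx O2 0 (AAnd (eqF 0 1) (semSO f)))))
  | SAll x f => letn 0 x (AAll O2 1 (AImp exptF
      (AEx O2 0 (AAnd (eqF 0 1) (semSO f)))))
  | SExR i k f => letn 0 i (letn 1 k (AEx O3 2 (AAnd exrF (becF 2 (semSO f)))))
  | SAllR i k f => letn 0 i (letn 1 k (AAll O3 2 (AImp exrF (becF 2 (semSO f)))))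
  end.

Lemma fvin_atomA (R : vars) a : R O2 0 -> fvin R (atomA a).
Proof.
move=> r0; case: a => [x y|x y|i x|x y];
  rewrite [atomA _]/= /eqA /leA /predA /levelA /secF /defF /memA /AIff /AImp;
  fvs; by rewrite ?r0.
Qed.

Lemma fvin_semSO f (R : vars) :
  R O2 0 -> R O3 0 -> R O3 1 -> fvin R (semSO f).
Proof.
elim: f R => [a|i xs|f IH|f IHf g IHg|f IHf g IHg|x f IH|x f IH|i k f IH|i k f IH] R r r0 r1.
- exact: fvin_atomA.
- rewrite [semSO _]/= /relF; fvs; rewrite r0.
  rewrite -[(_ && _)]/(fvin _ _).
  suff H (Q : vars) : Q O1 0 -> Q O1 1 -> Q O2 0 -> Q O2 1 ->
      fvin Q (foldr argF (taggedF 1) xs) by apply: H; rewrite //= r ?orbT.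
  elim: xs {R r r0 r1} Q => [|x xs IH] Q q q0 q1 q2.
    by rewrite [foldr _ _ _]/= /taggedF /memA /AIff /AImp; fvs; rewrite q q0 q2.
  rewrite [foldr _ _ _]/= {1}/argF /secF /defF /memA /AIff /AImp; fvs.
  by rewrite q0 q1 q2 /=; apply: IH; rewrite /= ?q ?q1 ?q2 ?orbT.
- exact: IH.
- by rewrite /= IHf ?IHg.
- by rewrite /= IHf ?IHg.
- rewrite [semSO _]/= /exptF /eqF /updF /updB /memA /AIff /AImp; fvs.
  by rewrite IH ?r ?r0 ?r1 ?orbT.
- rewrite [semSO _]/= /exptF /eqF /updF /updB /memA /AIff /AImp; fvs.
  by rewrite IH ?r ?r0 ?r1 ?orbT.
- rewrite [semSO _]/= /exrF /becF /eqT /taggedF /memA /AIff /AImp; fvs.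
  by rewrite IH ?r ?r0 ?r1 ?orbT.
rewrite [semSO _]/= /exrF /becF /eqT /taggedF /memA /AIff /AImp; fvs.
by rewrite IH ?r ?r0 ?r1 ?orbT.
Qed.

Arguments eqF : simpl never.
Arguments relF : simpl never.
Arguments becF : simpl never.

Section SemSO.
Variables (P : Type) (B : P -> set nat) (T : set trace).
Notation gs := (gsat B).
Notation pt := (pt B).
Hypothesis ptR : forall s : rasg, finsupp s ->
  (forall x t n, s x = Some (t, n) -> T t) -> exists p, pt p s.
Hypothesis T0 : T !=set0.

Definition tagged (p : P) (i k : nat) :=
  (forall b, B p (pairn 0 (pairn 0 b)) <-> b = i) /\
  (forall b, B p (pairn 1 (pairn 0 b)) <-> b = k).

Lemma tagged_inj p i k i' k' : tagged p i k -> tagged p i' k' -> (i, k) = (i', k').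
Proof.
move=> [h1 h2] [h1' h2']; have /h1' <- := (h1 i).2 erefl.
by have /h2' <- := (h2 k).2 erefl.
Qed.

Lemma taggedP v1 v2 v3 p : gs v1 v2 v3 (taggedF p) <-> tagged (v2 p) (v1 0) (v1 1).
Proof.
rewrite gand !gall1; split=> -[h1 h2]; split.
- by move=> b; move: (h1 b); rewrite giff gmem.
- by move=> b; move: (h2 b); rewrite giff gmem.
- by move=> b; move: (h1 b); rewrite giff gmem.
by move=> b; move: (h2 b); rewrite giff gmem.
Qed.

Definition sect (p : P) (x : nat) (o : option (trace * nat)) :=
  forall a b, B p (pairn x (pairn a b)) <-> rmem o a b.

Lemma sect_inj p x o o' : sect p x o -> sect p x o' -> o = o'.
Proof. by move=> h h'; apply: rmem_inj => a b; rewrite -h h'. Qed.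

Lemma secFP2 v1 v2 v3 p x q y s xv yv : pt (v2 q) s ->
  (forall a b, term_val (upd (upd v1 22 a) 23 b) x = xv) ->
  (forall a b, term_val (upd (upd v1 22 a) 23 b) y = yv) ->
  gs v1 v2 v3 (secF p x q y) <-> sect (v2 p) xv (s yv).
Proof.
move=> pq xE yE; split=> [/gall1 h a b|h].
  move: (h a) => /gall1/(_ b)/giff.
  by rewrite !gmem xE yE (pt_mem _ _ _ pq).
apply/gall1 => a; apply/gall1 => b.
by apply/giff; rewrite !gmem xE yE (pt_mem _ _ _ pq).
Qed.

Definition tup (t : trace) (i k : nat) (ds : seq (dom T)) : rasg := fun x =>
  match x with
  | 0 => Some (t, i) | 1 => Some (t, k)
  | j.+2 => omap (fun d => (val d.1, d.2)) (onth ds j)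
  end.

Definition rd (d : dom T) : trace * nat := (val d.1, d.2).

Definition holds (p : P) i k (ds : seq (dom T)) : Prop :=
  tagged p i k /\ forall j d, onth ds j = Some d -> sect p j.+2 (Some (rd d)).

Definition repV (X : set P) (U : nat * nat -> set (seq (dom T))) :=
  forall i ds, U (i, size ds) ds <-> exists2 p, X p & holds p i (size ds) ds.

Lemma holds_ex i ds : exists p, holds p i (size ds) ds.
Proof.
have [t Tt] := T0; have [||p pp] := ptR (s := tup t i (size ds) ds).
- exists (size ds).+2 => -[|[|x]] //= sx.
  by rewrite onth_default.
- by move=> [|[|x]] t' n /= => [[<- _]|[<- _]|] //; case: (onth ds x) => // d [<- _]; apply: set_valP.
exists p; split; first by split=> b; rewrite (pt_mem _ _ _ pp).
by move=> j d dj a b; rewrite (pt_mem _ _ _ pp) /= dj.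
Qed.

Lemma argFP v1 v2 v3 s xs c : pt (v2 0) (raw s) -> v1 1 = c ->
  gs v1 v2 v3 (foldr argF (taggedF 1) xs) <->
  exists2 ds : seq (dom T), map s xs = map Some ds &
    (forall j d, onth ds j = Some d -> sect (v2 1) (c + j).+2 (Some (rd d))) /\
    tagged (v2 1) (v1 0) (c + size xs).
Proof.
move=> ps; elim: xs c v1 => [|x xs IH] c v1 vc.
  rewrite taggedP vc addn0; split=> [h|[ds _ []]//].
  by exists [::] => //; split=> // j d; rewrite onth0n.
have E : gs v1 v2 v3 (foldr argF (taggedF 1) (x :: xs)) <->
   (exists d, raw s x = Some d /\ sect (v2 1) c.+2 (raw s x)) /\
   gs (upd (upd v1 3 c.+1) 1 c.+1) v2 v3 (foldr argF (taggedF 1) xs).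
  rewrite [foldr _ _ _]/= {1}/argF gand gletn gand.
  rewrite (@defFP _ _ _ _ _ _ _ (raw s) x) //.
  rewrite (@secFP2 _ _ _ _ _ _ _ (raw s) c.+2 x) //; last first.
    by move=> a b /=; rewrite /upd /= vc.
  rewrite gex1; split=> [[[[d sd] h] [a /gand[e /gex1[b /gand[e' h']]]]]|[[d [sd h]] h']].
    split; first by exists d.
    move: e e' => /=; rewrite /upd /= vc addn1 => e e'; move: h'.
    by rewrite e' e.
  split; first by split=> //; exists d.
  exists c.+1; apply/gand; split; first by rewrite /= /upd /= vc addn1.
  by exists c.+1.
rewrite E (IH c.+1) //; split=> [[[d [sd h]] [ds e [h1 h2]]]|[[|d ds] //= [sx e] [h1 h2]]].
  move: sd h; rewrite /raw; case sx: (s x) => [d'|//] /= [dE] h.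
  exists (d' :: ds); first by rewrite /= sx e.
  split; last by rewrite addnS -addSn.
  by case=> [d'' [<-]|j d'' /h1]; rewrite ?addn0 // addnS addSn.
have rx : raw s x = Some (rd d) by rewrite /raw sx.
split.
  by exists (rd d); rewrite rx; split=> //; have := h1 0 d erefl; rewrite addn0.
exists ds => //; split; last by move: h2; rewrite addnS -addSn.
by move=> j d' jd; have := h1 j.+1 d' jd; rewrite addnS addSn.
Qed.

Lemma relFP v1 v2 v3 s i xs U : pt (v2 0) (raw s) -> repV (v3 0) U ->
  gs v1 v2 v3 (relF i xs) <-> so_sat U s (SRel i xs).
Proof.
move=> ps rU; rewrite /relF gletn gex2.
have E p : gs (upd (upd v1 0 i) 1 0) (upd v2 1 p) v3 (foldr argF (taggedF 1) xs) <->
   exists2 ds : seq (dom T), map s xs = map Some ds & holds p i (size xs) ds.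
  rewrite (@argFP _ _ _ s xs 0) //.
  by split=> -[ds e [h h']]; exists ds.
split=> [[p /gand[Xp /gletn/E[ds e h]]]|[ds e]].
  exists ds => //.
  have se : size xs = size ds by rewrite -(size_map s) e size_map.
  by rewrite se; apply/rU; exists p => //; rewrite -se.
have se : size xs = size ds by rewrite -(size_map s) e size_map.
rewrite se => /rU [p Xp h]; exists p; apply/gand; split=> //.
by apply/gletn/E; exists ds; rewrite ?se.
Qed.

Lemma exptFP v1 v2 v3 (s : assignment T) : pt (v2 0) (raw s) ->
  repT B T (v3 1) -> gs v1 v2 v3 exptF <->
  exists d : dom T, pt (v2 1) (raw (upd s (v1 0) (Some d))).
Proof.
move=> ps [T1 T2]; rewrite /exptF gex2; split=> [[q /gex1[n /gand[Xq]]]|[[t n] h]].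
  have [t Tt tt] := T1 _ Xq.
  rewrite (@updFP _ _ _ _ _ _ _ _ _ _ (raw s) t (v1 0) n 0) // => pp.
  by exists (exist _ t (mem_set Tt), n); rewrite raw_upd.
have [tau Xt tt] := T2 _ (set_valP t).
exists tau; apply/gex1; exists n; apply/gand; split=> //.
by rewrite (@updFP _ _ _ _ _ _ _ _ _ _ (raw s) (val t) (v1 0) n 0) // -(raw_upd _ _ (t, n)).
Qed.

Lemma exrFP v1 v2 v3 (U : nat * nat -> set (seq (dom T))) : repV (v3 0) U ->
  gs v1 v2 v3 exrF -> exists R, repV (v3 2) (upd U (v1 0, v1 1) R).
Proof.
move=> rU /gall2 h.
exists [set ds | exists2 p, v3 2 p & holds p (v1 0) (v1 1) ds] => i ds.
rewrite /upd; case: eqP => [[-> ->] //|ne].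
have hp p : tagged p i (size ds) -> (v3 2 p <-> v3 0 p).
  move=> tp; move: (h p) => /gor[/taggedP tp'|/giff//].
  by case: ne; apply: tagged_inj tp tp'.
by rewrite rU; split=> -[p Xp hh]; exists p => //; apply/hp => //; case: hh.
Qed.

Lemma exrFP2 v1 v2 v3 (U : nat * nat -> set (seq (dom T))) R i k : repV (v3 0) U ->
  v1 0 = i -> v1 1 = k ->
  exists X, gs v1 v2 (upd v3 2 X) exrF /\ repV X (upd U (i, k) R).
Proof.
move=> rU v0 v1k.
exists [set p | (~ tagged p i k /\ v3 0 p) \/
   exists2 ds, size ds = k & R ds /\ holds p i k ds]; split.
  apply/gall2 => p; apply/gor.
  have [tp|ntp] := pselect (tagged p i k); [left|right].
    by apply/taggedP; rewrite v0 v1k.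
  apply/giff; rewrite !gin3 /upd /=; split=> [[[//]|[ds _ [_ []//]]]|]; by left.
move=> i' ds; rewrite /upd; case: eqP => [[-> sk]|ne].
  split=> [Rds|[p [[nt _]|[ds' sk' [Rds' h']]] h]].
  - have [p hp] := holds_ex i ds; exists p => //; right; exists ds; rewrite -?sk //.
  - by case: nt; rewrite -sk; case: h.
  (* A point determines the tuple stored in it. *)
  suff -> : ds = ds' by [].
  apply: eq_from_onth => j; case: (leqP k j) => jk.
    by rewrite !onth_default ?sk ?sk'.
  have := onthTE ds j; have := onthTE ds' j; rewrite sk sk' jk.
  case dj': (onth ds' j) => [d'|//]; case dj: (onth ds j) => [d|//] _ _.
  have := sect_inj (h.2 _ _ dj) (h'.2 _ _ dj').
  by case: d d' {dj dj'} => [t n] [t' n'] [/val_inj -> ->].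
split=> [/rU[p Xp h]|[p [[nt Xp]|[ds' sk' [_ [h' _]]]] h]].
- exists p => //; left; split=> // tp; apply: ne.
  by case: h => tp' _; apply: tagged_inj tp' tp.
- by apply/rU; exists p.
by case: ne; case: h => h _; apply: tagged_inj h h'.
Qed.

Lemma semSOP f v1 v2 v3 s U : finsupp (raw s) -> pt (v2 0) (raw s) ->
  repV (v3 0) U -> repT B T (v3 1) ->
  gs v1 v2 v3 (semSO f) <-> so_sat U s f.
Proof.
elim: f v1 v2 v3 s U => [a|i xs|f IH|f IHf g IHg|f IHf g IHg|x f IH|x f IH|i k f IH|i k f IH]
  v1 v2 v3 s U fs ps rU rT.
- by rewrite [semSO _]/= (@atomAP _ _ _ _ _ (raw s)) // ratom_raw.
- exact: relFP.
- by rewrite [semSO _]/= gnot (IH _ _ _ s U).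
- by rewrite [semSO _]/= gand (IHf _ _ _ s U) // (IHg _ _ _ s U).
- by rewrite [semSO _]/= gor (IHf _ _ _ s U) // (IHg _ _ _ s U).
- rewrite [semSO _]/= gletn gex2; split=> [[p /gand[/(@exptFP _ _ _ s)]]|[d h]].
    case=> // d pd /gex2[q /gand[/eqFP e h]]; exists d; apply/(IH _ _ _ _ _ _ _ _ _).1; last exact: h.
    + by rewrite raw_upd; apply: finsupp_upd.
    + by rewrite /pt /= e; apply: pd.
    + exact: rU.
    exact: rT.
  have fsd : finsupp (raw (upd s x (Some d))) by rewrite raw_upd; apply: finsupp_upd.
  have [p pd] : exists p, pt p (raw (upd s x (Some d))).
    apply: ptR => // y t n; rewrite /raw; case: (upd _ _ _ y) => //= d' [<- _].
    exact: set_valP.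
  exists p; apply/gand; split; first by apply/(@exptFP _ _ _ s) => //; exists d.
  exists p; apply/gand; split; first exact/eqFP.
  by apply/(IH _ _ _ _ _ _ _ _ _).2; last exact: h.
- rewrite [semSO _]/= gletn gall2; split=> [h d|h p].
    have fsd : finsupp (raw (upd s x (Some d))) by rewrite raw_upd; apply: finsupp_upd.
    have [p pd] : exists p, pt p (raw (upd s x (Some d))).
      apply: ptR => // y t n; rewrite /raw; case: (upd _ _ _ y) => //= d' [<- _].
      exact: set_valP.
    have e : gs (upd v1 0 x) (upd v2 1 p) v3 exptF by apply/(@exptFP _ _ _ s) => //; exists d.
    move: (h p) => /gimp/(_ e)/gex2[q {e}]; case/gand => /eqFP e h'; apply/(IH _ _ _ _ _ _ _ _ _).1; last exact: h'.
    + by [].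
    + by rewrite /pt /= e; apply: pd.
    + exact: rU.
    exact: rT.
  apply/gimp => /(@exptFP _ _ _ s) []// d pd.
  have fsd : finsupp (raw (upd s x (Some d))) by rewrite raw_upd; apply: finsupp_upd.
  exists p; apply/gand; split; first exact/eqFP.
  by apply/(IH _ _ _ _ _ _ _ _ _).2; last exact: h.
- rewrite [semSO _]/= !gletn gex3; split=> [[X /gand[h1]]|[R h]].
    rewrite gbec // => h2.
    have [R rR] := exrFP (rU : repV (upd v3 2 X 0) U) h1.
    by exists R; apply/(IH _ _ _ _ _ _ _ _ _).1; last exact: h2.
  have [X [h1 rX]] := @exrFP2 (upd (upd v1 0 i) 1 k) v2 v3 U R i k rU erefl erefl.
  exists X; apply/gand; split=> //; apply/gbec => //.
  by apply/(IH _ _ _ _ _ _ _ _ _).2; last exact: h.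
rewrite [semSO _]/= !gletn gall3; split=> [h R|h X].
  have [X [h1 rX]] := @exrFP2 (upd (upd v1 0 i) 1 k) v2 v3 U R i k rU erefl erefl.
  move: (h X) => /gimp/(_ h1)/gbec => /(_ isT) h2.
  by apply/(IH _ _ _ _ _ _ _ _ _).1; last exact: h2.
apply/gimp => h1; apply/gbec => //.
have [R rR] := exrFP (rU : repV (upd v3 2 X 0) U) h1.
by apply/(IH _ _ _ _ _ _ _ _ _).2; last exact: (h R).
Qed.

End SemSO.

(** * Asynchronous TeamLTL *)

(** A function on traces is a set [H] of points, each of which is a trace with the value as its
    position. *)
Definition hF (H p : nat) (n : term) : arith :=
  AEx O2 5 (AAnd (AIn3 5 H) (updF p TZero p n 5)).

Definition funF (X H : nat) : arith :=
  AAll O2 0 (AImp (AIn3 0 X)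
    (AEx O1 0 (AAll O1 1 (AIff (hF H 0 (V 1)) (AEq (V 1) (V 0)))))).

Definition sufTF (X H Y : nat) : arith :=
  AAll O2 1 (AIff (AIn3 1 Y) (AEx O2 0 (AAnd (AIn3 0 X)
    (AEx O1 0 (AAnd (hF H 0 (V 0)) (sufF 0 (V 0) 1)))))).

Definition nextF : arith :=
  AAll O2 1 (AIff (AIn3 1 2) (AEx O2 0 (AAnd (AIn3 0 0) (sufF 0 TOne 1)))).

Definition posF : arith :=
  AAll O2 0 (AIff (AIn3 0 4) (AAnd (AIn3 0 0) (ANot (hF 3 0 TZero)))).

Definition ltF : arith :=
  AAll O2 0 (AImp (AIn3 0 4) (AAll O1 0 (AAll O1 1
    (AImp (AAnd (hF 5 0 (V 0)) (hF 3 0 (V 1))) (ALe (TAdd (V 0) TOne) (V 1)))))).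

Definition litF (i : nat) : arith := letn 0 i (memA 0 TZero TOne (V 0)).

Definition becSuf (X H : nat) (f : arith) : arith :=
  AEx O3 2 (AAnd (sufTF X H 2) (becF 2 f)).

Fixpoint semLTL (f : ltl) : arith :=
  match f with
  | LLit b i => AAll O2 0 (AOr (ANot (AIn3 0 0)) (ANot (iter b ANot (litF i))))
  | LNot f => ANot (semLTL f)
  | LAnd f g => AAnd (semLTL f) (semLTL g)
  | LOr f g => AEx O3 2 (AEx O3 3 (AAnd unF
      (AAnd (becF 2 (semLTL f)) (becF 3 (semLTL g)))))
  | LNext f => AEx O3 2 (AAnd nextF (becF 2 (semLTL f)))
  | LFin f => AEx O3 3 (AAnd (funF 0 3) (becSuf 0 3 (semLTL f)))
  | LGlob f => AAll O3 3 (AImp (funF 0 3) (becSuf 0 3 (semLTL f)))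
  | LUntil f g => AEx O3 3 (AAnd (funF 0 3)
      (AAnd (AEx O3 4 (AAnd posF (AAll O3 5 (AImp (AAnd (funF 4 5) ltF)
               (becSuf 4 5 (semLTL f))))))
            (becSuf 0 3 (semLTL g))))
  end.

Ltac fvq := rewrite /becSuf /sufTF /funF /posF /ltF /nextF /hF /unF /becF /eqT
  /litF /updF /updB /sufF /sufB /memA /AIff /AImp; fvs.

Lemma fvin_semLTL f (R : vars) :
  R O3 0 -> fvin R (semLTL f).
Proof.
elim: f R => [b i|f IH|f IHf g IHg|f IHf g IHg|f IH|f IH|f IH|f IHf g IHg] R r0.
- by case: b; rewrite [semLTL _]/=; fvq; rewrite r0.
- exact: IH.
- by rewrite /= IHf ?IHg.
- by rewrite [semLTL _]/=; fvq; rewrite IHf ?IHg ?r0 ?orbT.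
- by rewrite [semLTL _]/=; fvq; rewrite IH ?r0 ?orbT.
- by rewrite [semLTL _]/=; fvq; rewrite IH ?r0 ?orbT.
- by rewrite [semLTL _]/=; fvq; rewrite IH ?r0 ?orbT.
by rewrite [semLTL _]/=; fvq; rewrite IHf ?IHg ?r0 ?orbT.
Qed.

Section SemLTL.
Variables (P : Type) (B : P -> set nat).
Notation gs := (gsat B).
Notation pt := (pt B).
Hypothesis ptU : forall p t n, pt p (tr t 0) -> exists q, pt q (tr t n).
Hypothesis ptS : forall p t n, pt p (tr t 0) -> exists q, pt q (tr (tfrom t n) 0).

Lemma hFP v1 v2 v3 H p n t nv : pt (v2 p) (tr t 0) -> p != 5 ->
  (forall a b c d, term_val (upd (upd (upd (upd v1 20 a) 21 b) 22 c) 23 d) n = nv) ->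
  gs v1 v2 v3 (hF H p n) <-> exists2 q, v3 H q & pt q (tr t nv).
Proof.
move=> pp p5 nE; rewrite /hF gex2.
have E q : gs v1 (upd v2 5 q) v3 (updF p TZero p n 5) <-> pt q (tr t nv).
  have u : upd v2 5 q p = v2 p by rewrite /upd (negbTE p5).
  by rewrite (@updFP _ _ _ _ _ _ _ _ _ _ (tr t 0) t 0 nv 0) ?u ?updE ?upd_tr.
by split=> [[q /gand[h /E h']]|[q h /E h']]; [exists q|exists q; apply/gand].
Qed.

Definition hrep (H : set P) (T : set trace) (h : trace -> nat) : Prop :=
  forall t, T t -> forall n, (exists2 q, H q & pt q (tr t n)) <-> n = h t.

Lemma funFP v1 v2 v3 X H T : repT B T (v3 X) ->
  gs v1 v2 v3 (funF X H) <-> exists h, hrep (v3 H) T h.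
Proof.
move=> [T1 T2]; split=> [/gall2 h|[h hh]].
  have : forall t, exists n, T t -> forall m, (exists2 q, v3 H q & pt q (tr t m)) <-> m = n.
    move=> t; have [Tt|nT] := pselect (T t); last by exists 0.
    have [p Xp pp] := T2 _ Tt.
    move: (h p) => /gimp/(_ Xp)/gex1[n /gall1 hn]; exists n => _ m.
    by have := hn m => /giff; rewrite (@hFP _ _ _ _ _ _ t m).
  by move=> /choice[g gh]; exists g => t Tt n; apply: gh.
apply/gall2 => p; apply/gimp => Xp; have [t Tt pp] := T1 _ Xp.
apply/gex1; exists (h t); apply/gall1 => m; apply/giff.
by rewrite (@hFP _ _ _ _ _ _ t m) //; exact: hh.
Qed.

Lemma sufTFP v1 v2 v3 X H Y T h : repT B T (v3 X) -> hrep (v3 H) T h ->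
  gs v1 v2 v3 (sufTF X H Y) <->
  forall p', v3 Y p' <-> exists2 t, T t & pt p' (tr (tfrom t (h t)) 0).
Proof.
move=> [T1 T2] hh.
have E p' : gs v1 (upd v2 1 p') v3 (AEx O2 0 (AAnd (AIn3 0 X)
    (AEx O1 0 (AAnd (hF H 0 (V 0)) (sufF 0 (V 0) 1))))) <->
    exists2 t, T t & pt p' (tr (tfrom t (h t)) 0).
  rewrite gex2; split=> [[p /gand[Xp /gex1[n /gand[]]]]|[t Tt pp']].
    have [t Tt pp] := T1 _ Xp.
    rewrite (@hFP _ _ _ _ _ _ t n) // hh // => ->.
    by rewrite (@sufFP _ _ _ _ _ _ _ _ t (h t) 0) // => ?; exists t.
  have [p Xp pp] := T2 _ Tt; exists p; apply/gand; split=> //.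
  apply/gex1; exists (h t); apply/gand; split; last first.
    by apply/(@sufFP _ _ _ _ _ _ _ _ t (h t) 0).
  by apply/(@hFP _ _ _ _ _ _ t (h t)) => //; apply/hh.
split=> [/gall2 g p'|g]; first by move: (g p') => /giff; rewrite E.
by apply/gall2 => p'; apply/giff; rewrite E -g.
Qed.

Lemma repT_suf X T h Y : repT B T X ->
  (forall p', Y p' <-> exists2 t, T t & pt p' (tr (tfrom t (h t)) 0)) ->
  repT B (suffixes h T) Y.
Proof.
move=> [T1 T2] YE; split=> [p /YE[t Tt pp]|_ [t Tt <-]].
  by exists (tfrom t (h t)) => //; exists t.
have [p Xp pp] := T2 _ Tt; have [q qq] := ptS (h t) pp.
by exists q => //; apply/YE; exists t.
Qed.

Lemma becSufP v1 v2 v3 X H T h F (Q : Prop) : repT B T (v3 X) ->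
  hrep (v3 H) T h -> X != 2 -> H != 2 ->
  (forall w3, repT B (suffixes h T) (w3 0) -> gs v1 v2 w3 F <-> Q) ->
  gs v1 v2 v3 (becSuf X H F) <-> Q.
Proof.
move=> rT hh X2 H2 FQ; rewrite /becSuf gex3.
have u (Y : set P) x : x != 2 -> upd v3 2 Y x = v3 x by rewrite /upd => /negbTE->.
split=> [[Y /gand[]]|q].
  rewrite (@sufTFP _ _ _ _ _ _ T h) ?(u _ X) ?(u _ H) ?updE // => YE; rewrite gbec // => g.
  by apply/(FQ _ _).1; last exact: g; apply: repT_suf rT YE.
exists [set p' | exists2 t, T t & pt p' (tr (tfrom t (h t)) 0)].
apply/gand; split; first by rewrite (@sufTFP _ _ _ _ _ _ T h) ?(u _ X) ?(u _ H) ?updE.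
by apply/gbec => //; apply/(FQ _ _).2 => //; apply: repT_suf rT _.
Qed.

Definition hgraph (T : set trace) (h : trace -> nat) : set P :=
  [set q | exists2 t, T t & pt q (tr t (h t))].

Lemma hgraphP X T h : repT B T X -> hrep (hgraph T h) T h.
Proof.
move=> [T1 T2] t Tt n; split=> [[q [t' Tt' qt'] qt]|->].
  by have [-> ->] := tr_inj (pt_inj qt qt').
have [p Xp pp] := T2 _ Tt; have [q qq] := ptU (h t) pp.
by exists q => //; exists t.
Qed.

Lemma semLTLP f v1 v2 v3 T : repT B T (v3 0) ->
  gs v1 v2 v3 (semLTL f) <-> ltl_sat T f.
Proof.
elim: f v1 v2 v3 T => [b i|f IH|f IHf g IHg|f IHf g IHg|f IH|f IH|f IH|f IHf g IHg]
  v1 v2 v3 T rT.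
- have E p t : pt p (tr t 0) -> gs v1 (upd v2 0 p) v3 (iter b ANot (litF i)) <->
      (t 0 i = ~~ b).
    move=> pp; have e : gs v1 (upd v2 0 p) v3 (litF i) <-> t 0 i.
      by rewrite /litF gletn gmem (pt_mem _ _ _ pp).
    case: b; rewrite ?[iter _ _ _]/= ?gnot e; first by split=> [/negP/negbTE|->].
    by split=> [->|->].
  rewrite [semLTL _]/=; case: (rT) => T1 T2; split=> [/gall2 h t Tt|h].
    have [p Xp pp] := T2 _ Tt; move: (h p) => /gor[/gnot//|/gnot].
    by rewrite (E _ _ pp); case: (t 0 i); case: (b).
  apply/gall2 => p; apply/gor.
  have [Xp|nX] := pselect (v3 0 p); last by left.
  right; have [t Tt pp] := T1 _ Xp; apply/gnot; rewrite (E _ _ pp) h //.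
  by case: (b).
- by rewrite [semLTL _]/= gnot (IH _ _ _ T).
- by rewrite [semLTL _]/= gand (IHf _ _ _ T) // (IHg _ _ _ T).
- rewrite [semLTL _]/= gex3; case: (rT) => S1 S2.
  split=> [[X1 /gex3[X2 /gand[/unFP U /gand[]]]]|[R1 [R2 [SE h1 h2]]]].
    rewrite !gbec // => h1 h2.
    have {}U p : v3 0 p <-> X1 p \/ X2 p by rewrite -[v3 0]/(upd (upd v3 2 X1) 3 X2 0) U.
    pose R (Y : set P) := [set t | T t /\ exists2 p, Y p & pt p (tr t 0)].
    have repR Y : (forall p, Y p -> v3 0 p) -> repT B (R Y) Y.
      move=> Y0; split=> [p Yp|s [_ //]].
      by have [s Ss ps] := S1 _ (Y0 _ Yp); exists s => //; split=> //; exists p.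
    exists (R X1), (R X2); split.
    - apply: set_ext => s; split=> [Ss|[] []//].
      have [p Xp ps] := S2 _ Ss; move/U: Xp => [] Xp; [left|right];
      by split=> //; exists p.
    - by apply/(IHf v1 v2 (upd (upd (upd v3 2 X1) 3 X2) 0 X1)) => //;
        apply: repR => p Xp; apply/U; left.
    - by apply/(IHg v1 v2 (upd (upd (upd v3 2 X1) 3 X2) 0 X2)) => //;
        apply: repR => p Xp; apply/U; right.
  pose Y (R : set trace) := [set p | v3 0 p /\ exists2 s, R s & pt p (tr s 0)].
  have repY R : R `<=` T -> repT B R (Y R).
    move=> RS; split=> [p [_ //]|s Rs].
    by have [p Xp ps] := S2 _ (RS _ Rs); exists p => //; split=> //; exists s.
  have R1S : R1 `<=` T by rewrite SE; left.
  have R2S : R2 `<=` T by rewrite SE; right.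
  exists (Y R1); apply/gex3; exists (Y R2); apply/gand; split; last (apply/gand; split).
  - apply/unFP/funext => p; apply/propext; split=> [Xp|[] []//].
    have [s] := S1 _ Xp; rewrite SE => -[Rs|Rs] ps; [left|right];
    by split=> //; exists s.
  - apply/gbec => //; apply/(IHf v1 v2 (upd (upd (upd v3 2 _) 3 _) 0 (Y R1)) R1) => //.
    exact: repY.
  apply/gbec => //; apply/(IHg v1 v2 (upd (upd (upd v3 2 _) 3 _) 0 (Y R2)) R2) => //.
  exact: repY.
- rewrite [semLTL _]/= gex3.
  have E Y : gs v1 v2 (upd v3 2 Y) nextF <->
      forall p', Y p' <-> exists2 t, T t & pt p' (tr (tfrom t 1) 0).
    have e p' : gs v1 (upd v2 1 p') (upd v3 2 Y) (AEx O2 0 (AAnd (AIn3 0 0) (sufF 0 TOne 1)))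
        <-> exists2 t, T t & pt p' (tr (tfrom t 1) 0).
      rewrite gex2; split=> [[p /gand[Xp]]|[t Tt pp']].
        have [t Tt pp] := rT.1 _ Xp.
        by rewrite (@sufFP _ _ _ _ _ _ _ _ t 1 0) // => ?; exists t.
      have [p Xp pp] := rT.2 _ Tt; exists p; apply/gand; split=> //.
      by apply/(@sufFP _ _ _ _ _ _ _ _ t 1 0).
    split=> [/gall2 g p'|g]; first by move: (g p') => /giff; rewrite e.
    by apply/gall2 => p'; apply/giff; rewrite e -g.
  split=> [[Y /gand[/E YE]]|h].
    rewrite gbec // => h; apply/(IH _ _ _ _ _).1; last exact: h.
    exact: repT_suf rT YE.
  exists [set p' | exists2 t, T t & pt p' (tr (tfrom t 1) 0)].
  apply/gand; split; first exact/E.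
  apply/gbec => //; apply/(IH _ _ _ _ _).2; last exact: h.
  exact: (@repT_suf _ _ (fun=> 1) _ rT).
- rewrite [semLTL _]/= gex3; split=> [[H /gand[/(funFP _ _ _ rT)[h hh] g]]|[h g]].
    exists h; apply: (@becSufP v1 v2 (upd v3 3 H) 0 3 T h (semLTL f) (ltl_sat (suffixes h T) f) rT hh isT isT _).1; last exact: g.
    by move=> w3 rw; apply: IH.
  exists (hgraph T h); apply/gand; have hg := hgraphP h rT.
  split; first by apply/(@funFP _ _ (upd v3 3 _) 0 3 T) => //; exists h.
  by apply: (@becSufP v1 v2 (upd v3 3 (hgraph T h)) 0 3 T h (semLTL f) (ltl_sat (suffixes h T) f) rT hg isT isT _).2 => // w3 rw; apply: IH.
- rewrite [semLTL _]/= gall3; split=> [g h|g H].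
    have hg := hgraphP h rT.
    have e : gs v1 v2 (upd v3 3 (hgraph T h)) (funF 0 3).
      by apply/(@funFP _ _ (upd v3 3 _) 0 3 T) => //; exists h.
    move: (g (hgraph T h)) => /gimp/(_ e) {}g.
    apply: (@becSufP v1 v2 (upd v3 3 (hgraph T h)) 0 3 T h (semLTL f) (ltl_sat (suffixes h T) f) rT hg isT isT _).1; last exact: g.
    by move=> w3 rw; apply: IH.
  apply/gimp => /(@funFP _ _ (upd v3 3 _) 0 3 T rT)[h hh].
  by apply: (@becSufP v1 v2 (upd v3 3 H) 0 3 T h (semLTL f) (ltl_sat (suffixes h T) f) rT hh isT isT _).2 => // w3 rw; apply: IH.
rewrite [semLTL _]/= gex3.
pose T' h := [set t | T t /\ 0 < h t].
have posE v1' v2' w3 h : repT B T (w3 0) -> hrep (w3 3) T h -> gs v1' v2' w3 posF ->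
    repT B (T' h) (w3 4).
  move=> [T1 T2] hh /gall2 k.
  have e p t : T t -> pt p (tr t 0) -> w3 4 p <-> w3 0 p /\ 0 < h t.
    move=> Tt pp; move: (k p) => /giff; rewrite gand gnot !gin3 updE => ->.
    rewrite (@hFP _ _ _ _ _ _ t 0) // hh // lt0n.
    by split=> -[? ?]; split=> //; [apply/eqP => ?|apply/eqP; rewrite eq_sym]; auto.
  split=> [p Xp|t [Tt h0]]; last first.
    by have [p Xp pp] := T2 _ Tt; exists p => //; apply/(e _ _ Tt pp).
  have [X0 _] : w3 0 p /\ True.
    by move: (k p) => /giff; rewrite gand !gin3 updE => -[/(_ Xp)[]].
  have [t Tt pp] := T1 _ X0; exists t => //; split=> //.
  by have [] := (e _ _ Tt pp).1 Xp.
have ltE v1' v2' w3 h h' : repT B (T' h) (w3 4) -> hrep (w3 3) T h ->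
    hrep (w3 5) (T' h) h' ->
    gs v1' v2' w3 ltF <-> forall t, T' h t -> h' t < h t.
  move=> [T1 T2] hh hh'; split=> [/gall2 k t Tt|k].
    have [p Xp pp] := T2 _ Tt.
    move: (k p) => /gimp/(_ Xp)/gall1/(_ (h' t))/gall1/(_ (h t))/gimp.
    rewrite gand (@hFP _ _ _ _ _ _ t (h' t)) // (@hFP _ _ _ _ _ _ t (h t)) //.
    rewrite hh' // hh; last by case: Tt.
    by move/(_ (conj erefl erefl)); rewrite /= addn1.
  apply/gall2 => p; apply/gimp => Xp; have [t Tt pp] := T1 _ Xp.
  apply/gall1 => a; apply/gall1 => b; apply/gimp.
  rewrite gand (@hFP _ _ _ _ _ _ t a) // (@hFP _ _ _ _ _ _ t b) //.
  rewrite hh' // hh; last by case: Tt.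
  by move=> [-> ->]; rewrite /= addn1 /upd /=; apply: k.
split=> [[H /gand[/(funFP _ _ _ rT)[h hh] /gand[/gex3[X4 /gand[pos k]] g2]]]|[h [g2 k]]].
  have r4 := posE v1 v2 (upd (upd v3 3 H) 4 X4) h rT hh pos.
  exists h; split.
    apply: (@becSufP v1 v2 (upd v3 3 H) 0 3 T h (semLTL g) (ltl_sat (suffixes h T) g) rT hh isT isT _).1; last exact: g2.
    by move=> w3 rw; apply: IHg.
  move=> T'' h' lt_h; have hg := hgraphP h' r4.
  have e : gs v1 v2 (upd (upd (upd v3 3 H) 4 X4) 5 (hgraph (T' h) h')) (AAnd (funF 4 5) ltF).
    apply/gand; split.
      by apply/(@funFP _ _ (upd (upd (upd v3 3 H) 4 X4) 5 _) 4 5 (T' h)) => //; exists h'.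
    by apply/(@ltE _ _ (upd (upd (upd v3 3 H) 4 X4) 5 _) h h' r4 hh hg).
  move: k => /gall3/(_ (hgraph (T' h) h'))/gimp/(_ e) k.
  apply: (@becSufP v1 v2 (upd (upd (upd v3 3 H) 4 X4) 5 (hgraph (T' h) h')) 4 5 (T' h) h' (semLTL f) (ltl_sat (suffixes h' (T' h)) f) r4 hg isT isT _).1; last exact: k.
  by move=> w3 rw; apply: IHf.
have hg := hgraphP h rT.
exists (hgraph T h); apply/gand; split.
  by apply/(@funFP _ _ (upd v3 3 _) 0 3 T) => //; exists h.
apply/gand; split; last first.
  by apply: (@becSufP v1 v2 (upd v3 3 (hgraph T h)) 0 3 T h (semLTL g) (ltl_sat (suffixes h T) g) rT hg isT isT _).2 => // w3 rw; apply: IHg.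
pose X4 := [set p | v3 0 p /\ ~ exists2 q, hgraph T h q & exists2 t, pt p (tr t 0) & pt q (tr t 0)].
apply/gex3; exists X4.
have pos : gs v1 v2 (upd (upd v3 3 (hgraph T h)) 4 X4) posF.
  apply/gall2 => p; apply/giff; rewrite gand gnot !gin3 !updE.
  rewrite -[upd _ 4 X4 0]/(v3 0).
  split=> -[Xp nh]; split=> //; have [t Tt pp] := rT.1 _ Xp.
    rewrite (@hFP _ _ _ _ _ _ t 0) // => -[q hq qq].
    by apply: nh; exists q => //; exists t.
  move=> [q hq [t' pp' qq]]; apply: nh.
  rewrite (@hFP _ _ _ _ _ _ t 0) //; exists q => //.
  by have [-> _] := tr_inj (pt_inj pp pp').
have r4 := posE v1 v2 (upd (upd v3 3 (hgraph T h)) 4 X4) h rT hg pos.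
apply/gand; split=> //; apply/gall3 => H5; apply/gimp.
move=> /gand[/(@funFP _ _ (upd (upd (upd v3 3 _) 4 X4) 5 H5) 4 5 (T' h) r4)[h' hh']].
rewrite (@ltE _ _ (upd (upd (upd v3 3 _) 4 X4) 5 H5) h h' r4 hg hh') => lt_h.
apply: (@becSufP v1 v2 (upd (upd (upd v3 3 (hgraph T h)) 4 X4) 5 H5) 4 5 (T' h) h' (semLTL f) (ltl_sat (suffixes h' (T' h)) f) r4 hh' isT isT _).2; last exact: k.
by move=> w3 rw; apply: IHf.
Qed.

End SemLTL.

(** * From trace sets to arithmetic *)

(** These closure conditions make the rows of a relation provide the points whose existence the
    translations rely on; the full power set satisfies them by [AxC_id]. *)
Definition AxC : arith :=
  AAnd (AEx O2 0 (emptyF 0))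
    (AAnd (AAll O2 0 (AAll O2 1 (AImp (wfF 1)
            (AAll O1 0 (AAll O1 1 (AEx O2 2 (updF 0 (V 0) 1 (V 1) 2)))))))
          (AAll O2 1 (AImp (wfF 1) (AAll O1 0 (AEx O2 2 (sufF 1 (V 0) 2)))))).

Definition AxT : arith :=
  AAnd (AEx O2 0 (AIn3 0 1)) (AAll O2 0 (AImp (AIn3 0 1) (wfF 0))).

(** The trace set is guessed; [K] is the place for the description of it that model checking
    adds. *)
Definition top (start K : arith) : arith :=
  AEx O3 1 (AAnd (AAnd AxC AxT) (AAnd start K)).

Definition startFO (f : arith) : arith :=
  AEx O3 0 (AAnd (AAll O2 0 (AIff (AIn3 0 0) (emptyF 0))) f).
Definition startSO (f : arith) : arith :=
  AEx O3 0 (AEx O2 0 (AAnd (emptyF 0) (AAnd (AAll O2 1 (ANot (AIn3 1 0))) f))).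
Definition startLTL (f : arith) : arith := AEx O3 0 (AAnd (eqT 0 1) f).

Section Top.
Variables (P : Type) (B : P -> set nat).
Notation gs := (gsat B).
Notation pt := (pt B).

Definition closedP : Prop :=
  [/\ exists p, pt p (fun=> None),
      forall p tau s t x n, pt p s -> pt tau (tr t 0) ->
        exists p', pt p' (upd s x (Some (t, n))) &
      forall tau t n, pt tau (tr t 0) -> exists p', pt p' (tr (tfrom t n) 0)].

Lemma AxC_closedP v1 v2 v3 : gs v1 v2 v3 AxC -> closedP.
Proof.
move=> /gand[/gex2[p /emptyFP pp] /gand[/gall2 h1 /gall2 h2]]; split.
- by exists p.
- move=> q tau s t x n qs tt; move: (h1 q) => /gall2/(_ tau)/gimp.
  have w : gs v1 (upd (upd v2 0 q) 1 tau) v3 (wfF 1) by apply/wfFP; exists t.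
  move/(_ w)/gall1/(_ x)/gall1/(_ n)/gex2 => [q'].
  by rewrite (@updFP _ _ _ _ _ _ _ _ _ _ s t x n 0) // => h; exists q'.
move=> tau t n tt; move: (h2 tau) => /gimp.
have w : gs v1 (upd v2 1 tau) v3 (wfF 1) by apply/wfFP; exists t.
move/(_ w)/gall1/(_ n)/gex2 => [q'].
by rewrite (@sufFP _ _ _ _ _ _ _ _ t n 0) // => h; exists q'.
Qed.

Lemma closedP_AxC v1 v2 v3 : (forall p, exists s, pt p s) -> closedP -> gs v1 v2 v3 AxC.
Proof.
move=> hp [[p pp] h1 h2]; apply/gand; split; first by exists p; apply/emptyFP.
apply/gand; split.
  apply/gall2 => q; apply/gall2 => tau; apply/gimp => /wfFP[t tt].
  apply/gall1 => x; apply/gall1 => n; have [s qs] := hp q.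
  have [q' hq] := h1 q tau s t x n qs tt.
  by apply/gex2; exists q'; rewrite (@updFP _ _ _ _ _ _ _ _ _ _ s t x n 0).
apply/gall2 => tau; apply/gimp => /wfFP[t tt].
apply/gall1 => n; have [q' hq] := h2 tau t n tt.
by apply/gex2; exists q'; rewrite (@sufFP _ _ _ _ _ _ _ _ t n 0).
Qed.

Lemma AxTP v1 v2 v3 : gs v1 v2 v3 AxT -> exists T, T !=set0 /\ repT B T (v3 1).
Proof.
move=> /gand[/gex2[p Xp] /gall2 h].
have wf q : v3 1 q -> exists t, pt q (tr t 0).
  by move=> Xq; move: (h q) => /gimp/(_ Xq)/wfFP.
exists [set t | exists2 q, v3 1 q & pt q (tr t 0)]; split.
  by have [t pp] := wf p Xp; exists t, p.
by split=> [q Xq|t [q Xq qt]]; [have [t qt] := wf q Xq; exists t => //; exists q|exists q].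
Qed.

Lemma repT_AxT v1 v2 v3 T : T !=set0 -> repT B T (v3 1) -> gs v1 v2 v3 AxT.
Proof.
move=> [t Tt] [T1 T2]; apply/gand; split; first by have [p Xp _] := T2 _ Tt; exists p.
apply/gall2 => p; apply/gimp => Xp; apply/wfFP.
by have [u _ pu] := T1 _ Xp; exists u.
Qed.

(** An assignment of finite support arises from the empty one by finitely many updates, so the
    closure conditions supply a point for it. *)
Lemma repT_pt T X s : closedP -> repT B T X -> finsupp s ->
  (forall x t n, s x = Some (t, n) -> T t) -> exists p, pt p s.
Proof.
move=> [h0 h1 _] [_ T2] [N]; elim: N s => [|N IH] s sN sT.
  by have -> : s = fun=> None by apply/funext => x; apply: sN.
have [||p pp] := IH (upd s N None).
- by move=> x; rewrite /upd leq_eqVlt eq_sym; case: eqP => // _ /sN.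
- by move=> x t n; rewrite /upd; case: eqP => // _ /sT.
case sNE: (s N) => [[t n]|]; last first.
  exists p; have -> : s = upd s N None by apply/funext => x; rewrite /upd; case: eqP => // ->.
  by [].
have [tau _ tt] := T2 _ (sT _ _ _ sNE).
have [q qq] := h1 _ _ _ _ N n pp tt; exists q.
have -> : s = upd (upd s N None) N (Some (t, n)) => //.
by apply/funext => x; rewrite /upd; case: eqP => // ->.
Qed.

Definition start_spec (F : Type) (mod : set trace -> F -> Prop) (st : F -> arith) :=
  forall (f : F) v1 v2 v3 T, T !=set0 -> closedP -> repT B T (v3 1) ->
  gs v1 v2 v3 (st f) <-> mod T f.

Lemma startFOP : start_spec fo_models (startFO \o semFO).
Proof.
move=> f v1 v2 v3 T T0 cl rT; have [[p0 pp0] _ _] := cl.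
have ptE (s : assignment T) : finsupp (raw s) -> exists p, pt p (raw s).
  move=> fs; apply: (repT_pt cl rT) => // x t n.
  by rewrite /raw; case: (s x) => //= d [<- _]; apply: set_valP.
rewrite [(_ \o _) _]/= /startFO gex3; have fS : finS [set @empty_assignment T] by move=> s ->; exists 0.
have rX X : (forall p, X p <-> pt p (fun=> None)) -> rep B X [set @empty_assignment T].
  move=> XE; split=> [p /XE h|_ ->]; last by exists p0 => //; apply/XE.
  by exists (@empty_assignment T).
split=> [[X /gand[/gall2 XE h]]|h].
  have {}XE p : X p <-> pt p (fun=> None).
    by move: (XE p) => /giff; rewrite gin3 updE emptyFP.
  by apply/(@semFOP _ _ _ ptE f v1 v2 (upd v3 0 X)) => //; apply: rX.
exists [set p | pt p (fun=> None)]; apply/gand; split.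
  by apply/gall2 => p; apply/giff; rewrite gin3 updE emptyFP.
by apply/(@semFOP _ _ _ ptE f v1 v2 (upd v3 0 _)); [|apply: rX|exact: rT|exact: h].
Qed.

Lemma startSOP : start_spec so_models (startSO \o semSO).
Proof.
move=> f v1 v2 v3 T T0 cl rT; have [[p0 pp0] _ _] := cl.
rewrite [(_ \o _) _]/=.
have fS : finsupp (raw (@empty_assignment T)) by exists 0.
have rV (X : set P) : (forall p, ~ X p) -> repV B X (fun=> @set0 (seq (dom T))).
  by move=> X0 i ds; split=> // -[p /X0].
have ptR := fun s => repT_pt (s := s) cl rT.
rewrite /startSO gex3.
split=> [[X /gex2[p /gand[/emptyFP pp /gand[/gall2 X0 h]]]]|h].
  apply/(@semSOP _ _ _ ptR T0 f v1 (upd v2 0 p) (upd v3 0 X)) => //.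
  by apply: rV => q; apply: X0.
exists set0, p0; apply/gand; split; first exact/emptyFP.
apply/gand; split; first by apply/gall2 => q; apply/gnot; rewrite gin3.
have rV0 := rV set0 (fun p => id).
exact: (@semSOP _ _ _ ptR T0 f v1 (upd v2 0 p0) (upd v3 0 set0) (@empty_assignment T) _ fS pp0 rV0 rT).2.
Qed.

Lemma startLTLP : start_spec ltl_sat (startLTL \o semLTL).
Proof.
move=> f v1 v2 v3 T T0 [h0 h1 h2] rT; rewrite [(_ \o _) _]/=.
have ptU p t n : pt p (tr t 0) -> exists q, pt q (tr t n).
  by move=> pp; have [q] := h1 _ _ _ _ 0 n pp pp; rewrite upd_tr; exists q.
have ptS p t n := h2 p t n.
rewrite /startLTL gex3.
split=> [[X /gand[/eqTP e h]]|h].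
  apply/(@semLTLP _ _ ptU ptS f v1 v2 (upd v3 0 X)) => //.
  by rewrite e.
exists (v3 1); apply/gand; split; first exact/eqTP.
by apply/(@semLTLP _ _ ptU ptS f v1 v2 (upd v3 0 _)); [exact: rT|exact: h].
Qed.

End Top.

Definition trX (T : set trace) : set (set nat) := [set code (tr t 0) | t in T].

Lemma repT_trX T : repT id T (trX T).
Proof. by split=> [_ [t Tt <-]|t Tt]; [exists t|exists (code (tr t 0)) => //; exists t]. Qed.

Lemma closedP_id : closedP (@id (set nat)).
Proof.
split=> [|p tau s t x n _ _|tau t n _]; last by exists (code (tr (tfrom t n) 0)).
  by exists (code (fun=> None)).
by exists (code (upd s x (Some (t, n)))).
Qed.

Lemma AxC_id v1 v2 v3 : gsat (P := set nat) id v1 v2 v3 AxC.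
Proof.
apply/gand; split; first by exists set0; apply/emptyFP; apply: set_ext => m; split=> // -[? [? [? []]]].
apply/gand; split.
  apply/gall2 => p; apply/gall2 => tau; apply/gimp => _.
  apply/gall1 => x; apply/gall1 => n; apply/gex2.
  exists [set m | gsat (P := set nat) id (upd (upd (upd v1 0 x) 1 n) 20 m)
    (upd (upd v2 0 p) 1 tau) v3 (updB 0 (V 0) 1 (V 1))].
  by apply/gall1 => m; apply/giff.
apply/gall2 => tau; apply/gimp => /wfFP[t tt]; apply/gall1 => n; apply/gex2.
by exists (code (tr (tfrom t n) 0)); apply/(@sufFP _ _ _ _ _ _ _ _ t n 0).
Qed.

Lemma top3P (F : Type) mod (st : F -> arith) (f : F) K v1 v2 v3 :
  start_spec (@id (set nat)) mod st ->
  arith_sat v1 v2 v3 (top (st f) K) <->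
  exists T, [/\ T !=set0, mod T f & arith_sat v1 v2 (upd v3 1 (trX T)) K].
Proof.
move=> sp; rewrite -gsat_id /top gex3; split.
  move=> [X /gand[/gand[_ /AxTP[T [T0 rT]]] /gand[/sp hs]]].
  have e : X = trX T.
    apply: set_ext => p; split=> [/rT.1[t Tt pp]|[t Tt <-]].
      by exists t.
    by have [q Xq <-] := rT.2 _ Tt.
  rewrite gsat_id e => hk; exists T; split=> //.
  by apply: (hs T T0 closedP_id rT).
move=> [T [T0 mT hk]]; exists (trX T); have rT := repT_trX T.
apply/gand; split; first by apply/gand; split; [exact: AxC_id|exact: repT_AxT T0 _].
apply/gand; split; last exact/gsat_id.
by apply/(sp f _ _ _ T T0 closedP_id).
Qed.

Definition lasg (l : seq (nat * (trace * nat))) : rasg :=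
  foldr (fun a s => upd s a.1 (Some a.2)) (fun=> None) l.

Definition top2 (start : arith) : arith := AEx O2 0 (cmp (top start (AEq TZero TZero))).

(** If the sentence holds, distinct traces of [T] are denoted by distinct row numbers, so [T] is
    countable. Conversely, the assignments of finite support over suffixes of traces in a countable
    [T] can be listed as rows, and they are closed under updating and cutting. *)
Lemma top2P (F : Type) mod (st : F -> arith) (f : F) :
  (forall P B, @start_spec P B F mod st) ->
  arith_sat (fun=> 0) (fun=> set0) (fun=> set0) (top2 (st f)) <->
  exists T, [/\ T !=set0, countable T & mod T f].
Proof.
move=> sp.
have E C : arith_sat (fun=> 0) (upd (fun=> set0) 0 C) (fun=> set0)
    (cmp (top (st f) (AEq TZero TZero))) <->
    gsat (fun e => [set m | C (pairn e m)]) (fun=> 0) (fun=> 0) (fun=> set0)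
      (top (st f) (AEq TZero TZero)).
  rewrite -(cmpP C (fun=> set0)).
  have -> : comb (fun=> 0) (fun=> 0) = (fun=> 0).
    by apply/funext => n; rewrite /comb; case: odd.
  by have -> : comb2 C (fun=> set0) = upd (fun=> set0) 0 C by apply/funext; case.
split=> [[C /E]|[T [T0 Tc mT]]].
  rewrite /top gex3 => -[X /gand[/gand[/AxC_closedP cl /AxTP[T [T0 rT]]] /gand[hs _]]].
  exists T; split=> //; last by move: hs; rewrite (sp _ _ f _ _ _ T T0 cl rT).
  have {rT}rT : forall t, T t -> exists2 p, X p & [set m | C (pairn p m)] = code (tr t 0).
    exact: rT.2.
  apply/countable_injP.
  exists (fun t => xget 0 [set p | [set m | C (pairn p m)] = code (tr t 0)]).
  move=> t u /set_mem Tt /set_mem Tu.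
  case: xgetP => [p _ /= pt|/=]; last by have [q _ qt] := rT t Tt; move=> /(_ q).
  case: xgetP => [q _ /= qu pq|/=]; last by have [q _ qu] := rT u Tu; move=> /(_ q).
  by move: pt; rewrite pq qu => /code_inj/tr_inj[].
(* An enumeration of [T] with repetitions; the default [t0] keeps it inside [T]. *)
have [g Tg] : exists g : nat -> trace, forall t, T t <-> exists n, g n = t.
  have [t0 Tt0] := T0; have /countable_injP[f0 f0i] := Tc.
  exists (fun n => xget t0 [set t | T t /\ f0 t = n]) => t; split=> [Tt|[n <-]].
    exists (f0 t); case: xgetP => [u _ [Tu]|/(_ t)[]//].
    by apply: f0i; apply/mem_set.
  by case: xgetP => [u _ []|].
(* An entry [(x, (m, j, n))] sends the variable [x] to position [n] of the trace [g m] read from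
   time [j] on. *)
pose dec (a : nat * (nat * nat * nat)) := (a.1, (tfrom (g a.2.1.1) a.2.1.2, a.2.2)).
pose pts (e : nat) : set nat :=
  if @unpickle (seq (nat * (nat * nat * nat))) e is Some l
  then code (lasg (map dec l)) else code (fun=> None).
have BE : (fun e => [set m | [set k | exists e m, k = pairn e m /\ pts e m] (pairn e m)]) = pts.
  apply/funext => e; apply: set_ext => m; split=> [[e' [m' [/pairn_inj[-> ->]]]]//|h].
  by exists e, m.
have ptl l : pt pts (pickle l) (lasg (map dec l)) by rewrite /pt /pts pickleK.
have ptp e : exists l, pt pts e (lasg (map dec l)).
  by rewrite /pt /pts; case: unpickle => [l|]; [exists l|exists [::]].
have wfl l t k : lasg (map dec l) 0 = Some (t, k) -> exists n j, t = tfrom (g n) j.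
  elim: l => //= a l IH; rewrite /upd; case: eqP => // _ [<- _].
  by exists a.2.1.1, a.2.1.2.
have wf e t : pt pts e (tr t 0) -> exists n j, t = tfrom (g n) j.
  by have [l pl] := ptp e; move=> /(pt_inj pl) h; apply: (wfl l t 0); rewrite h.
have tr1 t : upd (fun=> None) 0 (Some (t, 0)) = tr t 0.
  by apply/funext => x; rewrite /upd /tr.
have cl : closedP pts.
  split=> [|p tau s t x n ps /wf[m [j ->]]|tau t n /wf[m [j ->]]].
  - by exists (pickle ([::] : seq (nat * (nat * nat * nat)))); apply: ptl.
  - have [l pl] := ptp p; rewrite (pt_inj ps pl).
    by exists (pickle ((x, (m, j, n)) :: l)); apply: ptl.
  exists (pickle [:: (0, (m, j + n, 0))]); have := ptl [:: (0, (m, j + n, 0))].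
  rewrite /= tr1; suff -> : tfrom (tfrom (g m) j) n = tfrom (g m) (j + n) by [].
  by apply/funext => i; rewrite /tfrom addnA.
exists [set k | exists e m, k = pairn e m /\ pts e m]; apply/E.
rewrite BE /top gex3; exists [set e | exists2 t, T t & pt pts e (tr t 0)].
have rT : repT pts T [set e | exists2 t, T t & pt pts e (tr t 0)].
  split=> // t Tt; have [n gn] := (Tg t).1 Tt.
  have pp : pt pts (pickle [:: (0, (n, 0, 0))]) (tr t 0).
    by have := ptl [:: (0, (n, 0, 0))]; rewrite /= tr1 /dec /= -gn.
  by exists (pickle [:: (0, (n, 0, 0))]) => //; exists t.
apply/gand; split.
  apply/gand; split; last exact: repT_AxT T0 rT.
  by apply: closedP_AxC => // e; have [l pl] := ptp e; exists (lasg (map dec l)).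
by apply/gand; split=> //; apply/(sp _ _ f _ _ _ T T0 cl).
Qed.

Local Close Scope classical_set_scope.
(** * Strings of formulas *)

Arguments ser : simpl never.

(* [m] tells whether formulas are compiled by [cmp]. *)
Definition sE (m : bool) (f : arith) : seq bool :=
  locked (ser (arith_code (if m then cmp f else f))).
Definition sT (t : term) : seq bool := locked (ser (term_code t)).

Definition lower (m : bool) (o : Defs.order) (x : nat) : Defs.order * nat :=
  if m then match o with O1 => (O1, x.*2) | O2 => (O1, x.*2.+1) | O3 => (O2, x.+1) end
  else (o, x).
Definition pQ (k : nat) (m : bool) (o : Defs.order) (x : nat) : seq bool :=
  locked (hdr k 3 ++ ser (leaf (order_nat (lower m o x).1)) ++ ser (leaf (lower m o x).2)).
Definition pEx m o x := pQ 7 m o x.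
Definition pAll m o x := pQ 8 m o x.
Definition pAnd := hdr 5 2.
Definition pOr := hdr 6 2.
Definition pNot := hdr 4 1.
Definition pLet (m : bool) (r : nat) : seq bool :=
  locked (pEx m O1 r ++ pAnd ++ hdr 0 2 ++ sT (V (if m then r.*2 else r))).
Definition pStep := locked (hdr 3 2 ++ sT TOne).
Definition pBec (m : bool) (Y : nat) : seq bool := locked (pEx m O3 0 ++ pAnd ++ sE m (eqT 0 Y)).

Ltac serE := rewrite /= ?ser_node /= ?cats0 -?catA.

Lemma sE_and m f g : sE m (AAnd f g) = pAnd ++ sE m f ++ sE m g.
Proof. by rewrite /sE -!lock; case: m; serE. Qed.
Lemma sE_or m f g : sE m (AOr f g) = pOr ++ sE m f ++ sE m g.
Proof. by rewrite /sE -!lock; case: m; serE. Qed.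
Lemma sE_not m f : sE m (ANot f) = pNot ++ sE m f.
Proof. by rewrite /sE -!lock; case: m; serE. Qed.
Lemma sE_ex m o x f : sE m (AEx o x f) = pEx m o x ++ sE m f.
Proof. by rewrite /sE /pEx /pQ -!lock; case: m; case: o; serE. Qed.
Lemma sE_all m o x f : sE m (AAll o x f) = pAll m o x ++ sE m f.
Proof. by rewrite /sE /pAll /pQ -!lock; case: m; case: o; serE. Qed.
Lemma sE_imp m f g : sE m (AImp f g) = pOr ++ pNot ++ sE m f ++ sE m g.
Proof. by rewrite /AImp sE_or sE_not -?catA. Qed.
Lemma sT_num n : sT (num n) = flatten (nseq n pStep) ++ sT TZero.
Proof. by elim: n => //= n; rewrite /sT /pStep /sT -!lock /=; serE => ->; rewrite -?catA. Qed.
Lemma sE_letn m r n f : sE m (letn r n f) =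
  pLet m r ++ flatten (nseq n pStep) ++ sT TZero ++ sE m f.
Proof.
rewrite /letn sE_ex sE_and /pLet -lock -!catA; do 2 congr (_ ++ _).
have tn : tcmp (num n) = num n by elim: n => //= n ->.
have -> : sE m (AEq (V r) (num n)) = hdr 0 2 ++ sT (V (if m then r.*2 else r)) ++ sT (num n).
  by rewrite /sE /sT -!lock; case: m; rewrite /= ?tn ser_node /= ?cats0.
by rewrite sT_num -!catA.
Qed.
Lemma sE_bec m Y f : sE m (becF Y f) = pBec m Y ++ sE m f.
Proof. by rewrite /becF sE_ex sE_and /pBec -lock -!catA. Qed.

Lemma sE_nots m n f : sE m (iter n ANot f) = flatten (nseq n pNot) ++ sE m f.
Proof. by elim: n => //= n IH; rewrite sE_not IH catA. Qed.

Lemma seval2 (a b c : seq bool) n :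
  seval [:: (a, b); (c, [::])] n = a ++ flatten (nseq n b) ++ c.
Proof.
rewrite /seval -lock /= cats0 -catA; congr (_ ++ (_ ++ _)).
by elim: n => //=; rewrite cats0.
Qed.

Lemma seval1 (a b : seq bool) n : seval [:: (a, b)] n = a ++ flatten (nseq n b).
Proof. by rewrite /seval -lock /= cats0. Qed.

Lemma seval0 n : seval [::] n = [::].
Proof. by rewrite /seval -lock. Qed.

(** What a leaf that names a variable writes: the opening of [letn], the numeral as the repeated
    part, and a fixed continuation. *)
Definition segL m r post : seq (seq bool * seq bool) :=
  [:: (pLet m r, pStep); (sT TZero ++ post, [::])].

Lemma segLE m r n f : seval (segL m r (sE m f)) n = sE m (letn r n f).
Proof. by rewrite seval2 sE_letn. Qed.

Lemma segLE2 m r n pre f : seval (segL m r pre) n ++ sE m f =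
  pLet m r ++ flatten (nseq n pStep) ++ sT TZero ++ pre ++ sE m f.
Proof. by rewrite seval2 -!catA. Qed.

(** * Tables *)

Definition bounded (b : nat) (T : table) :=
  forall q k j p l, delta T q k j p l < b.

(** Cutting the states at [b] makes the bound on them hold by construction. *)
Definition mkT (b : nat) (bn : b < nstates) (d : nat -> nat -> nat -> nat -> bool -> nat)
    (okl : nat -> nat -> bool) (okn : nat -> nat -> nat -> bool)
    (outl : nat -> seq (seq bool * seq bool)) (outn : nat -> nat -> nat -> seq bool) :
    table.
Proof.
refine (@Table (fun q k j p l => minn (d q k j p l) b) okl okn outl outn _).
by move=> q k j p l; rewrite (leq_ltn_trans (geq_minr _ _)).
Defined.

Lemma mkT_bounded b bn d okl okn outl outn : bounded b.+1 (@mkT b bn d okl okn outl outn).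
Proof. by move=> q k j p l; rewrite ltnS geq_minr. Qed.

(** Serves to place a constant string in the list of passes, and to ignore one component of a
    pair. *)
Definition silent : table := @mkT 0 isT (fun _ _ _ _ _ => 0) (fun _ _ => true)
  (fun _ _ _ => true) (fun _ => [::]) (fun _ _ _ => [::]).

Lemma trav_silent q t : trav silent q t = [::].
Proof.
elim/tree_ind: t q => [n|k ts IH] q /=; first exact: seval0.
suff H s j p : children [::] cat (trav silent) s j p ts = [::] by apply: H.
elim: ts j p IH {k} => //= t ts IHts j p IH; rewrite IH; last by left.
by apply: IHts => u hu; apply: IH; right.
Qed.

Lemma trav_sim (T T' : table) (phi : nat -> nat) (Q : pred nat) :
  (forall q, Q q -> [/\ outL T (phi q) = outL T' q, outN T (phi q) =2 outN T' q,
    okL T (phi q) =1 okL T' q & okN T (phi q) =2 okN T' q]) ->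
  (forall q k j p l, Q q -> delta T (phi q) k j p l = phi (delta T' q k j p l) /\
    Q (delta T' q k j p l)) ->
  forall t q, Q q -> trav T (phi q) t = trav T' q t /\ okt T (phi q) t = okt T' q t.
Proof.
move=> out dl; elim/tree_ind => [n|k ts IH] q Qq; have [oL oN kL kN] := out q Qq.
  by rewrite /= oL kL.
rewrite /= oN kN.
suff H s s' j p : (forall j p l, s j p l = phi (s' j p l) /\ Q (s' j p l)) ->
  children [::] cat (trav T) s j p ts = children [::] cat (trav T') s' j p ts /\
  children true andb (okt T) s j p ts = children true andb (okt T') s' j p ts.
  by have [|-> ->] := H (delta T (phi q) (cap k)) (delta T' q (cap k)) 0 0; auto.
move=> ss; elim: ts j p IH {oN kN} => //= t ts IHts j p IH.
have [-> Qs] := ss (cap j) p (nilp ts).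
have [|-> ->] := IH t _ _ Qs; first by left.
by have [|-> ->] := IHts j.+1 (lval t); first by move=> u hu; apply: IH; right.
Qed.

(* The table of a pair, with the states of the components shifted. *)
Definition mc (A B : table) : table := @mkT 39 isT
  (fun q k j p l => if q is q'.+1 then
      if q' < 18 then (delta A q' k j p l).+1 else 19 + delta B (q' - 18) k j p l
    else if j == 0 then 1 else 19)
  (fun q n => if q is q'.+1 then
      if q' < 18 then okL A q' n else okL B (q' - 18) n else false)
  (fun q k m => if q is q'.+1 then
      if q' < 18 then okN A q' k m else okN B (q' - 18) k m else (k == 0) && (m == 2))
  (fun q => if q is q'.+1 then
      if q' < 18 then outL A q' else outL B (q' - 18) else [::])
  (fun q k m => if q is q'.+1 then
      if q' < 18 then outN A q' k m else outN B (q' - 18) k m else [::]).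

Lemma cap_eq n c : c < 9 -> (cap n == c) = (n == c).
Proof. by rewrite /cap; lia. Qed.

Section Mc.
Variables A B : table.
Hypotheses (bA : bounded 18 A) (bB : bounded 20 B).

Lemma mcA q t : q < 18 -> trav (mc A B) q.+1 t = trav A q t /\
  okt (mc A B) q.+1 t = okt A q t.
Proof.
apply: (@trav_sim (mc A B) A S (fun q => q < 18)) => {q t}[q q18|q k j p l q18].
  by rewrite /= q18.
by rewrite /= q18; have := bA q k j p l; rewrite /minn; case: ifP => //; lia.
Qed.

Lemma mcB q t : q < 20 -> trav (mc A B) (q + 19) t = trav B q t /\
  okt (mc A B) (q + 19) t = okt B q t.
Proof.
apply: (@trav_sim (mc A B) B (addn^~ 19) (fun q => q < 20)) => {q t}[q q18|q k j p l q18].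
  by rewrite /= addnS /= ltnNge leq_addl /= addnK.
rewrite /= addnS /= ltnNge leq_addl /= addnK.
by have := bB q k j p l; rewrite /minn; case: ifP => //; lia.
Qed.

Lemma trav_mc t u : trav (mc A B) 0 (node 0 [:: t; u]) = trav A 0 t ++ trav B 0 u.
Proof.
by rewrite /= cats0 -/(0 + 19) (mcA _ (isT : 0 < 18)).1 (mcB _ (isT : 0 < 20)).1.
Qed.

Lemma okt_mc w : okt (mc A B) 0 w <->
  exists t u, [/\ w = node 0 [:: t; u], okt A 0 t & okt B 0 u].
Proof.
have E t u : okt (mc A B) 0 (node 0 [:: t; u]) = okt A 0 t && okt B 0 u.
  by rewrite /= andbT -/(0 + 19) (mcA _ (isT : 0 < 18)).2 (mcB _ (isT : 0 < 20)).2.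
split=> [|[t [u [-> h1 h2]]]]; last by rewrite E h1.
case: w => // k [|t [|u [|v ts]]].
- by rewrite [okt _ _ _]/= andbF.
- by rewrite [okt _ _ _]/= andbF.
- move=> h; have k0 : k = 0 by move: h; rewrite /= => /andP[/andP[]]; rewrite cap_eq // => /eqP.
  by move: h; rewrite k0 E => /andP[]; exists t, u.
by rewrite /= => /andP[/andP[_]]; rewrite cap_eq.
Qed.

End Mc.

Lemma cap_in k m (s : seq (nat * nat)) : all (fun c => (c.1 < 9) && (c.2 < 9)) s ->
  ((cap k, cap m) \in s) = ((k, m) \in s).
Proof.
elim: s => //= -[a b] s IH /andP[/andP[a9 b9] /IH h].
by rewrite !inE h !xpair_eqE !cap_eq.
Qed.

Lemma okt_list (T : table) s s' ts j p : (forall j p l, s j p l = s') ->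
  (forall k m, okN T s' k m = false) -> children true andb (okt T) s j p ts ->
  exists xs, ts = map leaf xs.
Proof.
move=> sc nN; elim: ts j p => [|t ts IH] j p; first by exists [::].
rewrite /= sc => /andP[h /IH[xs ->]]; case: t h => [n|k us] /=; last by rewrite nN.
by exists (n :: xs).
Qed.

Lemma okt_leaves (T : table) s s' xs j p : (forall j p l, s j p l = s') ->
  (forall n, okL T s' n) -> children true andb (okt T) s j p (map leaf xs).
Proof. by move=> sc oL; elim: xs j p => //= x xs IH j p; rewrite sc /= oL IH. Qed.

Lemma trav_leaves (T : table) s s' xs j p : (forall j p l, s j p l = s') ->
  children [::] cat (trav T) s j p (map leaf xs) = flatten [seq seval (outL T s') x | x <- xs].
Proof. by move=> sc; elim: xs j p => //= x xs IH j p; rewrite sc /= IH. Qed.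

(** * The table of first-order team logic *)

Section FOtable.
Variables (m lf : bool).

Definition atomD (b k : nat) (j : nat) : nat := if j == 0 then b else b + k.+1.

Definition atomS (k : nat) : seq bool := sE m
  match k with 0 => eqA | 1 => leA | 2 => predA | _ => levelA end.

Definition atomOK (k n : nat) : bool :=
  (k, n) \in [:: (0, 2); (1, 2); (2, 2)] ++ (if lf then [::] else [:: (3, 2)]).

(** A node writes only before its children, so what stands between two children is left to the
    second one, which is visited in a state of its own. States: 0 formula; 1 right disjunct; 2 sign;
    3 atom; 4 its first entry; 5 to 8 its second entry, by tag; 9 to 11 the list, its entries and
    the last variable of a dependence atom; 12, 13 quantified variable; 14 failure. *)
Definition semFOT : table := @mkT 17 isT
  (fun q k j _ _ => match q with
    | 0 | 1 => match k with
       | 0 => if j == 0 then 2 else 3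
       | 1 => if j == 0 then 9 else 11
       | 2 | 3 => 0
       | 4 => if j == 0 then 0 else 1
       | 5 => if j == 0 then 12 else 0
       | _ => if j == 0 then 13 else 0 end
    | 3 => atomD 4 k j
    | 9 => 10
    | _ => 14 end)
  (fun q n => match q with
    | 0 | 1 | 3 | 9 | 14 => false | 2 => n <= 1 | _ => true end)
  (fun q k n => match q with
    | 0 | 1 => (k, n) \in [:: (0, 2); (1, 2); (2, 1); (3, 2); (4, 2); (5, 2); (6, 2)]
    | 3 => atomOK k n
    | 9 => k == 0
    | _ => false end)
  (fun q => match q with
    | 2 => [:: ([::], pNot)]
    | 4 => segL m 0 [::]
    | 5 | 6 | 7 | 8 => segL m 1 (atomS (q - 5))
    | 10 => [:: (pOr ++ pLet m 0, pStep);
                (sT TZero ++ sE m (ANot (secF 0 (V 0) 1 (V 0))), [::])]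
    | 11 => segL m 0 (sE m (secF 0 (V 0) 1 (V 0)))
    | 12 => segL m 0 (pEx m O3 2 ++ pAnd ++ sE m exF ++ pBec m 2)
    | 13 => segL m 0 (pEx m O3 2 ++ pAnd ++ sE m allF ++ pBec m 2)
    | _ => [::] end)
  (fun q k _ => match q with
    | 0 | 1 => (if q == 1 then pBec m 3 else [::]) ++ match k with
       | 0 => pAll m O2 0 ++ pOr ++ sE m (ANot (AIn3 0 0)) ++ pNot
       | 1 => pAll m O2 0 ++ pAll m O2 1 ++ pOr ++ sE m (ANot (AIn3 0 0)) ++
              pOr ++ sE m (ANot (AIn3 1 0))
       | 2 => pNot
       | 3 => pAnd
       | 4 => pEx m O3 2 ++ pEx m O3 3 ++ pAnd ++ sE m unF ++ pAnd ++ pBec m 2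
       | _ => [::] end
    | _ => [::] end).

Lemma semFOT_bounded : bounded 18 semFOT. Proof. exact: mkT_bounded. Qed.

Lemma sE_atom a : exists k x y (t : seq bool -> Prop), atom_code a = node k [:: leaf x; leaf y] /\
  (k < 4) /\ sE m (atomA a) = seval (segL m 0 [::]) x ++ seval (segL m 1 (atomS k)) y.
Proof.
by case: a => [x y|x y|x y|x y]; [exists 0|exists 1|exists 2|exists 3]; exists x, y, (fun _ => True);
   split=> //; split=> //; rewrite [atomA _]/= sE_letn !seval2 sE_letn cats0 -!catA.
Qed.

Lemma semFOT_1 f : trav semFOT 1 (fo_code f) = pBec m 3 ++ trav semFOT 0 (fo_code f).
Proof. by case: f => *; rewrite /= -?catA. Qed.

Lemma semFOTE f : trav semFOT 0 (fo_code f) = sE m (semFO f).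
Proof.
elim: f => [b a|xs y|f IH|f IHf g IHg|f IHf g IHg|x f IH|x f IH].
- have [k [x [y [_ [ac [k4 aE]]]]]] := sE_atom a.
  have c : cap k = k by rewrite /cap; lia.
  rewrite [fo_code _]/= ac [trav _ _ _]/= !cats0 c seval1 -!catA /=.
  rewrite sE_all sE_or !sE_not sE_nots aE !seval2.
  rewrite -!catA; do 6 congr (_ ++ _).
  by case: k k4 {ac aE c} => [|[|[|[|]]]] // _; rewrite /= seval2 -?catA.
- rewrite [semFO _]/= !sE_all !sE_or [fo_code _]/= [trav _ _ _]/= -!catA cats0.
  do 6 congr (_ ++ _); rewrite (@trav_leaves _ _ 10) //.
  elim: xs => [|x xs IH] /=; first by rewrite segLE.
  rewrite -!/(depF _ _) sE_or sE_letn seval2 -!catA; do 5 congr (_ ++ _).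
  exact: IH.
- by rewrite [semFO _]/= sE_not /= IH cats0.
- by rewrite [semFO _]/= sE_and /= IHf IHg cats0.
- rewrite [semFO _]/= !sE_ex !sE_and !sE_bec [fo_code _]/= [trav _ _ _]/= cats0.
  by rewrite semFOT_1 IHf IHg -!catA.
- rewrite [semFO _]/= sE_letn sE_ex sE_and sE_bec [fo_code _]/= [trav _ _ _]/= cats0.
  by rewrite IH segLE2 -!catA.
rewrite [semFO _]/= sE_letn sE_ex sE_and sE_bec [fo_code _]/= [trav _ _ _]/= cats0.
by rewrite IH segLE2 -!catA.
Qed.

Lemma okt_atom (T : table) q t : okN T q =2 atomOK -> (forall n, ~~ okL T q n) ->
  (forall k j p l, k < 4 -> j < 2 -> (forall n, okL T (delta T q k j p l) n) /\
     forall k' m', ~~ okN T (delta T q k j p l) k' m') ->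
  okt T q t <-> exists2 a, t = atom_code a & lf -> level_free_atom a.
Proof.
move=> oN oL oD.
have E k x y : k < 4 -> okt T q (node k [:: leaf x; leaf y]) = atomOK k 2.
  move=> k4; have c : cap k = k by rewrite /cap; lia.
  by rewrite /= oN c !(oD _ _ _ _ k4 _).1 // !andbT.
split=> [|[[x y|x y|x y|x y] -> h]]; last first.
- by rewrite [atom_code _]/= E // /atomOK; case: lf h => // /(_ isT).
- by rewrite [atom_code _]/= E.
- by rewrite [atom_code _]/= E.
- by rewrite [atom_code _]/= E.
case: t => [n|k ts]; first by rewrite /= (negbTE (oL _)).
rewrite /= oN /atomOK cap_in; last by case: lf.
move=> /andP[]; case: ts => [|t [|u [|v ts]]] km; try by move: km; case: lf; rewrite !inE !xpair_eqE /= ?andbF.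
have k4 : k < 4 by move: km; case: lf; rewrite !inE !xpair_eqE /=; lia.
have c : cap k = k by rewrite /cap; lia.
rewrite /= c => /andP[ht /andP[hu _]].
have [x tx] : exists x, t = leaf x.
  by case: t ht {hu km} => [x|k' ts] /=; [exists x|rewrite (negbTE ((oD _ _ _ _ k4 _).2 _ _))].
have [y uy] : exists y, u = leaf y.
  by case: u hu {ht km} => [y|k' ts] /=; [exists y|rewrite (negbTE ((oD _ _ _ _ k4 _).2 _ _))].
move: km; rewrite tx uy !inE !xpair_eqE.
case: k {ht hu c} k4 => [|[|[|[|k]]]] // _; rewrite ?andbT ?andbF.
- by exists (Eq x y).
- by exists (Le x y).
- by exists (Pred x y).
by move=> h; exists (Level x y) => // l; move: h; rewrite l.
Qed.

Lemma semFOT_ok q t : q < 2 -> okt semFOT q t <->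
  exists2 f, t = fo_code f & lf -> fo_level_free f.
Proof.
have okA := @okt_atom semFOT 3 _ (fun _ _ => erefl) (fun=> isT).
have {}okA t' : okt semFOT 3 t' <-> exists2 a, t' = atom_code a & lf -> level_free_atom a.
  by apply: okA => -[|[|[|[|k]]]] [|[|j]].
elim/tree_ind: t q => [n|k ts IH] q q2.
  split=> [|[[]]//]; by case: q q2 => [|[]].
have okE : okt semFOT q (node k ts) = okt semFOT 0 (node k ts) by case: q q2 => [|[]].
rewrite {}okE; split=> [|[f]].
  rewrite [okt _ _ _]/= cap_in // => /andP[].
  case: ts IH => [|t [|u [|v ts]]] IH km; try by move: km; rewrite !inE !xpair_eqE ?andbF.
    have -> : k = 2 by arity km.
    by rewrite /= andbT => /(IH _ in_0 0 isT)[f -> h]; exists (FNot f).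
  have {km} k7 : k < 7 /\ k <> 2 by arity km.
  have IHt := IH t in_0; have IHu := IH u in_1.
  case: k {IH} k7 => [|[|[|[|[|[|[|k]]]]]]] // [] // _ _; rewrite /= andbT.
  - case/andP; case: t {IHt} => // n /= n1 /okA[a -> h].
    have {}n1 : n <= 1 by move: n1; rewrite /cap; lia.
    by exists (FLit (n == 1) a) => //=; case: n n1 => [|[]].
  - case/andP; case: t {IHt} => // k us /andP[/eqP k0 h2]; case: u {IHu} => // y _.
    have [xs ->] := okt_list (T := semFOT) (s' := 10) (fun _ _ _ => erefl) (fun _ _ => erefl) h2.
    exists (FDep xs y) => //=; congr (node 1 [:: node _ _; _]).
    by apply/eqP; rewrite -(@cap_eq k 0) // k0.
  - by move=> /andP[/(IHt 0 isT)[f -> hf] /(IHu 0 isT)[g -> hg]]; exists (FAnd f g) => //= l; rewrite hf ?hg.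
  - by move=> /andP[/(IHt 0 isT)[f -> hf] /(IHu 1 isT)[g -> hg]]; exists (FOr f g) => //= l; rewrite hf ?hg.
  - by case/andP; case: t {IHt} => // x _ /(IHu 0 isT)[f -> hf]; exists (FEx x f).
  - by case/andP; case: t {IHt} => // x _ /(IHu 0 isT)[f -> hf]; exists (FAll x f).
case: f => [b a|xs y|f|f g|f g|x f|x f] [-> tsE] h; subst ts; rewrite /= ?andbT.
- by apply/andP; split; [case: (b)|apply/okA; exists a].
- by rewrite (@okt_leaves _ _ 10).
- by apply/(IH _ in_0 0) => //; exists f.
- have hl l : _ /\ _ := andP (h l).
  by apply/andP; split; [apply/(IH _ in_0 0)|apply/(IH _ in_1 0)] => //;
    [exists f|exists g] => // l; case: (hl l).
- have hl l : _ /\ _ := andP (h l).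
  by apply/andP; split; [apply/(IH _ in_0 0)|apply/(IH _ in_1 1)] => //;
    [exists f|exists g] => // l; case: (hl l).
- by apply/(IH _ in_1 0) => //; exists f.
by apply/(IH _ in_1 0) => //; exists f.
Qed.

End FOtable.

Definition seg := seq (seq bool * seq bool).
Definition sPre (s : seq bool) (g : seg) : seg := (s, [::]) :: g.
Definition sPost (s : seq bool) (g : seg) : seg := g ++ [:: (s, [::])].

Lemma flat_nil n : flatten (nseq n ([::] : seq bool)) = [::].
Proof. by elim: n. Qed.
Lemma seval_pre s g n : seval (sPre s g) n = s ++ seval g n.
Proof. by rewrite /seval /sPre -!lock /= flat_nil cats0. Qed.
Lemma seval_post s g n : seval (sPost s g) n = seval g n ++ s.
Proof. by rewrite /seval /sPost -!lock map_cat flatten_cat /= flat_nil !cats0. Qed.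

(** A string that follows a list is written by the last entry, recognised by the flag of the
    transition, or by the list node itself if there is no entry. *)
Lemma trav_leaves_last (T : table) s q1 q2 e xs j p :
  (forall j p l, s j p l = if l then q2 else q1) ->
  (forall x, seval (outL T q2) x = seval (outL T q1) x ++ e) ->
  (if cap (size xs) == 0 then e else [::]) ++ children [::] cat (trav T) s j p (map leaf xs) =
  flatten [seq seval (outL T q1) x | x <- xs] ++ e.
Proof.
move=> sE oE; rewrite cap_eq //; case: xs => [|x xs]; first by rewrite /= cats0.
rewrite [size _ == 0]/= cat0s; elim: xs x j p => [|y xs IH] x j p.
  by rewrite /= sE oE !cats0.
rewrite -[LHS]/(seval (outL T (s (cap j) p false)) x ++
  children [::] cat (trav T) s j.+1 (cap x) (map leaf (y :: xs))) IH.
by rewrite sE [map _ (x :: _)]/= [flatten (_ :: _)]/= -catA.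
Qed.

Lemma arith_and v1 v2 v3 f g :
  arith_sat v1 v2 v3 (AAnd f g) <-> arith_sat v1 v2 v3 f /\ arith_sat v1 v2 v3 g.
Proof. by []. Qed.

(** * Closedness *)

Definition tt_ := AEq TZero TZero.

Section ClF.
Variables (lfF : nat -> arith) (lfS : seg) (qF : nat -> arith -> arith) (qS : seg).
Hypothesis lfE : forall x, seval lfS x = sE false (lfF x).
Hypothesis qE : forall x f, seval qS x ++ sE false f = sE false (qF x f).

Definition clA (a : atom) : arith :=
  match a with
  | Pred _ x => lfF x
  | Eq x y | Le x y | Level x y => AAnd (lfF x) (lfF y)
  end.

(** A skeleton of [f] with a formula for each occurrence of a variable. With [vS] and [qall] it is
    valid and has the free variables of [f]; so it is a true sentence exactly if [f] is closed, and
    [true_in_N] does the check. With [lf3] and [q3] it says that all variables are among three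
    guessed numbers. *)
Fixpoint clFO (f : fo) : arith :=
  match f with
  | FLit _ a => clA a
  | FDep xs y => foldr (fun x g => AAnd (lfF x) g) (lfF y) xs
  | FNot f => clFO f
  | FAnd f g | FOr f g => AAnd (clFO f) (clFO g)
  | FEx x f | FAll x f => qF x (clFO f)
  end.

Definition clFOT : table := @mkT 17 isT
  (fun q k j _ _ => match q with
    | 0 => match k with
       | 0 => if j == 0 then 1 else 2
       | 1 => if j == 0 then 5 else 4
       | 2 | 3 | 4 => 0
       | _ => if j == 0 then 7 else 0 end
    | 2 => if (k == 2) && (j == 0) then 3 else 4
    | _ => 6 end)
  (fun _ _ => true) (fun _ _ _ => true)
  (fun q => match q with
    | 4 => lfS | 6 => sPre pAnd lfS | 7 => qS | _ => [::] end)
  (fun q k _ => match q with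
    | 0 => match k with 3 | 4 => pAnd | _ => [::] end
    | 2 => if k == 2 then [::] else pAnd
    | _ => [::] end).

Lemma clFOTE f : trav clFOT 0 (fo_code f) = sE false (clFO f).
Proof.
elim: f => [b a|xs y|f IH|f IHf g IHg|f IHf g IHg|x f IH|x f IH].
- by case: a => [x y|x y|x y|x y]; rewrite /= ?sE_and !lfE ?seval0 ?cats0.
- rewrite [fo_code _]/= [trav _ _ _]/= cats0 (@trav_leaves _ _ 6) //.
  elim: xs => [|x xs IH] /=; first by rewrite lfE.
  by rewrite sE_and seval_pre lfE -!catA; do 2 congr (_ ++ _); exact: IH.
- by rewrite /= IH cats0.
- by rewrite /= sE_and IHf IHg cats0.
- by rewrite /= sE_and IHf IHg cats0.
- by rewrite /= cats0 IH qE.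
by rewrite /= cats0 IH qE.
Qed.

Fixpoint clSO (f : so) : arith :=
  match f with
  | SAtom a => clA a
  | SRel _ xs => foldr (fun x g => AAnd (lfF x) g) tt_ xs
  | SNot f | SExR _ _ f | SAllR _ _ f => clSO f
  | SAnd f g | SOr f g => AAnd (clSO f) (clSO g)
  | SEx x f | SAll x f => qF x (clSO f)
  end.

Definition clSOT : table := @mkT 17 isT
  (fun q k j _ l => match q with
    | 0 => match k with
       | 0 => 2
       | 1 => if j == 0 then 3 else 5
       | 2 | 3 | 4 => 0
       | 5 | 6 => if j == 0 then 7 else 0
       | _ => if j < 2 then 3 else 0 end
    | 2 => if (k == 2) && (j == 0) then 3 else 4
    | _ => if l then 8 else 6 end)
  (fun _ _ => true) (fun _ _ _ => true)
  (fun q => match q with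
    | 4 => lfS | 6 => sPre pAnd lfS | 7 => qS
    | 8 => sPost (sE false tt_) (sPre pAnd lfS) | _ => [::] end)
  (fun q k m => match q with
    | 0 => match k with 3 | 4 => pAnd | _ => [::] end
    | 2 => if k == 2 then [::] else pAnd
    | 5 => if m == 0 then sE false tt_ else [::]
    | _ => [::] end).

Lemma clSOTE f : trav clSOT 0 (so_code f) = sE false (clSO f).
Proof.
elim: f => [a|i xs|f IH|f IHf g IHg|f IHf g IHg|x f IH|x f IH|i k f IH|i k f IH].
- by case: a => [x y|x y|x y|x y]; rewrite /= ?sE_and !lfE ?seval0 ?cats0.
- rewrite [so_code _]/= [trav _ _ _]/= cats0 seval0 size_map.
  rewrite (@trav_leaves_last _ _ 6 8 (sE false tt_)); [|by move=> ? ? []|]; last first.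
    by move=> x; rewrite [outL _ _]/= seval_post.
  elim: xs => [|x xs IH] //=; rewrite sE_and seval_pre lfE -!catA.
  by do 2 congr (_ ++ _); exact: IH.
- by rewrite /= IH cats0.
- by rewrite /= sE_and IHf IHg cats0.
- by rewrite /= sE_and IHf IHg cats0.
- by rewrite /= cats0 IH qE.
- by rewrite /= cats0 IH qE.
- by rewrite /= cats0 IH !seval0.
by rewrite /= cats0 IH !seval0.
Qed.

End ClF.

Definition vS (x : nat) := ALe TZero (V x).
(** Here the name itself must be copied: the code of a leaf is its number in unary between two
    zeros. *)
Definition vseg : seg :=
  sPre (hdr 1 2 ++ sT TZero ++ hdr 0 1 ++ [:: false]) [:: ([::], [:: true]); ([:: false], [::])].
Definition qall (x : nat) (f : arith) := AAll O1 x f.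
Definition qseg : seg :=
  sPre (hdr 8 3 ++ ser (leaf 1) ++ [:: false]) [:: ([::], [:: true]); ([:: false], [::])].

Lemma flat_true n : flatten (nseq n [:: true]) = nseq n true.
Proof. by elim: n => //= n ->. Qed.

Lemma vsegE x : seval vseg x = sE false (vS x).
Proof.
rewrite seval_pre seval2 flat_true /sE /sT -!lock /=; serE.
by rewrite /ser /= /unary -cats1.
Qed.

Lemma qsegE x f : seval qseg x ++ sE false f = sE false (qall x f).
Proof.
rewrite seval_pre seval2 flat_true /sE -!lock /=; serE.
by rewrite /unary -cats1 -!catA.
Qed.

Lemma fvin_vS R x : fvin R (vS x) = R O1 x. Proof. by []. Qed.

Lemma fvin_clA R a : fvin R (clA vS a) = all (R O1) (atom_vars a).
Proof. by case: a => *; rewrite /= ?andbT. Qed.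

Lemma fvin_clL R f xs : fvin R (foldr (fun x g => AAnd (vS x) g) f xs) =
  all (R O1) xs && fvin R f.
Proof. by elim: xs => //= x xs ->; rewrite andbA. Qed.

Lemma ext_filter R x s : all (ext R O1 x O1) s = all (R O1) [seq y <- s | y != x].
Proof.
by rewrite all_filter; apply: eq_all => y; rewrite /ext /= eq_sym; case: eqP.
Qed.

Lemma fvin_clFO R f : fvin R (clFO vS qall f) = all (R O1) (fo_free f).
Proof.
elim: f R => [b a|xs y|f IH|f IHf g IHg|f IHf g IHg|x f IH|x f IH] R /=.
- exact: fvin_clA.
- by rewrite fvin_clL fvin_vS andbC.
- exact: IH.
- by rewrite IHf IHg all_cat.
- by rewrite IHf IHg all_cat.
- by rewrite IH ext_filter.
by rewrite IH ext_filter.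
Qed.

Lemma fvin_clSO R f : fvin R (clSO vS qall f) = all (R O1) (so_free f).
Proof.
elim: f R => [a|i xs|f IH|f IHf g IHg|f IHf g IHg|x f IH|x f IH|i k f IH|i k f IH] R /=.
- exact: fvin_clA.
- by rewrite fvin_clL andbT.
- exact: IH.
- by rewrite IHf IHg all_cat.
- by rewrite IHf IHg all_cat.
- by rewrite IH ext_filter.
- by rewrite IH ext_filter.
- exact: IH.
exact: IH.
Qed.

Lemma clA_true v1 v2 v3 a : arith_sat v1 v2 v3 (clA vS a).
Proof. by case: a. Qed.

Lemma clL_true v1 v2 v3 xs f : arith_sat v1 v2 v3 f ->
  arith_sat v1 v2 v3 (foldr (fun x g => AAnd (vS x) g) f xs).
Proof. by move=> h; elim: xs. Qed.

Lemma clFO_true f v1 v2 v3 : arith_sat v1 v2 v3 (clFO vS qall f).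
Proof.
elim: f v1 v2 v3 => [b a|xs y|f IH|f IHf g IHg|f IHf g IHg|x f IH|x f IH] v1 v2 v3 //=.
- exact: clA_true.
- exact: clL_true.
Qed.

Lemma clSO_true f v1 v2 v3 : arith_sat v1 v2 v3 (clSO vS qall f).
Proof.
elim: f v1 v2 v3 => [a|i xs|f IH|f IHf g IHg|f IHf g IHg|x f IH|x f IH|i k f IH|i k f IH] v1 v2 v3 //=.
- exact: clA_true.
- exact: clL_true.
Qed.

Lemma clA_so a : second_order (clA vS a). Proof. by case: a. Qed.
Lemma clL_so f xs : second_order f -> second_order (foldr (fun x g => AAnd (vS x) g) f xs).
Proof. by move=> h; elim: xs. Qed.
Lemma clFO_so f : second_order (clFO vS qall f).
Proof.
elim: f => [b a|xs y|f IH|f IHf g IHg|f IHf g IHg|x f IH|x f IH] //=; rewrite ?IHf ?IHg //.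
- exact: clA_so.
exact: clL_so.
Qed.
Lemma clSO_so f : second_order (clSO vS qall f).
Proof.
elim: f => [a|i xs|f IH|f IHf g IHg|f IHf g IHg|x f IH|x f IH|i k f IH|i k f IH] //=; rewrite ?IHf ?IHg //.
- exact: clA_so.
exact: clL_so.
Qed.

(** ** Three variables *)

Definition three : arith := AOr (AEq (V 3) (V 0)) (AOr (AEq (V 3) (V 1)) (AEq (V 3) (V 2))).
Definition lf3 (x : nat) := letn 3 x three.
Definition q3 (x : nat) (f : arith) := AAnd (lf3 x) f.
Definition chk3 (f : fo) := AEx O1 0 (AEx O1 1 (AEx O1 2 (clFO lf3 q3 f))).
Definition seg3 : seg := segL false 3 (sE false three).

Lemma seg3E x : seval seg3 x = sE false (lf3 x). Proof. exact: segLE. Qed.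
Lemma q3E x f : seval (sPre pAnd seg3) x ++ sE false f = sE false (q3 x f).
Proof. by rewrite seval_pre seg3E sE_and catA. Qed.

Lemma fvin_and R f g : fvin R (AAnd f g) = fvin R f && fvin R g.
Proof. by []. Qed.

Lemma fvin_chk3 R f : fvin R (chk3 f).
Proof.
rewrite /chk3 /=; suff H (Q : vars) : Q O1 0 -> Q O1 1 -> Q O1 2 ->
  fvin Q (clFO lf3 q3 f) by apply: H.
move=> q0 q1 q2.
have L x : fvin Q (lf3 x) by rewrite /lf3 fvin_letn /three; fvs; rewrite q0 q1 q2.
elim: f => [b a|xs y|f IH|f IHf g IHg|f IHf g IHg|x f IH|x f IH].
- by case: a => [x y|x y|i x|x y]; rewrite [clFO _ _ _]/= ?fvin_and ?L.
- rewrite [clFO _ _ _]/=; elim: xs => [|x xs IH]; first exact: L.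
  by rewrite [foldr _ _ _]/= fvin_and L IH.
- exact: IH.
- by rewrite /= IHf IHg.
- by rewrite /= IHf IHg.
- by apply/andP; split; [exact: L|exact: IH].
by apply/andP; split; [exact: L|exact: IH].
Qed.

Lemma chk3_so f : second_order (chk3 f).
Proof.
have L x : second_order (lf3 x) by rewrite /lf3 /letn.
rewrite /chk3 /=; elim: f => [b a|xs y|f IH|f IHf g IHg|f IHf g IHg|x f IH|x f IH].
- by case: a => [x y|x y|i x|x y]; rewrite [clFO _ _ _]/= /= ?L.
- by rewrite [clFO _ _ _]/=; elim: xs => [|x xs IH] /=; rewrite ?L.
- exact: IH.
- by rewrite /= IHf IHg.
- by rewrite /= IHf IHg.
- by apply/andP; split; [exact: L|exact: IH].
by apply/andP; split; [exact: L|exact: IH].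
Qed.

Lemma lf3P v1 v2 v3 x : arith_sat v1 v2 v3 (lf3 x) <-> x \in [:: v1 0; v1 1; v1 2].
Proof.
rewrite -gsat_id gletn !gor /= /upd /= !inE.
split=> [[->|[->|->]]|/or3P[] /eqP ->]; rewrite ?eqxx ?orbT //; [by left|by right;left|by right;right].
Qed.

Lemma clFO3P f v1 v2 v3 : arith_sat v1 v2 v3 (clFO lf3 q3 f) <->
  {subset fo_vars f <= [:: v1 0; v1 1; v1 2]}.
Proof.
have cat2 s1 s2 (P : seq nat) : {subset s1 ++ s2 <= P} <-> {subset s1 <= P} /\ {subset s2 <= P}.
  split=> [h|[h1 h2] x]; last by rewrite mem_cat => /orP[/h1|/h2].
  by split=> x xs; apply: h; rewrite mem_cat xs ?orbT.
have cons x s (P : seq nat) : {subset x :: s <= P} <-> x \in P /\ {subset s <= P}.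
  split=> [h|[h1 h2] y]; last by rewrite inE => /predU1P[->|/h2].
  by split=> [|y ys]; apply: h; rewrite inE ?eqxx ?ys ?orbT.
have nl (P : seq nat) : {subset [::] <= P} by [].
elim: f v1 v2 v3 => [b a|xs y|f IH|f IHf g IHg|f IHf g IHg|x f IH|x f IH] v1 v2 v3.
- have := nl [:: v1 0; v1 1; v1 2].
  by case: a => [x y|x y|i x|x y]; rewrite [clFO _ _ _]/= ?arith_and ?lf3P [fo_vars _]/= !cons; tauto.
- rewrite [clFO _ _ _]/= [fo_vars _]/= cons; elim: xs => [|x xs IH].
    by rewrite [foldr _ _ _]/= lf3P; have := nl [:: v1 0; v1 1; v1 2]; tauto.
  by rewrite [foldr _ _ _]/= arith_and IH lf3P cons; tauto.
- exact: IH.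
- by rewrite /= IHf IHg cat2.
- by rewrite /= IHf IHg cat2.
- by rewrite [clFO _ _ _]/= arith_and IH lf3P cons.
by rewrite [clFO _ _ _]/= arith_and IH lf3P cons.
Qed.

Lemma chk3P f v1 v2 v3 : arith_sat v1 v2 v3 (chk3 f) <-> size (undup (fo_vars f)) <= 3.
Proof.
rewrite /chk3; split=> [[a [b [c /clFO3P h]]]|].
  apply: (@uniq_leq_size _ _ [:: a; b; c]); first exact: undup_uniq.
  by move=> x; rewrite mem_undup => /h.
move=> s3; pose s := undup (fo_vars f).
(* If there are fewer than three variables, the default 0 completes the triple. *)
exists (nth 0 s 0), (nth 0 s 1), (nth 0 s 2); apply/clFO3P => x.
rewrite -mem_undup -/s /upd /= => xs.
have := nth_index 0 xs; have : index x s < 3 by apply: leq_trans s3; rewrite index_mem.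
by case: (index x s) => [|[|[|]]] // _ <-; rewrite !inE eqxx ?orbT.
Qed.

(** ** Relation variables *)

Definition cntF (x : nat) (f : arith) : arith :=
  AEx O1 3 (AAnd (AEq (V 3) (TAdd (V 1) TOne)) (AEx O1 1 (AAnd (AEq (V 1) (V 3)) f))).
Definition insF (f : arith) : arith :=
  AEx O2 31 (AAnd (AAll O1 4 (AIff (AIn2 (V 4) 31)
      (AOr (AIn2 (V 4) 30) (AEq (V 4) (tp (V 0) (V 1))))))
    (AEx O2 30 (AAnd (AAll O1 4 (AIff (AIn2 (V 4) 30) (AIn2 (V 4) 31))) f))).

(** The arity of a relation atom is the length of its list, which is nowhere written as a number and
    so cannot be copied into a name. Instead the set 30 collects the pairs of index and arity bound
    so far, and an atom counts its arguments and looks up its pair. *)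
Fixpoint relC (f : so) : arith :=
  match f with
  | SAtom _ => tt_
  | SRel i xs => letn 0 i (letn 1 0 (foldr cntF (AIn2 (tp (V 0) (V 1)) 30) xs))
  | SNot f | SEx _ f | SAll _ f => relC f
  | SAnd f g | SOr f g => AAnd (relC f) (relC g)
  | SExR i k f | SAllR i k f => letn 0 i (letn 1 k (insF (relC f)))
  end.
Definition relCl (f : so) : arith :=
  AEx O2 30 (AAnd (AAll O1 4 (ANot (AIn2 (V 4) 30))) (relC f)).

Lemma cntFP P (B : P -> set nat) v1 v2 v3 xs :
  gsat B v1 v2 v3 (foldr cntF (AIn2 (tp (V 0) (V 1)) 30) xs) <->
  B (v2 30) (pairn (v1 0) (v1 1 + size xs)).
Proof.
elim: xs v1 => [|x xs IH] v1; first by rewrite addn0 [foldr _ _ _]/= gin2 term_val_tp.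
rewrite [foldr _ _ _]/= gex1 [size _]/= -addSnnS; split=> [[a /gand[e /gex1[b /gand[e' /IH]]]]|h].
  by move: e e'; rewrite /= /upd /= addn1 => -> ->.
exists (v1 1).+1; apply/gand; split; first by rewrite /= /upd /= addn1.
by apply/gex1; exists (v1 1).+1; apply/gand; split=> //; apply/IH.
Qed.

Lemma insFP v1 v2 v3 f (Q : set nat -> Prop) :
  (forall w2 w3, gsat (P := set nat) id v1 w2 w3 f <-> Q (w2 30)) ->
  gsat (P := set nat) id v1 v2 v3 (insF f) <->
  Q [set k | v2 30 k \/ k = pairn (v1 0) (v1 1)]%classic.
Proof.
move=> fQ; rewrite /insF gex2; split=> [[D /gand[/gall1 h /gex2[D' /gand[/gall1 h' /fQ]]]]|q].
  suff -> : upd (upd v2 31 D) 30 D' 30 = [set k | v2 30 k \/ k = pairn (v1 0) (v1 1)]%classic by [].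
  apply: set_ext => k; rewrite updE; move: (h k) => /giff.
  rewrite gor !gin2 /= term_val_tp /= /upd /= => h2.
  by move: (h' k) => /giff; rewrite !gin2 /= /upd /= => ->.
exists [set k | v2 30 k \/ k = pairn (v1 0) (v1 1)]%classic; apply/gand; split.
  by apply/gall1 => k; apply/giff; rewrite gor !gin2 /= term_val_tp /= /upd /=.
apply/gex2; exists [set k | v2 30 k \/ k = pairn (v1 0) (v1 1)]%classic.
apply/gand; split; last exact/fQ.
by apply/gall1 => k; apply/giff.
Qed.

Lemma relCP f v1 v2 v3 : gsat (P := set nat) id v1 v2 v3 (relC f) <->
  forall X, X \in so_free_rel f -> v2 30 (pairn X.1 X.2).
Proof.
have cat2 s1 s2 (D : set nat) : (forall X, X \in s1 ++ s2 -> D (pairn X.1 X.2)) <->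
   (forall X, X \in s1 -> D (pairn X.1 X.2)) /\ (forall X, X \in s2 -> D (pairn X.1 X.2)).
  split=> [h|[h1 h2] x]; last by rewrite mem_cat => /orP[/h1|/h2].
  by split=> x xs; apply: h; rewrite mem_cat xs ?orbT.
have flt s i k (D : set nat) :
   (forall X, X \in s -> [set j | D j \/ j = pairn i k]%classic (pairn X.1 X.2)) <->
   (forall X, X \in [seq Y <- s | Y != (i, k)] -> D (pairn X.1 X.2)).
  split=> h [a b]; first by rewrite mem_filter => /andP[/eqP ne /h[//|/pairn_inj[ea eb]]]; case: ne; move: ea eb => /= -> ->.
  move=> abs; have [[-> ->]|/eqP ne] := (a, b) =P (i, k); first by right.
  by left; apply: (h (a, b)); rewrite mem_filter ne.
elim: f v1 v2 v3 => [a|i xs|f IH|f IHf g IHg|f IHf g IHg|x f IH|x f IH|i k f IH|i k f IH] v1 v2 v3.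
- by split.
- rewrite [relC _]/= !gletn cntFP /upd /= add0n; split=> [h X|h]; first by rewrite inE => /eqP->.
  by apply: (h (i, size xs)); rewrite inE.
- exact: IH.
- by rewrite [relC _]/= gand IHf IHg cat2.
- by rewrite [relC _]/= gand IHf IHg cat2.
- exact: IH.
- exact: IH.
- rewrite [relC _]/= !gletn (@insFP _ _ _ _ (fun D => forall X, X \in so_free_rel f -> D (pairn X.1 X.2))).
  exact: (flt (so_free_rel f) i k (v2 30)).
  by move=> w2 w3; apply: IH.
rewrite [relC _]/= !gletn (@insFP _ _ _ _ (fun D => forall X, X \in so_free_rel f -> D (pairn X.1 X.2))).
  exact: (flt (so_free_rel f) i k (v2 30)).
by move=> w2 w3; apply: IH.
Qed.

Lemma relClP f v1 v2 v3 : arith_sat v1 v2 v3 (relCl f) <-> so_free_rel f = [::].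
Proof.
rewrite -gsat_id /relCl gex2; split=> [[D /gand[/gall1 h /relCP]]|e].
  case: so_free_rel => // X s /(_ X); rewrite inE eqxx updE => /(_ isT) d.
  by case: (h (pairn X.1 X.2)).
exists set0; apply/gand; split; first by apply/gall1 => k; apply/gnot.
by apply/relCP => X; rewrite e.
Qed.

Lemma relC_so f : second_order (relC f).
Proof.
elim: f => [a|i xs|f IH|f IHf g IHg|f IHf g IHg|x f IH|x f IH|i k f IH|i k f IH] //=; rewrite ?IHf ?IHg //=.
  by rewrite /letn /=; elim: xs.
all: by rewrite /letn /= IH.
Qed.

Lemma fvin_relC (R : vars) f : R O2 30 -> fvin R (relC f).
Proof.
elim: f R => [a|i xs|f IH|f IHf g IHg|f IHf g IHg|x f IH|x f IH|i k f IH|i k f IH] R r //.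
- rewrite [relC _]/= !fvin_letn; suff H (Q : vars) : Q O1 0 -> Q O1 1 -> Q O2 30 ->
     fvin Q (foldr cntF (AIn2 (tp (V 0) (V 1)) 30) xs) by apply: H; rewrite /ext /= ?r.
  elim: xs {r} Q => [|x xs IH] Q q0 q1 q2; first by rewrite /= tin_tp /= q0 q1 q2.
  by rewrite /= /ext /= !q1 /=; apply: IH; rewrite ?q0 ?q2 ?orbT.
- exact: IH.
- by rewrite [relC _]/= [fvin _ _]/= IHf ?IHg.
- by rewrite [relC _]/= [fvin _ _]/= IHf ?IHg.
- exact: IH.
- exact: IH.
- by rewrite [relC _]/= /insF /AIff /AImp; fvs; rewrite r IH.
by rewrite [relC _]/= /insF /AIff /AImp; fvs; rewrite r IH.
Qed.

Definition pIns : seq bool := pEx false O2 31 ++ pAnd ++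
  sE false (AAll O1 4 (AIff (AIn2 (V 4) 31)
      (AOr (AIn2 (V 4) 30) (AEq (V 4) (tp (V 0) (V 1)))))) ++
  pEx false O2 30 ++ pAnd ++ sE false (AAll O1 4 (AIff (AIn2 (V 4) 30) (AIn2 (V 4) 31))).
Definition pCnt : seq bool := pEx false O1 3 ++ pAnd ++
  sE false (AEq (V 3) (TAdd (V 1) TOne)) ++ pEx false O1 1 ++ pAnd ++ sE false (AEq (V 1) (V 3)).
Definition inRel := sE false (AIn2 (tp (V 0) (V 1)) 30).

Definition relCT : table := @mkT 17 isT
  (fun q k j _ l => match q with
    | 0 => match k with
       | 0 => 2
       | 1 => if j == 0 then 3 else 5
       | 2 | 3 | 4 => 0
       | 5 | 6 => if j == 0 then 1 else 0
       | _ => match j with 0 => 8 | 1 => 9 | _ => 0 end end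
    | 2 => 1
    | _ => if l then 7 else 6 end)
  (fun _ _ => true) (fun _ _ _ => true)
  (fun q => match q with
    | 3 => segL false 0 (pLet false 1 ++ sT TZero)
    | 6 => [:: (pCnt, [::])] | 7 => [:: (pCnt ++ inRel, [::])]
    | 8 => segL false 0 [::]
    | 9 => segL false 1 pIns
    | _ => [::] end)
  (fun q k m => match q with
    | 0 => match k with 3 | 4 => pAnd | _ => [::] end
    | 2 => sE false tt_
    | 5 => if m == 0 then inRel else [::]
    | _ => [::] end).

Lemma relCTE f : trav relCT 0 (so_code f) = sE false (relC f).
Proof.
have cntE x f' : sE false (cntF x f') = pCnt ++ sE false f'.
  by rewrite /cntF sE_ex sE_and sE_ex sE_and /pCnt -!catA.
elim: f => [a|i xs|f IH|f IHf g IHg|f IHf g IHg|x f IH|x f IH|i k f IH|i k f IH].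
- by case: a => [x y|x y|x y|x y]; rewrite /= ?seval0 ?cats0.
- rewrite [so_code _]/= [relC _]/= sE_letn sE_letn [trav _ _ _]/= cats0 size_map.
  rewrite (@trav_leaves_last _ _ 6 7 inRel); [|by move=> ? ? []|]; last first.
    by move=> x; rewrite [outL _ _]/= !seval1 !flat_nil !cats0.
  rewrite !seval2 -!catA [flatten (nseq 0 _)]/= cat0s; do 5 congr (_ ++ _).
  elim: xs => [|x xs IH] //.
  by rewrite [foldr _ _ _]/= cntE [flatten _]/= seval1 flat_nil cats0 -catA IH.
- by rewrite /= IH cats0.
- by rewrite /= sE_and IHf IHg cats0.
- by rewrite /= sE_and IHf IHg cats0.
- by rewrite /= cats0 IH seval0.
- by rewrite /= cats0 IH seval0.
- rewrite [relC _]/= !sE_letn /insF !(sE_ex, sE_and) [trav _ _ _]/= cats0 IH !seval2 /pIns.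
  by rewrite -!catA.
rewrite [relC _]/= !sE_letn /insF !(sE_ex, sE_and) [trav _ _ _]/= cats0 IH !seval2 /pIns.
by rewrite -!catA.
Qed.

(** * The table of second-order logic *)

Section SOtable.
Variable m : bool.

Definition argS : seq bool :=
  sE m (AAnd (defF 0 (V 2)) (secF 1 (TAdd (TAdd TOne TOne) (V 1)) 0 (V 2))).
Definition cntS : seq bool := locked (pEx m O1 3 ++ pAnd ++
  sE m (AEq (V 3) (TAdd (V 1) TOne)) ++ pEx m O1 1 ++ pAnd ++ sE m (AEq (V 1) (V 3))).
Definition segArg : seg := sPost cntS (sPre pAnd (segL m 2 argS)).
Definition eqfS : seq bool := locked (pEx m O2 0 ++ pAnd ++ sE m (eqF 0 1)).

(** States: 0 formula; 1 atom; 2 its first entry; 3 to 6 its second entry, by tag; 7 index of a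
    relation atom; 8 to 10 its list, its entries and the last entry; 11, 12 quantified element; 13
    index of a quantified relation; 14, 15 its arity; 16 failure. *)
Definition semSOT : table := @mkT 17 isT
  (fun q k j _ l => match q with
    | 0 => match k with
       | 0 => 1
       | 1 => if j == 0 then 7 else 8
       | 2 | 3 | 4 => 0
       | 5 => if j == 0 then 11 else 0
       | 6 => if j == 0 then 12 else 0
       | 7 => match j with 0 => 13 | 1 => 14 | _ => 0 end
       | _ => match j with 0 => 13 | 1 => 15 | _ => 0 end end
    | 1 => atomD 2 k j
    | 8 => if l then 10 else 9
    | _ => 16 end)
  (fun q n => match q with 0 | 1 | 8 | 16 => false | _ => true end)
  (fun q k n => match q with
    | 0 => (k, n) \in [:: (0, 1); (1, 2); (2, 1); (3, 2); (4, 2); (5, 2); (6, 2); (7, 3); (8, 3)]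
    | 1 => atomOK true k n
    | 8 => k == 0
    | _ => false end)
  (fun q => match q with
    | 2 => segL m 0 [::]
    | 3 | 4 | 5 | 6 => segL m 1 (atomS m (q - 3))
    | 7 => segL m 0 (pEx m O2 1 ++ pAnd ++ sE m (AIn3 1 0) ++ pLet m 1 ++ sT TZero)
    | 9 => segArg
    | 10 => sPost (sE m (taggedF 1)) segArg
    | 11 => segL m 0 (pEx m O2 1 ++ pAnd ++ sE m exptF ++ eqfS)
    | 12 => segL m 0 (pAll m O2 1 ++ pOr ++ pNot ++ sE m exptF ++ eqfS)
    | 13 => segL m 0 [::]
    | 14 => segL m 1 (pEx m O3 2 ++ pAnd ++ sE m exrF ++ pBec m 2)
    | 15 => segL m 1 (pAll m O3 2 ++ pOr ++ pNot ++ sE m exrF ++ pBec m 2)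
    | _ => [::] end)
  (fun q k n => match q with
    | 0 => match k with 2 => pNot | 3 => pAnd | 4 => pOr | _ => [::] end
    | 8 => if n == 0 then sE m (taggedF 1) else [::]
    | _ => [::] end).

Lemma semSOT_bounded : bounded 18 semSOT. Proof. exact: mkT_bounded. Qed.

Lemma sE_arg x f : sE m (argF x f) = seval segArg x ++ sE m f.
Proof.
rewrite /argF sE_and sE_ex sE_and sE_ex sE_and seval_post seval_pre segLE /cntS -lock.
by rewrite -!catA.
Qed.

Lemma semSOTE f : trav semSOT 0 (so_code f) = sE m (semSO f).
Proof.
elim: f => [a|i xs|f IH|f IHf g IHg|f IHf g IHg|x f IH|x f IH|i k f IH|i k f IH].
- have [k [x [y [_ [ac [k4 aE]]]]]] := sE_atom m a.
  have c : cap k = k by rewrite /cap; lia.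
  rewrite [so_code _]/= ac [trav _ _ _]/= !cats0 c [semSO _]/= aE.
  by case: k k4 {ac aE c} => [|[|[|[|]]]].
- rewrite [so_code _]/= [semSO _]/= /relF sE_letn sE_ex sE_and sE_letn [trav _ _ _]/= cats0 size_map.
  rewrite (@trav_leaves_last _ _ 9 10 (sE m (taggedF 1))); [|by move=> ? ? []|]; last first.
    by move=> x; rewrite [outL _ _]/= seval_post.
  rewrite !seval2 -!catA [flatten (nseq 0 _)]/= cat0s; do 8 congr (_ ++ _).
  elim: xs => [|x xs IH] //.
  by rewrite [foldr _ _ _]/= sE_arg [flatten _]/= -catA IH.
- by rewrite [semSO _]/= sE_not /= IH cats0.
- by rewrite [semSO _]/= sE_and /= IHf IHg cats0.
- by rewrite [semSO _]/= sE_or /= IHf IHg cats0.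
- rewrite [semSO _]/= sE_letn (sE_ex m O2 1) sE_and (sE_ex m O2 0) sE_and.
  rewrite [trav _ _ _]/= cats0 IH segLE2 /eqfS -lock.
  by rewrite -!catA.
- rewrite [semSO _]/= sE_letn sE_all sE_imp (sE_ex m O2 0) sE_and.
  rewrite [trav _ _ _]/= cats0 IH segLE2 /eqfS -lock.
  by rewrite -!catA.
- rewrite [semSO _]/= !sE_letn sE_ex sE_and sE_bec [trav _ _ _]/= cats0 IH segLE2 seval2.
  by rewrite -!catA.
rewrite [semSO _]/= !sE_letn sE_all sE_imp sE_bec [trav _ _ _]/= cats0 IH segLE2 seval2.
by rewrite -!catA.
Qed.

Lemma okt_list2 (T : table) s q1 q2 ts j p : (forall j p l, s j p l = if l then q2 else q1) ->
  (forall k m, okN T q1 k m = false) -> (forall k m, okN T q2 k m = false) ->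
  children true andb (okt T) s j p ts -> exists xs, ts = map leaf xs.
Proof.
move=> sc n1 n2; elim: ts j p => [|t ts IH] j p; first by exists [::].
rewrite /= sc => /andP[h /IH[xs ->]]; case: t h => [n|k us] /=.
  by exists (n :: xs).
by case: (nilp _); rewrite ?n1 ?n2.
Qed.

Lemma okt_leaves2 (T : table) s q1 q2 xs j p : (forall j p l, s j p l = if l then q2 else q1) ->
  (forall n, okL T q1 n) -> (forall n, okL T q2 n) ->
  children true andb (okt T) s j p (map leaf xs).
Proof.
by move=> sc o1 o2; elim: xs j p => //= x xs IH j p; rewrite sc /= IH; case: (nilp _); rewrite ?o1 ?o2.
Qed.

Lemma semSOT_ok t : okt semSOT 0 t <-> exists2 f, t = so_code f & so_level_free f.
Proof.
have okA t' : okt semSOT 1 t' <-> exists2 a, t' = atom_code a & true -> level_free_atom a.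
  by apply: (@okt_atom true) => // -[|[|[|[|k]]]] [|[|j]].
elim/tree_ind: t => [n|k ts IH]; first by split=> [|[[]]].
split=> [|[f]].
  rewrite [okt _ _ _]/= cap_in // => /andP[].
  case: ts IH => [|t [|u [|v [|z ts]]]] IH km; try by move: km; rewrite !inE !xpair_eqE ?andbF.
  - have {km} [->|->] : k = 0 \/ k = 2 by arity km.
      by rewrite /= andbT => /okA[a -> /(_ isT) h]; exists (SAtom a).
    by rewrite /= andbT => /(IH _ in_0)[f -> h]; exists (SNot f).
  - have {km} k7 : 0 < k < 7 /\ k <> 2 by arity km.
    have IHt := IH t in_0; have IHu := IH u in_1.
    case: k {IH} k7 => [|[|[|[|[|[|[|k]]]]]]] // [] // _ _; rewrite /= andbT => /andP[].
    + case: t {IHt} => // i _; case: u {IHu} => // k us /andP[/eqP k0 h2].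
      have sc j p l : delta semSOT (minn 8 17) (cap k) j p l = if l then 10 else 9 by case: l.
      have [xs ->] := okt_list2 (T := semSOT) sc (fun _ _ => erefl) (fun _ _ => erefl) h2.
      exists (SRel i xs) => //=; congr (node 1 [:: _; node _ _]).
      by apply/eqP; rewrite -(@cap_eq k 0) // k0.
    + by move=> /IHt[f -> hf] /IHu[g -> hg]; exists (SAnd f g) => //=; rewrite hf.
    + by move=> /IHt[f -> hf] /IHu[g -> hg]; exists (SOr f g) => //=; rewrite hf.
    + by case: t {IHt} => // x _ /IHu[f -> hf]; exists (SEx x f).
    + by case: t {IHt} => // x _ /IHu[f -> hf]; exists (SAll x f).
  have {km} [->|->] : k = 7 \/ k = 8 by arity km.
    case: t IH => // i; case: u => // k' IH; rewrite /= andbT.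
    by move=> /(IH v in_2)[f -> h]; exists (SExR i k' f).
  case: t IH => // i; case: u => // k' IH; rewrite /= andbT.
  by move=> /(IH v in_2)[f -> h]; exists (SAllR i k' f).
case: f => [a|i xs|f|f g|f g|x f|x f|i k' f|i k' f] [-> tsE] h; subst ts; rewrite /= ?andbT.
- by apply/okA; exists a.
- by rewrite (@okt_leaves2 _ _ 9 10) //; move=> ? ? [].
- by apply/(IH _ in_0); exists f.
- have [hf hg] := andP h.
  by apply/andP; split; [apply/(IH _ in_0); exists f|apply/(IH _ in_1); exists g].
- have [hf hg] := andP h.
  by apply/andP; split; [apply/(IH _ in_0); exists f|apply/(IH _ in_1); exists g].
- by apply/(IH _ in_1); exists f.
- by apply/(IH _ in_1); exists f.
- by apply/(IH _ in_2); exists f.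
by apply/(IH _ in_2); exists f.
Qed.

End SOtable.

(** * The table of TeamLTL *)

Section LTLtable.
Variable m : bool.

Definition pSuf (X H : nat) : seq bool :=
  locked (pEx m O3 2 ++ pAnd ++ sE m (sufTF X H 2) ++ pBec m 2).

Lemma sE_suf X H f : sE m (becSuf X H f) = pSuf X H ++ sE m f.
Proof. by rewrite /becSuf sE_ex sE_and sE_bec /pSuf -lock -!catA. Qed.

(** States: 0 formula; 1 right disjunct; 2 right argument of until, which opens with the suffix
    team; 3 sign; 4 proposition; 5 failure. *)
Definition semLTLT : table := @mkT 17 isT
  (fun q k j _ _ => match q with
    | 0 | 1 | 2 => match k with
       | 0 => if j == 0 then 3 else 4
       | 3 => if j == 0 then 0 else 1
       | 7 => if j == 0 then 0 else 2
       | _ => 0 end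
    | _ => 5 end)
  (fun q n => match q with 3 => n <= 1 | 4 => true | _ => false end)
  (fun q k n => match q with
    | 0 | 1 | 2 => (k, n) \in [:: (0, 2); (1, 1); (2, 2); (3, 2); (4, 1); (5, 1); (6, 1); (7, 2)]
    | _ => false end)
  (fun q => match q with
    | 3 => [:: ([::], pNot)]
    | 4 => segL m 0 (sE m (memA 0 TZero TOne (V 0)))
    | _ => [::] end)
  (fun q k _ => match q with
    | 0 | 1 | 2 => match q with 1 => pBec m 3 | 2 => pSuf 0 3 | _ => [::] end ++ match k with
       | 0 => pAll m O2 0 ++ pOr ++ sE m (ANot (AIn3 0 0)) ++ pNot
       | 1 => pNot
       | 2 => pAnd
       | 3 => pEx m O3 2 ++ pEx m O3 3 ++ pAnd ++ sE m unF ++ pAnd ++ pBec m 2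
       | 4 => pEx m O3 2 ++ pAnd ++ sE m nextF ++ pBec m 2
       | 5 => pEx m O3 3 ++ pAnd ++ sE m (funF 0 3) ++ pSuf 0 3
       | 6 => pAll m O3 3 ++ pOr ++ pNot ++ sE m (funF 0 3) ++ pSuf 0 3
       | _ => pEx m O3 3 ++ pAnd ++ sE m (funF 0 3) ++ pAnd ++ pEx m O3 4 ++ pAnd ++ sE m posF ++
              pAll m O3 5 ++ pOr ++ pNot ++ sE m (AAnd (funF 4 5) ltF) ++ pSuf 4 5 end
    | _ => [::] end).

Lemma semLTLT_bounded : bounded 18 semLTLT. Proof. exact: mkT_bounded. Qed.

Lemma semLTLT_1 f : trav semLTLT 1 (ltl_code f) = pBec m 3 ++ trav semLTLT 0 (ltl_code f).
Proof. by case: f => *; rewrite /= -?catA. Qed.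
Lemma semLTLT_2 f : trav semLTLT 2 (ltl_code f) = pSuf 0 3 ++ trav semLTLT 0 (ltl_code f).
Proof. by case: f => *; rewrite /= -?catA. Qed.

Lemma semLTLTE f : trav semLTLT 0 (ltl_code f) = sE m (semLTL f).
Proof.
elim: f => [b i|f IH|f IHf g IHg|f IHf g IHg|f IH|f IH|f IH|f IHf g IHg].
- rewrite [trav _ _ _]/= !cats0 seval1 segLE -/(litF i) -!catA /=.
  by rewrite sE_all sE_or !sE_not sE_nots -!catA.
- by rewrite [semLTL _]/= sE_not /= IH cats0.
- by rewrite [semLTL _]/= sE_and /= IHf IHg cats0.
- rewrite [semLTL _]/= !sE_ex !sE_and !sE_bec [trav _ _ _]/= cats0.
  by rewrite semLTLT_1 IHf IHg -!catA.
- by rewrite [semLTL _]/= !sE_ex !sE_and !sE_bec [trav _ _ _]/= cats0 IH -!catA.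
- by rewrite [semLTL _]/= !sE_ex !sE_and !sE_suf [trav _ _ _]/= cats0 IH -!catA.
- by rewrite [semLTL _]/= !sE_all sE_imp !sE_suf [trav _ _ _]/= cats0 IH -!catA.
rewrite [semLTL _]/= (sE_ex m O3 3) (sE_and m (funF 0 3)) sE_and (sE_ex m O3 4).
rewrite (sE_and m posF) (sE_all m O3 5) sE_imp !sE_suf [trav _ _ _]/= cats0.
by rewrite semLTLT_2 IHf IHg -!catA.
Qed.

Lemma semLTLT_ok q t : q < 3 -> okt semLTLT q t <-> exists f, t = ltl_code f.
Proof.
elim/tree_ind: t q => [n|k ts IH] q q3.
  by split=> [|[[]]//]; case: q q3 => [|[|[]]].
have okE : okt semLTLT q (node k ts) = okt semLTLT 0 (node k ts) by case: q q3 => [|[|[]]].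
rewrite {}okE; split=> [|[f]].
  rewrite [okt _ _ _]/= cap_in // => /andP[].
  case: ts IH => [|t [|u [|v ts]]] IH km; try by move: km; rewrite !inE !xpair_eqE ?andbF.
    have {km} k7 : k = 1 \/ k = 4 \/ k = 5 \/ k = 6 by arity km.
    case: k7 => [->|[->|[->|->]]]; rewrite /= andbT => /(IH _ in_0 0 isT)[f ->];
    by [exists (LNot f)|exists (LNext f)|exists (LFin f)|exists (LGlob f)].
  have {km} k7 : k = 0 \/ k = 2 \/ k = 3 \/ k = 7 by arity km.
  have IHt := IH t in_0; have IHu := IH u in_1.
  case: k7 => [->|[->|[->|->]]]; rewrite /= andbT => /andP[].
  - case: t {IH IHt} => // n n1; case: u {IHu} => // i _.
    have {}n1 : n <= 1 by move: n1; rewrite /= /cap; lia.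
    by exists (LLit (n == 1) i) => /=; case: n n1 => [|[]].
  - by move=> /(IHt 0 isT)[f ->] /(IHu 0 isT)[g ->]; exists (LAnd f g).
  - by move=> /(IHt 0 isT)[f ->] /(IHu 1 isT)[g ->]; exists (LOr f g).
  by move=> /(IHt 0 isT)[f ->] /(IHu 2 isT)[g ->]; exists (LUntil f g).
case: f => [b i|f|f g|f g|f|f|f|f g] [-> tsE]; subst ts; rewrite /= ?andbT.
- by case: b IH.
- by apply/(IH _ in_0 0) => //; exists f.
- by apply/andP; split; [apply/(IH _ in_0 0) => //; exists f|apply/(IH _ in_1 0) => //; exists g].
- by apply/andP; split; [apply/(IH _ in_0 0) => //; exists f|apply/(IH _ in_1 1) => //; exists g].
- by apply/(IH _ in_0 0) => //; exists f.
- by apply/(IH _ in_0 0) => //; exists f.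
- by apply/(IH _ in_0 0) => //; exists f.
by apply/andP; split; [apply/(IH _ in_0 0) => //; exists f|apply/(IH _ in_1 2) => //; exists g].
Qed.

End LTLtable.

(** * Kripke structures *)

(** The data in the code of a Kripke structure, without the properties: words that pass the
    finite-state check are codes of such data, and the rest is up to the formula. *)
Definition kdata := (nat * seq (seq nat * seq nat))%type.

Definition dcode (D : kdata) : tree :=
  node 0 [:: leaf D.1; node 0 [seq node 0 [:: leaves w.1; leaves w.2] | w <- D.2]].

Definition addLF (p : nat) (f : arith) : arith :=
  letn 13 p (AEx O2 12 (AAnd (AAll O1 14 (AIff (AIn2 (V 14) 12)
      (AOr (AIn2 (V 14) 10) (AEq (V 14) (tp (V 10) (V 13))))))
    (AEx O2 10 (AAnd (AAll O1 14 (AIff (AIn2 (V 14) 10) (AIn2 (V 14) 12))) f)))).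
(** [kripke_code] lists successors in increasing order. Register 12 is a lower bound for the next
    one, so that no other list of the same successors is accepted. *)
Definition addRF (p : nat) (f : arith) : arith :=
  letn 13 p (AAnd (ALe (V 12) (V 13)) (AEx O2 12 (AAnd (AAll O1 14 (AIff (AIn2 (V 14) 12)
      (AOr (AIn2 (V 14) 11) (AEq (V 14) (tp (V 10) (V 13))))))
    (AEx O2 11 (AAnd (AAll O1 14 (AIff (AIn2 (V 14) 11) (AIn2 (V 14) 12)))
      (AEx O1 12 (AAnd (AEq (V 12) (TAdd (V 13) TOne)) f))))))).
(** The world counter is increased before a world is read, so worlds are numbered from 1, while
    successors are listed with numbers from 0. This causes the shifts by one in [pathF], [dL], [dR]
    and [dtraces]. *)
Definition incF (f : arith) : arith :=
  AEx O1 13 (AAnd (AEq (V 13) (TAdd (V 10) TOne)) (AEx O1 10 (AAnd (AEq (V 10) (V 13)) f))).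
Definition worldF (w : seq nat * seq nat) (f : arith) : arith :=
  incF (foldr addLF (letn 12 0 (foldr addRF f w.2)) w.1).
Definition noneF (p : nat) : arith := AAll O1 14 (ANot (AIn2 (V 14) p)).
Definition setupF (f : arith) : arith :=
  AEx O2 10 (AAnd (noneF 10) (AEx O2 11 (AAnd (noneF 11) (letn 10 0 f)))).
(** The set 13 is the graph of a run that produces the trace [0]; the sets 10 and 11 are the
    labelling and the transitions. *)
Definition pathF : arith :=
  AAnd (AAll O1 20 (AEx O1 21 (AAll O1 22 (AIff (AIn2 (tp (V 20) (V 22)) 13) (AEq (V 22) (V 21))))))
  (AAnd (AIn2 (tp TZero (TAdd (V 11) TOne)) 13)
  (AAnd (AAll O1 20 (AAll O1 21 (AAll O1 22 (AImp
      (AAnd (AIn2 (tp (V 20) (V 21)) 13) (AIn2 (tp (TAdd (V 20) TOne) (V 22)) 13))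
      (AEx O1 23 (AAnd (AEq (V 22) (TAdd (V 23) TOne)) (AIn2 (tp (V 21) (V 23)) 11)))))))
    (AAll O1 20 (AAll O1 21 (AImp (AIn2 (tp (V 20) (V 21)) 13)
      (AAll O1 22 (AIff (memA 0 TZero (TAdd (V 20) TOne) (V 22)) (AIn2 (tp (V 21) (V 22)) 10)))))))).
Definition finF : arith :=
  AAnd (ALe (TAdd (V 11) TOne) (V 10))
  (AAnd (AAll O1 20 (AAll O1 21 (AImp (AIn2 (tp (V 20) (V 21)) 11) (ALe (TAdd (V 21) TOne) (V 10)))))
    (AAll O2 0 (AIff (AIn3 0 1) (AAnd (wfF 0) (AEx O2 13 pathF))))).
Definition krF (D : kdata) : arith :=
  letn 11 D.1 (setupF (foldr worldF finF D.2)).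

Definition pUpdL : seq bool := locked (pEx false O2 12 ++ pAnd ++ sE false (AAll O1 14 (AIff (AIn2 (V 14) 12)
      (AOr (AIn2 (V 14) 10) (AEq (V 14) (tp (V 10) (V 13)))))) ++ pEx false O2 10 ++ pAnd ++
      sE false (AAll O1 14 (AIff (AIn2 (V 14) 10) (AIn2 (V 14) 12)))).
Definition pUpdR : seq bool := locked (pAnd ++ sE false (ALe (V 12) (V 13)) ++
   pEx false O2 12 ++ pAnd ++ sE false (AAll O1 14 (AIff (AIn2 (V 14) 12)
      (AOr (AIn2 (V 14) 11) (AEq (V 14) (tp (V 10) (V 13)))))) ++ pEx false O2 11 ++ pAnd ++
      sE false (AAll O1 14 (AIff (AIn2 (V 14) 11) (AIn2 (V 14) 12))) ++
   pEx false O1 12 ++ pAnd ++ sE false (AEq (V 12) (TAdd (V 13) TOne))).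
Definition pInc : seq bool := locked (pEx false O1 13 ++ pAnd ++ sE false (AEq (V 13) (TAdd (V 10) TOne)) ++
   pEx false O1 10 ++ pAnd ++ sE false (AEq (V 10) (V 13))).
Definition pSet : seq bool := locked (pEx false O2 10 ++ pAnd ++ sE false (noneF 10) ++
   pEx false O2 11 ++ pAnd ++ sE false (noneF 11) ++ pLet false 10 ++ sT TZero).

(** Totality of the transitions is checked here, as the condition that no list of successors is
    empty; ranges and order are left to [krF]. *)
Definition krT : table := @mkT 19 isT
  (fun q k j _ _ => match q with
    | 0 => if j == 0 then 1 else 2
    | 2 => 3
    | 3 => if j == 0 then 4 else 6
    | 4 => 5 | 6 => 7 | _ => 8 end)
  (fun q n => match q with 1 | 5 | 7 => true | _ => false end)
  (fun q k n => match q with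
    | 0 | 3 => (k, n) \in [:: (0, 2)]
    | 2 | 4 => k == 0
    | 6 => (k == 0) && (n != 0)
    | _ => false end)
  (fun q => match q with
    | 1 => segL false 11 pSet
    | 5 => segL false 13 pUpdL
    | 7 => segL false 13 pUpdR
    | _ => [::] end)
  (fun q k _ => match q with
    | 3 => pInc | 6 => pLet false 12 ++ sT TZero | _ => [::] end).

Lemma krT_bounded : bounded 20 krT. Proof. exact: mkT_bounded. Qed.

Lemma krTE D : trav krT 0 (dcode D) ++ sE false finF = sE false (krF D).
Proof.
have addLE p f : sE false (addLF p f) = seval (segL false 13 pUpdL) p ++ sE false f.
  by rewrite /addLF sE_letn !(sE_ex, sE_and) segLE2 /pUpdL -lock -!catA.
have addRE p f : sE false (addRF p f) = seval (segL false 13 pUpdR) p ++ sE false f.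
  by rewrite /addRF sE_letn !(sE_ex, sE_and) segLE2 /pUpdR -lock -!catA.
have lsE ls f : sE false (foldr addLF f ls) =
    flatten [seq seval (segL false 13 pUpdL) p | p <- ls] ++ sE false f.
  by elim: ls => //= p ls IH; rewrite addLE IH catA.
have rsE ls f : sE false (foldr addRF f ls) =
    flatten [seq seval (segL false 13 pUpdR) p | p <- ls] ++ sE false f.
  by elim: ls => //= p ls IH; rewrite addRE IH catA.
case: D => i ws; rewrite /dcode /krF sE_letn /setupF (sE_ex false O2 10).
rewrite (sE_and false (noneF 10)) (sE_ex false O2 11) (sE_and false (noneF 11)) sE_letn.
rewrite [trav _ _ _]/= !cats0 seval2 /pSet -lock -!catA [flatten (nseq 0 _)]/= cat0s.
do 11 congr (_ ++ _).
have s3 (s : nat -> nat -> bool -> nat) j p : (forall j p l, s j p l = 3) ->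
   children [::] cat (trav krT) s j p [seq node 0 [:: leaves w.1; leaves w.2] | w <- ws] ++
   sE false finF = sE false (foldr worldF finF ws).
  move=> sE; elim: ws j p => //= w ws IH j p; rewrite sE /= cats0 -!catA.
  rewrite IH /worldF /incF !(sE_ex, sE_and) lsE sE_letn rsE /pInc -lock -!catA.
  by rewrite (@trav_leaves _ _ 5) // (@trav_leaves _ _ 7).
exact: s3.
Qed.

Lemma krT_ok t : okt krT 0 t <-> exists2 D : kdata, t = dcode D & all (fun w => w.2 != [::]) D.2.
Proof.
have lv (q : nat) u : q = 4 \/ q = 6 -> okt krT q u <->
    exists2 xs, u = leaves xs & (q == 4) || (xs != [::]).
  move=> q46; split=> [|[xs -> nx]].
    case: u => [n|k us]; first by case: q46 => ->.
    move=> h; have [k0 [hn hc]] : k = 0 /\ (q == 4) || (us != [::]) /\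
       children true andb (okt krT) (fun _ _ _ => q.+1) 0 0 us.
      case: q46 h => ->; rewrite [okt _ _ _]/=.
        by rewrite cap_eq // => /andP[/eqP-> ->].
      by rewrite !cap_eq // => /andP[/andP[/eqP-> n0] ->]; split=> //; rewrite -size_eq0.
    have [||xs us_] := okt_list (T := krT) (s' := q.+1) _ _ hc => //; first by case: q46 => ->.
    exists xs; rewrite ?k0 ?us_ //; move: hn; rewrite us_; case: (q == 4) => //=.
    by case: (xs).
  case: q46 nx => -> /= nx; rewrite /leaves /=; first by rewrite (@okt_leaves _ _ 5).
  by rewrite (@okt_leaves _ _ 7) // cap_eq // size_map size_eq0 nx.
have wd u : okt krT 3 u <-> exists2 w, u = node 0 [:: leaves w.1; leaves w.2] & w.2 != [::].
  split=> [|[[ls ss] -> /= nx]]; last first.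
    rewrite -[is_true _]/(is_true [&& okt krT 4 (leaves ls), okt krT 6 (leaves ss) & true]) andbT //.
    apply/andP; split; first by apply/lv; [left|exists ls].
    by apply/lv; [right|exists ss].
  case: u => // k us; rewrite [okt _ _ _]/= cap_in // inE xpair_eqE => /andP[/andP[/eqP->]].
  case: us => [|a [|b [|c us]]] // _; rewrite /= andbT => /andP[].
  move=> /(lv 4 _ in_0)[ls -> _] /(lv 6 _ (or_intror erefl))[ss -> n0].
  by exists (ls, ss).
have wds us j p : children true andb (okt krT) (fun _ _ _ => 3) j p us <->
    exists2 ws, us = [seq node 0 [:: leaves w.1; leaves w.2] | w <- ws] & all (fun w : seq nat * seq nat => w.2 != [::]) ws.
  split=> [|[ws -> h]].
    elim: us j p => [|u us IH] j p; first by exists [::].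
    by move=> /andP[/wd[w -> n] /IH[ws -> h]]; exists (w :: ws) => //=; rewrite n.
  elim: ws j p h => // w ws IH j p /andP[n h].
  by apply/andP; split; [apply/wd; exists w|exact: IH].
split=> [|[[i ws] -> h]]; last first.
  by rewrite /dcode /= andbT; apply/wds; exists ws.
case: t => // k ts; rewrite [okt _ _ _]/= cap_in // inE xpair_eqE => /andP[/andP[/eqP->]].
case: ts => [|a [|b [|c us]]] // _; rewrite /= andbT => /andP[]; case: a => // i _.
case: b => [//|k' us]; rewrite [okt _ _ _]/= => /andP[]; rewrite cap_eq // => /eqP-> /wds[ws -> h].
by exists (i, ws).
Qed.

Fixpoint inc (m : nat) (ss : seq nat) : bool :=
  if ss is w :: ss then (m <= w) && inc w.+1 ss else true.

Local Open Scope classical_set_scope.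

Definition dL (D : kdata) (a p : nat) : Prop :=
  exists i w, [/\ onth D.2 i = Some w, p \in w.1 & a = i.+1].
Definition dR (D : kdata) (a b : nat) : Prop :=
  exists i w, [/\ onth D.2 i = Some w, b \in w.2 & a = i.+1].
Definition dtraces (D : kdata) : set trace :=
  [set t | exists s : nat -> nat, [/\ s 0 = D.1.+1,
     forall j, exists2 b, s j.+1 = b.+1 & dR D (s j) b &
     forall j p, t j p <-> dL D (s j) p]].
Definition dok (D : kdata) : Prop :=
  [/\ D.1 < size D.2, forall a b, dR D a b -> b < size D.2 & all (fun w => inc 0 w.2) D.2].

Section KrSem.
Variables (v3 : nat -> set (set nat)).
Notation gs := (gsat (P := set nat) id).
(** [krF] is written in continuation style, in the reading order of the code. [kcont] describes what
    remains to be read by the registers that it may consult: world counter, initial world, labels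
    and transitions so far. *)
Definition kcont (F : arith) (Q : nat -> nat -> set nat -> set nat -> Prop) :=
  forall v1 v2, gs v1 v2 v3 F <-> Q (v1 10) (v1 11) (v2 10) (v2 11).

Lemma exeq o1 (v1 : nat -> nat) v2 x t F n : o1 = O1 ->
  (forall a, term_val (upd v1 x a) t = n) ->
  gs v1 v2 v3 (AEx o1 x (AAnd (AEq (V x) t) F)) <-> gs (upd v1 x n) v2 v3 F.
Proof.
move=> -> tE; rewrite gex1; split=> [[a /gand[e h]]|h].
  by move: e h; rewrite /= updE tE => ->.
by exists n; apply/gand; split=> //=; rewrite updE tE.
Qed.

Lemma exset v1 v2 x y z (E : arith) F (A : set nat) : x != y -> y != z ->
  (forall k D, gs (upd v1 14 k) (upd v2 z D) v3 E <-> A k) -> x = z ->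
  gs v1 v2 v3 (AEx O2 x (AAnd (AAll O1 14 (AIff (AIn2 (V 14) x) E))
    (AEx O2 y (AAnd (AAll O1 14 (AIff (AIn2 (V 14) y) (AIn2 (V 14) x))) F)))) <->
  gs v1 (upd (upd v2 x A) y A) v3 F.
Proof.
move=> xy yz EA xz; subst z; rewrite gex2; split=> [[D /gand[/gall1 h /gex2[D' /gand[/gall1 h' hF]]]]|hF].
  have DA : D = A.
    by apply: set_ext => k; move: (h k) => /giff; rewrite gin2 EA /= !updE.
  have DA' : D' = A.
    apply: set_ext => k; move: (h' k) => /giff; rewrite !gin2 /= !updE DA.
    by rewrite /upd (negbTE xy) eqxx.
  by move: hF; rewrite DA DA'.
exists A; apply/gand; split.
  by apply/gall1 => k; apply/giff; rewrite gin2 EA /= !updE.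
apply/gex2; exists A; apply/gand; split=> //.
by apply/gall1 => k; apply/giff; rewrite !gin2 /= !updE /upd (negbTE xy) eqxx.
Qed.

Definition ins (c : nat) (A : set nat) (s : seq nat) : set nat :=
  [set k | A k \/ exists2 p, p \in s & k = pairn c p].

Lemma ins_cons c A p s : ins c [set k | A k \/ k = pairn c p] s = ins c A (p :: s).
Proof.
apply: set_ext => k; split=> [[[h|->]|[q qs ->]]|[h|[q]]].
- by left.
- by right; exists p; rewrite ?inE ?eqxx.
- by right; exists q; rewrite ?inE ?qs ?orbT.
- by left; left.
by rewrite inE => /predU1P[->|qs] ->; [left; right|right; exists q].
Qed.

Lemma addLsP F Q ls : kcont F Q -> kcont (foldr addLF F ls)
  (fun c i L R => Q c i (ins c L ls) R).
Proof.
move=> FQ; elim: ls => [|p ls IH] v1 v2.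
  rewrite [foldr _ _ _]/= FQ; suff -> : ins (v1 10) (v2 10) [::] = v2 10 by [].
  by apply: set_ext => k; split=> [[//|[p]]|]; [rewrite in_nil|left].
rewrite [foldr _ _ _]/= gletn (@exset _ _ 12 10 12 _ _ [set k | v2 10 k \/ k = pairn (v1 10) p]) //.
  by rewrite IH /upd /= ins_cons.
Qed.

Lemma addRsP F Q ls v1 v2 : kcont F Q -> gs v1 v2 v3 (foldr addRF F ls) <->
  inc (v1 12) ls /\ Q (v1 10) (v1 11) (v2 10) (ins (v1 10) (v2 11) ls).
Proof.
move=> FQ; elim: ls v1 v2 => [|p ls IH] v1 v2.
  rewrite [foldr _ _ _]/= FQ; have -> : ins (v1 10) (v2 11) [::] = v2 11.
    by apply: set_ext => k; split=> [[//|[p]]|]; [rewrite in_nil|left].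
  by split=> [|[]].
rewrite [foldr _ _ _]/= gletn gand (@exset _ _ 12 11 12 _ _ [set k | v2 11 k \/ k = pairn (v1 10) p]) //.
  rewrite (@exeq O1 _ _ 12 _ _ p.+1) //; last by move=> a; rewrite /= /upd /= addn1.
  rewrite IH -[gs (upd v1 13 p) v2 v3 (ALe (V 12) (V 13))]/(is_true (v1 12 <= p)) /upd /= ins_cons.
  by split=> [[-> [-> ?]]|[/andP[-> ->] ?]].
Qed.

Lemma worldsP F Q ws : kcont F Q -> kcont (foldr worldF F ws) (fun c i L R =>
  all (fun w => inc 0 w.2) ws /\ Q (c + size ws) i
   [set k | L k \/ exists j w p, [/\ onth ws j = Some w, p \in w.1 & k = pairn (c + j.+1) p]]
   [set k | R k \/ exists j w p, [/\ onth ws j = Some w, p \in w.2 & k = pairn (c + j.+1) p]]).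
Proof.
move=> FQ; elim: ws => [|w ws IH] v1 v2.
  rewrite [foldr _ _ _]/= FQ addn0.
  have e (A : set nat) (g : seq nat * seq nat -> seq nat) : [set k | A k \/ exists j (w : seq nat * seq nat) p,
     [/\ onth [::] j = Some w, p \in g w & k = pairn (v1 10 + j.+1) p]] = A.
    by apply: set_ext => k; split=> [[//|[j [w [p []]]]]|]; [rewrite onth0n|left].
  by rewrite (e _ fst) (e _ snd); split=> [|[]].
rewrite [foldr _ _ _]/= /worldF /incF.
rewrite (@exeq O1 _ _ 13 _ _ (v1 10).+1) //; last by move=> a; rewrite /= /upd /= addn1.
rewrite (@exeq O1 _ _ 10 _ _ (v1 10).+1) //.
have e c (A : set nat) (g : seq nat * seq nat -> seq nat) :
  [set k | ins c.+1 A (g w) k \/ exists j w p, [/\ onth ws j = Some w, p \in g w & k = pairn (c.+1 + j.+1) p]] =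
  [set k | A k \/ exists j w', exists p, [/\ onth (w :: ws) j = Some w', p \in g w' & k = pairn (c + j.+1) p]].
  apply: set_ext => k; split=> [[[h|[p pw ->]]|[j [w' [p [h1 h2 ->]]]]]|[h|[[|j] [w' [p [h1 h2 ->]]]]]].
  - by left.
  - by right; exists 0, w, p; rewrite addn1.
  - by right; exists j.+1, w', p; rewrite addSnnS.
  - by left; left.
  - by move: h1 h2 => /= -[<-] h2; left; right; exists p => //; rewrite addn1.
  by right; exists j, w', p; rewrite addSnnS.
have K : kcont (letn 12 0 (foldr addRF (foldr worldF F ws) w.2)) (fun c i L R =>
    inc 0 w.2 /\ (all (fun w => inc 0 w.2) ws /\ Q (c + size ws) i
   [set k | L k \/ exists j w p, [/\ onth ws j = Some w, p \in w.1 & k = pairn (c + j.+1) p]]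
   [set k | ins c R w.2 k \/ exists j w p, [/\ onth ws j = Some w, p \in w.2 & k = pairn (c + j.+1) p]])).
  by move=> w1 w2; rewrite gletn (addRsP _ _ _ IH).
rewrite (addLsP w.1 K) /= /upd /= (e _ _ fst) (e _ _ snd) addSnnS.
by split=> [[-> [-> ?]]|[/andP[-> ->] ?]].
Qed.

Lemma pathFP v1 v2 t L R i : v1 11 = i -> v2 10 = L -> v2 11 = R -> v2 0 = code (tr t 0) ->
  gs v1 v2 v3 (AEx O2 13 pathF) <-> exists s : nat -> nat, [/\ s 0 = i.+1,
     forall j, exists2 b, s j.+1 = b.+1 & R (pairn (s j) b) &
     forall j p, t j p <-> L (pairn (s j) p)].
Proof.
move=> vi vL vR v0; rewrite gex2; split=> [[S /gand[/gall1 h1 /gand[h2 /gand[/gall1 h3 /gall1 h4]]]]|[s [s0 s1 s2]]].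
  have : forall j, exists a, forall b, S (pairn j b) <-> b = a.
    move=> j; move: (h1 j) => /gex1[a /gall1 ha]; exists a => b.
    by move: (ha b) => /giff; rewrite gin2 term_val_tp.
  move=> /choice[s sE]; exists s; split.
  - move: h2; rewrite gin2 term_val_tp /= vi addn1 /upd /= => /sE //.
  - move=> j; move: (h3 j) => /gall1/(_ (s j))/gall1/(_ (s j.+1))/gimp.
    have e : gs (upd (upd (upd v1 20 j) 21 (s j)) 22 (s j.+1)) (upd v2 13 S) v3
      (AAnd (AIn2 (tp (V 20) (V 21)) 13) (AIn2 (tp (TAdd (V 20) TOne) (V 22)) 13)).
      by rewrite gand !gin2 !term_val_tp /= /upd /= addn1; split; apply/sE.
    move=> /(_ e)/gex1[b /gand[e1]]; rewrite gin2 term_val_tp => h.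
    exists b; first by move: e1; rewrite /= /upd /= addn1.
    by rewrite -vR.
  move=> j p; move: (h4 j) => /gall1/(_ (s j))/gimp.
  have e : gs (upd (upd v1 20 j) 21 (s j)) (upd v2 13 S) v3 (AIn2 (tp (V 20) (V 21)) 13).
    by rewrite gin2 term_val_tp; apply/sE.
  move=> /(_ e)/gall1/(_ p)/giff; rewrite gmem gin2 term_val_tp /= /upd /= v0 vL addn1.
  by move=> <-; rewrite codeE.
exists [set k | exists j, k = pairn j (s j)].
have sE j b : (exists j', pairn j b = pairn j' (s j')) <-> b = s j.
  by split=> [[j' /pairn_inj[-> ->]]|->]; [|exists j].
apply/gand; split; [|apply/gand; split; [|apply/gand; split]].
- apply/gall1 => j; apply/gex1; exists (s j); apply/gall1 => b; apply/giff.
  by rewrite gin2 term_val_tp; exact: sE.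
- by rewrite gin2 term_val_tp /= vi addn1 -s0; exists 0.
- apply/gall1 => j; apply/gall1 => a; apply/gall1 => b; apply/gimp; rewrite gand !gin2 !term_val_tp.
  rewrite /= /upd /= addn1 => -[/sE-> /sE->]; have [c sc Rc] := s1 j.
  by exists c; split; [rewrite addn1|rewrite term_val_tp vR].
apply/gall1 => j; apply/gall1 => a; apply/gimp; rewrite gin2 term_val_tp => /sE aE.
apply/gall1 => p; apply/giff; rewrite gmem gin2 term_val_tp /= /upd /= v0 vL addn1 codeE /=.
have {}aE : a = s j := aE.
by rewrite aE s2.
Qed.

Lemma krFP D T v1 v2 : v3 1 = trX T -> gs v1 v2 v3 (krF D) <-> dok D /\ T = dtraces D.
Proof.
move=> vT.
have FQ : kcont finF (fun c i L R => [/\ i < c, forall a b, R (pairn a b) -> b < c &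
    T = [set t | exists s : nat -> nat, [/\ s 0 = i.+1,
     forall j, exists2 b, s j.+1 = b.+1 & R (pairn (s j) b) &
     forall j p, t j p <-> L (pairn (s j) p)]]]).
  move=> w1 w2; rewrite /finF !gand.
  have -> : gs w1 w2 v3 (ALe (TAdd (V 11) TOne) (V 10)) <-> w1 11 < w1 10 by rewrite /= addn1.
  have -> : gs w1 w2 v3 (AAll O1 20 (AAll O1 21 (AImp (AIn2 (tp (V 20) (V 21)) 11) (ALe (TAdd (V 21) TOne) (V 10)))))
     <-> forall a b, w2 11 (pairn a b) -> b < w1 10.
    split=> [/gall1 h a b|h]; last apply/gall1 => a; last apply/gall1 => b; last apply/gimp.
      by move: (h a) => /gall1/(_ b)/gimp; rewrite gin2 term_val_tp /= addn1.
    by rewrite gin2 term_val_tp /= addn1; exact: h.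
  have -> : gs w1 w2 v3 (AAll O2 0 (AIff (AIn3 0 1) (AAnd (wfF 0) (AEx O2 13 pathF)))) <->
    T = [set t | exists s : nat -> nat, [/\ s 0 = (w1 11).+1,
     forall j, exists2 b, s j.+1 = b.+1 & w2 11 (pairn (s j) b) &
     forall j p, t j p <-> w2 10 (pairn (s j) p)]].
    split=> [/gall2 h|TE].
      apply/funext => t; apply/propext; move: (h (code (tr t 0))) => /giff.
      rewrite gin3 gand wfFP (@pathFP _ _ t (w2 10) (w2 11) (w1 11)) // vT updE => e.
      split=> [Tt|hs]; first by have [_] := e.1 (ex_intro2 _ _ t Tt erefl).
      by have [t' Tt' /code_inj/tr_inj[<- _]] := e.2 (conj (ex_intro _ t erefl) hs).
    apply/gall2 => A; apply/giff; rewrite gin3 gand wfFP updE vT.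
    split=> [[t Tt <-]|[[t tA] hp]].
      split; first by exists t.
      by apply/(@pathFP _ _ t (w2 10) (w2 11) (w1 11)) => //; move: Tt; rewrite TE.
    exists t; last by rewrite -tA.
    by rewrite TE; apply/(@pathFP _ _ t (w2 10) (w2 11) (w1 11)); last exact: hp.
  by split=> [[? []]|[]].
rewrite /krF gletn /setupF gex2.
have none p w1 w2 : gs w1 w2 v3 (noneF p) <-> w2 p = set0.
  rewrite /noneF gall1; split=> [h|h k]; last by rewrite gnot gin2 h.
  by apply: set_ext => k; split=> // hk; case: (h k).
have E w1 w2 : w1 11 = D.1 -> w1 10 = 0 -> w2 10 = set0 -> w2 11 = set0 ->
    gs w1 w2 v3 (foldr worldF finF D.2) <-> dok D /\ T = dtraces D.
  move=> e1 e2 e3 e4; rewrite (worldsP D.2 FQ) e1 e2 e3 e4 add0n.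
  have LE (g : seq nat * seq nat -> seq nat) a p : [set k | set0 k \/ exists j w p,
      [/\ onth D.2 j = Some w, p \in g w & k = pairn (0 + j.+1) p]] (pairn a p) <->
      exists i w, [/\ onth D.2 i = Some w, p \in g w & a = i.+1].
    split=> [[//|[j [w [q [h1 h2 /pairn_inj[-> ->]]]]]]|[j [w [h1 h2 ->]]]]; first by exists j, w.
    by right; exists j, w, p.
  have tE : dtraces D = [set t | exists s : nat -> nat, [/\ s 0 = D.1.+1,
     forall j, exists2 b, s j.+1 = b.+1 & [set k | set0 k \/ exists j w p,
      [/\ onth D.2 j = Some w, p \in w.2 & k = pairn (0 + j.+1) p]] (pairn (s j) b) &
     forall j p, t j p <-> [set k | set0 k \/ exists j w p,
      [/\ onth D.2 j = Some w, p \in w.1 & k = pairn (0 + j.+1) p]] (pairn (s j) p)]].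
    apply: set_ext => t; split=> -[s [s0 s1 s2]]; exists s; split=> //.
    - by move=> j; have [b sb hb] := s1 j; exists b => //; apply/(LE snd).
    - by move=> j p; rewrite s2; symmetry; exact: (LE fst).
    - by move=> j; have [b sb /(LE snd) hb] := s1 j; exists b.
    by move=> j p; rewrite s2; exact: (LE fst).
  rewrite tE /dok; split=> [[h0 [h1 h2 h3]]|[[h1 h2 h0] h3]].
    by split=> //; split=> // a b hab; apply: (h2 a); apply/(LE snd).
  by split=> //; split=> // a b /(LE snd); exact: h2.
split=> [[L /gand[/none L0 /gex2[R /gand[/none R0 /gletn]]]]|h].
  by rewrite E.
exists set0; apply/gand; split; first exact/none.
by apply/gex2; exists set0; apply/gand; split; [apply/none|apply/gletn; rewrite E].
Qed.

End KrSem.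

Definition dataof (K : kripke) : kdata :=
  (val (kinit K), [seq (klabel w, [seq val w' | w' <- enum 'I_(kworlds K) & ktrans w w'])
                  | w <- enum 'I_(kworlds K)]).

Lemma dcode_dataof K : dcode (dataof K) = kripke_code K.
Proof. by rewrite /dcode /kripke_code /= -map_comp. Qed.

Lemma onth_dataof K i w : onth (dataof K).2 i = Some w <->
  exists2 x : 'I_(kworlds K), i = val x & w = (klabel x, [seq val w' | w' <- enum 'I_(kworlds K) & ktrans x w']).
Proof.
rewrite /= onth_map; split=> [|[x -> ->]]; last first.
  rewrite (_ : onth (enum 'I_(kworlds K)) (val x) = Some x) //.
  have := onthTE (enum 'I_(kworlds K)) (val x); rewrite size_enum_ord ltn_ord.
  case e: (onth _ _) => [y|//] _; rewrite -(@onth_nth _ x y _ _ e).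
  by congr Some; apply: nth_ord_enum.
case e: (onth _ i) => [x|//] [<-]; exists x => //.
have iK : i < kworlds K by have := onthTE (enum 'I_(kworlds K)) i; rewrite e size_enum_ord.
have := @onth_nth _ (kinit K) x _ _ e => <-; by rewrite nth_enum_ord.
Qed.

Lemma inc_sorted m ss : inc m ss = all (leq m) ss && sorted ltn ss.
Proof.
elim: ss m => //= w ss IH m; rewrite IH /= (path_sortedE ltn_trans).
case: (leqP m w) => //= mw; rewrite -[all (leq w.+1) ss]/(all (ltn w) ss).
case a: (all (ltn w) ss) => /=; last by rewrite andbF.
by rewrite (sub_all _ a) // => x wx; apply: leq_trans mw (ltnW wx).
Qed.

Lemma sorted_enum n (p : pred 'I_n) : sorted ltn [seq val x | x <- enum 'I_n & p x].
Proof.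
have : sorted ltn [seq val x | x <- enum 'I_n] by rewrite val_enum_ord iota_ltn_sorted.
exact: subseq_sorted ltn_trans _ _ (map_subseq val (filter_subseq p _)).
Qed.

Lemma dok_dataof K : dok (dataof K) /\ all (fun w => w.2 != [::]) (dataof K).2.
Proof.
split; first split.
- by rewrite /= size_map size_enum_ord ltn_ord.
- move=> a b [i [w [/onth_dataof[x _ ->] /= /mapP[y _ ->] _]]].
  by rewrite size_map size_enum_ord ltn_ord.
- apply/allP => w /= /mapP[x _ ->] /=; rewrite inc_sorted sorted_enum andbT.
  by apply/allP.
apply/allP => w /= /mapP[x _ ->] /=; have [y xy] := ktotal x.
have : val y \in [seq val w' | w' <- enum 'I_(kworlds K) & ktrans x w'].
  by apply/mapP; exists y => //; rewrite mem_filter xy mem_enum.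
by case: [seq _ | _ <- _ & _].
Qed.

Lemma dtraces_dataof K : dtraces (dataof K) = traces K.
Proof.
apply: set_ext => t; split=> [[s [s0 s1 s2]]|[pi [p0 p1 p2]]].
  have sx j : exists x : 'I_(kworlds K), s j = (val x).+1.
    by have [b _ [i [w [/onth_dataof[x -> _] _ ->]]]] := s1 j; exists x.
  have [pi piE] := choice sx; exists pi; split.
  - by apply: val_inj; have := piE 0; rewrite s0 => -[].
  - move=> j; have [b sb [i [w [/onth_dataof[x ix ->] /= /mapP[y]]]]] := s1 j.
    rewrite mem_filter => /andP[xy _] by_; rewrite piE ix => -[/val_inj->].
    by move: sb; rewrite piE by_ => -[/val_inj ->].
  move=> j p; apply/idP/idP => [/s2[i [w [/onth_dataof[x ix ->] /= h]]]|h].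
    by rewrite piE ix => -[/val_inj->].
  apply/s2; exists (val (pi j)); eexists; split; [apply/onth_dataof; exists (pi j); reflexivity|exact: h|exact: piE].
exists (fun j => (val (pi j)).+1); split.
- by rewrite p0.
- move=> j; exists (val (pi j.+1)) => //; exists (val (pi j)); eexists; split=> //.
    by apply/onth_dataof; exists (pi j).
  by apply/mapP; exists (pi j.+1) => //; rewrite mem_filter p1 mem_enum.
move=> j p; rewrite p2; split=> [h|[i [w [/onth_dataof[x -> ->] h [/val_inj->]]]]//].
exists (val (pi j)); eexists; split=> //; first by apply/onth_dataof; exists (pi j).
exact: h.
Qed.

(** The checks are exact. In particular an increasing list of successors is determined by its
    members, so it is the one that [kripke_code] produces. *)
Lemma dataof_onto D : dok D -> all (fun w => w.2 != [::]) D.2 -> exists K, dataof K = D.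
Proof.
case: D => i ws [/= i0 Rn incs] ne.
pose nt (w : 'I_(size ws)) := nth ([::], [::]) ws w.
have nin (w : 'I_(size ws)) : nt w \in ws by apply: mem_nth.
have lt (w : 'I_(size ws)) b : b \in (nt w).2 -> b < size ws.
  move=> h; apply: (Rn (val w).+1); exists (val w), (nt w); split=> //.
  by rewrite /= onthE (nth_map ([::], [::])).
have tot (w : 'I_(size ws)) : exists w' : 'I_(size ws), val w' \in (nt w).2.
  have := allP ne _ (nin w); case e: (nt w).2 => [|b s] // _.
  have bl : b < size ws by apply: (lt w); rewrite e inE eqxx.
  by exists (Ordinal bl); rewrite inE eqxx.
exists (@Kripke (size ws) (Ordinal i0) (fun w w' => val w' \in (nt w).2) (fun w => (nt w).1) tot).
rewrite /dataof /=; congr (_, _).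
apply: (@eq_from_nth _ ([::], [::])); first by rewrite size_map size_enum_ord.
move=> j; rewrite size_map size_enum_ord => js.
rewrite (nth_map (Ordinal js)) ?size_enum_ord //.
have -> : nth (Ordinal js) (enum 'I_(size ws)) j = Ordinal js.
  by apply: val_inj; rewrite /= nth_enum_ord.
have -> : nth ([::], [::]) ws j = nt (Ordinal js) by [].
case e: (nt (Ordinal js)) => [ls ss] /=; congr (_, _).
have := allP incs _ (nin (Ordinal js)); rewrite inc_sorted => /andP[_]; rewrite e /= => ss_s.
apply: (irr_sorted_eq ltn_trans ltnn) => //; first exact: sorted_enum.
move=> b; apply/mapP/idP => [[y]|bs]; first by rewrite mem_filter => /andP[h _] ->.
have bl : b < size ws by apply: (lt (Ordinal js)); rewrite e.
by exists (Ordinal bl) => //; rewrite mem_filter mem_enum andbT.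
Qed.

(** * Upper bounds *)

Lemma term_code_inj : injective term_code.
Proof.
elim=> [x|||t IHt u IHu|t IHt u IHu] [y|||t' u'|t' u'] //=.
- by case=> ->.
- by case=> /IHt-> /IHu->.
by case=> /IHt-> /IHu->.
Qed.

Lemma arith_code_inj : injective arith_code.
Proof.
elim=> [t u|t u|t x|x y|f IH|f IHf g IHg|f IHf g IHg|o x f IH|o x f IH]
  [t' u'|t' u'|t' x'|x' y'|f'|f' g'|f' g'|o' x' f'|o' x' f'] //=.
- by case=> /term_code_inj-> /term_code_inj->.
- by case=> /term_code_inj-> /term_code_inj->.
- by case=> /term_code_inj-> ->.
- by case=> -> ->.
- by case=> /IH->.
- by case=> /IHf-> /IHg->.
- by case=> /IHf-> /IHg->.
- by case=> /order_nat_inj-> -> /IH->.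
by case=> /order_nat_inj-> -> /IH->.
Qed.

Lemma ser_neq0 t : ser t <> [::].
Proof. by case: t. Qed.

Lemma sE0 f : sE false f = ser (arith_code f).
Proof. by rewrite /sE -lock. Qed.

Lemma true_and f g : true_in_N (AAnd f g) <-> true_in_N f /\ true_in_N g.
Proof.
rewrite /true_in_N /=; case: (arith_free f) (arith_free g) => [|a s] [|b s'] /=;
by split=> [[] //|[[] // ? ? [] // ? ?]]; try (move=> _ [h1 h2]).
Qed.

Lemma true_closed f : fvin (fun _ _ => false) f -> true_in_N f <->
  arith_sat (fun=> 0) (fun=> set0) (fun=> set0) f.
Proof. by move=> /fvin_closed e; split=> [[]|h]. Qed.

Lemma traces_neq0 K : traces K !=set0.
Proof.
have [g gP] := choice (@ktotal K).
by exists (fun j p => p \in klabel (iter j g (kinit K))), (fun j => iter j g (kinit K)); split.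
Qed.

Lemma fvin_ex R o x f : fvin R (AEx o x f) = fvin (ext R o x) f.
Proof. by []. Qed.

Lemma fvin_AxC R : fvin R AxC.
Proof. by rewrite /AxC /wfF /emptyF; fvq. Qed.
Lemma fvin_AxT (R : vars) : R O3 1 -> fvin R AxT.
Proof. by move=> r; rewrite /AxT /wfF; fvq; rewrite r. Qed.
Lemma fvin_top R s K : (forall R : vars, R O3 1 -> fvin R s /\ fvin R K) ->
  fvin R (top s K).
Proof.
move=> h; rewrite /top fvin_ex (fvin_and _ (AAnd AxC AxT)) (fvin_and _ AxC) (fvin_and _ s).
rewrite fvin_AxC fvin_AxT //.
by have [|-> ->] := h (ext R O3 1).
Qed.
Lemma fvin_top2 R s : (forall R : vars, R O3 1 -> fvin R s) -> fvin R (top2 s).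
Proof.
move=> h; rewrite /top2 fvin_ex; apply: (@fvin_cmp (fun _ _ => false)) => //.
by apply: fvin_top => Q q; split=> //; apply: h.
Qed.

Lemma fvin_krF (R : vars) D : R O3 1 -> fvin R (krF D).
Proof.
move=> r; rewrite /krF fvin_letn /setupF /noneF; fvs.
suff H (Q : vars) : Q O3 1 -> Q O2 10 -> Q O2 11 -> Q O1 10 -> Q O1 11 ->
   fvin Q (foldr worldF finF D.2) by apply: H; rewrite /ext /= ?r ?orbT.
have fin (S : vars) : [&& S O3 1, S O2 10, S O2 11, S O1 10 & S O1 11] -> fvin S finF.
  move=> /and5P[s1 s2 s3 s4 s5].
  by rewrite /finF /pathF /wfF; fvq; rewrite s1 s2 s3 s4 s5.
pose G F := forall S : vars, [&& S O3 1, S O2 10, S O2 11, S O1 10 & S O1 11] -> fvin S F.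
have gL F ls : G F -> G (foldr addLF F ls).
  move=> gF; elim: ls => //= p ls IH S /and5P[s1 s2 s3 s4 s5].
  by rewrite /addLF /AIff /AImp; fvs; rewrite s2 s4 /= IH //= s1 s3 s4 s5 ?orbT.
have gR F ls : G F -> forall S : vars, S O1 12 ->
    [&& S O3 1, S O2 10, S O2 11, S O1 10 & S O1 11] -> fvin S (foldr addRF F ls).
  move=> gF; elim: ls => [|p ls IH] S s12 h; first exact: gF.
  move: (h) => /and5P[s1 s2 s3 s4 s5]; rewrite [foldr _ _ _]/= /addRF /AIff /AImp; fvs.
  by rewrite ?s12 ?s3 ?s4 /= IH //= ?s1 ?s2 ?s3 ?s4 ?s5 ?orbT.
have g ws : G (foldr worldF finF ws).
  elim: ws => [|w ws IH]; first exact: fin.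
  move=> S /and5P[s1 s2 s3 s4 s5]; rewrite [foldr _ _ _]/= /worldF /incF; fvs.
  rewrite s4 /=; apply: gL => [S'|]; last by rewrite /= s1 s2 s3 s5 ?orbT.
  move=> /and5P[q1 q2 q3 q4 q5]; rewrite fvin_letn; apply: gR => //.
  by rewrite /ext /= q1 q2 q3 q4 q5 ?orbT.
by move=> q1 q2 q3 q4 q5; apply: g; rewrite q1 q2 q3 q4 q5.
Qed.

Section Upper.
Variables (L : logic) (wf : form L -> Prop) (T : bool -> table) (sem : form L -> arith)
  (pst : bool -> seq bool) (cl : form L -> arith) (pcl : seq (seq bool * table)) (fcl : seq bool).
Hypotheses (Tb : forall m, bounded 18 (T m))
  (Tok : forall m t, okt (T m) 0 t <-> exists2 f, t = fcode f & wf f)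
  (TE : forall m f, sE m (sem f) = pst m ++ trav (T m) 0 (fcode f))
  (sP : forall P B, @start_spec P B (form L) (@models L) sem)
  (fvS : forall f (R : vars), R O3 1 -> fvin R (sem f))
  (clb : forall p, List.In p pcl -> bounded 18 p.2)
  (clE : forall f, flatten [seq p.1 ++ trav p.2 0 (fcode f) | p <- pcl] ++ fcl = sE false (cl f))
  (clso : forall f, second_order (cl f))
  (clP : forall f, sentence f <-> wf f /\ true_in_N (cl f)).

Definition pTop (m : bool) : seq bool :=
  pEx m O3 1 ++ pAnd ++ sE m (AAnd AxC AxT) ++ pAnd.

Lemma sE_top m f K : sE m (top (sem f) K) = pTop m ++ pst m ++ trav (T m) 0 (fcode f) ++ sE m K.
Proof. by rewrite /top sE_ex sE_and (sE_and m (sem f)) TE /pTop -!catA. Qed.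

Lemma ser_top2 f : sE false (top2 (sem f)) = pEx false O2 0 ++ sE true (top (sem f) tt_).
Proof. by rewrite /top2 sE_ex; congr (_ ++ _); rewrite /sE -!lock. Qed.

(** The output is the conjunction of [cl f], which is true exactly if the remaining conditions on
    sentences hold, and the translation. A word that fails the check goes to the empty word, which
    codes no arithmetic sentence. *)
Lemma sat_upper : logspace_reducible (satisfiability L) Delta30.
Proof.
have [F Fl FP] := logspace_trav (T false) ((pAnd, silent) :: pcl ++
   [:: (fcl ++ pTop false ++ pst false, T false)]) (sE false tt_).
have FE f w : wf f -> w = ser (fcode f) ->
    F w = ser (arith_code (AAnd (cl f) (top (sem f) tt_))).
  move=> wff e; rewrite (proj1 (FP w) (fcode f) e); last by apply/Tok; exists f.
  rewrite -sE0 sE_and -clE sE_top /= trav_silent map_cat flatten_cat /= !cats0 -!catA.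
  by [].
have tr f : true_in_N (top (sem f) tt_) <-> exists T0, T0 !=set0 /\ models T0 f.
  rewrite true_closed; last by apply: fvin_top => R r; split=> //; apply: fvS.
  rewrite (top3P _ _ _ _ _ (@sP _ _)); split=> [[T0 [h1 h2 _]]|[T0 [h1 h2]]]; exists T0; split=> //.
exists F => // w; split=> [[f [/clP[wff cf] e h]]|[phi pt e]].
  exists (AAnd (cl f) (top (sem f) tt_)); last exact: FE.
  by apply/true_and; split=> //; apply/tr.
have [[t [wt /Tok[f tf wff]]]|n] := pselect (exists t, w = ser t /\ okt (T false) 0 t); last first.
  case: (@ser_neq0 (arith_code phi)); rewrite -e; apply: (FP w).2 => t wt ot.
  by apply: n; exists t.
rewrite tf in wt; move: e; rewrite (FE f) // => /ser_inj/arith_code_inj e.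
move: pt; rewrite -e => /true_and[cf /tr h]; exists f; split=> //.
by apply/clP.
Qed.

Lemma csat_upper : logspace_reducible (countable_satisfiability L) Delta20.
Proof.
have [F Fl FP] := logspace_trav (T true) ((pAnd, silent) :: pcl ++
   [:: (fcl ++ pEx false O2 0 ++ pTop true ++ pst true, T true)]) (sE true tt_).
have FE f w : wf f -> w = ser (fcode f) ->
    F w = ser (arith_code (AAnd (cl f) (top2 (sem f)))).
  move=> wff e; rewrite (proj1 (FP w) (fcode f) e); last by apply/Tok; exists f.
  rewrite -sE0 sE_and -clE ser_top2 sE_top /= trav_silent map_cat flatten_cat /= !cats0 -!catA.
  by [].
have tr f : true_in_N (top2 (sem f)) <-> exists T0, [/\ T0 !=set0, countable T0 & models T0 f].
  rewrite true_closed; last by apply: fvin_top2 => R r; apply: fvS.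
  exact: top2P.
exists F => // w; split=> [[f [/clP[wff cf] e h]]|[phi [_ pt e]]].
  exists (AAnd (cl f) (top2 (sem f))); split; [|by apply/true_and; split=> //; apply/tr|exact: FE].
  by rewrite /= clso cmp_second_order.
have [[t [wt /Tok[f tf wff]]]|n] := pselect (exists t, w = ser t /\ okt (T true) 0 t); last first.
  case: (@ser_neq0 (arith_code phi)); rewrite -e; apply: (FP w).2 => t wt ot.
  by apply: n; exists t.
rewrite tf in wt; move: e; rewrite (FE f) // => /ser_inj/arith_code_inj e.
move: pt; rewrite -e => /true_and[cf /tr h]; exists f; split=> //.
by apply/clP.
Qed.

Lemma mc_upper : logspace_reducible (model_checking L) Delta30.
Proof.
have sb n : bounded n.+1 silent by move=> q k j p l.
(* Each pass reads one component of the pair; [silent] goes over the other. *)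
have [F Fl FP] := logspace_trav (mc (T false) krT) ((pAnd, silent) :: [seq (p.1, mc p.2 silent) | p <- pcl] ++
   [:: (fcl ++ pTop false ++ pst false, mc (T false) silent); ([::], mc silent krT)]) (sE false finF).
have FE f D w : wf f -> all (fun w => w.2 != [::]) D.2 -> w = ser (node 0 [:: fcode f; dcode D]) ->
    F w = ser (arith_code (AAnd (cl f) (top (sem f) (krF D)))).
  move=> wff aD e; rewrite (proj1 (FP w) _ e); last first.
    apply/(okt_mc (Tb false) krT_bounded); exists (fcode f), (dcode D); split=> //.
      by apply/Tok; exists f.
    by apply/krT_ok; exists D.
  have E1 : trav (mc (T false) silent) 0 (node 0 [:: fcode f; dcode D]) = trav (T false) 0 (fcode f).
    by rewrite (trav_mc (Tb false) (sb _)) trav_silent cats0.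
  have E2 : trav (mc silent krT) 0 (node 0 [:: fcode f; dcode D]) = trav krT 0 (dcode D).
    by rewrite (trav_mc (sb _) krT_bounded) trav_silent.
  have E3 : flatten [seq p.1 ++ trav p.2 0 (node 0 [:: fcode f; dcode D]) |
      p <- [seq (p.1, mc p.2 silent) | p <- pcl]] =
      flatten [seq p.1 ++ trav p.2 0 (fcode f) | p <- pcl].
    elim: (pcl) clb => // p ps IH b; rewrite !map_cons [LHS]/(_ ++ _) [RHS]/(_ ++ _).
    congr (_ ++ _); last by apply: IH => q qs; apply: b; right.
    by congr (_ ++ _); rewrite (trav_mc _ (sb _)) ?trav_silent ?cats0 //; apply: b; left.
  move: (node 0 _) E1 E2 E3 => t0 E1 E2 E3.
  rewrite -sE0 sE_and -clE sE_top -krTE /= map_cat flatten_cat /= E1 E2 E3 trav_silent !cats0.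
  by rewrite -!catA.
have tr f D : true_in_N (top (sem f) (krF D)) <-> exists T0, [/\ T0 !=set0, models T0 f & dok D /\ T0 = dtraces D].
  rewrite true_closed; last by apply: fvin_top => R r; split; [apply: fvS|apply: fvin_krF].
  rewrite (top3P _ _ _ _ _ (@sP _ _)); split=> -[T0 [h1 h2 h3]]; exists T0; split=> //.
    by move: h3; rewrite -gsat_id (@krFP _ D T0).
  by rewrite -gsat_id (@krFP _ D T0).
exists F => // w; split=> [[f [K [/clP[wff cf] h e]]]|[phi pt e]].
  have [dK aK] := dok_dataof K.
  exists (AAnd (cl f) (top (sem f) (krF (dataof K)))); last first.
    by apply: FE => //; rewrite dcode_dataof.
  apply/true_and; split=> //; apply/tr; exists (traces K); split=> //.
    exact: traces_neq0.
  by rewrite dtraces_dataof.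
have [[t [wt /(okt_mc (Tb false) krT_bounded)[a [b [tab /Tok[f af wff] /krT_ok[D bD aD]]]]]]|n] :=
    pselect (exists t, w = ser t /\ okt (mc (T false) krT) 0 t); last first.
  case: (@ser_neq0 (arith_code phi)); rewrite -e; apply: (FP w).2 => t wt ot.
  by apply: n; exists t.
rewrite tab af bD in wt; move: e; rewrite (FE f D) // => /ser_inj/arith_code_inj e.
move: pt; rewrite -e => /true_and[cf /tr[T0 [h1 h2 [dD TE0]]]].
have [K KD] := dataof_onto dD aD; exists f, K; split.
- exact/clP.
- by rewrite -dtraces_dataof KD -TE0.
by rewrite wt -KD dcode_dataof.
Qed.

End Upper.

Definition upper (L : logic) := [/\ logspace_reducible (model_checking L) Delta30,
  logspace_reducible (satisfiability L) Delta30 &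
  logspace_reducible (countable_satisfiability L) Delta20].

Definition pStFO m : seq bool := pEx m O3 0 ++ pAnd ++ sE m (AAll O2 0 (AIff (AIn3 0 0) (emptyF 0))).
Definition pStSO m : seq bool := pEx m O3 0 ++ pEx m O2 0 ++ pAnd ++ sE m (emptyF 0) ++ pAnd ++
  sE m (AAll O2 1 (ANot (AIn3 1 0))).
Definition pStLTL m : seq bool := pEx m O3 0 ++ pAnd ++ sE m (eqT 0 1).

Lemma fvin_startFO f (R : vars) : R O3 1 -> fvin R ((startFO \o semFO) f).
Proof.
move=> r; rewrite [(_ \o _) _]/= /startFO /emptyF /AIff /AImp; fvs.
by rewrite fvin_semFO //= r orbT.
Qed.

Lemma fo_true f : true_in_N (clFO vS qall f) <-> fo_free f == [::].
Proof.
split=> [[h _]|/eqP h].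
  have : fvin (fun _ _ => false) (clFO vS qall f) by rewrite fvinP h.
  by rewrite fvin_clFO; case: (fo_free f).
split; last exact: clFO_true.
by apply: fvin_closed; rewrite fvin_clFO h.
Qed.

Lemma so_true f : true_in_N (clSO vS qall f) <-> so_free f == [::].
Proof.
split=> [[h _]|/eqP h].
  have : fvin (fun _ _ => false) (clSO vS qall f) by rewrite fvinP h.
  by rewrite fvin_clSO; case: (so_free f).
split; last exact: clSO_true.
by apply: fvin_closed; rewrite fvin_clSO h.
Qed.

Lemma fo_sE m f : sE m ((startFO \o semFO) f) = pStFO m ++ trav (semFOT m false) 0 (fo_code f).
Proof. by rewrite [(_ \o _) _]/= /startFO sE_ex sE_and semFOTE /pStFO -!catA. Qed.

Lemma fo_sE' m f : sE m ((startFO \o semFO) f) = pStFO m ++ trav (semFOT m true) 0 (fo_code f).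
Proof. by rewrite [(_ \o _) _]/= /startFO sE_ex sE_and semFOTE /pStFO -!catA. Qed.

Theorem FO_upper : upper FO_team.
Proof.
pose clT := clFOT vseg qseg.
have H1 m : bounded 18 (semFOT m true) by exact: semFOT_bounded.
have H2 m t : okt (semFOT m true) 0 t <-> exists2 f : form FO_team, t = fcode f & fo_level_free f.
  by rewrite semFOT_ok //; split=> -[f -> h]; exists f => //; exact: h.
have H3 p : List.In p [:: ([::] : seq bool, clT)] -> bounded 18 p.2.
  by case=> // <-; apply: mkT_bounded.
have H4 (f : form FO_team) : flatten [seq p.1 ++ trav p.2 0 (fcode f) | p <- [:: ([::] : seq bool, clT)]] ++ [::] =
    sE false (clFO vS qall f).
  by rewrite /= !cats0 (clFOTE vsegE qsegE).
have H5 (f : form FO_team) : sentence f <-> fo_level_free f /\ true_in_N (clFO vS qall f).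
  by rewrite fo_true /=; split=> [/andP[]|[-> ->]].
split; [exact: (mc_upper H1 H2 fo_sE' (fun P B => @startFOP P B) fvin_startFO H3 H4 H5)
  |exact: (sat_upper H2 fo_sE' (fun P B => @startFOP P B) fvin_startFO H4 H5)
  |exact: (csat_upper H2 fo_sE' (fun P B => @startFOP P B) fvin_startFO H4 clFO_so H5)].
Qed.

Theorem FO3_upper : upper FO3_team.
Proof.
pose ps := [:: (pAnd, clFOT vseg qseg);
  (pEx false O1 0 ++ pEx false O1 1 ++ pEx false O1 2, clFOT seg3 (sPre pAnd seg3))].
have H1 m : bounded 18 (semFOT m false) by exact: semFOT_bounded.
have H2 m t : okt (semFOT m false) 0 t <-> exists2 f : form FO3_team, t = fcode f & True.
  by rewrite semFOT_ok //; split=> -[f -> h]; exists f.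
have H3 p : List.In p ps -> bounded 18 p.2.
  by case=> [<-|[<-|//]]; apply: mkT_bounded.
have H4 (f : form FO3_team) : flatten [seq p.1 ++ trav p.2 0 (fcode f) | p <- ps] ++ [::] =
    sE false (AAnd (clFO vS qall f) (chk3 f)).
  rewrite /= !cats0 (clFOTE vsegE qsegE) (clFOTE seg3E q3E) sE_and /chk3 !sE_ex.
  by rewrite -!catA.
have H5 (f : form FO3_team) : sentence f <-> True /\ true_in_N (AAnd (clFO vS qall f) (chk3 f)).
  rewrite true_and fo_true (true_closed (fvin_chk3 _ f)) chk3P /=.
  by split=> [/andP[]|[_ [-> ->]]].
have H6 (f : form FO3_team) : second_order (AAnd (clFO vS qall f) (chk3 f)).
  by rewrite /= clFO_so; exact: chk3_so.
split; [exact: (mc_upper H1 H2 fo_sE (fun P B => @startFOP P B) fvin_startFO H3 H4 H5)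
  |exact: (sat_upper H2 fo_sE (fun P B => @startFOP P B) fvin_startFO H4 H5)
  |exact: (csat_upper H2 fo_sE (fun P B => @startFOP P B) fvin_startFO H4 H6 H5)].
Qed.

Lemma fvin_startSO f (R : vars) : R O3 1 -> fvin R ((startSO \o semSO) f).
Proof.
move=> r; rewrite [(_ \o _) _]/= /startSO /emptyF; fvs.
by rewrite fvin_semSO //= r ?orbT.
Qed.

Lemma so_sE m f : sE m ((startSO \o semSO) f) = pStSO m ++ trav (semSOT m) 0 (so_code f).
Proof.
rewrite [(_ \o _) _]/= /startSO (sE_ex m O3 0) (sE_ex m O2 0) !sE_and semSOTE /pStSO.
by rewrite -!catA.
Qed.

Theorem SO_upper : upper SO.
Proof.
pose ps := [:: (pAnd, clSOT vseg qseg);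
  (pEx false O2 30 ++ pAnd ++ sE false (AAll O1 4 (ANot (AIn2 (V 4) 30))), relCT)].
have H1 m : bounded 18 (semSOT m) by exact: semSOT_bounded.
have H2 m t : okt (semSOT m) 0 t <-> exists2 f : form SO, t = fcode f & so_level_free f.
  exact: semSOT_ok.
have H3 p : List.In p ps -> bounded 18 p.2.
  by case=> [<-|[<-|//]]; apply: mkT_bounded.
have H4 (f : form SO) : flatten [seq p.1 ++ trav p.2 0 (fcode f) | p <- ps] ++ [::] =
    sE false (AAnd (clSO vS qall f) (relCl f)).
  rewrite /= !cats0 (clSOTE vsegE qsegE) relCTE sE_and /relCl (sE_ex false O2 30).
  by rewrite (sE_and false (AAll _ _ _)) -!catA.
have fvR (f : form SO) : fvin (fun _ _ => false) (relCl f) by rewrite /relCl /= fvin_relC.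
have H5 (f : form SO) : sentence f <-> so_level_free f /\ true_in_N (AAnd (clSO vS qall f) (relCl f)).
  rewrite true_and so_true (true_closed (fvR f)) relClP /=.
  by split=> [/and3P[-> /eqP -> ->]|[-> [-> ->]]].
have H6 (f : form SO) : second_order (AAnd (clSO vS qall f) (relCl f)).
  by rewrite /= clSO_so relC_so.
split; [exact: (mc_upper H1 H2 so_sE (fun P B => @startSOP P B) fvin_startSO H3 H4 H5)
  |exact: (sat_upper H2 so_sE (fun P B => @startSOP P B) fvin_startSO H4 H5)
  |exact: (csat_upper H2 so_sE (fun P B => @startSOP P B) fvin_startSO H4 H6 H5)].
Qed.

Lemma fvin_startLTL f (R : vars) : R O3 1 -> fvin R ((startLTL \o semLTL) f).
Proof.
move=> r; rewrite [(_ \o _) _]/= /startLTL /eqT /AIff /AImp; fvs.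
by rewrite fvin_semLTL //= r ?orbT.
Qed.

Lemma ltl_sE m f : sE m ((startLTL \o semLTL) f) = pStLTL m ++ trav (semLTLT m) 0 (ltl_code f).
Proof. by rewrite [(_ \o _) _]/= /startLTL (sE_ex m O3 0) sE_and semLTLTE /pStLTL -!catA. Qed.

Theorem LTL_upper : upper TeamLTLa.
Proof.
have H1 m : bounded 18 (semLTLT m) by exact: semLTLT_bounded.
have H2 m t : okt (semLTLT m) 0 t <-> exists2 f : form TeamLTLa, t = fcode f & True.
  by rewrite semLTLT_ok //; split=> [[f ->]|[f ->]]; exists f.
have H4 (f : form TeamLTLa) : flatten [seq p.1 ++ trav p.2 0 (fcode f) | p <- [::]] ++ sE false tt_ =
    sE false tt_ by [].
have H5 (f : form TeamLTLa) : sentence f <-> True /\ true_in_N tt_ by [].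
split; [exact: (mc_upper H1 H2 ltl_sE (fun P B => @startLTLP P B) fvin_startLTL (fun p (h : List.In p [::]) => match h with end) H4 H5)
  |exact: (sat_upper H2 ltl_sE (fun P B => @startLTLP P B) fvin_startLTL H4 H5)
  |exact: (csat_upper H2 ltl_sE (fun P B => @startLTLP P B) fvin_startLTL H4 (fun=> erefl) H5)].
Qed.

(** * Monadic second-order logic over traces *)

Inductive latom := AId | ADiff | ASing | AZero | ASub of nat | ASucc.

(** Numbers are shifted by one since all traces of a Kripke structure agree at time 0, where they
    are in the initial world. *)
Definition single (a : trace) (n : nat) : Prop := forall k, a k 0 = (k == n.+1).

Definition latom_sat (h : latom) (a b : trace) : Prop :=
  match h with
  | AId => a = b
  | ADiff => a <> b
  | ASing => exists n, single a n
  | AZero => a 1 0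
  | ASub p => forall k, a k 0 -> b k p
  | ASucc => exists2 k, a k 0 & b k.+1 0
  end.

(** There are no individual variables: an individual is a singleton, and an atom speaks of some
    member of each of two sets. This is what one team can represent. *)
Inductive l3 :=
  | LAtm of latom & nat & nat
  | LNeg of l3
  | LCon of l3 & l3
  | LExq of nat & l3.

Fixpoint l3sat (T : set trace) (V : nat -> set trace) (f : l3) : Prop :=
  match f with
  | LAtm h i j => exists a b, [/\ V i a, V j b & latom_sat h a b]
  | LNeg f => ~ l3sat T V f
  | LCon f g => l3sat T V f /\ l3sat T V g
  | LExq i f => exists2 X, X `<=` T & l3sat T (upd V i X) f
  end.

Fixpoint l3in (R : nat -> bool) (f : l3) : bool :=
  match f with
  | LAtm _ i j => R i && R j
  | LNeg f => l3in R f
  | LCon f g => l3in R f && l3in R g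
  | LExq i f => l3in (fun j => (j == i) || R j) f
  end.

Definition LDis f g := LNeg (LCon (LNeg f) (LNeg g)).
Definition LIff f g := LCon (LNeg (LCon f (LNeg g))) (LNeg (LCon g (LNeg f))).
Definition LOne i := LCon (LAtm AId i i) (LNeg (LAtm ADiff i i)).
Definition LNum i := LCon (LOne i) (LAtm ASing i i).
Definition exnum i f := LExq i (LCon (LNum i) f).
Definition allnum i f := LNeg (exnum i (LNeg f)).
Definition LIn i j := LAtm (ASub 0) i j.
Definition ltri A a b c := LExq 6 (LCon (LOne 6) (LCon (LAtm AId 6 A)
  (LCon (LIn a 6) (LCon (LAtm (ASub 1) b 6) (LAtm (ASub 2) c 6))))).
Definition eqset i j := LNeg (exnum 3 (LNeg (LIff (LIn 3 i) (LIn 3 j)))).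

(** The variables 1 and 2 are the graphs of addition and multiplication, and 3 to 9 are auxiliary.
    As the orders are 1 to 3, the variables of the source start at 12 without collisions. *)
Definition vidx (o x : nat) : nat := 3 * x + o + 11.

(** [trT t] says that the number in variable 3 is the value of [t]. Copying [r] to 3 replaces a
    renaming of variables, which a table could not perform. *)
Definition sub3 (r : nat) (f : l3) := exnum 3 (LCon (LIn 3 r) f).

Fixpoint trT (t : term) : l3 :=
  match t with
  | TVar x => LIn 3 (vidx 1 x)
  | TZero => LAtm AZero 3 3
  | TOne => exnum 4 (LCon (LAtm AZero 4 4) (LAtm ASucc 4 3))
  | TAdd t u => exnum 4 (exnum 5 (LCon (ltri 1 4 5 3) (LCon (sub3 4 (trT t)) (sub3 5 (trT u)))))
  | TMul t u => exnum 4 (exnum 5 (LCon (ltri 2 4 5 3) (LCon (sub3 4 (trT t)) (sub3 5 (trT u)))))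
  end.

Definition exvar (o : Defs.order) (x : nat) (f : l3) : l3 :=
  if o is O1 then exnum (vidx 1 x) f else LExq (vidx (order_nat o) x) f.

Fixpoint trA (f : arith) : l3 :=
  match f with
  | AEq t u => exnum 3 (LCon (trT t) (trT u))
  | ALe t u => exnum 4 (exnum 5 (exnum 7 (LCon (ltri 1 4 7 5)
      (LCon (sub3 4 (trT t)) (sub3 5 (trT u))))))
  | AIn2 t x => exnum 3 (LCon (trT t) (LIn 3 (vidx 2 x)))
  | AIn3 x y => LExq 8 (LCon (LOne 8) (LCon (eqset 8 (vidx 2 x)) (LAtm AId 8 (vidx 3 y))))
  | ANot f => LNeg (trA f)
  | AAnd f g => LCon (trA f) (trA g)
  | AOr f g => LNeg (LCon (LNeg (trA f)) (LNeg (trA g)))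
  | AEx o x f => exvar o x (trA f)
  | AAll o x f => LNeg (exvar o x (LNeg (trA f)))
  end.

Definition nev i := LAtm AId i i.

Definition ltrue := LExq 6 (LNeg (nev 6)).

Fixpoint clT (t : term) : l3 :=
  match t with
  | TVar x => nev (vidx 1 x)
  | TZero | TOne => ltrue
  | TAdd t u | TMul t u => LCon (clT t) (clT u)
  end.

(** The start valuation makes all set variables empty. Closedness is thus expressible: every
    variable that occurs is non-empty, where quantifiers bind non-empty sets. *)
Fixpoint clR (f : arith) : l3 :=
  match f with
  | AEq t u | ALe t u => LCon (clT t) (clT u)
  | AIn2 t x => LCon (clT t) (nev (vidx 2 x))
  | AIn3 x y => LCon (nev (vidx 2 x)) (nev (vidx 3 y))
  | ANot f => clR f
  | AAnd f g | AOr f g => LCon (clR f) (clR g)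
  | AEx o x f | AAll o x f =>
      LExq (vidx (order_nat o) x) (LCon (nev (vidx (order_nat o) x)) (clR f))
  end.

(** [axZ] and [axS] yield, by induction outside the logic, a singleton trace for every number. [axA]
    and [axM] are the recursion equations of addition and multiplication. *)
Definition axZ := exnum 3 (LAtm AZero 3 3).
Definition axS := allnum 3 (exnum 4 (LAtm ASucc 3 4)).
Definition axC := LNeg (LExq 9 (LNeg (LExq 8 (LCon (LOne 8) (eqset 8 9))))).
Definition axA := allnum 3 (allnum 4 (allnum 5 (LIff (ltri 1 3 4 5)
  (LDis (LCon (LAtm AZero 4 4) (LIn 3 5))
    (exnum 7 (exnum 8 (LCon (LAtm ASucc 7 4) (LCon (LAtm ASucc 8 5) (ltri 1 3 7 8))))))))).
Definition axM := allnum 3 (allnum 4 (allnum 5 (LIff (ltri 2 3 4 5)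
  (LDis (LCon (LAtm AZero 4 4) (LAtm AZero 5 5))
    (exnum 7 (exnum 8 (LCon (LAtm ASucc 7 4) (LCon (ltri 2 3 7 8) (ltri 1 8 3 5))))))))).

(* [c] tells whether the comprehension axiom is required. *)
Definition axioms (c : bool) : l3 :=
  LCon (LCon axZ axS) (LCon (if c then axC else axZ) (LCon axA axM)).

Definition Gf (c : bool) (f : arith) : l3 :=
  LExq 1 (LExq 2 (LCon (axioms c) (LCon (clR f) (trA f)))).

Section Sem.
Variable T : set trace.
Notation sat := (l3sat T).

Lemma negP3 V f : sat V (LNeg f) <-> ~ sat V f.
Proof. by []. Qed.

Lemma conP V f g : sat V (LCon f g) <-> sat V f /\ sat V g.
Proof. by []. Qed.
Lemma lexP V i f : sat V (LExq i f) <-> exists2 X, X `<=` T & sat (upd V i X) f.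
Proof. by []. Qed.

Lemma oneP V i : sat V (LOne i) <-> exists a, V i = [set a].
Proof.
split=> [[[a [_ [Va _ _]]] nd]|[a Va]].
  exists a; apply: set_ext => b; split=> [Vb|->//].
  by apply: contrapT => ab; apply: nd; exists b, a.
split=> /=; rewrite ?Va; first by exists a, a.
by move=> [b [c [-> ->]]].
Qed.

Definition numV (X : set trace) (n : nat) : Prop := exists2 a, X = [set a] & single a n.

Lemma numP V i : sat V (LNum i) <-> exists n, numV (V i) n.
Proof.
split=> [[/oneP[a Va] /= [a' [_ [Va' _ [n an]]]]]|[n [a Va an]]].
  by exists n, a => //; move: Va'; rewrite Va => <-.
split; first by apply/oneP; exists a.
by exists a, a; rewrite Va; split=> //; exists n.
Qed.

Lemma exnumP V i f : sat V (exnum i f) <->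
  exists a n, [/\ T a, single a n & sat (upd V i [set a]) f].
Proof.
split=> [[X XT [/numP[n [a]]]]|[a [n [Ta an h]]]].
  by rewrite updE => Xa an h; exists a, n; split; [apply: XT; rewrite Xa| |rewrite -Xa].
exists [set a]; first by move=> _ ->.
by split=> //; apply/numP; exists n, a; rewrite ?updE.
Qed.

Lemma allnumP V i f : sat V (allnum i f) <->
  forall a n, T a -> single a n -> sat (upd V i [set a]) f.
Proof.
rewrite /allnum negP3 exnumP; split=> [h a n Ta an|h [a [n [Ta an]]]]; last by apply; apply: h an.
by apply: contrapT => nf; apply: h; exists a, n.
Qed.

Lemma disP V f g : sat V (LDis f g) <-> sat V f \/ sat V g.
Proof.
split=> [h|[h|h] [n1 n2]//]; have [hf|nf] := pselect (sat V f); first by left.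
by right; apply: contrapT => ng; apply: h.
Qed.

Lemma iffP3 V f g : sat V (LIff f g) <-> (sat V f <-> sat V g).
Proof.
split=> [[h1 h2]|[h1 h2]]; last by split=> -[ha nb]; [exact: nb (h1 ha)|exact: nb (h2 ha)].
by split=> h; apply: contrapT => n; [apply: h1|apply: h2].
Qed.

Lemma subP V p i j n : numV (V i) n ->
  sat V (LAtm (ASub p) i j) <-> exists2 b, V j b & b n.+1 p.
Proof.
move=> [a Va an]; split=> [[a' [b [Va' Vb h]]]|[b Vb h]].
  move: Va'; rewrite Va => e; exists b => //; apply: h.
  by rewrite e an eqxx.
by exists a, b; split=> // [|k]; [rewrite Va|rewrite an => /eqP->].
Qed.

Lemma inP V i j n m : numV (V i) n -> numV (V j) m -> sat V (LIn i j) <-> n = m.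
Proof.
move=> Vi [b Vj bm]; rewrite (subP _ _ Vi) Vj; split=> [[_ ->]|->].
  by rewrite bm => /eqP[].
by exists b; rewrite ?bm.
Qed.

Lemma zeroP V i n : numV (V i) n -> sat V (LAtm AZero i i) <-> n = 0.
Proof.
move=> [a Va an]; split=> [[a' [b [Va' _]]]|n0].
  by move: Va'; rewrite Va => ->; rewrite /= an => /eqP[].
by exists a, a; rewrite Va; split=> //=; rewrite an n0.
Qed.

Lemma succP V i j n m : numV (V i) n -> numV (V j) m -> sat V (LAtm ASucc i j) <-> m = n.+1.
Proof.
move=> [a Va an] [b Vb bm]; split=> [[a' [b' []]]|e].
  rewrite Va Vb => -> -> [k]; rewrite an bm => /eqP-> /eqP[->] //.
by exists a, b; rewrite Va Vb; split=> //; exists n.+1; rewrite ?an ?bm ?e ?eqxx.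
Qed.

Definition triS (X : set trace) a b c : Prop :=
  exists R : trace, [/\ X R, R a.+1 0, R b.+1 1 & R c.+1 2].

Lemma triP V A a b c na nb nc : V A `<=` T -> A != 6 -> a != 6 -> b != 6 -> c != 6 ->
  numV (V a) na -> numV (V b) nb -> numV (V c) nc ->
  sat V (ltri A a b c) <-> triS (V A) na nb nc.
Proof.
move=> AT A6 a6 b6 c6 Va Vb Vc.
have u X x : x != 6 -> upd V 6 X x = V x by rewrite /upd => /negbTE->.
have E X : [/\ sat (upd V 6 X) (LIn a 6) <-> exists2 R, X R & R na.+1 0,
   sat (upd V 6 X) (LAtm (ASub 1) b 6) <-> exists2 R, X R & R nb.+1 1 &
   sat (upd V 6 X) (LAtm (ASub 2) c 6) <-> exists2 R, X R & R nc.+1 2].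
  by split; [rewrite (@subP _ _ _ _ na)|rewrite (@subP _ _ _ _ nb)|rewrite (@subP _ _ _ _ nc)];
     rewrite ?updE ?u.
split=> [/lexP[X XT /conP[/oneP[R]]]|[R [AR Ra Rb Rc]]].
  have [e1 e2 e3] := E X; rewrite updE => XR /conP[[R' [R'' [h1 h2 h3]]]].
  case/conP=> /e1[Q1 Q1X r1] /conP[/e2[Q2 Q2X r2] /e3[Q3 Q3X r3]].
  move: h1 h2 Q1X r1 Q2X r2 Q3X r3; rewrite updE u // XR -h3 => -> VA -> r1 -> r2 -> r3.
  by exists R; split.
exists [set R]; first by move=> _ ->; apply: AT.
have [e1 e2 e3] := E [set R]; split; first by apply/oneP; exists R; rewrite updE.
split; first by exists R, R; rewrite updE u.
by split; [apply/e1|split; [apply/e2|apply/e3]]; exists R.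
Qed.

(** The union of what the traces in [X] code, so every set of numbers is coded once all singletons
    exist. In [famV] each trace codes a member by itself, and there comprehension is what provides
    all sets of numbers. *)
Definition setV (X : set trace) : set nat := [set n | exists2 b, X b & b n.+1 0].

Lemma eqsetP V i j : i != 3 -> j != 3 -> (forall n, exists2 a, T a & single a n) ->
  sat V (eqset i j) <-> setV (V i) = setV (V j).
Proof.
move=> i3 j3 hN; have u X x : x != 3 -> upd V 3 X x = V x by rewrite /upd => /negbTE->.
have E a n : single a n -> sat (upd V 3 [set a]) (LIff (LIn 3 i) (LIn 3 j)) <->
    (setV (V i) n <-> setV (V j) n).
  move=> an; have num : numV (upd V 3 [set a] 3) n by exists a; rewrite ?updE.
  by rewrite iffP3 /LIn !(subP _ _ num) !u.
rewrite /eqset -/(allnum 3 _) allnumP; split=> [h|e a n _ an]; last by rewrite E // e.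
apply: set_ext => n; have [a Ta an] := hN n.
by rewrite -(E a n an); apply: h an.
Qed.

Section Model.
Hypothesis hN : forall n, exists2 a, T a & single a n.

Definition isA (X : set trace) := forall a b c, triS X a b c <-> a + b = c.
Definition isM (X : set trace) := forall a b c, triS X a b c <-> a * b = c.

Lemma num_upd (V : nat -> set trace) i a n : single a n -> numV (upd V i [set a] i) n.
Proof. by move=> an; exists a; rewrite ?updE. Qed.

Lemma sub3P W r s m v : r != 3 -> numV (W r) m ->
  (forall a n, single a n -> sat (upd W 3 [set a]) s <-> n = v) ->
  sat W (sub3 r s) <-> m = v.
Proof.
move=> r3 Wr e; rewrite /sub3 exnumP.
have Wr' d : numV (upd W 3 [set d] r) m by rewrite /upd (negbTE r3).
split=> [[d [i [Td di [/(inP (num_upd W 3 di) (Wr' d)) <- /(e _ _ di)]]]]//|h].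
have [d Td dm] := hN m; exists d, m; split=> //; split; last exact/(e _ _ dm).
exact/(inP (num_upd W 3 dm) (Wr' d)).
Qed.

Lemma binP op V A s1 s2 n x y : V A `<=` T -> A < 3 ->
  (forall a b c, triS (V A) a b c <-> op a b = c) -> numV (V 3) n ->
  (forall X Y a k, single a k -> sat (upd (upd (upd V 4 X) 5 Y) 3 [set a]) s1 <-> k = x) ->
  (forall X Y a k, single a k -> sat (upd (upd (upd V 4 X) 5 Y) 3 [set a]) s2 <-> k = y) ->
  sat V (exnum 4 (exnum 5 (LCon (ltri A 4 5 3) (LCon (sub3 4 s1) (sub3 5 s2))))) <-> n = op x y.
Proof.
move=> AT A3 hA V3 h1 h2; rewrite exnumP.
have uA X Y : upd (upd V 4 X) 5 Y A = V A by case: (A) A3 => [|[|[|]]].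
have E a b k j : single a k -> single b j -> sat (upd (upd V 4 [set a]) 5 [set b])
      (LCon (ltri A 4 5 3) (LCon (sub3 4 s1) (sub3 5 s2))) <-> [/\ op k j = n, k = x & j = y].
  move=> ak bj; set W := upd _ 5 _.
  have W4 : numV (W 4) k by exists a.
  have W5 : numV (W 5) j by exists b.
  have WA : W A = V A by rewrite /W uA.
  have e1 : sat W (ltri A 4 5 3) <-> op k j = n.
    rewrite (@triP W A 4 5 3 k j n) ?WA //; first by case: (A) A3 => [|[|[|]]].
  have e2 : sat W (sub3 4 s1) <-> k = x by apply: sub3P => //; apply: h1.
  have e3 : sat W (sub3 5 s2) <-> j = y by apply: sub3P => //; apply: h2.
  by rewrite !conP e1 e2 e3; split=> [[? []]|[]].
split=> [[a [k [Ta ak /exnumP[b [j [Tb bj /(E _ _ _ _ ak bj)[<- -> ->]]]]]]]//|e].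
have [a Ta ak] := hN x; have [b Tb bj] := hN y.
exists a, x; split=> //; apply/exnumP; exists b, y; split=> //.
exact/(E _ _ _ _ ak bj).
Qed.

Lemma trTP t V v1 n : (forall x, x \in term_vars t -> numV (V (vidx 1 x)) (v1 x)) ->
  V 1 `<=` T -> V 2 `<=` T -> isA (V 1) -> isM (V 2) -> numV (V 3) n ->
  sat V (trT t) <-> n = term_val v1 t.
Proof.
have big (W : nat -> set trace) i X o x : i < 12 -> upd W i X (vidx o.+1 x) = W (vidx o.+1 x).
  by move=> i12; rewrite /upd /vidx; case: eqP => //; lia.
elim: t V n => [x||| t IHt u IHu|t IHt u IHu] V n hv T1 T2 hA hM h3.
- by rewrite [trT _]/= (inP h3 (hv x _)) ?inE.
- exact: zeroP h3.
- rewrite [trT _]/= exnumP; split=> [[a [k [Ta ak []]]]|n1].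
    move=> /(zeroP (num_upd V 4 ak)) k0; have h3' : numV (upd V 4 [set a] 3) n := h3.
    by move/(succP (num_upd V 4 ak) h3'); rewrite k0.
  have [a Ta a0] := hN 0; exists a, 0; split=> //; split; first exact/(zeroP (num_upd V 4 a0)).
  exact/(succP (num_upd V 4 a0) (h3 : numV (upd V 4 [set a] 3) n)).
- apply: (@binP addn) => // X Y a k ak; [apply: IHt|apply: IHu] => //; try exact: num_upd;
  by move=> x xs; rewrite !big //; apply: hv; rewrite /= mem_cat xs ?orbT.
apply: (@binP muln) => // X Y a k ak; [apply: IHt|apply: IHu] => //; try exact: num_upd;
by move=> x xs; rewrite !big //; apply: hv; rewrite /= mem_cat xs ?orbT.
Qed.

Definition famV (X : set trace) : set (set nat) := [set D | exists2 b, X b & D = setV [set b]].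
Definition all_sets_in := forall D, exists2 b, T b & setV [set b] = D.

Definition okv (R : vars) V v1 v2 v3 :=
  [/\ forall x, R O1 x -> numV (V (vidx 1 x)) (v1 x),
      forall x, R O2 x -> setV (V (vidx 2 x)) = v2 x &
      forall x, R O3 x -> V (vidx 3 x) `<=` T /\ famV (V (vidx 3 x)) = v3 x].

Lemma vidx_inj (o o' : Defs.order) x x' : vidx (order_nat o) x = vidx (order_nat o') x' ->
  o = o' /\ x = x'.
Proof. by rewrite /vidx; case: o; case: o' => /= e; first [by split=> //; lia | exfalso; lia]. Qed.

Lemma okv_big R V v1 v2 v3 i X : i < 12 -> okv R V v1 v2 v3 -> okv R (upd V i X) v1 v2 v3.
Proof.
have b o x : i < 12 -> upd V i X (vidx o.+1 x) = V (vidx o.+1 x).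
  by move=> i12; rewrite /upd /vidx; case: eqP => //; lia.
by move=> i12 [h1 h2 h3]; split=> x; rewrite b //; auto.
Qed.

Lemma upd_vidx (V : nat -> set trace) (o o' : Defs.order) x x' X : upd V (vidx (order_nat o) x) X (vidx (order_nat o') x') =
  if (order_nat o == order_nat o') && (x == x') then X else V (vidx (order_nat o') x').
Proof.
rewrite /upd; case: eqP => [/vidx_inj[-> ->]|ne]; first by rewrite !eqxx.
by case: eqP => // /order_nat_inj e; case: eqP => // e'; case: ne; rewrite e e'.
Qed.

Lemma trAP f R V v1 v2 v3 : fvin R f -> okv R V v1 v2 v3 -> V 1 `<=` T -> V 2 `<=` T ->
  isA (V 1) -> isM (V 2) -> second_order f \/ all_sets_in ->
  sat V (trA f) <-> arith_sat v1 v2 v3 f.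
Proof.
have tr t W R' n w1 w2 w3 : tin R' t -> okv R' W w1 w2 w3 -> W 1 `<=` T -> W 2 `<=` T ->
    isA (W 1) -> isM (W 2) -> numV (W 3) n -> sat W (trT t) <-> n = term_val w1 t.
  rewrite tinP => /allP h [h1 _ _] W1 W2 WA WM W3.
  by apply: trTP => // x /h; apply: h1.
elim: f R V v1 v2 v3 => [t u|t u|t x|x y|f IH|f IHf g IHg|f IHf g IHg|o x f IH|o x f IH]
  R V v1 v2 v3 fR ok V1 V2 VA VM so.
- move: fR => /andP[tR uR]; rewrite [trA _]/= exnumP /=.
  have E a n : single a n -> sat (upd V 3 [set a]) (LCon (trT t) (trT u)) <->
      n = term_val v1 t /\ n = term_val v1 u.
    move=> an; have ok' := @okv_big _ _ _ _ _ 3 [set a] isT ok.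
    have e1 := tr t (upd V 3 [set a]) R n v1 v2 v3 tR ok' V1 V2 VA VM (num_upd _ _ an).
    have e2 := tr u (upd V 3 [set a]) R n v1 v2 v3 uR ok' V1 V2 VA VM (num_upd _ _ an).
    by split=> [[/e1 ? /e2 ?]|[/e1 ? /e2 ?]].
  split=> [[a [n [Ta an /(E _ _ an)[<-]]]]//|e].
  have [a Ta an] := hN (term_val v1 t); exists a, (term_val v1 t); split=> //.
  by apply/(E _ _ an).
- move: fR => /andP[tR uR]; rewrite [trA _]/= exnumP [arith_sat _ _ _ _]/=.
  have E a b c k j l : single a k -> single b j -> single c l ->
     sat (upd (upd (upd V 4 [set a]) 5 [set b]) 7 [set c])
      (LCon (ltri 1 4 7 5) (LCon (sub3 4 (trT t)) (sub3 5 (trT u)))) <->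
      [/\ k + l = j, k = term_val v1 t & j = term_val v1 u].
    move=> ak bj cl; set W := upd _ 7 _.
    have W4 : numV (W 4) k by exists a.
    have W5 : numV (W 5) j by exists b.
    have W7 : numV (W 7) l by exists c.
    have okW : okv R W v1 v2 v3 by do 3! (apply: okv_big => //).
    have e1 : sat W (ltri 1 4 7 5) <-> k + l = j by rewrite (@triP _ _ _ _ _ k l j).
    have e s d i : tin R s -> single d i -> sat (upd W 3 [set d]) (trT s) <-> i = term_val v1 s.
      move=> sR di; apply: (tr s (upd W 3 [set d]) R i v1 v2 v3) => //; first exact: okv_big.
      exact: num_upd.
    have e2 : sat W (sub3 4 (trT t)) <-> k = term_val v1 t by apply: sub3P => // d i; apply: e.
    have e3 : sat W (sub3 5 (trT u)) <-> j = term_val v1 u by apply: sub3P => // d i; apply: e.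
    by split=> [[/e1 h1 [/e2 h2 /e3 h3']]|[/e1 h1 /e2 h2 /e3 h3']].
  split=> [[a [k [_ ak /exnumP[b [j [_ bj /exnumP[c [l [_ cl /(E _ _ _ _ _ _ ak bj cl)[<- -> <-]]]]]]]]]]|le].
    exact: leq_addr.
  have [a Ta ak] := hN (term_val v1 t); have [b Tb bj] := hN (term_val v1 u).
  have [c Tc cl] := hN (term_val v1 u - term_val v1 t).
  exists a, (term_val v1 t); split=> //; apply/exnumP; exists b, (term_val v1 u); split=> //.
  apply/exnumP; exists c, (term_val v1 u - term_val v1 t); split=> //.
  by apply/(E _ _ _ _ _ _ ak bj cl); rewrite subnKC.
- move: fR => /andP[xR tR]; rewrite [trA _]/= exnumP [arith_sat _ _ _ _]/=.
  have E a n : single a n -> sat (upd V 3 [set a]) (LCon (trT t) (LIn 3 (vidx 2 x))) <->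
      n = term_val v1 t /\ v2 x n.
    move=> an; have ok' := @okv_big _ _ _ _ _ 3 [set a] isT ok.
    have e1 := tr t (upd V 3 [set a]) R n v1 v2 v3 tR ok' V1 V2 VA VM (num_upd _ _ an).
    have [_ h2 _] := ok'; rewrite -(h2 x xR).
    have e2 : sat (upd V 3 [set a]) (LIn 3 (vidx 2 x)) <-> setV (upd V 3 [set a] (vidx 2 x)) n.
      exact: (subP _ _ (num_upd _ _ an)).
    by split=> [[/e1 ? /e2 ?]|[/e1 ? /e2 ?]].
  split=> [[a [n [Ta an /(E _ _ an)[<-]]]]//|h].
  have [a Ta an] := hN (term_val v1 t); exists a, (term_val v1 t); split=> //.
  by apply/(E _ _ an).
- case: so => // cmpT; move: fR => /andP[xR yR]; have [_ h2 h3] := ok.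
  have [VyT fy] := h3 y yR; rewrite [arith_sat _ _ _ _]/= -fy -(h2 x xR).
  have u X o z : upd V 8 X (vidx o.+1 z) = V (vidx o.+1 z).
    by rewrite /upd /vidx; case: eqP => //; lia.
  have e X : sat (upd V 8 X) (eqset 8 (vidx 2 x)) <-> setV X = setV (V (vidx 2 x)).
    by rewrite eqsetP ?updE ?u // /vidx; apply/eqP; lia.
  split=> [/lexP[X XT /conP[/oneP[b] Xb /conP[/e sx [b' [b'' []]]]]]|[b Vb Vx]].
    move: Xb; rewrite !updE u => Xb; rewrite Xb /= => -> Vb bb.
    by exists b''; rewrite // -bb -sx Xb.
  exists [set b]; first by move=> _ ->; apply: VyT.
  split; first by apply/oneP; exists b; rewrite updE.
  split; first exact/e.
  by exists b, b; rewrite updE u.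
- have {}IH := IH R V v1 v2 v3 fR ok V1 V2 VA VM so.
  by rewrite /= IH.
- move: fR => /andP[fR gR].
  have so1 : second_order f \/ all_sets_in by case: so => [/andP[]|]; auto.
  have so2 : second_order g \/ all_sets_in by case: so => [/andP[]|]; auto.
  by rewrite /= (IHf R V v1 v2 v3) // (IHg R V v1 v2 v3).
- move: fR => /andP[fR gR].
  have so1 : second_order f \/ all_sets_in by case: so => [/andP[]|]; auto.
  have so2 : second_order g \/ all_sets_in by case: so => [/andP[]|]; auto.
  rewrite [trA _]/= -/(LDis (trA f) (trA g)) disP.
  by rewrite (IHf R V v1 v2 v3) // (IHg R V v1 v2 v3).
all: have b12 i X : i < 12 -> upd V (vidx (order_nat o) x) X i = V i
  by move=> i12; rewrite /upd /vidx; case: eqP => // e; move: e; case: (o) => /= e; lia.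
all: have so' : (o != O3 /\ second_order f) \/ all_sets_in by case: so => [/andP[? ?]|]; auto.
all: have so1 : second_order f \/ all_sets_in by case: so' => [[]|]; auto.
all: have ok1 a n : o = O1 -> single a n -> okv (ext R o x) (upd V (vidx (order_nat o) x) [set a]) (upd v1 x n) v2 v3
  by (move=> oE an; subst o; have [h1 h2 h3] := ok; split=> y; rewrite /ext /=;
      [rewrite (upd_vidx V O1 O1) /= /upd [y == x]eq_sym; case: (x == y) => /= [_|]; [exists a|exact: h1]
      |rewrite (upd_vidx V O1 O2) /=; exact: h2|rewrite (upd_vidx V O1 O3) /=; exact: h3]).
all: have ok2 X D : o = O2 -> setV X = D -> okv (ext R o x) (upd V (vidx (order_nat o) x) X) v1 (upd v2 x D) v3
  by (move=> oE an; subst o; have [h1 h2 h3] := ok; split=> y; rewrite /ext /=;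
      [rewrite (upd_vidx V O2 O1) /=; exact: h1
      |rewrite (upd_vidx V O2 O2) /= /upd [y == x]eq_sym; case: (x == y) => /= [_|]; [exact: an|exact: h2]
      |rewrite (upd_vidx V O2 O3) /=; exact: h3]).
all: have ok3 X D : o = O3 -> X `<=` T -> famV X = D -> okv (ext R o x) (upd V (vidx (order_nat o) x) X) v1 v2 (upd v3 x D)
  by (move=> oE XT an; subst o; have [h1 h2 h3] := ok; split=> y; rewrite /ext /=;
      [rewrite (upd_vidx V O3 O1) /=; exact: h1|rewrite (upd_vidx V O3 O2) /=; exact: h2
      |rewrite (upd_vidx V O3 O3) /= /upd [y == x]eq_sym; case: (x == y) => /= [_|]; [split|exact: h3]]).
all: have IH' X w1 w2 w3 : okv (ext R o x) (upd V (vidx (order_nat o) x) X) w1 w2 w3 ->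
    sat (upd V (vidx (order_nat o) x) X) (trA f) <-> arith_sat w1 w2 w3 f
  by move=> ok'; apply: (IH (ext R o x)) => //; rewrite b12.
all: have exD D : exists2 X, X `<=` T & setV X = D
  by (exists [set a | T a /\ exists2 n, D n & single a n]; [by move=> a []|];
      apply: set_ext => n; split=> [[a [Ta [m Dm am]]]|Dn]; [by rewrite am => /eqP[->]|];
      have [a Ta an] := hN n; exists a; [split=> //; exists n|rewrite an]).
all: have exF D : o = O3 -> exists2 X, X `<=` T & famV X = D.
1,3: move=> o3; have cT : all_sets_in by (case: so' => // -[]; rewrite o3 eqxx).
1,2: exists [set b | T b /\ D (setV [set b])]; first by move=> a [].
1,2: apply: set_ext => S; split=> [[b [Tb Db] ->]//|DS].
1,2: by have [b Tb bS] := cT S; exists b; [split=> //; rewrite bS|rewrite bS].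
- case: o fR so IH b12 so' ok1 ok2 ok3 IH' exF => fR so IH b12 so' ok1 ok2 ok3 IH' exF.
  + rewrite [trA _]/= exnumP /=; split=> [[a [n [Ta an /(IH' _ _ _ _ (ok1 _ _ erefl an)) h]]]|[n h]]; first by exists n.
    by have [a Ta an] := hN n; exists a, n; split=> //; apply/(IH' _ _ _ _ (ok1 _ _ erefl an)).
  + split=> [[X XT /(IH' _ _ _ _ (ok2 _ _ erefl erefl)) h]|[D h]]; first by exists (setV X).
    by have [X XT XD] := exD D; exists X => //; apply/(IH' _ _ _ _ (ok2 _ _ erefl XD)).
  split=> [[X XT /(IH' _ _ _ _ (ok3 _ _ erefl XT erefl)) h]|[D h]]; first by exists (famV X).
  by have [X XT XD] := exF D erefl; exists X => //; apply/(IH' _ _ _ _ (ok3 _ _ erefl XT XD)).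
case: o fR so IH b12 so' ok1 ok2 ok3 IH' exF => fR so IH b12 so' ok1 ok2 ok3 IH' exF.
- rewrite [trA _]/= -/(allnum _ _) allnumP /=; split=> [h n|h a n Ta an].
    by have [a Ta an] := hN n; apply/(IH' _ _ _ _ (ok1 _ _ erefl an)); apply: h an.
  by apply/(IH' _ _ _ _ (ok1 _ _ erefl an)).
- split=> [h D|h [X XT []]]; last by apply/(IH' _ _ _ _ (ok2 _ _ erefl erefl)).
  have [X XT XD] := exD D; apply/(IH' _ _ _ _ (ok2 _ _ erefl XD)).
  by apply: contrapT => n; apply: h; exists X.
split=> [h D|h [X XT []]]; last by apply/(IH' _ _ _ _ (ok3 _ _ erefl XT erefl)).
have [X XT XD] := exF D erefl; apply/(IH' _ _ _ _ (ok3 _ _ erefl XT XD)).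
by apply: contrapT => n; apply: h; exists X.
Qed.

End Model.

Hypothesis T0 : T !=set0.

Lemma nevP V i : sat V (nev i) <-> V i !=set0.
Proof. by split=> [[a [_ [Va _ _]]]|[a Va]]; [exists a|exists a, a]. Qed.

Lemma ltrueP V : sat V ltrue.
Proof. by exists set0 => //; apply/negP3 => /nevP[a]; rewrite updE. Qed.

Lemma clTP V t : sat V (clT t) <-> tin (fun o x => `[< V (vidx (order_nat o) x) !=set0 >]) t.
Proof.
elim: t => [x|||t IHt u IHu|t IHt u IHu].
- by rewrite [clT _]/= nevP; split=> [h|/asboolP//]; exact/asboolP.
- by split=> // _; apply: ltrueP.
- by split=> // _; apply: ltrueP.
- by rewrite /= IHt IHu; split=> [[-> ->]|/andP[]].
by rewrite /= IHt IHu; split=> [[-> ->]|/andP[]].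
Qed.

Lemma clRP f V : sat V (clR f) <-> fvin (fun o x => `[< V (vidx (order_nat o) x) !=set0 >]) f.
Proof.
have nP o x W : sat W (nev (vidx (order_nat o) x)) <-> `[< W (vidx (order_nat o) x) !=set0 >].
  by rewrite nevP; split=> [h|/asboolP//]; exact/asboolP.
move: V; have Q (V : nat -> set trace) o x g : (forall W, sat W (clR g) <-> fvin (fun o x => `[< W (vidx (order_nat o) x) !=set0 >]) g) ->
   sat V (LExq (vidx (order_nat o) x) (LCon (nev (vidx (order_nat o) x)) (clR g))) <->
   fvin (ext (fun o x => `[< V (vidx (order_nat o) x) !=set0 >]) o x) g.
  move=> IH; have E X : X !=set0 -> (fun o' x' => `[< upd V (vidx (order_nat o) x) X (vidx (order_nat o') x') !=set0 >])
     = ext (fun o x => `[< V (vidx (order_nat o) x) !=set0 >]) o x.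
    move=> X0; apply/funext => o'; apply/funext => x'; rewrite upd_vidx /ext.
    by case: (_ && _) => //=; apply/asboolP.
  split=> [[X XT [/nP/asboolP]]|h]; first by rewrite updE => X0 /IH; rewrite E.
  (* Any non-empty set is a witness, and [T] is one. *)
  exists T => //; split; first by apply/nP/asboolP; rewrite updE.
  by apply/IH; rewrite E.
elim: f => [t u|t u|t x|x y|f IH|f IHf g IHg|f IHf g IHg|o x f IH|o x f IH] V.
- by rewrite /= !clTP; split=> [[-> ->]|/andP[]].
- by rewrite /= !clTP; split=> [[-> ->]|/andP[]].
- by rewrite [clR _]/= conP clTP (nP O2) [fvin _ _]/= andbC; split=> [[-> ->]|/andP[]].
- by rewrite [clR _]/= conP (nP O2) (nP O3); split=> [[]|] /=; [move=> -> ->|move=> /andP[]].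
- exact: IH.
- by rewrite /= IHf IHg; split=> [[-> ->]|/andP[]].
- by rewrite /= IHf IHg; split=> [[-> ->]|/andP[]].
- exact: Q.
exact: Q.
Qed.

Definition isA' (X : set trace) := forall a b c, triS X a b c <->
  (b = 0 /\ a = c) \/ exists b' c', [/\ b = b'.+1, c = c'.+1 & triS X a b' c'].
Definition isM' (X Y : set trace) := forall a b c, triS Y a b c <->
  (b = 0 /\ c = 0) \/ exists b' c', [/\ b = b'.+1, triS Y a b' c' & triS X c' a c].

(** The recursion equations determine the graph at [b.+1] from the graph at [b], so addition is
    their only solution. *)
Lemma isA'P X : isA' X <-> isA X.
Proof.
split=> [h a b|h a b c].
  elim: b => [|b IH] c; rewrite h.
    by rewrite addn0; split=> [[[_ //]|[b' [c' []//]]]|->]; left.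
  split=> [[[]//|[b' [c' [[<-] -> /IH <-]]]]|<-]; first by rewrite addnS.
  by right; exists b, (a + b); rewrite addnS; split=> //; apply/IH.
rewrite h; split=> [<-|[[-> ->]|[b' [c' [-> -> /h <-]]]]]; rewrite ?addn0 ?addnS //.
case: b => [|b]; [by left; rewrite addn0|right; exists b, (a + b); rewrite addnS; split=> //; exact/h].
Qed.

Lemma isM'P X Y : isA X -> isM' X Y <-> isM Y.
Proof.
move=> hX; split=> [h a b|h a b c].
  elim: b => [|b IH] c; rewrite h.
    by rewrite muln0; split=> [[[_ ->//]|[b' [c' []//]]]|<-]; left.
  split=> [[[]//|[b' [c' [[<-] /IH <- /hX <-]]]]|<-]; first by rewrite mulnSr.
  by right; exists b, (a * b); split=> //; [apply/IH|apply/hX; rewrite mulnSr].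
rewrite h; split=> [<-|[[-> ->]|[b' [c' [-> /h <- /hX <-]]]]]; rewrite ?muln0 ?mulnSr //.
case: b => [|b]; [left; rewrite muln0|right; exists b, (a * b)]; split=> //; first by rewrite h.
by apply/hX; rewrite mulnSr.
Qed.

Section Ax.
Hypothesis hN : forall n, exists2 a, T a & single a n.

Lemma ax3P (V : nat -> set trace) A F (Q : nat -> nat -> nat -> Prop) : V A `<=` T -> 0 < A < 3 ->
  (forall a b c n m k, single a n -> single b m -> single c k ->
     sat (upd (upd (upd V 3 [set a]) 4 [set b]) 5 [set c]) F <-> Q n m k) ->
  sat V (allnum 3 (allnum 4 (allnum 5 (LIff (ltri A 3 4 5) F)))) <->
  forall n m k, triS (V A) n m k <-> Q n m k.
Proof.
move=> AT A3 hF.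
have E a b c n m k : single a n -> single b m -> single c k ->
     sat (upd (upd (upd V 3 [set a]) 4 [set b]) 5 [set c]) (LIff (ltri A 3 4 5) F) <->
     (triS (V A) n m k <-> Q n m k).
  move=> an bm ck; rewrite iffP3 (hF _ _ _ _ _ _ an bm ck).
  set W := upd _ 5 _; have WA : W A = V A by rewrite /W; case: (A) A3 => [|[|[|]]].
  rewrite (@triP W A 3 4 5 n m k) ?WA //; first by case: (A) A3 => [|[|[|]]].
  - by exists a.
  - by exists b.
  by exists c.
rewrite allnumP; split=> [h n m k|h a n Ta an].
  have [a Ta an] := hN n; have [b Tb bm] := hN m; have [c Tc ck] := hN k.
  by rewrite -(E _ _ _ _ _ _ an bm ck); move: (h a n Ta an) => /allnumP/(_ b m Tb bm)/allnumP/(_ c k Tc ck).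
apply/allnumP => b m Tb bm; apply/allnumP => c k Tc ck.
exact/(E _ _ _ _ _ _ an bm ck).
Qed.

Lemma ex2P V i j F (Q : nat -> nat -> Prop) :
  (forall a b n m, single a n -> single b m -> sat (upd (upd V i [set a]) j [set b]) F <-> Q n m) ->
  sat V (exnum i (exnum j F)) <-> exists n m, Q n m.
Proof.
move=> h; rewrite exnumP; split=> [[a [n [Ta an /exnumP[b [m [Tb bm /(h _ _ _ _ an bm) q]]]]]]|[n [m q]]].
  by exists n, m.
have [a Ta an] := hN n; have [b Tb bm] := hN m; exists a, n; split=> //.
by apply/exnumP; exists b, m; split=> //; apply/(h _ _ _ _ an bm).
Qed.

Lemma axAP V : V 1 `<=` T -> sat V axA <-> isA (V 1).
Proof.
move=> V1; rewrite -isA'P; apply: ax3P => // a b c n m k an bm ck.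
set W := upd _ 5 _; have W3 : numV (W 3) n by exists a.
have W4 : numV (W 4) m by exists b.
have W5 : numV (W 5) k by exists c.
rewrite disP conP (zeroP W4) (inP W3 W5) (@ex2P _ _ _ _ (fun b' c' => [/\ m = b'.+1, k = c'.+1 & triS (V 1) n b' c'])) //.
move=> d e i j di ej; set U := upd _ 8 _; have U7 : numV (U 7) i by exists d.
have U8 : numV (U 8) j by exists e.
rewrite !conP (@succP U 7 4 i m) // (@succP U 8 5 j k) // (@triP U 1 3 7 8 n i j) //.
by split=> [[-> []]|[]].
Qed.

Lemma axMP V : V 1 `<=` T -> V 2 `<=` T -> isA (V 1) -> sat V axM <-> isM (V 2).
Proof.
move=> V1 V2 hA; rewrite -(isM'P _ hA); apply: ax3P => // a b c n m k an bm ck.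
set W := upd _ 5 _; have W3 : numV (W 3) n by exists a.
have W4 : numV (W 4) m by exists b.
have W5 : numV (W 5) k by exists c.
rewrite disP conP (zeroP W4) (zeroP W5) (@ex2P _ _ _ _ (fun b' c' => [/\ m = b'.+1, triS (V 2) n b' c' & triS (V 1) c' n k])) //.
move=> d e i j di ej; set U := upd _ 8 _; have U7 : numV (U 7) i by exists d.
have U8 : numV (U 8) j by exists e.
rewrite !conP (@succP U 7 4 i m) // (@triP U 2 3 7 8 n i j) // (@triP U 1 8 3 5 j n k) //.
by split=> [[-> []]|[]].
Qed.

Lemma axCP V : sat V axC <-> all_sets_in.
Proof.
have E X b : sat (upd (upd V 9 X) 8 [set b]) (eqset 8 9) <-> setV [set b] = setV X.
  by rewrite eqsetP //.
split=> [h D|h [X XT]]; last first.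
  move=> n; apply: n; have [b Tb bX] := h (setV X).
  exists [set b]; first by move=> _ ->.
  by split; [apply/oneP; exists b; rewrite updE|apply/E].
pose X := [set a | T a /\ exists2 n, D n & single a n].
have XD : setV X = D.
  apply: set_ext => n; split=> [[a [Ta [m Dm am]]]|Dn]; first by rewrite am => /eqP[->].
  by have [a Ta an] := hN n; exists a; [split=> //; exists n|rewrite an].
have : sat (upd V 9 X) (LExq 8 (LCon (LOne 8) (eqset 8 9))).
  by apply: contrapT => n; apply: h; exists X => // a [].
case=> Y YT [/oneP[b]]; rewrite updE => Yb; rewrite Yb => /E e.
by exists b; [apply: YT; rewrite Yb|rewrite e XD].
Qed.

End Ax.

Lemma axN V : sat V axZ -> sat V axS -> forall n, exists2 a, T a & single a n.
Proof.
move=> /exnumP[a [k [Ta ak /(zeroP (num_upd V 3 ak)) k0]]] /allnumP h; elim=> [|n [b Tb bn]].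
  by exists a; rewrite // -k0.
have /exnumP[c [m [Tc cm]]] := h b n Tb bn.
have W3 : numV (upd (upd V 3 [set b]) 4 [set c] 3) n by exists b.
have W4 : numV (upd (upd V 3 [set b]) 4 [set c] 4) m by exists c.
by move/(succP W3 W4) => mn; exists c; rewrite // -mn.
Qed.

(** The axioms pin down the arithmetic inside [T], so the translation of [f] is true in it only if
    [f] is true; what remains are conditions on the richness of [T]. *)
Lemma Gf_iff c f V : (forall o x, V (vidx o.+1 x) = set0) -> c || second_order f ->
  sat V (Gf c f) <->
  [/\ (forall n, exists2 a, T a & single a n), (c -> all_sets_in),
      exists2 X, X `<=` T & isA X, exists2 X, X `<=` T & isM X & true_in_N f].
Proof.
move=> V0 cso.
have u o x X Y : upd (upd V 1 X) 2 Y (vidx o.+1 x) = set0.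
  rewrite /upd; case: eqP => [e|_]; first by move: e; rewrite /vidx; lia.
  case: eqP => [e|_]; first by move: e; rewrite /vidx; lia.
  exact: V0.
have clE X Y : sat (upd (upd V 1 X) 2 Y) (clR f) <-> arith_free f = [::].
  rewrite clRP; have -> : (fun o x => `[< upd (upd V 1 X) 2 Y (vidx (order_nat o) x) !=set0 >]) = (fun _ _ => false).
    apply/funext => o; apply/funext => x; apply/asboolP => -[a].
    by case: o => /=; rewrite u.
  by split=> [/fvin_closed|h]; rewrite ?fvinP ?h.
have ok X Y : okv (fun _ _ => false) (upd (upd V 1 X) 2 Y) (fun=> 0) (fun=> set0) (fun=> set0) by [].
split=> [/lexP[X XT /lexP[Y YT]]|[hN hC [X XT hA] [Y YT hM] [fr tf]]].
  move=> /conP[/conP[/conP[hZ hS] /conP[hC /conP[hA hM]]] /conP[/clE fr ht]].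
  have hN := axN hZ hS.
  have {}hC : c -> all_sets_in by move=> c1; move: hC; rewrite c1 => /(axCP hN).
  have {}hA : isA X by move/(axAP hN): hA; apply.
  have {}hM : isM Y by move/(axMP hN): hM; apply.
  split=> //; [by exists X|by exists Y|split=> //].
  have fv : fvin (fun _ _ => false) f by rewrite fvinP fr.
  apply/(trAP hN fv (ok X Y)) => //.
  by case/orP: cso => h; [right; apply: hC|left].
apply/lexP; exists X => //; apply/lexP; exists Y => //.
have fv : fvin (fun _ _ => false) f by rewrite fvinP fr.
have hZ W : sat W axZ.
  by have [a Ta a0] := hN 0; apply/exnumP; exists a, 0; split=> //; apply/(zeroP (num_upd W 3 a0)).
apply/conP; split; [apply/conP; split|apply/conP; split; first exact/clE].
- apply/conP; split; first exact: hZ.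
  apply/allnumP => a n Ta an; have [b Tb bn] := hN n.+1; apply/exnumP; exists b, n.+1; split=> //.
  by apply/(@succP _ 3 4 n n.+1) => //; [exists a|exists b].
- apply/conP; split; first by case: (c) hC => h; [apply/(axCP hN); apply: h|apply: hZ].
  by apply/conP; split; [apply/(axAP hN)|apply/(axMP hN)].
apply/(trAP hN fv (ok X Y)) => //.
by case/orP: cso => h; [right; apply: hC|left].
Qed.

End Sem.

(** * Expressing the atoms in first-order logic *)

(* First-order formulas in negation normal form, evaluated on a single
   assignment; [KLev] stands for Level(0, 2). *)
Inductive fl :=
  | KLit of bool & atom
  | KLev
  | KAnd of fl & fl
  | KOr of fl & fl
  | KEx of nat & fl
  | KAll of nat & fl.

Notation KT := (KLit true).
Notation KF := (KLit false).

Definition same x y := locked (KOr (KT (Le x y)) (KT (Le y x))).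
Definition nsame x y := locked (KAnd (KF (Le x y)) (KF (Le y x))).
Definition kmin x z := locked (KAnd (KT (Eq x x))
  (KAll z (KOr (KF (Le z x)) (KT (Eq z x))))).
Definition kpred x y z := locked (KAnd (KT (Le x y)) (KAnd (KF (Eq x y))
  (KAll z (KOr (KF (Le z y)) (KOr (KT (Le z x)) (KT (Eq z y))))))).

(** Position [i] with three variables: the predecessor of 1 is put into 2, with 0 for the minimality
    test, and copied back to 1 before the next step. *)
Fixpoint kpos (i : nat) : fl :=
  if i is i'.+1 then KEx 2 (KAnd (kpred 2 1 0) (KEx 1 (KAnd (KT (Eq 1 2)) (kpos i'))))
  else kmin 1 2.

Definition kpos1 : fl := locked (kpos 1).

(** Depends on the traces of the variables 0 and 1 but not on their positions, which therefore
    remain free to name set variables. *)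
Definition kat (h : latom) : fl :=
  match h with
  | AId => same 0 1
  | ADiff => nsame 0 1
  | ASing => KEx 2 (KAnd (same 2 0) (KAnd (KT (Pred 0 2)) (KAnd
      (KEx 1 (KAnd (KT (Le 1 2)) (KF (Eq 1 2))))
      (KAll 1 (KOr (nsame 1 0) (KOr (KF (Pred 0 1)) (KT (Eq 1 2))))))))
  | AZero => KEx 1 (KAnd (same 1 0) (KAnd (KT (Pred 0 1)) kpos1))
  | ASub p => KAll 2 (KOr (nsame 2 0) (KOr (KF (Pred 0 2))
      (KEx 0 (KAnd KLev (KAnd (same 0 1) (KT (Pred p 0)))))))
  | ASucc => KEx 2 (KAnd (same 2 0) (KAnd (KT (Pred 0 2)) (KEx 0 (KAnd KLev
      (KAnd (same 0 1) (KEx 2 (KAnd (kpred 0 2 1) (KT (Pred 0 2)))))))))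
  end.

(** Simultaneous descent from the pair (3, 4) to the pair (5, 6), which stops when both are at
    position 0. *)
Definition kstep := KOr
  (KAnd (kmin 3 9) (KAnd (kmin 4 9) (KAnd (KT (Eq 5 3)) (KT (Eq 6 4)))))
  (KAnd (kpred 5 3 9) (kpred 6 4 9)).

Section Flat.
Variable T : set trace.
Implicit Types s : assignment T.

Fixpoint ksat s (f : fl) : Prop :=
  match f with
  | KLit b a => if b then sat_atom s a else ~ sat_atom s a
  | KLev => sat_atom s (Level 0 2)
  | KAnd f g => ksat s f /\ ksat s g
  | KOr f g => ksat s f \/ ksat s g
  | KEx x f => exists d, ksat (upd s x (Some d)) f
  | KAll x f => forall d, ksat (upd s x (Some d)) f
  end.

Lemma kandE s f g : ksat s (KAnd f g) = (ksat s f /\ ksat s g). Proof. by []. Qed.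
Lemma korE s f g : ksat s (KOr f g) = (ksat s f \/ ksat s g). Proof. by []. Qed.
Lemma kexE s x f : ksat s (KEx x f) = (exists d, ksat (upd s x (Some d)) f). Proof. by []. Qed.
Lemma kallE s x f : ksat s (KAll x f) = (forall d, ksat (upd s x (Some d)) f). Proof. by []. Qed.
Lemma klitT s a : ksat s (KT a) = sat_atom s a. Proof. by []. Qed.
Lemma klitF s a : ksat s (KF a) = (~ sat_atom s a). Proof. by []. Qed.
Lemma klevE s : ksat s KLev = sat_atom s (Level 0 2). Proof. by []. Qed.
Definition kE := (kandE, korE, kexE, kallE, klitT, klitF, klevE).

Lemma leP' s x y (a b : T) n m : s x = Some (a, n) -> s y = Some (b, m) ->
  sat_atom s (Le x y) <-> a = b /\ n <= m.
Proof.
move=> sx sy; split=> [[t [n' [m' []]]]|[e nm]].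
  by rewrite sx sy => -[-> ->] [-> ->].
by subst b; exists a, n, m.
Qed.

Lemma eqP' s x y (d e : dom T) : s x = Some d -> s y = Some e -> sat_atom s (Eq x y) <-> d = e.
Proof.
move=> sx sy; split=> [[d' /=]|e']; first by rewrite sx sy => -[->] [->].
by subst e; exists d.
Qed.

Lemma predP' s p x (a : T) n : s x = Some (a, n) -> sat_atom s (Pred p x) <-> val a n p.
Proof.
move=> sx; split=> [[d /=]|h]; first by rewrite sx => -[<-].
by exists (a, n).
Qed.

Lemma levP' s x y (a b : T) n m : s x = Some (a, n) -> s y = Some (b, m) ->
  sat_atom s (Level x y) <-> n = m.
Proof.
move=> sx sy; split=> [[t [t' [k []]]]|e]; first by rewrite sx sy => -[_ ->] [_ ->].
by subst m; exists a, b, n.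
Qed.

Lemma sameP s x y (a b : T) n m : s x = Some (a, n) -> s y = Some (b, m) ->
  ksat s (same x y) <-> a = b.
Proof.
move=> sx sy; rewrite /same -lock !kE (leP' sx sy) (leP' sy sx).
split=> [[[]|[]]//|->].
by case: (leqP n m) => nm; [left|right; split=> //; exact: ltnW].
Qed.

Lemma nsameP s x y (a b : T) n m : s x = Some (a, n) -> s y = Some (b, m) ->
  ksat s (nsame x y) <-> a <> b.
Proof.
move=> sx sy; rewrite -(sameP sx sy) /same /nsame -!lock /=; split=> [[n1 n2] []//|h].
by split=> h'; apply: h; [left|right].
Qed.

Lemma kminP s x z : z != x -> ksat s (kmin x z) <-> exists t, s x = Some (t, 0).
Proof.
move=> zx; have u d : upd s z d x = s x by rewrite /upd eq_sym (negbTE zx).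
have uz d : upd s z d z = d by rewrite /upd eqxx.
rewrite /kmin -lock; split=> [[[[t n] sx _] /(_ (t, 0))[h|]]|[t sx]].
- by case: h; apply/(@leP' _ _ _ t t 0 n); rewrite ?u ?uz.
- by move/(@eqP' _ _ _ (t, 0) (t, n)); rewrite u uz => /(_ erefl sx)[n0]; exists t; rewrite sx -n0.
split; first by exists (t, 0).
move=> [t' n]; have [h|h] := pselect (sat_atom (upd s z (Some (t', n))) (Le z x)); last by left.
right; move: h => /(@leP' _ _ _ t' t n 0); rewrite u uz => /(_ erefl sx)[-> n0].
apply/(@eqP' _ _ _ (t, n) (t, 0)); rewrite ?u ?uz //; congr (_, _).
by move: n0; rewrite leqn0 => /eqP.
Qed.

Lemma kpredP s x y z : z != x -> z != y ->
  ksat s (kpred x y z) <-> exists t n, s x = Some (t, n) /\ s y = Some (t, n.+1).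
Proof.
move=> zx zy; have ux d : upd s z d x = s x by rewrite /upd eq_sym (negbTE zx).
have uy d : upd s z d y = s y by rewrite /upd eq_sym (negbTE zy).
have uz d : upd s z d z = d by rewrite /upd eqxx.
rewrite /kpred -lock; split=> [[[t [n [m [sx sy nm]]]] [ne h]]|[t [n [sx sy]]]].
  have ltnm : n < m.
    rewrite ltn_neqAle nm andbT; apply/eqP => e; apply: ne; apply/(eqP' sx sy).
    by rewrite e.
  exists t, n; split=> //; case: (h (t, n.+1)) => [h1|[h1|h1]].
  - by case: h1; apply/(@leP' _ _ _ t t n.+1 m); rewrite ?uz ?uy.
  - by move: h1 => /(@leP' _ _ _ t t n.+1 n); rewrite uz ux => /(_ erefl sx)[_]; rewrite ltnn.
  - by move: h1 => /(@eqP' _ _ _ (t, n.+1) (t, m)); rewrite uz uy => /(_ erefl sy) ->.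
split; first by exists t, n, n.+1.
split; first by move/(eqP' sx sy) => -[/eqP]; rewrite -[n in n == _]addn0 -addn1 eqn_add2l.
move=> [t' k]; have [h|h] := pselect (sat_atom (upd s z (Some (t', k))) (Le z y)); last by left.
right; move: h => /(@leP' _ _ _ t' t k n.+1); rewrite uy uz => /(_ erefl sy)[-> kn].
move: kn; rewrite leq_eqVlt => /orP[/eqP e|kn].
  by right; apply/(@eqP' _ _ _ (t, k) (t, n.+1)); rewrite ?uy ?uz ?e.
by left; apply/(@leP' _ _ _ t t k n); rewrite ?ux ?uz.
Qed.

Lemma kposP i s : ksat s (kpos i) <-> exists t, s 1 = Some (t, i).
Proof.
elim: i s => [|i IH] s; first exact: kminP.
rewrite [kpos _]/= kexE; split=> [[d]|[t s1]].
  rewrite !kE kpredP // => -[[t [n [s2 s1]]] [e]].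
  rewrite !kE (@eqP' _ 1 2 e d) // IH => -[de [t' e']].
  move: s2 e' s1; rewrite /upd /= => -[d2] [e2] s1; exists t; rewrite s1.
  by move: e2; rewrite de d2 => -[_ ->].
exists (t, i); rewrite !kE kpredP //; split; first by exists t, i.
by exists (t, i); rewrite !kE (@eqP' _ 1 2 (t, i) (t, i)) // IH; split=> //; exists t.
Qed.

Lemma katP h s (a b : T) i j : s 0 = Some (a, i) -> s 1 = Some (b, j) ->
  ksat s (kat h) <-> latom_sat h (val a) (val b).
Proof.
move=> s0 s1; case: h => [||||p|]; rewrite [kat _]/=.
- by rewrite (sameP s0 s1); split=> [->|/val_inj].
- by rewrite (nsameP s0 s1); split=> [h /val_inj|h e]; [exact: h|apply: h; rewrite e].
- rewrite kexE; split=> [[[t k]]|[n an]].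
    rewrite !kE (@sameP _ 2 0 t a k i) // (@predP' _ 0 2 t k) // => -[ta [h1 [[[u l]]]]].
    rewrite !kE (@leP' _ 1 2 u t l k) // (@eqP' _ 1 2 (u, l) (t, k)) // => -[[ul lk] ne] h4.
    subst u t; have {}lk : l < k.
      by rewrite ltn_neqAle lk andbT; apply/eqP => e; apply: ne; rewrite e.
    exists k.-1 => k'; rewrite prednK; last by lia.
    apply/idP/eqP => [ak'|->//].
    move: (h4 (a, k')); rewrite !kE (@nsameP _ 1 0 a a k' i) // (@predP' _ 0 1 a k') //.
    by rewrite (@eqP' _ 1 2 (a, k') (a, k)) // => -[|[|[]]].
  exists (a, n.+1); rewrite !kE (@sameP _ 2 0 a a n.+1 i) // (@predP' _ 0 2 a n.+1) // an eqxx.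
  do 2 split=> //; split.
    by exists (a, 0); rewrite !kE (@leP' _ 1 2 a a 0 n.+1) // (@eqP' _ 1 2 (a, 0) (a, n.+1)).
  move=> [t k]; rewrite !kE (@nsameP _ 1 0 t a k i) // (@predP' _ 0 1 t k) //.
  rewrite (@eqP' _ 1 2 (t, k) (a, n.+1)) //.
  have [->|ta] := pselect (t = a); last by left.
  right; rewrite an; have [->|nk] := eqVneq k n.+1; [by right|by left].
- rewrite kexE /kpos1 -lock; split=> [[[t k]]|h].
    rewrite kandE kandE klitT kposP (@sameP _ 1 0 t a k i) // (@predP' _ 0 1 t k) // => -[-> [h1 [t' [_ k1]]]].
    by move: h1; rewrite k1.
  exists (a, 1); rewrite kandE kandE klitT kposP (@sameP _ 1 0 a a 1 i) // (@predP' _ 0 1 a 1) //.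
  by do 2 split=> //; exists a.
- rewrite kallE; split=> [h k ak|h [t k]].
    move: (h (a, k)); rewrite !kE (@nsameP _ 2 0 a a k i) // (@predP' _ 0 2 a k) // => -[//|[//|[[t l]]]].
    rewrite !kE (@levP' _ 0 2 t a l k) // (@sameP _ 0 1 t b l j) // (@predP' _ p 0 t l) //.
    by move=> [-> [->]].
  rewrite !kE (@nsameP _ 2 0 t a k i) // (@predP' _ 0 2 t k) //.
  have [->|ta] := pselect (t = a); last by left.
  right; have [ak|nak] := pselect (val a k 0); last by left.
  right; exists (b, k); rewrite !kE (@levP' _ 0 2 b a k k) // (@sameP _ 0 1 b b k j) //.
  by rewrite (@predP' _ p 0 b k) //; do 2 split=> //; apply: h.
rewrite kexE; split=> [[[t k]]|[k ak bk]].
  rewrite !kE (@sameP _ 2 0 t a k i) // (@predP' _ 0 2 t k) // => -[-> [ak [[u l]]]].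
  rewrite !kE (@levP' _ 0 2 u a l k) // (@sameP _ 0 1 u b l j) // => -[-> [-> [[v m]]]].
  rewrite !kE kpredP // (@predP' _ 0 2 v m) // /upd /= => -[[w [n [[<- <-] [-> ->]]]] h].
  by exists k.
exists (a, k); rewrite !kE (@sameP _ 2 0 a a k i) // (@predP' _ 0 2 a k) //; do 2 split=> //.
exists (b, k); rewrite !kE (@levP' _ 0 2 b a k k) // (@sameP _ 0 1 b b k j) //; do 2 split=> //.
exists (b, k.+1); rewrite !kE kpredP // (@predP' _ 0 2 b k.+1) //; split=> //.
by exists b, k.
Qed.

Definition stp (a b c d : dom T) : Prop :=
  [/\ a.2 = 0, b.2 = 0, c = a & d = b] \/
  [/\ c.1 = a.1, a.2 = c.2.+1, d.1 = b.1 & b.2 = d.2.+1].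

Lemma kstepP s a b c d : s 3 = Some a -> s 4 = Some b -> s 5 = Some c -> s 6 = Some d ->
  ksat s kstep <-> stp a b c d.
Proof.
move=> s3 s4 s5 s6; rewrite /kstep !kE !kminP // !kpredP // (eqP' s5 s3) (eqP' s6 s4) s3 s4 s5 s6 /stp.
case: a {s3} => a n; case: b {s4} => b m; case: c {s5} => c k; case: d {s6} => d l /=.
split=> [[[[t [_ ->]] [[t' [_ ->]] [-> ->]]]|[[t [k' [[-> ->] [-> ->]]]] [t' [l' [[-> ->] [-> ->]]]]]]|].
- by left.
- by right.
case=> [[-> -> -> ->]|[-> -> -> ->]]; [left|right].
  by split; [exists a|split; [exists b|]].
by split; [exists a, k|exists b, l].
Qed.

(** From a pair at different positions the descent gets stuck when one element is at 0 before the
    other. A set closed under the descent thus contains only pairs of equal level. *)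
Lemma stp_lev (P : dom T -> dom T -> Prop) a b :
  (forall a b, P a b -> exists c d, P c d /\ stp a b c d) -> P a b -> a.2 = b.2.
Proof.
move=> h; elim: {a}a.2 {-2}a (erefl a.2) b => [|n IH] a an b Pab; have [c [d [Pcd]]] := h a b Pab.
  by case=> [[-> ->]|[]] //; rewrite an.
case=> [[]|[_ e _ ->]]; first by rewrite an.
by rewrite e; congr _.+1; apply: IH => //; move: e; rewrite an => -[].
Qed.

Lemma lev_stp (a b : dom T) : a.2 = b.2 ->
  exists c d, [/\ stp a b c d, c.2 = d.2, c = (a.1, a.2.-1) & d = (b.1, b.2.-1)].
Proof.
case: a b => a n [b m] /= <-; exists (a, n.-1), (b, n.-1); split=> //.
by case: n => [|n]; [left|right].
Qed.

Fixpoint kfo (lv : fo) (f : fl) : fo :=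
  match f with
  | KLit b a => FLit b a
  | KLev => lv
  | KAnd f g => FAnd (kfo lv f) (kfo lv g)
  | KOr f g => FOr (kfo lv f) (kfo lv g)
  | KEx x f => FEx x (kfo lv f)
  | KAll x f => FAll x (kfo lv f)
  end.

Definition lvP (lv : fo) := forall S : set (assignment T),
  fo_sat S lv <-> forall s, S s -> sat_atom s (Level 0 2).

(** Flatness: without dependence atoms and Boolean negation a team satisfies a formula exactly if
    each member does. The one part that need not be of this form, [lv], has the property by
    assumption. *)
Lemma kfoP lv f S : lvP lv -> fo_sat S (kfo lv f) <-> forall s, S s -> ksat s f.
Proof.
move=> h; elim: f S => [b a|//|f IHf g IHg|f IHf g IHg|x f IH|x f IH] S /=.
- by [].
- by rewrite IHf IHg; split=> [[h1 h2] s Ss|h1]; [split; [apply: h1|apply: h2]|split=> s /h1[]].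
- split=> [[S1 [S2 [-> /IHf h1 /IHg h2]]] s [/h1|/h2]|h1]; [by left|by right|].
  exists [set s | S s /\ ksat s f], [set s | S s /\ ksat s g]; split.
  + apply: set_ext => s; split=> [Ss|[[]|[]]//].
    by have [|] := h1 s Ss; [left|right].
  + by apply/IHf => s [].
  by apply/IHg => s [].
- split=> [[F [F0 /IH h1]] s Ss|h1].
    by have [d Fd] := F0 s Ss; exists d; apply: h1; exists s, d.
  exists (fun s => [set d | ksat (upd s x (Some d)) f]); split; first exact: h1.
  by apply/IH => _ [s [d [Ss Fd ->]]].
split=> [/IH h1 s Ss d|h1]; first by apply: h1; exists s, d.
by apply/IH => _ [s [d [Ss ->]]]; apply: h1.
Qed.

Definition shift_team (S : set (assignment T)) x (d : dom T) : set (assignment T) :=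
  [set upd s x (Some d) | s in S].

(** The dependence atom without determining variables makes [x] constant, so one element is chosen
    for the whole team. *)
Lemma cexP S x f : S !=set0 ->
  fo_sat S (FEx x (FAnd (FDep [::] x) f)) <-> exists d, fo_sat (shift_team S x d) f.
Proof.
move=> [s0 S0]; have ux s d : upd s x (Some d) x = Some d by rewrite /upd eqxx.
have E (F : assignment T -> set (dom T)) d : (forall s, S s -> F s !=set0) ->
    (forall s e, S s -> F s e -> e = d) ->
    [set s' | exists s d, [/\ S s, F s d & s' = upd s x (Some d)]] = shift_team S x d.
  move=> F0 Fd; apply: set_ext => s'; split=> [[s [e [Ss Fe ->]]]|[s Ss <-]].
    by exists s => //; rewrite (Fd _ _ Ss Fe).
  by have [e Fe] := F0 s Ss; exists s, e; split=> //; rewrite (Fd _ _ Ss Fe).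
split=> [[F [F0 [dep h]]]|[d h]].
  have [d Fd] := F0 _ S0; exists d; rewrite -(E F d) // => s e Ss Fe.
  have := dep (upd s x (Some e)) (upd s0 x (Some d)); rewrite !ux => dep'.
  have : Some e = Some d by apply: dep' => //; [exists s, e|exists s0, d].
  by case.
exists (fun=> [set d]); split; first by move=> s _; exists d.
rewrite (E _ d) //; last by move=> s _; exists d.
by split=> // s s' [t _ <-] [t' _ <-] _; rewrite !ux.
Qed.

Lemma fnotE S f : fo_sat S (FNot f) = (~ fo_sat (T := T) S f). Proof. by []. Qed.
Lemma fandE S f g : fo_sat S (FAnd f g) = (fo_sat (T := T) S f /\ fo_sat S g). Proof. by []. Qed.
Lemma forE S f g : fo_sat S (FOr f g) = exists S1 S2, [/\ S = S1 `|` S2, fo_sat (T := T) S1 f & fo_sat S2 g].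
Proof. by []. Qed.
Lemma fexE S x f : fo_sat S (FEx x f) = exists F : assignment T -> set (dom T),
  (forall s, S s -> F s !=set0) /\
  fo_sat [set s' | exists s d, [/\ S s, F s d & s' = upd s x (Some d)]] f.
Proof. by []. Qed.
Lemma fallE S x f : fo_sat S (FAll x f) =
  fo_sat (T := T) [set s' | exists s d, S s /\ s' = upd s x (Some d)] f.
Proof. by []. Qed.

End Flat.

Definition lvD := FLit true (Level 0 2).
(** The inclusion atom for (5, 6) and (3, 4): no constant pair (7, 8) is taken by (5, 6) somewhere
    and avoided by (3, 4) everywhere. *)
Definition inclF := FNot (FEx 7 (FAnd (FDep [::] 7) (FEx 8 (FAnd (FDep [::] 8)
  (FAnd (FNot (kfo lvD (KOr (KF (Eq 5 7)) (KF (Eq 6 8)))))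
        (kfo lvD (KOr (KF (Eq 3 7)) (KF (Eq 4 8))))))))).
(* Level(0, 2) without the equal-level predicate: the values of (3, 4) form a
   set containing the pair at (0, 2) and closed under simultaneous predecessor. *)
Definition levM : fo := FAnd (FLit true (Eq 0 0)) (FAnd (FLit true (Eq 2 2))
  (FAll 3 (FAll 4 (FOr (kfo lvD (KOr (KF (Eq 3 0)) (KF (Eq 4 2))))
    (FEx 5 (FEx 6 (FAnd (kfo lvD kstep) inclF))))))).

Section Lev.
Variable T : set trace.
Implicit Types s : assignment T.

Lemma lvDP : lvP T lvD. Proof. by []. Qed.

Lemma inclP (S : set (assignment T)) :
  (forall s, S s -> exists a b c d, [/\ s 3 = Some a, s 4 = Some b, s 5 = Some c & s 6 = Some d]) ->
  fo_sat S inclF <-> forall s c d, S s -> s 5 = Some c -> s 6 = Some d ->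
    exists2 s', S s' & s' 3 = Some c /\ s' 4 = Some d.
Proof.
move=> def; have ne x y u v s (a b c d : dom T) : s x = Some a -> s y = Some b -> s u = Some c -> s v = Some d ->
    ksat s (KOr (KF (Eq x u)) (KF (Eq y v))) <-> ~ (a = c /\ b = d).
  move=> sx sy su sv; rewrite !kE (eqP' sx su) (eqP' sy sv).
  split=> [[h|h] []//|h]; have [ac|] := pselect (a = c); last by left.
  by right=> bd; apply: h.
have [[s0 S0]|S0] := pselect (S !=set0); last first.
  split=> [_ s c d Ss|_]; first by case: S0; exists s.
  rewrite /inclF fnotE fexE => -[F [_]]; rewrite fandE fexE => -[_ [G [_]]].
  rewrite fandE fandE fnotE => -[_ [h _]]; apply: h; apply/(kfoP _ _ lvDP) => s.
  by case=> s' [d [[s'' [d' [Ss _ _]]]]]; case: S0; exists s''.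
have H : fo_sat S (FEx 7 (FAnd (FDep [::] 7) (FEx 8 (FAnd (FDep [::] 8)
  (FAnd (FNot (kfo lvD (KOr (KF (Eq 5 7)) (KF (Eq 6 8)))))
        (kfo lvD (KOr (KF (Eq 3 7)) (KF (Eq 4 8))))))))) <->
  exists c d, (exists2 s, S s & s 5 = Some c /\ s 6 = Some d) /\
     ~ (exists2 s, S s & s 3 = Some c /\ s 4 = Some d).
  rewrite cexP; last by exists s0.
  have E c : fo_sat (shift_team S 7 c) (FEx 8 (FAnd (FDep [::] 8)
    (FAnd (FNot (kfo lvD (KOr (KF (Eq 5 7)) (KF (Eq 6 8)))))
        (kfo lvD (KOr (KF (Eq 3 7)) (KF (Eq 4 8))))))) <->
    exists d, (exists2 s, S s & s 5 = Some c /\ s 6 = Some d) /\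
     ~ (exists2 s, S s & s 3 = Some c /\ s 4 = Some d).
    rewrite cexP; last by exists (upd s0 7 (Some c)), s0.
    have E d : fo_sat (shift_team (shift_team S 7 c) 8 d) (FAnd
        (FNot (kfo lvD (KOr (KF (Eq 5 7)) (KF (Eq 6 8)))))
        (kfo lvD (KOr (KF (Eq 3 7)) (KF (Eq 4 8))))) <->
      (exists2 s, S s & s 5 = Some c /\ s 6 = Some d) /\
      ~ (exists2 s, S s & s 3 = Some c /\ s 4 = Some d).
      rewrite fandE fnotE !(kfoP _ _ lvDP).
      split=> [[h1 h2]|[[s Ss [s5 s6]] h2]]; split.
      - apply: contrapT => n; apply: h1 => _ [_ [s Ss <-] <-].
        have [a [b [c' [d' [s3 s4 s5 s6]]]]] := def s Ss.
        apply/(@ne 5 6 7 8 _ c' d' c d) => // -[e1 e2]; subst c' d'.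
        by apply: n; exists s.
      - move=> [s Ss [s3 s4]]; have [_ [_ [c' [d' [_ _ s5 s6]]]]] := def s Ss.
        have := h2 (upd (upd s 7 (Some c)) 8 (Some d)) _.
        by move/(_ (ex_intro2 _ _ _ (ex_intro2 _ _ s Ss erefl) erefl))/(@ne 3 4 7 8 _ c d c d s3 s4 erefl erefl); apply.
      - move=> /(_ (upd (upd s 7 (Some c)) 8 (Some d)) (ex_intro2 _ _ _ (ex_intro2 _ _ s Ss erefl) erefl)).
        by move/(@ne 5 6 7 8 _ c d c d s5 s6 erefl erefl); apply.
      move=> _ [_ [s' Ss' <-] <-]; have [a [b [_ [_ [s3 s4 _ _]]]]] := def s' Ss'.
      apply/(@ne 3 4 7 8 _ a b c d) => // -[e1 e2]; subst a b.
      by apply: h2; exists s'.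
    by split=> -[d /E h]; exists d.
  by split=> -[c /E h]; exists c.
rewrite /inclF fnotE.
split=> [h s c d Ss s5 s6|h].
  by apply: contrapT => n; apply: h; apply/H; exists c, d; split=> //; exists s.
by move/H => [c [d [[s Ss [s5 s6]] n]]]; apply: n; exact: h s5 s6.
Qed.

Lemma levMP : lvP T levM.
Proof.
move=> S; rewrite /levM !fandE !fallE forE; split=> [[h0 [h2 h]] s Ss|h].
  have [d0 s0 _] := h0 s Ss; have [d2 s2 _] := h2 s Ss.
  case: h => S1 [S2 [eS /(kfoP _ _ lvDP) h1]]; rewrite fexE => -[F5 [F50]].
  rewrite fexE => -[F6 [F60]]; rewrite fandE => -[/(kfoP _ _ lvDP) hs hi].
  set S6 := [set s' | _] in hs hi.
  have mS s' : S2 s' -> exists s a b, s' = upd (upd s 3 (Some a)) 4 (Some b).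
    move=> S2s; have : (S1 `|` S2) s' by right.
    by rewrite -eS => -[_ [b [[u [a [_ ->]]] ->]]]; exists u, a, b.
  have def s' : S6 s' -> exists a b c d, [/\ s' 3 = Some a, s' 4 = Some b, s' 5 = Some c & s' 6 = Some d].
    move=> [_ [d [[t [c [/mS[u [a [b ->]]] _ ->]]] _ ->]]].
    by exists a, b, c, d.
  have {}hi := proj1 (inclP def) hi.
  (* The values of (3, 4) on the part of the team that passes the test form the set closed under
     descent. *)
  pose P a b := exists2 s', S2 s' & s' 3 = Some a /\ s' 4 = Some b.
  have Pd a b : P a b -> exists c d, P c d /\ stp a b c d.
    move=> [s' S2s [s3 s4]]; have [c Fc] := F50 s' S2s.
    have [|d Fd] := F60 (upd s' 5 (Some c)); first by exists s', c.
    have S6s : S6 (upd (upd s' 5 (Some c)) 6 (Some d)).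
      by exists (upd s' 5 (Some c)), d; split=> //; exists s', c.
    exists c, d; split; last exact/(kstepP (s := upd (upd s' 5 (Some c)) 6 (Some d)) s3 s4 erefl erefl)/hs.
    have [t [_ [d' [[u [c' [S2u _ ->]]] _ ->]]] [t3 t4]] := hi _ c d S6s erefl erefl.
    by exists u.
  have e := stp_lev Pd (a := d0) (b := d2).
  case: d0 d2 s0 s2 e => a n [b m] s0 s2 e; apply/(levP' s0 s2); apply: e.
  pose s' := upd (upd s 3 (Some (a, n))) 4 (Some (b, m)).
  exists s' => //; have : (S1 `|` S2) s'.
    by rewrite -eS; exists (upd s 3 (Some (a, n))), (b, m); split=> //; exists s, (a, n).
  case=> // /h1[]; case; first by apply/(@eqP' _ _ _ _ (a, n) (a, n)).
  by apply/(@eqP' _ _ _ _ (b, m) (b, m)).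
split; first by move=> s /h[t [t' [n [s0 _]]]]; exists (t, n).
split; first by move=> s /h[t [t' [n [_ s0]]]]; exists (t', n).
set S'' := [set s' | _].
have mS s' : S'' s' -> exists s a b, S s /\ s' = upd (upd s 3 (Some a)) 4 (Some b).
  by move=> [_ [b [[u [a [Su ->]]] ->]]]; exists u, a, b.
have Sm s a b : S s -> S'' (upd (upd s 3 (Some a)) 4 (Some b)).
  by move=> Ss; exists (upd s 3 (Some a)), b; split=> //; exists s, a.
(* For the converse the set of all pairs of equal level serves, the same for every member of the
   team. *)
pose S2 := [set s' | S'' s' /\ exists a b, [/\ s' 3 = Some a, s' 4 = Some b & a.2 = b.2]].
exists [set s' | S'' s' /\ ksat s' (KOr (KF (Eq 3 0)) (KF (Eq 4 2)))], S2.
split.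
- apply: set_ext => s'; split=> [S's|[[]|[]]//].
  have [n|n] := pselect (ksat s' (KOr (KF (Eq 3 0)) (KF (Eq 4 2)))); first by left.
  right; split=> //; have [s [a [b [Ss e]]]] := mS _ S's; exists a, b; subst s'; split=> //.
  have [t [t' [k [s0 s2]]]] := h _ Ss.
  have ea : a = (t, k).
    by apply: contrapT => ne; apply: n; left; rewrite klitF (@eqP' _ _ 3 0 a (t, k)).
  have eb : b = (t', k).
    by apply: contrapT => ne; apply: n; right; rewrite klitF (@eqP' _ _ 4 2 b (t', k)).
  by rewrite ea eb.
- by apply/(kfoP _ _ lvDP) => s' [].
pose pr (d : dom T) : dom T := (d.1, d.2.-1).
rewrite fexE; exists (fun s => [set c | exists2 a, s 3 = Some a & c = pr a]); split.
  by move=> s' [_ [a [b [s3 _ _]]]]; exists (pr a), a.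
rewrite fexE; exists (fun s => [set c | exists2 a, s 4 = Some a & c = pr a]); split.
  by move=> _ [s' [c [[_ [a [b [_ s4 _]]]] _ ->]]]; exists (pr b), b.
rewrite fandE; set S6 := [set s' | _].
have mS6 s' : S6 s' -> exists s a b, [/\ S s, a.2 = b.2 &
    s' = upd (upd (upd (upd s 3 (Some a)) 4 (Some b)) 5 (Some (pr a))) 6 (Some (pr b))].
  move=> [_ [d [[t [c [[S''t [a [b [t3 t4 ab]]]] [a' t3' ->] ->]]] [b' t4' ->] ->]]].
  have [s [a0 [b0 [Ss e]]]] := mS _ S''t; subst t; exists s, a, b; split=> //.
  by move: t3 t4 t3' t4'; rewrite /upd /= => -[->] [->] [->] [->].
have S6m s a b : S s -> a.2 = b.2 ->
    S6 (upd (upd (upd (upd s 3 (Some a)) 4 (Some b)) 5 (Some (pr a))) 6 (Some (pr b))).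
  move=> Ss ab; exists (upd (upd (upd s 3 (Some a)) 4 (Some b)) 5 (Some (pr a))), (pr b).
  split=> //; last by exists b.
  exists (upd (upd s 3 (Some a)) 4 (Some b)), (pr a); split=> //; last by exists a.
  by split; [exact: Sm|exists a, b].
split.
  apply/(kfoP _ _ lvDP) => _ /mS6[s [a [b [Ss ab ->]]]].
  have [c [d [st _ ec ed]]] := lev_stp ab; rewrite ec ed in st.
  exact/(kstepP (a := a) (b := b) (c := pr a) (d := pr b)).
apply/inclP.
  by move=> _ /mS6[s [a [b [Ss ab ->]]]]; exists a, b, (pr a), (pr b).
move=> _ c d /mS6[s [a [b [Ss ab ->]]]] [<-] [<-].
exists (upd (upd (upd (upd s 3 (Some (pr a))) 4 (Some (pr b))) 5 (Some (pr (pr a)))) 6 (Some (pr (pr b)))) => //.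
by apply: S6m; rewrite //= ab.
Qed.

End Lev.

(** * Monadic second-order logic over traces in team logic *)

(* The team over the variable 0 represents the sets [V k]: it contains (t, k+1)
   if and only if t is in [V k]. All points of level 0 belong to the team, so
   that it is never empty. *)
Section TeamCode.
Variable b : bool.
Notation lv := (if b then levM else lvD).

(** Variable 1 is paired with every member. A pair away from level [i.+1] must go right if it copies
    the member and left otherwise; pairs at level [i.+1] go either way, and those on the right are
    the new value of the set variable. Then 0 takes over the value of 1. *)
Definition mexF (i : nat) (f : fo) := FAll 1 (FOr
  (kfo lv (KOr (KF (Eq 0 1)) (kpos i.+1)))
  (FAnd (kfo lv (KOr (KT (Eq 0 1)) (kpos i.+1)))
        (FEx 0 (FAnd (kfo lv (KT (Eq 0 1))) f)))).

(** The constant 1 at level [j.+1] is a value of 0 in the team, so its trace is in the set [j]. The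
    trivial left disjunct allows the right one to select some non-empty part, with 0 at level
    [i.+1], as the member of the set [i]; there 1 may be overwritten to test the level of 0. *)
Definition matF (h : latom) (i j : nat) := FEx 1 (FAnd (FDep [::] 1)
  (FAnd (kfo lv (kpos j.+1)) (FAnd (FNot (kfo lv (KF (Eq 0 1))))
    (FOr (kfo lv (KT (Eq 1 1))) (FAnd (kfo lv (kat h))
      (FAnd (FNot (kfo lv (KF (Eq 1 1))))
        (kfo lv (KEx 1 (KAnd (KT (Eq 0 1)) (kpos i.+1)))))))))).

Fixpoint trF (f : l3) : fo :=
  match f with
  | LAtm h i j => matF h i j
  | LNeg f => FNot (trF f)
  | LCon f g => FAnd (trF f) (trF g)
  | LExq i f => mexF i (trF f)
  end.

Definition startF (f : fo) := FAll 0 (FOr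
  (kfo lv (KEx 2 (KAnd (KT (Le 2 0)) (KF (Eq 2 0)))))
  (FAnd (kfo lv (kmin 0 2)) f)).

Section Models.
Variable T : set trace.
Hypothesis T0 : T !=set0.

Lemma lvb : lvP T lv.
Proof. by case: b; [exact: levMP|exact: lvDP]. Qed.

Notation fP := (kfoP _ _ lvb).

Definition lvl (V : nat -> set trace) (d : dom T) : Prop :=
  if d.2 is k.+1 then V k (val d.1) else True.

Definition trel (S : set (assignment T)) (V : nat -> set trace) : Prop :=
  (forall s, S s -> exists2 d, s 0 = Some d & lvl V d) /\
  (forall d, lvl V d -> exists2 s, S s & s 0 = Some d).

Lemma trel_neq0 S V : trel S V -> S !=set0.
Proof.
by case: T0 => t Tt [_ /(_ (exist _ t (mem_set Tt), 0) I)[s Ss _]]; exists s.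
Qed.

Lemma lvl_upd V i X t k : lvl (upd V i X) (t, k) <->
  (if k == i.+1 then X (val t) else lvl V (t, k)).
Proof. by case: k => //= k; rewrite /lvl /upd /= eqSS; case: eqP. Qed.

Lemma matFP h i j V S : (forall i, V i `<=` T) -> trel S V ->
  fo_sat S (matF h i j) <-> l3sat T V (LAtm h i j).
Proof.
move=> VT R; have S0 := trel_neq0 R; rewrite /matF cexP //; split.
  case=> d; rewrite !fandE fnotE forE => -[/fP h1 [h2 [S1 [S2 [eS _]]]]].
  rewrite !fandE fnotE => -[/fP hk [h4 /fP h5]].
  have [u0 Su0] := S0.
  have [c] : exists c, upd u0 1 (Some d) 1 = Some (c, j.+1).
    by apply/kposP/h1; exists u0.
  rewrite /upd /= => -[dE]; subst d.
  have [s Ss s0] : exists2 s, S s & s 0 = Some (c, j.+1).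
    apply: contrapT => n; apply: h2; apply/fP => _ [s Ss <-]; have [e s0e _] := R.1 s Ss.
    rewrite klitF (@eqP' _ _ 0 1 e (c, j.+1)) // => ed; apply: n; exists s => //.
    by rewrite s0e ed.
  have Vc : V j (val c) by have [d] := R.1 s Ss; rewrite s0 => -[<-].
  have [s' S2s] : S2 !=set0.
    apply: contrapT => n; apply: h4; apply/fP => s' S2s'; case: n; by exists s'.
  have : (S1 `|` S2) s' by right.
  rewrite -eS => -[u Su eu]; have [e u0e eV] := R.1 u Su.
  move: (h5 _ S2s) (hk _ S2s); rewrite -{}eu kexE => -[e' ]; rewrite kandE klitT kposP.
  rewrite (@eqP' _ _ 0 1 e e') // => -[<- [a]]; rewrite /upd /= => -[ea]; subst e.
  by move/(@katP _ _ _ a c i.+1 j.+1 u0e erefl); exists (val a), (val c).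
move=> [a' [c' [Va Vc hac]]].
pose a : T := exist _ a' (mem_set (VT _ _ Va)); pose c : T := exist _ c' (mem_set (VT _ _ Vc)).
have [sa Sa sa0] := R.2 (a, i.+1) Va; have [sc Sc sc0] := R.2 (c, j.+1) Vc.
exists (c, j.+1); rewrite !fandE fnotE forE; split.
  by apply/fP => _ [s Ss <-]; apply/kposP; exists c.
split.
  move/fP => /(_ _ (ex_intro2 _ _ sc Sc erefl)).
  by rewrite klitF (@eqP' _ _ 0 1 (c, j.+1) (c, j.+1)).
(* The parts of a split may overlap, so the trivial disjunct takes the whole team. *)
exists (shift_team S 1 (c, j.+1)), [set upd sa 1 (Some (c, j.+1))]; split.
- apply: set_ext => s; split=> [Ss|[//|->]]; first by left.
  by exists sa.
- by apply/fP => _ [s Ss <-]; rewrite klitT; exists (c, j.+1).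
rewrite !fandE fnotE; split; first by apply/fP => _ ->; apply/(@katP _ _ _ a c i.+1 j.+1).
split.
  move/fP => /(_ _ erefl); rewrite klitF (@eqP' _ _ 1 1 (c, j.+1) (c, j.+1)) //.
apply/fP => _ ->; rewrite kexE; exists (a, i.+1); rewrite kandE klitT kposP.
by rewrite (@eqP' _ _ 0 1 (a, i.+1) (a, i.+1)) //; split=> //; exists a.
Qed.

Lemma trFP f V S : (forall i, V i `<=` T) -> trel S V -> fo_sat S (trF f) <-> l3sat T V f.
Proof.
elim: f V S => [h i j|f IH|f IHf g IHg|i f IH] V S VT R; first exact: matFP.
- by rewrite [trF _]/= fnotE negP3 (IH V S).
- by rewrite [trF _]/= fandE conP (IHf V S) // (IHg V S).
have VT' X : X `<=` T -> forall k, upd V i X k `<=` T.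
  by move=> XT k; rewrite /upd; case: eqP.
rewrite [trF _]/= /mexF fallE forE lexP; set S' := [set s' | _]; split.
  move=> [A [B [eS /fP hA]]]; rewrite fandE fexE => -[/fP hB [F [F0]]].
  rewrite fandE; set B' := [set s' | _]; move=> -[/fP hE hf].
  have BS s : B s -> exists u d, S u /\ s = upd u 1 (Some d).
    by move=> Bs; have : (A `|` B) s by [right]; rewrite -eS.
  have key s d : B s -> s 1 = Some d -> exists2 s', B' s' & s' 0 = Some d.
    move=> Bs s1; have [e Fe] := F0 s Bs.
    have B's : B' (upd s 0 (Some e)) by exists s, e.
    exists (upd s 0 (Some e)) => //; move: (hE _ B's).
    by rewrite klitT (@eqP' _ _ 0 1 e d) // => ->.
  pose X : set trace := [set a | exists2 t : T, a = val t & exists2 s, B s & s 1 = Some (t, i.+1)].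
  have XT : X `<=` T by move=> _ [t -> _]; exact: set_mem (valP t).
  exists X => //; apply/(IH (upd V i X) B') => //; first exact: VT'.
  split=> [_ [s [d [Bs Fd ->]]]|[t k]].
    have [u [[t k] [Su se]]] := BS s Bs; subst s.
    have B's : B' (upd (upd u 1 (Some (t, k))) 0 (Some d)) by exists (upd u 1 (Some (t, k))), d.
    move: (hE _ B's); rewrite klitT (@eqP' _ _ 0 1 d (t, k)) // => de; subst d.
    exists (t, k) => //; apply/lvl_upd; case: eqP => [ki|nk].
      by exists t => //; exists (upd u 1 (Some (t, k))) => //; rewrite ki.
    have [e u0e Ve] := R.1 u Su; move: (hB _ Bs); rewrite korE klitT kposP.
    rewrite (@eqP' _ _ 0 1 e (t, k)) // => -[<-//|[t' ]]; rewrite /upd /= => -[_ ki].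
    by case: nk.
  move/lvl_upd; case: eqP => [ki [t' /val_inj tt [s Bs s1]]|nk Vd].
    by apply: (key s) => //; rewrite s1 tt ki.
  have [u Su u0] := R.2 _ Vd; apply: (key (upd u 1 (Some (t, k)))) => //.
  have : S' (upd u 1 (Some (t, k))) by exists u, (t, k).
  rewrite eS => -[/hA|//]; rewrite korE klitF kposP (@eqP' _ _ 0 1 (t, k) (t, k)) // => -[//|[t']].
  by rewrite /upd /= => -[_ ki]; case: nk.
move=> [X XT hf].
(* Pairs at level [i.+1] are all put into [A], so [B] can contain just those that belong to [X]. *)
pose A : set (assignment T) := [set s | exists u d, [/\ S u, s = upd u 1 (Some d) & d.2 = i.+1 \/ u 0 <> Some d]].
pose B : set (assignment T) := [set s | exists u d, [/\ S u, s = upd u 1 (Some d) &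
  if d.2 == i.+1 then X (val d.1) else u 0 = Some d]].
exists A, B; split.
- apply: set_ext => s; split=> [[u [d [Su ->]]]|[|] [u [d [Su -> _]]]]; try by exists u, d.
  have [di|nd] := eqVneq d.2 i.+1; first by left; exists u, d; split=> //; left.
  have [ud|ud] := pselect (u 0 = Some d); last by left; exists u, d; split=> //; right.
  by right; exists u, d; rewrite (negbTE nd).
- apply/fP => _ [u [[t k] [Su -> h]]]; rewrite korE klitF kposP.
  have [e u0e _] := R.1 u Su; rewrite (@eqP' _ _ 0 1 e (t, k)) //.
  by case: h => [/= ->|ne]; [right; exists t|left=> ee; apply: ne; rewrite u0e ee].
rewrite fandE fexE; split.
  apply/fP => _ [u [[t k] [Su -> h]]]; rewrite korE klitT kposP.
  have [e u0e _] := R.1 u Su; rewrite (@eqP' _ _ 0 1 e (t, k)) //.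
  move: h => /=; case: eqP => [-> _|_ h]; first by right; exists t.
  by left; move: h; rewrite u0e => -[].
exists (fun s => [set d | s 1 = Some d]); split; first by move=> _ [u [d [_ -> _]]]; exists d.
rewrite fandE; split.
  apply/fP => _ [_ [d [[u [e [Su -> h]]] de ->]]]; rewrite klitT.
  by apply/(@eqP' _ _ 0 1 d e) => //; move: de; rewrite /upd /= => -[].
apply/(IH (upd V i X)) => //; first exact: VT'.
split=> [_ [_ [d [[u [e [Su -> h]]] de ->]]]|[t k]].
  exists d => //; move: de; rewrite /= {1}/upd /= => -[ed]; subst e.
  case: d h => t k /=; rewrite lvl_upd; case: eqP => // _ h.
  by have [e] := R.1 u Su; rewrite h => -[<-].
rewrite lvl_upd => h.
have [u Su hu] : exists2 u, S u & if k == i.+1 then X (val t) else u 0 = Some (t, k).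
  case: eqP h => [ki Xt|_ Vd]; last exact: R.2.
  by have [u Su] := trel_neq0 R; exists u.
exists (upd (upd u 1 (Some (t, k))) 0 (Some (t, k))) => //.
by exists (upd u 1 (Some (t, k))), (t, k); split=> //; exists u, (t, k).
Qed.

Lemma startFP f : fo_models T (startF (trF f)) <-> l3sat T (fun=> set0) f.
Proof.
rewrite /fo_models /startF fallE forE; set S' := [set s' | _].
have lv0 t k : lvl (fun=> set0) (t, k) <-> k = 0 by case: k.
split.
  move=> [A [B [eS /fP hA]]]; rewrite fandE => -[/fP hB /trFP hf]; apply: hf => //.
  by move=> _ a.
  split=> [s Bs|[t k] /lv0 k0].
    by have /kminP[//|t s0] := hB s Bs; exists (t, 0).
  subst k; have : S' (upd (@empty_assignment T) 0 (Some (t, 0))).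
    by exists (@empty_assignment T), (t, 0).
  rewrite eS => -[/hA|Bs]; last by exists (upd (@empty_assignment T) 0 (Some (t, 0))).
  rewrite kexE => -[[t' n]]; rewrite kandE klitT klitF (@leP' _ _ 2 0 t' t n 0) //.
  rewrite (@eqP' _ _ 2 0 (t', n) (t, 0)) // => -[[-> n0] ne].
  by case: ne; move: n0; rewrite leqn0 => /eqP->.
move=> h; pose B : set (assignment T) := [set s | exists t, s = upd (@empty_assignment T) 0 (Some (t, 0))].
exists [set s | S' s /\ ksat s (KEx 2 (KAnd (KT (Le 2 0)) (KF (Eq 2 0))))], B; split.
- apply: set_ext => s; split=> [Ss|[[]//|[t ->]]].
    have [_ [[t [|n]] [-> se]]] := Ss; first by right; exists t.
    left; split=> //; rewrite kexE; exists (t, 0); rewrite se kandE klitT klitF.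
    by rewrite (@leP' _ _ 2 0 t t 0 n.+1) // (@eqP' _ _ 2 0 (t, 0) (t, n.+1)).
  by exists (@empty_assignment T), (t, 0).
- by apply/fP => s [].
rewrite fandE; split; first by apply/fP => _ [t ->]; apply/kminP => //; exists t.
have R : trel B (fun=> set0).
  split=> [_ [t ->]|[t k] /lv0 ->]; first by exists (t, 0).
  by exists (upd (@empty_assignment T) 0 (Some (t, 0))) => //; exists t.
by apply/(trFP _ _ R) => // _ a.
Qed.

End Models.

Lemma kpos_free i : all (pred1 1) (fo_free (kfo lv (kpos i))).
Proof.
elim: i => [|i IH]; first by rewrite /= /kmin -lock.
rewrite /= /kpred -lock /= !(all_filter, all_cat) /=; apply: sub_all IH => x /eqP->.
by [].
Qed.

Lemma kat_free h : all (mem [:: 0; 1]) (fo_free (kfo lv (kat h))).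
Proof. by case: b; case: h => [||||p|]; rewrite /= /levM /kpos1 /same /nsame /kmin /kpred -?lock /= /kmin /kpred -?lock. Qed.

Lemma fo_free_mex i f : fo_free (mexF i f) = let k := fo_free (kfo lv (kpos i.+1)) in
  [seq y <- ([:: 0; 1] ++ k) ++ ([:: 0; 1] ++ k) ++ [seq y <- [:: 0; 1] ++ fo_free f | y != 0] | y != 1].
Proof. by []. Qed.

Lemma fo_free_mat h i j : fo_free (matF h i j) =
  [seq y <- [:: 1] ++ fo_free (kfo lv (kpos j.+1)) ++ [:: 0; 1] ++ [:: 1; 1] ++
    fo_free (kfo lv (kat h)) ++ [:: 1; 1] ++ [seq y <- [:: 0; 1] ++ fo_free (kfo lv (kpos i.+1)) | y != 1] | y != 1].
Proof. by []. Qed.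

Lemma trF_free f : all (pred1 0) (fo_free (trF f)).
Proof.
elim: f => [h i j|f IH|f IHf g IHg|i f IH].
- rewrite [trF _]/= fo_free_mat; move: (fo_free _) (fo_free _) (fo_free _) (kpos_free i.+1) (kpos_free j.+1) (kat_free h).
  move=> li lj lh /allP hi /allP hj /allP hh; apply/allP => x; rewrite mem_filter !mem_cat !mem_filter !mem_cat !inE.
  case: (x =P 1) => //= x1; rewrite !orbF; case/or4P=> [/hj/eqP//|//|/hh|/orP[//|/hi/eqP//]].
  by rewrite /= !inE => /orP[//|/eqP].
- exact: IH.
- by change (all (pred1 0) (fo_free (trF f) ++ fo_free (trF g))); rewrite all_cat IHf.
rewrite [trF _]/= fo_free_mex; cbv zeta; move: (kpos_free i.+1) IH.
move: (fo_free (kfo lv (kpos i.+1))) (fo_free (trF f)) => lk lf /allP hk /allP hf; apply/allP => x; rewrite !(mem_filter, mem_cat, inE).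
by case: (x =P 1) => //= x1; case: (x =P 0) => //= x0 /or3P[/hk/eqP//|/hk/eqP//|/hf/eqP].
Qed.

Lemma startF_free f : fo_free (startF (trF f)) = [::].
Proof.
have -> : fo_free (startF (trF f)) =
  [seq y <- fo_free (kfo lv (KEx 2 (KAnd (KT (Le 2 0)) (KF (Eq 2 0))))) ++
    fo_free (kfo lv (kmin 0 2)) ++ fo_free (trF f) | y != 0] by [].
have -> : fo_free (kfo lv (kmin 0 2)) = [:: 0; 0; 0; 0] by rewrite /kmin -lock.
rewrite filter_cat filter_cat /=; apply/eqP; rewrite -size_eq0 size_filter -leqn0 leqNgt -has_count -all_predC.
by apply: sub_all (trF_free f) => x /= ->.
Qed.

Lemma kpos_vars i : ~~ b -> all (fun x => x < 3) (fo_vars (kfo lv (kpos i))).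
Proof.
move=> nb; elim: i => [|i IH]; first by rewrite /= /kmin -lock.
by rewrite /= /kpred -lock /= IH.
Qed.

Lemma kat_vars h : ~~ b -> all (fun x => x < 3) (fo_vars (kfo lv (kat h))).
Proof. by case: b => // _; case: h => [||||p|]; rewrite /= /kpos1 /same /nsame /kmin /kpred -?lock /= /kmin /kpred -?lock. Qed.

Lemma trF_vars f : ~~ b -> all (fun x => x < 3) (fo_vars (trF f)).
Proof.
move=> nb; elim: f => [h i j|f IH|f IHf g IHg|i f IH].
- change (all (fun x => x < 3) ([:: 1; 1] ++ fo_vars (kfo lv (kpos j.+1)) ++ [:: 0; 1] ++ [:: 1; 1] ++
    fo_vars (kfo lv (kat h)) ++ [:: 1; 1] ++ [:: 1; 0; 1] ++ fo_vars (kfo lv (kpos i.+1)))).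
  by rewrite !all_cat !kpos_vars // kat_vars.
- exact: IH.
- by change (all (fun x => x < 3) (fo_vars (trF f) ++ fo_vars (trF g))); rewrite all_cat IHf.
change (all (fun x => x < 3) ([:: 1] ++ ([:: 0; 1] ++ fo_vars (kfo lv (kpos i.+1))) ++
  ([:: 0; 1] ++ fo_vars (kfo lv (kpos i.+1))) ++ [:: 0] ++ [:: 0; 1] ++ fo_vars (trF f))).
by rewrite !all_cat !kpos_vars // IH.
Qed.

Lemma startF_vars f : ~~ b -> size (undup (fo_vars (startF (trF f)))) <= 3.
Proof.
move=> nb; rewrite -[3](size_iota 0); apply: uniq_leq_size; first exact: undup_uniq.
move=> x; rewrite mem_undup mem_iota add0n; apply: (allP (a := fun x => x < 3)).
change (all (fun x => x < 3) ([:: 0; 2; 2; 0; 2; 0] ++ fo_vars (kfo lv (kmin 0 2)) ++ fo_vars (trF f))).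
by rewrite !all_cat trF_vars // /kmin -lock.
Qed.

Lemma kpos_level i : b -> fo_level_free (kfo lv (kpos i)).
Proof.
move=> bt; elim: i => [|i IH]; first by rewrite /= /kmin -lock.
by rewrite /= /kpred -lock /= IH.
Qed.

Lemma kat_level h : b -> fo_level_free (kfo lv (kat h)).
Proof. by case: b => // _; case: h => [||||p|]; rewrite /= /levM /kpos1 /same /nsame /kmin /kpred -?lock /= /kmin /kpred -?lock. Qed.

Lemma startF_level f : b -> fo_level_free (startF (trF f)).
Proof.
move=> bt; change (fo_level_free (kfo lv (kmin 0 2)) && fo_level_free (trF f)).
rewrite /kmin -lock /=; elim: f => [h i j|f IH|f IHf g IHg|i f IH].
- change ([&& fo_level_free (kfo lv (kpos j.+1)), true, true, fo_level_free (kfo lv (kat h)), true &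
    fo_level_free (kfo lv (kpos i.+1))]).
  by rewrite !kpos_level // kat_level.
- exact: IH.
- by change (fo_level_free (trF f) && fo_level_free (trF g)); rewrite IHf.
change ([&& fo_level_free (kfo lv (kpos i.+1)), fo_level_free (kfo lv (kpos i.+1)) & fo_level_free (trF f)]).
by rewrite !kpos_level // IH.
Qed.

End TeamCode.

(** * Monadic second-order logic over traces in SO *)

Fixpoint kso (lv : so) (f : fl) : so :=
  match f with
  | KLit b a => if b then SAtom a else SNot (SAtom a)
  | KLev => lv
  | KAnd f g => SAnd (kso lv f) (kso lv g)
  | KOr f g => SOr (kso lv f) (kso lv g)
  | KEx x f => SEx x (kso lv f)
  | KAll x f => SAll x (kso lv f)
  end.

(** The closed set of pairs is a binary relation here, whose arity keeps it apart from the unary set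
    variables. [kstep] contains no [KLev], so the [Level] atom passed to [kso] does not occur in the
    result. *)
Definition lvS : so := SExR 0 2 (SAnd (SRel 0 [:: 0; 2]) (SAll 3 (SAll 4 (SOr
  (SNot (SRel 0 [:: 3; 4]))
  (SEx 5 (SEx 6 (SAnd (SRel 0 [:: 5; 6]) (kso (SAtom (Level 0 2)) kstep)))))))).

Fixpoint trS (f : l3) : so :=
  match f with
  | LAtm h i j => SEx 0 (SEx 1 (SAnd (SRel j [:: 1]) (SAnd (SRel i [:: 0]) (kso lvS (kat h)))))
  | LNeg f => SNot (trS f)
  | LCon f g => SAnd (trS f) (trS g)
  | LExq i f => SExR i 1 (trS f)
  end.

Section Models.
Variable T : set trace.
Implicit Types (s : assignment T) (W : nat * nat -> set (seq (dom T))).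

Lemma sandE W s f g : so_sat W s (SAnd f g) = (so_sat W s f /\ so_sat W s g). Proof. by []. Qed.
Lemma sorE W s f g : so_sat W s (SOr f g) = (so_sat W s f \/ so_sat W s g). Proof. by []. Qed.
Lemma snotE W s f : so_sat W s (SNot f) = (~ so_sat W s f). Proof. by []. Qed.
Lemma sexE W s x f : so_sat W s (SEx x f) = exists d, so_sat W (upd s x (Some d)) f.
Proof. by []. Qed.
Lemma sallE W s x f : so_sat W s (SAll x f) = forall d, so_sat W (upd s x (Some d)) f.
Proof. by []. Qed.
Lemma sexrE W s i k f : so_sat W s (SExR i k f) = exists R, so_sat (upd W (i, k) R) s f.
Proof. by []. Qed.

Lemma rel1P W s i x d : s x = Some d -> so_sat W s (SRel i [:: x]) <-> W (i, 1) [:: d].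
Proof.
move=> sx; split=> [[[|e [|e' ds]] //=]|h]; first by rewrite sx => -[->].
by exists [:: d]; rewrite //= sx.
Qed.

Lemma rel2P W s i x y d e : s x = Some d -> s y = Some e ->
  so_sat W s (SRel i [:: x; y]) <-> W (i, 2) [:: d; e].
Proof.
move=> sx sy; split=> [[[|d' [|e' [|z ds]]] //=]|h]; first by rewrite sx sy => -[-> ->].
by exists [:: d; e]; rewrite //= sx sy.
Qed.

Lemma ksoP lv f W s : (forall W s, so_sat W s lv <-> sat_atom s (Level 0 2)) ->
  so_sat W s (kso lv f) <-> ksat s f.
Proof.
move=> h; elim: f W s => [[] a|//|f IHf g IHg|f IHf g IHg|x f IH|x f IH] W s //=.
- by rewrite IHf IHg.
- by rewrite IHf IHg.
- by split=> -[d /IH h']; exists d.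
by split=> h' d; apply/IH.
Qed.

Lemma lvSP W s : so_sat W s lvS <-> sat_atom s (Level 0 2).
Proof.
have sP := @ksoP (SAtom (Level 0 2)) _ _ _ (fun _ _ => iff_refl _).
rewrite /lvS sexrE; split=> [[R]|[t [t' [n [s0 s2]]]]].
  rewrite sandE => -[[ds e0 Rds] h]; rewrite sallE in h.
  case: ds e0 Rds => [|[a n] [|[b m] [|z ds]]] //= [s0 s2] Rab.
  apply/(levP' s0 s2); apply: (@stp_lev _ (fun a b => R [:: a; b]) (a, n) (b, m)) => // u v Ruv.
  move: (h u); rewrite sallE => /(_ v); rewrite sorE snotE (@rel2P _ _ 0 3 4 u v) // sexE => -[[]//|[c]].
  rewrite sexE => -[d]; rewrite sandE (@rel2P _ _ 0 5 6 c d) // => -[Rcd /sP/(@kstepP _ _ u v c d) st].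
  by exists c, d; split=> //; apply: st.
exists [set ds | exists a b : dom T, ds = [:: a; b] /\ a.2 = b.2]; rewrite sandE; split.
  by apply/(@rel2P _ _ 0 0 2 (t, n) (t', n)) => //; exists (t, n), (t', n).
rewrite sallE => a; rewrite sallE => b; rewrite sorE snotE (@rel2P _ _ 0 3 4 a b) //.
have [ab|nab] := pselect (a.2 = b.2); last first.
  by left=> -[a' [b' [[ea eb] e]]]; apply: nab; rewrite ea eb.
right; have [c [d [st cd _ _]]] := lev_stp ab; rewrite sexE; exists c; rewrite sexE; exists d.
rewrite sandE (@rel2P _ _ 0 5 6 c d) //; split; first by exists c, d.
exact/sP/(@kstepP _ _ a b c d).
Qed.

(** A unary relation contains elements, not traces; it represents the traces that have some position
    in it. *)
Definition srel W (V : nat -> set trace) : Prop :=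
  forall i (a : T), (exists n, W (i, 1) [:: (a, n)]) <-> V i (val a).

Lemma trSP f W V s : (forall i, V i `<=` T) -> srel W V -> so_sat W s (trS f) <-> l3sat T V f.
Proof.
elim: f W V s => [h i j|f IH|f IHf g IHg|i f IH] W V s VT R.
- rewrite [trS _]/= sexE; split=> [[[a n]]|[a' [c' [Va Vc hac]]]].
    rewrite sexE => -[[c m]]; rewrite !sandE (@rel1P _ _ j 1 (c, m)) // (@rel1P _ _ i 0 (a, n)) //.
    move=> [Wc [Wa /(ksoP _ _ _ lvSP)/(@katP _ _ _ a c n m erefl erefl) k]].
    by exists (val a), (val c); split=> //; apply/R; [exists n|exists m].
  pose a : T := exist _ a' (mem_set (VT _ _ Va)); pose c : T := exist _ c' (mem_set (VT _ _ Vc)).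
  have [n Wa] := proj2 (R i a) Va; have [m Wc] := proj2 (R j c) Vc.
  exists (a, n); rewrite sexE; exists (c, m); rewrite !sandE (@rel1P _ _ j 1 (c, m)) //.
  rewrite (@rel1P _ _ i 0 (a, n)) //; split=> //; split=> //.
  by apply/(ksoP _ _ _ lvSP)/(@katP _ _ _ a c n m).
- by rewrite [trS _]/= snotE negP3 (IH W V).
- by rewrite [trS _]/= sandE conP (IHf W V) // (IHg W V).
have VT' X : X `<=` T -> forall k, upd V i X k `<=` T.
  by move=> XT k; rewrite /upd; case: eqP.
rewrite [trS _]/= sexrE lexP; split=> [[Q h]|[X XT h]].
  pose X : set trace := [set a | exists2 t : T, a = val t & exists n, Q [:: (t, n)]].
  have XT : X `<=` T by move=> _ [t -> _]; exact: set_mem (valP t).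
  exists X => //; move: h; apply: (proj1 (IH _ _ _ _ _)); first exact: VT'.
  move=> k a; rewrite /upd xpair_eqE eqxx andbT; case: eqP => // _.
  by split=> [[n Qa]|[t /val_inj->]]; first by exists a => //; exists n.
exists [set ds | exists t : T, exists n, ds = [:: (t, n)] /\ X (val t)].
move: h; apply: (proj2 (IH _ _ _ _ _)); first exact: VT'.
move=> k a; rewrite /upd xpair_eqE eqxx andbT; case: eqP => // _.
split=> [[n [t [m [[-> _]]]]]//|Xa].
by exists 0, a, 0.
Qed.

Lemma trSP0 f : so_models T (trS f) <-> l3sat T (fun=> set0) f.
Proof.
apply: trSP; first by move=> _ a.
by move=> i a; split=> [[]|].
Qed.

End Models.

Lemma kat_so h : [/\ all (mem [:: 0; 1]) (so_free (kso lvS (kat h))),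
  so_free_rel (kso lvS (kat h)) = [::] & so_level_free (kso lvS (kat h))].
Proof.
by case: h => [||||p|]; split; rewrite /= /kpos1 /same /nsame /kmin /kpred -?lock /= /kmin /kpred -?lock.
Qed.

Lemma trS_free f : so_free (trS f) = [::].
Proof.
elim: f => [h i j|f IH|f IHf g IHg|i f IH] //=; last by rewrite IHf.
have [/allP h1 _ _] := kat_so h; move: h1; set l := so_free _ => h1.
apply/eqP; rewrite -size_eq0 size_filter -leqn0 leqNgt -has_count -all_predC.
apply/allP => x; rewrite mem_filter => /andP[x1 /h1].
by rewrite !inE => /orP[/eqP->//|]; rewrite (negbTE x1).
Qed.

Lemma trS_level f : so_level_free (trS f).
Proof.
elim: f => [h i j|f IH|f IHf g IHg|i f IH] //=; last by rewrite IHf.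
by have [_ _ ->] := kat_so h.
Qed.

Lemma trS_rel R f : l3in R f -> all (fun p => (p.2 == 1) && R p.1) (so_free_rel (trS f)).
Proof.
elim: f R => [h i j|f IH|f IHf g IHg|i f IH] R /=.
- by have [_ -> _] := kat_so h; case/andP=> /= -> ->.
- exact: IH.
- by case/andP=> /IHf h1 /IHg h2; rewrite all_cat h1.
move/IH => /allP h; apply/allP => -[x y]; rewrite mem_filter xpair_eqE => /andP[ne /h /=].
by case: (y =P 1) ne => //= _; rewrite andbT => /negbTE->.
Qed.

Lemma trS_rel0 f : l3in (fun=> false) f -> so_free_rel (trS f) = [::].
Proof. by move/trS_rel; case: (so_free_rel _) => // p l /= /andP[/andP[]]. Qed.

Lemma trT_in t (S : nat -> bool) : S 1 -> S 2 -> S 3 -> all (fun x => S (vidx 1 x)) (term_vars t) -> l3in S (trT t).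
Proof.
elim: t S => [x|||t IHt u IHu|t IHt u IHu] S S1 S2 S3.
- by rewrite /= andbT S3.
- by rewrite /= S3.
- by rewrite /= S3.
- rewrite /= all_cat ?S1 ?S2 ?S3 => /andP[/allP tS /allP uS] /=; rewrite IHt ?IHu //= ?S1 ?S2 ?S3 //.
    by apply/allP => x /uS ->; rewrite !orbT.
  by apply/allP => x /tS ->; rewrite !orbT.
rewrite /= all_cat ?S1 ?S2 ?S3 => /andP[/allP tS /allP uS] /=; rewrite IHt ?IHu //= ?S1 ?S2 ?S3 //.
  by apply/allP => x /uS ->; rewrite !orbT.
by apply/allP => x /tS ->; rewrite !orbT.
Qed.

Definition inR (R : vars) (S : nat -> bool) :=
  forall o x, R o x -> S (vidx (order_nat o) x).

Lemma inR_or R S p : inR R S -> inR R (fun j => p j || S j).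
Proof. by move=> h o x /h ->; rewrite orbT. Qed.

Lemma inR_ext R S o x : inR R S -> inR (ext R o x) (fun j => (j == vidx (order_nat o) x) || S j).
Proof.
move=> h o' x'; rewrite /ext => /orP[/andP[/eqP e /eqP e']|/h ->]; last by rewrite orbT.
by rewrite e e' eqxx.
Qed.

Lemma trA_in f R S : fvin R f -> inR R S -> S 1 -> S 2 -> l3in S (trA f).
Proof.
have tr t R' S' : tin R' t -> inR R' S' -> S' 1 -> S' 2 -> S' 3 -> l3in S' (trT t).
  by rewrite tinP => /allP h i S1 S2 S3; apply: trT_in => //; apply/allP => x /h /i.
elim: f R S => [t u|t u|t x|x y|f IH|f IHf g IHg|f IHf g IHg|o x f IH|o x f IH] R S.
- case/andP=> tR uR RS S1 S2 /=.
  by rewrite (tr t R) ?(tr u R) ?S1 ?S2 ?orbT //; exact: inR_or.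
- case/andP=> tR uR RS S1 S2 /=; rewrite S1 ?orbT /=.
  rewrite (tr t R) ?(tr u R) ?S1 ?S2 ?orbT //; do 4! apply: inR_or => //.
- case/andP=> xR tR RS S1 S2 /=.
  by rewrite (tr t R) ?S1 ?S2 ?(RS _ _ xR) ?orbT //; exact: inR_or.
- by case/andP=> xR yR RS S1 S2 /=; rewrite (RS _ _ xR) (RS _ _ yR) ?orbT.
- exact: IH.
- by case/andP=> fR gR RS S1 S2 /=; rewrite (IHf R) ?(IHg R).
- by case/andP=> fR gR RS S1 S2 /=; rewrite (IHf R) ?(IHg R).
- move=> fR RS S1 S2; have := IH _ _ fR (@inR_ext _ _ o x RS); rewrite S1 S2 !orbT => /(_ isT isT).
  by case: o {fR} => h /=; rewrite ?eqxx h.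
move=> fR RS S1 S2; have := IH _ _ fR (@inR_ext _ _ o x RS); rewrite S1 S2 !orbT => /(_ isT isT).
by case: o {fR} => h /=; rewrite ?eqxx h.
Qed.

Lemma clR_in f R S : fvin R f -> inR R S -> l3in S (clR f).
Proof.
have tr t R' S' : tin R' t -> inR R' S' -> l3in S' (clT t).
  rewrite tinP => /allP h i; elim: t h => [x|||t IHt u IHu|t IHt u IHu] h //=.
  - by rewrite (i _ _ (h x _)) ?inE.
  - by rewrite IHt ?IHu // => x xt; apply: h; rewrite mem_cat xt ?orbT.
  by rewrite IHt ?IHu // => x xt; apply: h; rewrite mem_cat xt ?orbT.
elim: f R S => [t u|t u|t x|x y|f IH|f IHf g IHg|f IHf g IHg|o x f IH|o x f IH] R S.
- by case/andP=> tR uR RS /=; rewrite (tr t R) ?(tr u R).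
- by case/andP=> tR uR RS /=; rewrite (tr t R) ?(tr u R).
- by case/andP=> xR tR RS /=; rewrite (tr t R) ?(RS _ _ xR).
- by case/andP=> xR yR RS /=; rewrite (RS _ _ xR) (RS _ _ yR).
- exact: IH.
- by case/andP=> fR gR RS /=; rewrite (IHf R) ?(IHg R).
- by case/andP=> fR gR RS /=; rewrite (IHf R) ?(IHg R).
- by move=> fR RS /=; rewrite eqxx /= (IH _ _ fR (@inR_ext _ _ o x RS)).
by move=> fR RS /=; rewrite eqxx /= (IH _ _ fR (@inR_ext _ _ o x RS)).
Qed.

Lemma Gf_in c f : arith_free f = [::] -> l3in (fun=> false) (Gf c f).
Proof.
move=> fr; have fv : fvin (fun _ _ => false) f by rewrite fvinP fr.
change (l3in (fun j => (j == 2) || ((j == 1) || false)) (LCon (axioms c) (LCon (clR f) (trA f)))).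
set S := fun j => _; have inS : inR (fun _ _ => false) S by [].
by rewrite [l3in _ _]/= (clR_in fv inS) (trA_in fv inS) //; case: c.
Qed.

(** * Writing down the translation of an arithmetic sentence *)

Definition reps (n : nat) (s : seq bool) := flatten (nseq n s).

(** The index is affine in [x], so its repetitions are a constant string followed by [x] copies of
    another: exactly what a leaf can write. *)
Lemma rep_vidx o x s : reps (vidx o x) s = reps (o + 11) s ++ reps x (reps 3 s).
Proof.
have repD n m : reps (n + m) s = reps n s ++ reps m s by rewrite /reps nseqD flatten_cat.
have -> : vidx o x = o + 11 + 3 * x by rewrite /vidx; lia.
rewrite repD; congr (_ ++ _).
by elim: x => // x IH; rewrite mulnS repD IH.
Qed.

Lemma seval_cat (g h : seg) n : seval (g ++ h) n = seval g n ++ seval h n.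
Proof. by rewrite /seval -!lock map_cat flatten_cat. Qed.

Definition gc (s : seq bool) : seg := [:: (s, [::])].
Definition gr (o : nat) (s : seq bool) : seg := [:: (reps (o + 11) s, reps 3 s)].

Lemma seval_gc s n : seval (gc s) n = s.
Proof. by rewrite seval1 flat_nil cats0. Qed.
Lemma seval_gr o s x : seval (gr o s) x = reps (vidx o x) s.
Proof. by rewrite seval1 rep_vidx. Qed.

Definition sevE := (seval_cat, seval_gc, seval_gr).

Section Strings.
Variables (pN pC s1 e0 e1 s2 e2 : seq bool) (a0 a1 a2 : latom -> seq bool).

(* Serialisation of a translation of [l3] under which the index of a set
   variable only determines how often certain strings are repeated. *)
Fixpoint lS (f : l3) : seq bool :=
  match f with
  | LAtm h i j => a0 h ++ reps j s1 ++ a1 h ++ reps i s1 ++ a2 h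
  | LNeg f => pN ++ lS f
  | LCon f g => pC ++ lS f ++ lS g
  | LExq i f => e0 ++ reps i s1 ++ e1 ++ reps i s2 ++ e2 ++ lS f
  end.

Lemma lSA h i j : lS (LAtm h i j) = a0 h ++ reps j s1 ++ a1 h ++ reps i s1 ++ a2 h.
Proof. by []. Qed.
Lemma lSN f : lS (LNeg f) = pN ++ lS f. Proof. by []. Qed.
Lemma lSC f g : lS (LCon f g) = pC ++ lS f ++ lS g. Proof. by []. Qed.

Definition pX i := locked (e0 ++ reps i s1 ++ e1 ++ reps i s2 ++ e2).
Lemma lSX i f : lS (LExq i f) = pX i ++ lS f.
Proof. by rewrite /pX -lock -!catA. Qed.

Definition pNum i := locked (pX i ++ pC ++ lS (LNum i)).
Lemma lSnum i f : lS (exnum i f) = pNum i ++ lS f.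
Proof. by rewrite /exnum lSX lSC /pNum -lock -!catA. Qed.

Definition pSub r := locked (pNum 3 ++ pC ++ lS (LIn 3 r)).
Lemma lSsub r f : lS (sub3 r f) = pSub r ++ lS f.
Proof. by rewrite /sub3 lSnum lSC /pSub -lock -!catA. Qed.

Definition gX o : seg := gc e0 ++ gr o s1 ++ gc e1 ++ gr o s2 ++ gc e2.
Definition gJ h i o : seg := gc (a0 h) ++ gr o s1 ++ gc (a1 h ++ reps i s1 ++ a2 h).
Definition gA h o : seg := gc (a0 h) ++ gr o s1 ++ gc (a1 h) ++ gr o s1 ++ gc (a2 h).
Definition gNum o : seg :=
  gX o ++ gc (pC ++ pC ++ pC) ++ gA AId o ++ gc pN ++ gA ADiff o ++ gA ASing o.
Definition gEx o : seg := if o == 1 then gNum 1 else gX o.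

Definition gAll o : seg := gEx o ++ gc pN.

Lemma gXE o x f : seval (gX o) x ++ lS f = lS (LExq (vidx o x) f).
Proof. by rewrite !sevE -!catA. Qed.
Lemma gJE h i o x : seval (gJ h i o) x = lS (LAtm h i (vidx o x)).
Proof. by rewrite !sevE. Qed.
Lemma gAE h o x : seval (gA h o) x = lS (LAtm h (vidx o x) (vidx o x)).
Proof. by rewrite !sevE. Qed.
Lemma gExE o x f : seval (gEx (order_nat o)) x ++ lS f = lS (exvar o x f).
Proof.
case: o; [rewrite /gEx /gNum|exact: gXE|exact: gXE].
by rewrite /exvar /exnum -gXE !(seval_cat, seval_gc, gAE) !(lSC, lSN) -!catA.
Qed.

Lemma gAllE o x f : seval (gAll (order_nat o)) x ++ lS f = lS (exvar o x (LNeg f)).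
Proof. by rewrite -gExE seval_cat seval_gc -catA. Qed.

Definition gSet : seg := gc (pN ++ pNum 3 ++ pN ++ pC ++ pN ++ pC ++ lS (LIn 3 8) ++ pN) ++
  gJ (ASub 0) 3 2 ++ gc (pN ++ pC) ++ gJ (ASub 0) 3 2 ++ gc (pN ++ lS (LIn 3 8)).

Lemma gSetE x : seval gSet x = lS (eqset 8 (vidx 2 x)).
Proof.
rewrite /eqset lSN lSnum lSN /LIff lSC lSN lSC lSN lSN lSC lSN.
by rewrite !(seval_cat, seval_gc, gJE) -!catA.
Qed.

Definition pIn3 := locked (pX 8 ++ pC ++ lS (LOne 8) ++ pC).
Definition pAdd A := locked (pNum 4 ++ pNum 5 ++ pC ++ lS (ltri A 4 5 3) ++ pC ++ pSub 4).
Definition pLe := locked (pNum 4 ++ pNum 5 ++ pNum 7 ++ pC ++ lS (ltri 1 4 7 5) ++ pC ++ pSub 4).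

Section TrTable.
Variable so : bool.

(* The states: 0, formulas; 1, formulas prefixed by a negation; 2, terms; 3,
   terms prefixed by the binding of the second operand; 4, the index of a
   variable of order 1 in a term; 5, the order of a quantified variable; 5 + o
   and 8 + o, the variable bound by an existential or universal quantifier of
   order o; 12-14, set variables in atoms. *)
Definition trD (q k j p : nat) (l : bool) : nat :=
  match q with
  | 0 | 1 => match k with
     | 0 => 2
     | 1 => if j == 0 then 2 else 3
     | 2 => if j == 0 then 2 else 12
     | 3 => if j == 0 then 13 else 14
     | 4 | 5 => 0
     | 6 => if j == 0 then 0 else 1
     | 7 => match j with 0 => 5 | 1 => 5 + p | _ => 0 end
     | _ => match j with 0 => 5 | 1 => 8 + p | _ => 0 end end
  | _ => match k with 0 => 4 | _ => if j == 0 then 2 else 3 end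
  end.

Definition trL (q n : nat) : bool :=
  match q with
  | 0 | 1 | 2 | 3 => false
  | 5 => 0 < n <= if so then 2 else 3
  | _ => true end.

Definition trOk (q k n : nat) : bool :=
  match q with
  | 0 | 1 => (k, n) \in (if so then [::] else [:: (3, 2)]) ++
      [:: (0, 2); (1, 2); (2, 2); (4, 1); (5, 2); (6, 2); (7, 3); (8, 3)]
  | 2 | 3 => (k, n) \in [:: (0, 1); (1, 0); (2, 0); (3, 2); (4, 2)]
  | _ => false end.

Definition trAT : table := @mkT 17 isT trD trL trOk
  (fun q => match q with
    | 4 => gJ (ASub 0) 3 1
    | 6 => gEx 1 | 7 => gEx 2 | 8 => gEx 3
    | 9 => gAll 1 | 10 => gAll 2 | 11 => gAll 3
    | 12 => gJ (ASub 0) 3 2 | 13 => gSet | 14 => gJ AId 8 3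
    | _ => [::] end)
  (fun q k _ => match q with
    | 0 | 1 => (if q == 1 then pN else [::]) ++ match k with
       | 0 => pNum 3 ++ pC | 1 => pLe | 2 => pNum 3 ++ pC | 3 => pIn3
       | 4 => pN | 5 => pC | 6 => pN ++ pC ++ pN | 7 => [::] | _ => pN end
    | 2 | 3 => (if q == 3 then pSub 5 else [::]) ++ match k with
       | 0 => [::] | 1 => lS (trT TZero) | 2 => lS (trT TOne) | 3 => pAdd 1 | _ => pAdd 2 end
    | _ => [::] end).

Definition clT_ : table := @mkT 17 isT trD trL trOk
  (fun q => match q with
    | 4 => gA AId 1
    | 6 | 9 => gX 1 ++ gc pC ++ gA AId 1
    | 7 | 10 => gX 2 ++ gc pC ++ gA AId 2
    | 8 | 11 => gX 3 ++ gc pC ++ gA AId 3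
    | 12 | 13 => gA AId 2 | 14 => gA AId 3
    | _ => [::] end)
  (fun q k _ => match q with
    | 0 | 1 => match k with 4 | 7 | 8 => [::] | _ => pC end
    | 2 | 3 => match k with 0 => [::] | 1 | 2 => lS ltrue | _ => pC end
    | _ => [::] end).

Lemma trAT1 f : trav trAT 1 (arith_code f) = pN ++ trav trAT 0 (arith_code f).
Proof. by case: f => *; rewrite /= -?catA. Qed.

Lemma trAT3 t : trav trAT 3 (term_code t) = pSub 5 ++ trav trAT 2 (term_code t).
Proof. by case: t => *; rewrite /= -?catA. Qed.

Lemma trTE t : trav trAT 2 (term_code t) = lS (trT t).
Proof.
elim: t => [x|||t IHt u IHu|t IHt u IHu]; rewrite [trav _ _ _]/= ?cats0 //.
- exact: gJE.
- rewrite IHt -/(trav trAT 3 (term_code u)) trAT3 IHu [trT _]/= !lSnum lSC lSC !lSsub /pAdd -lock.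
  by rewrite -!catA.
rewrite IHt -/(trav trAT 3 (term_code u)) trAT3 IHu [trT _]/= !lSnum lSC lSC !lSsub /pAdd -lock.
by rewrite -!catA.
Qed.

Lemma trAE f : trav trAT 0 (arith_code f) = lS (trA f).
Proof.
elim: f => [t u|t u|t x|x y|f IH|f IHf g IHg|f IHf g IHg|o x f IH|o x f IH].
- by rewrite [trav _ _ _]/= cats0 !trTE [trA _]/= lSnum lSC -!catA.
- rewrite [trav _ _ _]/= cats0 trTE trAT3 trTE [trA _]/= !lSnum lSC lSC !lSsub /pLe -lock.
  by rewrite -!catA.
- by rewrite [trav _ _ _]/= cats0 trTE gJE [trA _]/= lSnum lSC -!catA.
- rewrite [trav _ _ _]/= cats0 gSetE gJE [trA _]/= lSX (lSC (LOne 8)) (lSC (eqset 8 _)) /pIn3 -lock.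
  by rewrite -!catA.
- by rewrite [trav _ _ _]/= cats0 IH [trA _]/= lSN.
- by rewrite [trav _ _ _]/= cats0 IHf IHg [trA _]/= lSC.
- by rewrite [trav _ _ _]/= cats0 trAT1 IHf IHg [trA _]/= !(lSC, lSN) -!catA.
- by case: o; rewrite [trav _ _ _]/= seval0 cats0 IH [LHS]/= (gExE O1, gExE O2, gExE O3).
by case: o; rewrite [trav _ _ _]/= seval0 cats0 IH (gAllE O1, gAllE O2, gAllE O3).
Qed.

Lemma clTE t q : q = 2 \/ q = 3 -> trav clT_ q (term_code t) = lS (clT t).
Proof.
elim: t q => [x|||t IHt u IHu|t IHt u IHu] q [->|->]; rewrite [trav _ _ _]/= ?cats0 //;
  rewrite ?gAE // IHt ?IHu ?[clT _]/= ?lSC //; by [left|right].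
Qed.

Lemma clRE f q : q = 0 \/ q = 1 -> trav clT_ q (arith_code f) = lS (clR f).
Proof.
have E o x g : seval (gX o ++ gc pC ++ gA AId o) x ++ lS g =
    lS (LExq (vidx o x) (LCon (nev (vidx o x)) g)).
  by rewrite (seval_cat (gX o)) (seval_cat (gc pC)) seval_gc gAE -gXE lSC -!catA.
have h0 : 0 = 0 \/ 0 = 1 by left.
have h1 : 1 = 0 \/ 1 = 1 by right.
have h2 : 2 = 2 \/ 2 = 3 by left.
have h3 : 3 = 2 \/ 3 = 3 by right.
elim: f q => [t u|t u|t x|x y|f IH|f IHf g IHg|f IHf g IHg|o x f IH|o x f IH] q.
- by case=> ->; rewrite [trav _ _ _]/= cats0 !clTE // [clR _]/= lSC.
- by case=> ->; rewrite [trav _ _ _]/= cats0 !clTE // [clR _]/= lSC.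
- by case=> ->; rewrite [trav _ _ _]/= cats0 !clTE // gAE [clR _]/= lSC.
- by case=> ->; rewrite [trav _ _ _]/= cats0 !gAE [clR _]/= lSC.
- by case=> ->; rewrite [trav _ _ _]/= cats0 IH.
- by case=> ->; rewrite [trav _ _ _]/= cats0 IHf ?IHg // [clR _]/= lSC.
- by case=> ->; rewrite [trav _ _ _]/= cats0 IHf ?IHg // [clR _]/= lSC.
- by case=> ->; case: o; rewrite [trav _ _ _]/= seval0 cats0 IH // E.
by case=> ->; case: o; rewrite [trav _ _ _]/= seval0 cats0 IH // E.
Qed.

Lemma trT_ok t q : q = 2 \/ q = 3 -> okt trAT q t <-> exists u, t = term_code u.
Proof.
have h2 : 2 = 2 \/ 2 = 3 by left.
have h3 : 3 = 2 \/ 3 = 3 by right.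
elim/tree_ind: t q => [n|k ts IH] q hq; first by case: hq => ->; split=> // -[[]].
split=> [|[u]].
  have -> : okt trAT q (node k ts) = ((k, size ts) \in [:: (0, 1); (1, 0); (2, 0); (3, 2); (4, 2)]) &&
      children true andb (okt trAT) (delta trAT 2 (cap k)) 0 0 ts.
    by case: hq => ->; rewrite [okt _ _ _]/= cap_in.
  case/andP; case: ts IH => [|t [|u [|v ts]]] IH km; try by move: km; rewrite !inE !xpair_eqE ?andbF.
  - have [->|->] : k = 1 \/ k = 2 by arity km.
      by exists TZero.
    by exists TOne.
  - have -> : k = 0 by arity km.
    by case: t IH {km} => // x _ _; exists (TVar x).
  have [->|->] : k = 3 \/ k = 4 by arity km.
    rewrite /= andbT => /andP[/(IH _ in_0 _ h2)[a ->]].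
    by move=> /(IH _ in_1 _ h3)[c ->]; exists (TAdd a c).
  rewrite /= andbT => /andP[/(IH _ in_0 _ h2)[a ->]].
  by move=> /(IH _ in_1 _ h3)[c ->]; exists (TMul a c).
case: u => [x|||a c|a c] [-> tsE]; subst ts; case: hq => -> //=; rewrite ?andbT.
all: apply/andP; split; [apply/(IH _ in_0 _ h2); by exists a|
   apply/(IH _ in_1 _ h3); by exists c].
Qed.

Lemma trA_ok t q : q = 0 \/ q = 1 ->
  okt trAT q t <-> exists2 f, t = arith_code f & so -> second_order f.
Proof.
have h0 : 0 = 0 \/ 0 = 1 by left.
have h1 : 1 = 0 \/ 1 = 1 by right.
have h2 : 2 = 2 \/ 2 = 3 by left.
have h3 : 3 = 2 \/ 3 = 3 by right.
elim/tree_ind: t q => [n|k ts IH] q hq; first by case: hq => ->; split=> // -[[]].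
split=> [|[f]].
  have -> : okt trAT q (node k ts) = trOk 0 k (size ts) &&
      children true andb (okt trAT) (delta trAT 0 (cap k)) 0 0 ts.
    by case: hq => ->; rewrite [okt _ _ _]/= cap_in //; case: so.
  case/andP; case: ts IH => [|t [|u [|v [|w ts]]]] IH; rewrite /trOk => km;
    try by move: km; case: so; rewrite !inE !xpair_eqE ?andbF.
  - have -> : k = 4 by move: km; case: so; rewrite !inE !xpair_eqE /=; lia.
    by rewrite /= andbT => /(IH _ in_0 _ h0)[f -> h]; exists (ANot f).
  - have k7 : k < 7 by move: km; case: so; rewrite !inE !xpair_eqE /=; lia.
    have IHt := IH t in_0 _ h0; have IHu := IH u in_1.
    have k3 : k = 3 -> so = false by move=> k3; move: km; rewrite k3; case: so.
    have k4 : k <> 4 by move=> k4; move: km; rewrite k4; case: so.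
    case: k {IH km} k7 k3 k4 => [|[|[|[|[|[|[|k]]]]]]] // _ k3 k4; rewrite /= ?andbT.
    + by move=> /andP[/(trT_ok _ h2)[a ->] /(trT_ok _ h2)[c ->]]; exists (AEq a c).
    + by move=> /andP[/(trT_ok _ h2)[a ->] /(trT_ok _ h3)[c ->]]; exists (ALe a c).
    + move=> /andP[/(trT_ok _ h2)[a ->]]; case: u {IHu} => // x _; by exists (AIn2 a x).
    + rewrite k3 //; case: t {IHt} => // x; case: u {IHu} => // y _; by exists (AIn3 x y).
    + by move=> /andP[/IHt[f -> hf] /(IHu _ h0)[g -> hg]]; exists (AAnd f g) => // /[dup] /hf /= -> /hg.
    by move=> /andP[/IHt[f -> hf] /(IHu _ h1)[g -> hg]]; exists (AOr f g) => // /[dup] /hf /= -> /hg.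
  have IHv := IH v in_2 _ h0.
  have [->|->] : k = 7 \/ k = 8 by move: km; case: so; rewrite !inE !xpair_eqE /=; lia.
  1,2: clear km.
  1,2: case: t IH => // n _.
  1,2: have [n3|n3] := leqP n 3; last by (rewrite [children _ _ _ _ _ _ _]/= /trL /cap => /andP[]; case: so; lia).
  1,2: case: u => [x|k' us]; last by (case: n n3 => [|[|[|[|n]]]] // _; rewrite /= ?andbF //; case: so).
  1,2: rewrite [children _ _ _ _ _ _ _]/= andbT => /andP[hn /andP[_ /IHv[f -> hf]]].
  1,2: have [o on] : exists o, n = order_nat o by (case: n n3 hn => [|[|[|[|n]]]] // _ _; [exists O1|exists O2|exists O3]).
  1,2: have ho : so -> o != O3 by (move=> so1; move: hn; rewrite on /trL so1; case: (o)).
  1,2: rewrite on.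
    by exists (AEx o x f) => //= so1; rewrite ho ?hf.
  by exists (AAll o x f) => //= so1; rewrite ho ?hf.
have {hq} -> : okt trAT q (node k ts) = okt trAT 0 (node k ts) by case: hq => ->.
case: f => [a c|a c|a x|x y|f|f g|f g|o x f|o x f] [-> tsE] hf; subst ts.
- rewrite /= ?andbT; apply/andP; split; first by case: so.
  by apply/andP; split; apply/(trT_ok _ h2); [exists a|exists c].
- rewrite /= ?andbT; apply/andP; split; first by case: so.
  by apply/andP; split; [apply/(trT_ok _ h2); exists a|apply/(trT_ok _ h3); exists c].
- rewrite /= ?andbT; apply/andP; split; first by case: so.
  by apply/(trT_ok _ h2); exists a.
- by rewrite /=; case: so hf => [/(_ isT)|] /=.
- rewrite /= ?andbT; apply/andP; split; first by case: so.
  by apply/(IH _ in_0 _ h0); exists f.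
- rewrite /= ?andbT; apply/andP; split; first by case: so.
  apply/andP; split.
    by apply/(IH _ in_0 _ h0); exists f => // /hf /andP[].
  by apply/(IH _ in_1 _ h0); exists g => // /hf /andP[].
- rewrite /= ?andbT; apply/andP; split; first by case: so.
  apply/andP; split.
    by apply/(IH _ in_0 _ h0); exists f => // /hf /andP[].
  by apply/(IH _ in_1 _ h1); exists g => // /hf /andP[].
- have hf' : okt trAT 0 (arith_code f).
    by apply/(IH _ in_2 _ h0); exists f => // /hf /andP[].
  by case: o hf {IH} => hf; rewrite /= hf' /trL; case: so hf => // /(_ isT).
have hf' : okt trAT 0 (arith_code f).
  by apply/(IH _ in_2 _ h0); exists f => // /hf /andP[].
by case: o hf {IH} => hf; rewrite /= hf' /trL; case: so hf => // /(_ isT).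
Qed.

End TrTable.

Lemma flat2 x T1 T2 t :
  flatten [seq p.1 ++ trav p.2 0 t | p <- [:: (x, T1); ([::], T2)]] = x ++ trav T1 0 t ++ trav T2 0 t.
Proof. by rewrite /= cats0 catA. Qed.

(** The axioms are a constant string, and the two conjuncts that depend on [f] are written by two
    passes. Words that code no formula of the required kind go to the empty word, which is outside
    [B]. *)
Lemma reduction (c so : bool) (A B : language) (hd fin : seq bool) :
  (forall f, (so -> second_order f) ->
     A (ser (arith_code f)) <-> B (hd ++ lS (Gf c f) ++ fin)) ->
  (forall w, A w -> exists2 f, w = ser (arith_code f) & so -> second_order f) ->
  ~ B [::] -> logspace_reducible A B.
Proof.
move=> AB Aw B0; have h0 : 0 = 0 \/ 0 = 1 by left.
have [F Fl FP] := logspace_trav (trAT so)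
  [:: (hd ++ pX 1 ++ pX 2 ++ pC ++ lS (axioms c) ++ pC, clT_ so); ([::], trAT so)] fin.
have GE f : hd ++ lS (Gf c f) ++ fin =
    ((hd ++ pX 1 ++ pX 2 ++ pC ++ lS (axioms c) ++ pC) ++ lS (clR f) ++ lS (trA f)) ++ fin.
  rewrite /Gf lSX lSX (lSC (axioms c)) (lSC (clR f)).
  by move: (pX 1) (pX 2) (lS (axioms c)) (lS (clR f)) (lS (trA f)) => *; rewrite -!catA.
exists F => // w; split=> [Awt|Bw].
  have [f wE sf] := Aw w Awt; have ok : okt (trAT so) 0 (arith_code f) by apply/(trA_ok _ _ h0); exists f.
  rewrite (proj1 (FP w) _ wE ok) flat2 clRE // trAE -GE.
  by move: Awt; rewrite wE AB.
have [[t [wt /(trA_ok _ _ h0)[f tf sf]]]|n] := pselect (exists t, w = ser t /\ okt (trAT so) 0 t).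
  subst t; have ok : okt (trAT so) 0 (arith_code f) by apply/(trA_ok _ _ h0); exists f.
  move: Bw; rewrite (proj1 (FP w) _ wt ok) flat2 clRE // trAE -GE => Bw.
  by rewrite wt; apply/(AB f sf).
by case: B0; rewrite -(proj2 (FP w)) // => t wt ok; apply: n; exists t.
Qed.

End Strings.

(** * Hardness *)

(** The trace of a triple; through proposition 0 alone it is also the singleton of its first
    component. *)
Definition box (a b c : nat) : trace := fun k p =>
  match p with 0 => k == a.+1 | 1 => k == b.+1 | 2 => k == c.+1 | _ => false end.

Lemma box_isop (op : nat -> nat -> nat) n m k :
  triS [set box a b (op a b) | a in setT & b in setT] n m k <-> op n m = k.
Proof.
split=> [[_ [[a _ [b _ <-]]]]|<-]; first by rewrite /= => /eqP[<-] /eqP[<-] /eqP[<-].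
by exists (box n m (op n m)); split; rewrite ?eqxx //=; exists n => //; exists m.
Qed.

Lemma Gf_model T f (c : bool) : (forall a b d, T (box a b d)) -> (c -> all_sets_in T) -> c || second_order f ->
  true_in_N f -> l3sat T (fun=> set0) (Gf c f).
Proof.
move=> Tb Tc cs tf; apply/Gf_iff => //; first by exists (box 0 0 0).
split=> //.
- by move=> n; exists (box n 0 0).
- exists [set box a b (a + b) | a in setT & b in setT]; first by move=> _ [a _ [b _ <-]].
  exact: box_isop.
exists [set box a b (a * b) | a in setT & b in setT]; first by move=> _ [a _ [b _ <-]].
exact: box_isop.
Qed.

Definition subsets_label (w : 'I_8) : seq nat := [seq p <- [:: 0; 1; 2] | odd (w %/ 2 ^ p)].

(* The worlds are the subsets of {p_0, p_1, p_2}, with all transitions. *)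
Definition K0 : kripke :=
  @Kripke 8 ord0 (fun _ _ => true) subsets_label (fun w => ex_intro _ w isT).

(** The world at a given time is read off from the three propositions in binary. The initial world
    is the empty set, whence the condition at time 0. *)
Lemma traces_K0 t : (forall p, t 0 p = false) -> (forall k p, 2 < p -> t k p = false) -> traces K0 t.
Proof.
move=> t0 tp; exists (fun k => inord (t k 0 + 2 * t k 1 + 4 * t k 2)); split=> //.
  by apply: val_inj; rewrite /= inordK !t0.
move=> k p; rewrite [klabel _]/= mem_filter inordK; last by case: (t k 0) (t k 1) (t k 2) => [] [] [].
have [p3|p3] := leqP p 2; last first.
  rewrite tp // andbC; apply/esym/negbTE; rewrite negb_and; apply/orP; left.
  by rewrite !inE; lia.
case: p p3 => [|[|[|p]]] // _; rewrite !inE andbT;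
  by case: (t k 0) (t k 1) (t k 2) => [] [] [].
Qed.

Lemma comp_K0 : all_sets_in (traces K0).
Proof.
move=> D; exists (fun k p => if p is 0 then (if k is n.+1 then `[< D n >] else false) else false).
  by apply: traces_K0 => [[]|k [|p]].
apply: set_ext => n; split=> [[_ ->]/asboolP//|Dn].
by eexists; [reflexivity|exact/asboolP].
Qed.

Lemma dcode_inj : injective dcode.
Proof.
have leaf_inj : injective (fun n : nat => leaf n) by move=> n m [].
move=> [i l] [i' l'] [-> e]; congr (_, _); elim: l l' e => [|[a b] l IH] [|[a' b'] l'] //= [ea eb /IH ->].
by rewrite (inj_map leaf_inj ea) (inj_map leaf_inj eb).
Qed.

Lemma kripke_code_traces K K' : kripke_code K = kripke_code K' -> traces K = traces K'.
Proof. by rewrite -!dcode_dataof => /dcode_inj e; rewrite -!dtraces_dataof e. Qed.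

Lemma Delta30_code w : Delta30 w -> exists2 f, w = ser (arith_code f) & false -> second_order f.
Proof. by move=> [f _ ->]; exists f. Qed.
Lemma Delta20_code w : Delta20 w -> exists2 f, w = ser (arith_code f) & true -> second_order f.
Proof. by move=> [f [sf _ ->]]; exists f. Qed.

Definition hard (L : logic) : Prop :=
  [/\ logspace_reducible Delta30 (model_checking L),
      logspace_reducible Delta30 (satisfiability L) &
      logspace_reducible Delta20 (countable_satisfiability L)].

Section Lower.
Variables (L : logic) (X : l3 -> form L) (hd : seq bool).
Variables (pN pC s1 e0 e1 s2 e2 : seq bool) (a0 a1 a2 : latom -> seq bool).
Hypothesis serX : forall f, ser (fcode (X f)) = hd ++ lS pN pC s1 e0 e1 s2 e2 a0 a1 a2 f.
Hypothesis sentX : forall f, l3in (fun=> false) f -> sentence (X f).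
Hypothesis modX : forall T f, T !=set0 -> models T (X f) <-> l3sat T (fun=> set0) f.
Hypothesis fcodeI : injective (@fcode L).

Lemma Gf_true T f c : T !=set0 -> c || second_order f -> models T (X (Gf c f)) -> true_in_N f.
Proof. by move=> T0 cs /(modX _ T0)/(Gf_iff T0 (fun _ _ => erefl) cs)[]. Qed.

Lemma lowerX : hard L.
Proof.
have boxK a b d : traces K0 (box a b d) by apply: traces_K0 => [[|[|[|p]]]|k [|[|[|p]]]].
have TK0 : traces K0 !=set0 by exists (box 0 0 0).
have D3 f : Delta30 (ser (arith_code f)) <-> true_in_N f.
  by split=> [[g tg /ser_inj/arith_code_inj->]|tf] //; exists f.
split.
(* The Kripke structure is the same for all sentences, so its code is a constant end of the
   output. *)
- apply: (@reduction pN pC s1 e0 e1 s2 e2 a0 a1 a2 true false _ _ (hdr 0 2 ++ hd) (ser (kripke_code K0))).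
  + move=> f _; rewrite D3 -catA [hd ++ _]catA -serX.
    have -> : hdr 0 2 ++ ser (fcode (X (Gf true f))) ++ ser (kripke_code K0) =
      ser (node 0 [:: fcode (X (Gf true f)); kripke_code K0]) by rewrite ser_node /= cats0.
    split=> [tf|[g [K [_ mg]]]].
      exists (X (Gf true f)), K0; split=> //; first by apply: sentX; apply: Gf_in; case: tf.
      by apply/modX => //; apply: Gf_model => // _; exact: comp_K0.
    move/ser_inj => e.
    have /fcodeI eg := congr1 (fun t : tree => if t is GenTree.Node _ [:: t1; _] then t1 else t) e.
    have /kripke_code_traces eK := congr1 (fun t : tree => if t is GenTree.Node _ [:: _; t2] then t2 else t) e.
    subst g.
    by apply: (Gf_true (T := traces K0) (c := true)) => //; rewrite eK.
  + exact: Delta30_code.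
  by move=> [f [K [_ _ /esym]]]; apply: ser_neq0.
- apply: (@reduction pN pC s1 e0 e1 s2 e2 a0 a1 a2 true false _ _ hd [::]).
  + move=> f _; rewrite D3 cats0 -serX; split=> [tf|[g [_ /ser_inj/fcodeI <- [T [T0 mg]]]]].
      exists (X (Gf true f)); split=> //; first by apply: sentX; apply: Gf_in; case: tf.
      exists (traces K0); split=> //.
      by apply/modX => //; apply: Gf_model => // _; exact: comp_K0.
    exact: (Gf_true (c := true) T0).
  + exact: Delta30_code.
  by move=> [f [_ /esym]] /ser_neq0.
apply: (@reduction pN pC s1 e0 e1 s2 e2 a0 a1 a2 false true _ _ hd [::]).
- move=> f /(_ isT) sf; rewrite cats0 -serX; split=> [[h [_ th /ser_inj/arith_code_inj e]]|[g [_ /ser_inj/fcodeI <- [T [T0 _ mg]]]]].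
    subst h; exists (X (Gf false f)); split=> //; first by apply: sentX; apply: Gf_in; case: th.
    (* The triples form a countable trace set, which satisfies the axioms without comprehension. *)
    pose T1 := [set box p.1.1 p.1.2 p.2 | p in [set: (nat * nat) * nat]].
    have T1b a b d : T1 (box a b d) by exists ((a, b), d).
    have T10 : T1 !=set0 by exists (box 0 0 0).
    exists T1; split=> //; last by apply/modX => //; apply: Gf_model.
    exact: (sub_countable (card_image_le _ _) (countableP _)).
  by exists f; split=> //; apply: (Gf_true (c := false) T0).
- exact: Delta20_code.
by move=> [f [_ /esym]] /ser_neq0.
Qed.

End Lower.

Lemma atom_code_inj : injective atom_code.
Proof. by case=> [x y|x y|x y|x y] [x' y'|x' y'|x' y'|x' y'] //= [-> ->]. Qed.

Lemma leaves_inj : injective leaves.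
Proof. by move=> xs ys [/(inj_map (fun n m (e : leaf n = leaf m) => let: erefl := e in erefl))]. Qed.

Lemma fo_code_inj : injective fo_code.
Proof.
elim=> [b a|xs y|f IH|f IHf g IHg|f IHf g IHg|x f IH|x f IH] [b' a'|xs' y'|f'|f' g'|f' g'|x' f'|x' f'] //=.
- by case=> + /atom_code_inj->; case: b b' => [] [].
- by case=> e ->; rewrite (@leaves_inj xs xs') // /leaves e.
- by case=> /IH->.
- by case=> /IHf-> /IHg->.
- by case=> /IHf-> /IHg->.
- by case=> -> /IH->.
by case=> -> /IH->.
Qed.

Lemma so_code_inj : injective so_code.
Proof.
elim=> [a|i xs|f IH|f IHf g IHg|f IHf g IHg|x f IH|x f IH|i k f IH|i k f IH]
  [a'|i' xs'|f'|f' g'|f' g'|x' f'|x' f'|i' k' f'|i' k' f'] //=.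
- by case=> /atom_code_inj->.
- by case=> -> e; rewrite (@leaves_inj xs xs') // /leaves e.
- by case=> /IH->.
- by case=> /IHf-> /IHg->.
- by case=> /IHf-> /IHg->.
- by case=> -> /IH->.
- by case=> -> /IH->.
- by case=> -> -> /IH->.
by case=> -> -> /IH->.
Qed.

Section FOString.
Variable b : bool.
Notation lv := (if b then levM else lvD).
Notation sF f := (ser (fo_code f)).
Notation sK k := (ser (fo_code (kfo lv k))).

Definition qF (o x : nat) : seq bool := locked (hdr o 2 ++ ser (leaf x)).

Lemma sF_not f : sF (FNot f) = hdr 2 1 ++ sF f.
Proof. by rewrite [fo_code _]/= ser_node /= cats0. Qed.
Lemma sF_and f g : sF (FAnd f g) = hdr 3 2 ++ sF f ++ sF g.
Proof. by rewrite [fo_code _]/= ser_node /= cats0. Qed.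
Lemma sF_or f g : sF (FOr f g) = hdr 4 2 ++ sF f ++ sF g.
Proof. by rewrite [fo_code _]/= ser_node /= cats0. Qed.
Lemma sF_ex x f : sF (FEx x f) = qF 5 x ++ sF f.
Proof. by rewrite [fo_code _]/= ser_node /qF -lock /= cats0 -?catA. Qed.
Lemma sF_all x f : sF (FAll x f) = qF 6 x ++ sF f.
Proof. by rewrite [fo_code _]/= ser_node /qF -lock /= cats0 -?catA. Qed.

(** The string by which one more step lengthens the code of [kpos]. An index is thus a number of
    repetitions of it, as [lS] requires. *)
Definition stF : seq bool := locked (qF 5 2 ++ hdr 3 2 ++ sK (kpred 2 1 0) ++
  qF 5 1 ++ hdr 3 2 ++ sK (KT (Eq 1 2))).

Lemma sK_pos i : sK (kpos i) = reps i stF ++ sK (kmin 1 2).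
Proof.
elim: i => // i IH.
change (kfo lv (kpos i.+1)) with (FEx 2 (FAnd (kfo lv (kpred 2 1 0))
  (FEx 1 (FAnd (kfo lv (KT (Eq 1 2))) (kfo lv (kpos i)))))).
have E : reps i.+1 stF = stF ++ reps i stF by [].
rewrite sF_ex sF_and sF_ex sF_and IH E; move: (reps i stF) => r; rewrite /stF -lock.
by move: (qF 5 2) (qF 5 1) (sK _) (sK _) (sK _) => *; rewrite -!catA.
Qed.

Definition bF0 : seq bool := locked (qF 5 1 ++ hdr 3 2 ++ sF (FDep [::] 1) ++ hdr 3 2 ++ stF).
Definition bF1 (h : latom) : seq bool := locked (sK (kmin 1 2) ++ hdr 3 2 ++
  sF (FNot (kfo lv (KF (Eq 0 1)))) ++ hdr 4 2 ++ sK (KT (Eq 1 1)) ++ hdr 3 2 ++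
  sK (kat h) ++ hdr 3 2 ++ sF (FNot (kfo lv (KF (Eq 1 1)))) ++ qF 5 1 ++ hdr 3 2 ++
  sK (KT (Eq 0 1)) ++ stF).
Definition cF0 : seq bool := locked (qF 6 1 ++ hdr 4 2 ++ hdr 4 2 ++ sK (KF (Eq 0 1)) ++ stF).
Definition cF1 : seq bool := locked (sK (kmin 1 2) ++ hdr 3 2 ++ hdr 4 2 ++ sK (KT (Eq 0 1)) ++ stF).
Definition cF2 : seq bool := locked (sK (kmin 1 2) ++ qF 5 0 ++ hdr 3 2 ++ sK (KT (Eq 0 1))).
Definition hF0 : seq bool := locked (qF 6 0 ++ hdr 4 2 ++
  sK (KEx 2 (KAnd (KT (Le 2 0)) (KF (Eq 2 0)))) ++ hdr 3 2 ++ sK (kmin 0 2)).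

Lemma sF_tr f : sF (trF b f) = lS (hdr 2 1) (hdr 3 2) stF cF0 cF1 stF cF2
  (fun=> bF0) bF1 (fun=> sK (kmin 1 2)) f.
Proof.
elim: f => [h i j|f IH|f IHf g IHg|i f IH]; rewrite [trF _ _]/=.
- rewrite /matF sF_ex sF_and sF_and sK_pos sF_and sF_or sF_and sF_and.
  change (kfo lv (KEx 1 (KAnd (KT (Eq 0 1)) (kpos i.+1)))) with
    (FEx 1 (FAnd (kfo lv (KT (Eq 0 1))) (kfo lv (kpos i.+1)))).
  rewrite sF_ex sF_and sK_pos lSA /bF0 /bF1 -!lock [reps j.+1 _]/= [reps i.+1 _]/= -/(reps i stF) -/(reps j stF).
  move: (reps i stF) (reps j stF) (qF 5 1) stF (sF (FDep _ _)) (sK (kmin _ _)) (sF (FNot (kfo lv (KF (Eq 0 1)))))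
    (sF (FNot (kfo lv (KF (Eq 1 1))))) (sK (KT (Eq 1 1))) (sK (kat h)) (sK (KT (Eq 0 1))) => *.
  by rewrite -!catA.
- by rewrite sF_not IH.
- by rewrite sF_and IHf IHg.
rewrite /mexF sF_all sF_or sF_and sF_ex sF_and IH.
change (kfo lv (KOr (KF (Eq 0 1)) (kpos i.+1))) with
  (FOr (kfo lv (KF (Eq 0 1))) (kfo lv (kpos i.+1))).
change (kfo lv (KOr (KT (Eq 0 1)) (kpos i.+1))) with
  (FOr (kfo lv (KT (Eq 0 1))) (kfo lv (kpos i.+1))).
rewrite !sF_or sK_pos [reps _ _]/= -/(reps i stF) [lS _ _ _ _ _ _ _ _ _ _ (LExq i f)]/= /cF0 /cF1 /cF2 -!lock.
move: (reps i stF) (qF 6 1) (qF 5 0) stF (sK (kmin _ _)) (sK (KF (Eq 0 1))) (sK (KT (Eq 0 1))) (lS _ _ _ _ _ _ _ _ _ _ _) => *.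
by rewrite -!catA.
Qed.

Lemma sF_start f : sF (startF b f) = hF0 ++ sF f.
Proof.
rewrite /startF sF_all sF_or sF_and /hF0 -lock.
by move: (qF 6 0) (sK _) (sK _) (sF f) => *; rewrite -!catA.
Qed.

Lemma sF_sentence f : sF (startF b (trF b f)) = hF0 ++ lS (hdr 2 1) (hdr 3 2) stF cF0 cF1 stF cF2
  (fun=> bF0) bF1 (fun=> sK (kmin 1 2)) f.
Proof. by rewrite sF_start sF_tr. Qed.

End FOString.

Lemma FO_lower : hard FO_team.
Proof.
apply: (@lowerX FO_team (fun f => startF true (trF true f))) => [f|f _|T f T0|].
- exact: (sF_sentence true f).
- by rewrite [sentence _]/(_ && _) startF_free startF_level.
- exact: startFP.
exact: fo_code_inj.
Qed.

Lemma FO3_lower : hard FO3_team.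
Proof.
apply: (@lowerX FO3_team (fun f => startF false (trF false f))) => [f|f _|T f T0|].
- exact: (sF_sentence false f).
- by rewrite [sentence _]/(_ && _) startF_free startF_vars.
- exact: startFP.
exact: fo_code_inj.
Qed.

Notation sS f := (ser (so_code f)).

Definition dS0 : seq bool := locked (hdr 5 2 ++ ser (leaf 0) ++ hdr 5 2 ++ ser (leaf 1) ++
  hdr 3 2 ++ hdr 1 2 ++ [:: false]).
Definition dS1 : seq bool := locked ([:: false] ++ ser (leaves [:: 1]) ++ hdr 3 2 ++ hdr 1 2 ++ [:: false]).
Definition dS2 (h : latom) : seq bool :=
  locked ([:: false] ++ ser (leaves [:: 0]) ++ sS (kso lvS (kat h))).

Lemma sS_tr f : sS (trS f) = [::] ++ lS (hdr 2 1) (hdr 3 2) [:: true] (hdr 7 3 ++ [:: false])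
  ([:: false] ++ ser (leaf 1)) [::] [::] (fun=> dS0) (fun=> dS1) dS2 f.
Proof.
have serl n : ser (leaf n) = false :: reps n [:: true] ++ [:: false].
  by rewrite /reps flat_true cats1.
have n2 k t u : ser (node k [:: t; u]) = hdr k 2 ++ ser t ++ ser u by rewrite ser_node /= cats0.
elim: f => [h i j|f IH|f IHf g IHg|i f IH]; rewrite [trS _]/= [so_code _]/=.
- rewrite !n2 !serl lSA /dS0 /dS1 /dS2 -!lock !serl.
  move: (ser (leaves _)) (ser (leaves _)) (sS _) => *.
  by rewrite ?cats0 -!catA /= -?catA.
- by rewrite ser_node /= cats0 IH.
- by rewrite n2 IHf IHg.
have n3 k t u v : ser (node k [:: t; u; v]) = hdr k 3 ++ ser t ++ ser u ++ ser v.
  by rewrite ser_node /= cats0.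
rewrite n3 IH (serl i); move: (ser (leaf 1)) => l1.
by rewrite [lS _ _ _ _ _ _ _ _ _ _ (LExq i f)]/= [reps i [::]]flat_nil /= -?catA /= -?catA.
Qed.

Lemma SO_lower : hard SO.
Proof.
apply: (@lowerX SO trS) => [f|f fc|T f T0|].
- exact: sS_tr.
- by rewrite /= trS_free trS_level trS_rel0.
- exact: trSP0.
exact: so_code_inj.
Qed.

Theorem theorem7 :
  [/\ [/\ logspace_equivalent (model_checking FO_team) Delta30,
          logspace_equivalent (model_checking FO3_team) Delta30 &
          logspace_equivalent (model_checking SO) Delta30] /\
      [/\ logspace_equivalent (satisfiability FO_team) Delta30,
          logspace_equivalent (satisfiability FO3_team) Delta30 &
          logspace_equivalent (satisfiability SO) Delta30],
      [/\ logspace_equivalent (countable_satisfiability FO_team) Delta20,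
          logspace_equivalent (countable_satisfiability FO3_team) Delta20 &
          logspace_equivalent (countable_satisfiability SO) Delta20] &
      [/\ logspace_reducible (model_checking TeamLTLa) Delta30,
          logspace_reducible (satisfiability TeamLTLa) Delta30 &
          logspace_reducible (countable_satisfiability TeamLTLa) Delta20]].
Proof.
have [u1 u2 u3] := FO_upper; have [v1 v2 v3] := FO3_upper; have [w1 w2 w3] := SO_upper.
have [l1 l2 l3] := FO_lower; have [m1 m2 m3] := FO3_lower; have [n1 n2 n3] := SO_lower.
by do ?split=> //; case: LTL_upper.
Qed.
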